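(* Any Denjoy–Perron–Henstock–Kurzweil integrable function $f:[a,b]\to\overline{\mathbb R}$ over $[a,b]$ is also distributionally integrable over $[a,b]$, and the integrals coincide: $(\mathfrak{dist})\int_a^bf(x)\,dx$ equals the Denjoy–Perron–Henstock–Kurzweil integral of $f$ over $[a,b]$.
   Context: The Denjoy–Perron–Henstock–Kurzweil integral is the usual (restricted) Denjoy integral, equivalently the Perron integral, equivalently the Henstock–Kurzweil (gauge) integral, on a compact interval. Distributions are real. Notation: $\overline{\mathbb R}=\mathbb R\cup\{-\infty,\infty\}$; $\mathcal E'[a,b]$ is the space of distributions on $\mathbb R$ with support contained in $[a,b]$; $\langle \mathsf g(x+ty),\phi(y)\rangle:=|t|^{-1}\langle \mathsf g(y),\phi((y-x)/t)\rangle$ for $t\ne0$. Point values. For $\mathsf g\in\mathcal D'(\mathbb R)$, the distributional (Łojasiewicz) point value $\mathsf g(x_0)$ exists and equals $\gamma\in\mathbb R$ if $\lim_{\varepsilon\to0}\langle \mathsf g(x_0+\varepsilon y),\phi(y)\rangle=\gamma\int_{-\infty}^\infty\phi(y)\,dy$ for every $\phi\in\mathcal D(\mathbb R)$. A Łojasiewicz distribution is one having a point value at every point of $\mathbb R$. Test classes. $\mathcal T_0$: functions $\phi\in C^\infty(\mathbb R)$, $\phi\ge0$, $\int\phi=1$, such that for some $\alpha<-1$, $\phi^{(m)}(x)=O(|x|^{\alpha-m})$ as $|x|\to\infty$ for all $m\ge0$. $\mathcal T_1$: those $\phi\in\mathcal T_0$ with $x\phi'(x)\le0$ for all $x$. For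 $\mathsf g\in\mathcal E'(\mathbb R)$, $\phi\in\mathcal T_0$: $\mathsf g^{+}_{\phi,0}(x)=\limsup_{t\to0^+}\langle \mathsf g(x+ty),\phi(y)\rangle$ and $\mathsf g^{-}_{\phi,0}(x)=\liminf_{t\to0^+}\langle \mathsf g(x+ty),\phi(y)\rangle$. Integral. Let $f:[a,b]\to\overline{\mathbb R}$. A major distributional pair $(\mathsf u,\mathsf U)$ for $f$ consists of $\mathsf u\in\mathcal E'[a,b]$ and a Łojasiewicz distribution $\mathsf U$ with $\mathsf U'=\mathsf u$, $\mathsf U(a)=0$, such that there exist a countable set $E$ and a Lebesgue null set $Z$ with $\mathsf u^-_{\phi,0}(x)\ge f(x)$ for all $x\in[a,b]\setminus Z$, $\phi\in\mathcal T_0$, and $\mathsf u^-_{\phi,0}(x)>-\infty$ for all $x\in[a,b]\setminus E$, $\phi\in\mathcal T_1$. A minor distributional pair $(\mathsf v,\mathsf V)$ for $f$ consists of $\mathsf v\in\mathcal E'[a,b]$ and a Łojasiewicz distribution $\mathsf V$ with $\mathsf V'=\mathsf v$, $\mathsf V(a)=0$, such that there exist a countable set $E$ and a null set $Z$ with $\mathsf v^+_{\phi,0}(x)\le f(x)$ for all $x\in[a,b]\setminus Z$, $\phi\in\mathcal T_0$, and $\mathsf v^+_{\phi,0}(x)<\infty$ for all $x\in[a,b]\setminus E$, $\phi\in\mathcal T_1$. The function $f$ is distributionally integrable over $[a,b]$ if it has both major and minor pairs and $\sup\mathsf V(b)=\inf\mathsf U(b)$ (sup over minor pairs, inf over major pairs);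 the common value is $(\mathfrak{dist})\int_a^bf(x)\,dx$. *)

(* Defs.v *)
From HB Require Import structures.
From mathcomp Require Import all_boot all_order all_algebra.
From mathcomp Require Import all_classical all_reals all_analysis.

Set Implicit Arguments.
Unset Strict Implicit.
Unset Printing Implicit Defensive.

Import Order.TTheory GRing.Theory Num.Theory.
Import numFieldNormedType.Exports.

Local Open Scope classical_set_scope.
Local Open Scope ring_scope.

(** Smooth functions and distributions on the real line.

    A distribution is a functional on all of [R -> R] of which only the values
    on test functions (and, for compactly supported distributions, those on
    smooth functions multiplied by a cutoff) are ever used. *)

Section Distributions.
Context {R : realType}.
Implicit Types (phi psi chi : R -> R) (g u : (R -> R) -> R).

Definition smooth phi := forall (n : nat) (x : R), derivable (derive1n n phi) x 1.

Definition fsupp phi : set R := closure [set x | phi x != 0].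

Definition test_function phi := smooth phi /\ compact (fsupp phi).

(* The second clause is continuity for the usual topology of D(R), expressed
   through the defining seminorms: on every compact set, the functional has
   finite order. *)
Definition schwartz_distribution g :=
  (forall (c : R) phi psi, test_function phi -> test_function psi ->
     g (fun x => c * phi x + psi x) = c * g phi + g psi) /\
  (forall K : set R, compact K ->
     exists (N : nat) (C : R), forall phi,
       test_function phi -> fsupp phi `<=` K ->
       `|g phi| <= C * \sum_(k < N.+1) sup (range (fun x => `|(derive1n k phi) x|))).

(* supp u `<=` F, for F closed: u vanishes on the open set ~` F. *)
Definition supported_in u (F : set R) :=
  forall phi, test_function phi -> fsupp phi `&` F = set0 -> u phi = 0.

(* The space E'[a, b]. *)
Definition compact_distribution (a b : R) u :=
  schwartz_distribution u /\ supported_in u `[a, b].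

Definition distributional_derivative g u :=
  forall phi, test_function phi -> u phi = - g (derive1 phi).

(* <g(x + t y), phi(y)> *)
Definition scaled_pairing g (x t : R) phi : R :=
  `|t|^-1 * g (fun y => phi ((y - x) / t)).

Definition has_point_value g (x0 gamma : R) :=
  forall phi, test_function phi ->
    (fun eps : R => scaled_pairing g x0 eps phi) @ 0^' -->
      gamma * Rintegral lebesgue_measure setT phi.

Definition lojasiewicz g :=
  schwartz_distribution g /\ forall x0 : R, exists gamma : R, has_point_value g x0 gamma.

(* The canonical extension of a compactly supported distribution to all smooth
   functions: <u, phi> is the value of <u, chi phi> common to all cutoffs chi
   equal to 1 on a large enough interval. *)
Definition smooth_extension u phi : R :=
  get [set v : R | \forall M \near +oo, forall chi, test_function chi ->
    (forall x, `|x| <= M -> chi x = 1) -> u (fun x => chi x * phi x) = v].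

Definition T0_class phi :=
  [/\ smooth phi, (forall x, 0 <= phi x),
      (\int[lebesgue_measure]_(x in setT) (phi x)%:E = 1)%E &
      exists2 alpha : R, alpha < -1 &
        forall m : nat, exists C A : R, 0 < A /\
          forall x, A <= `|x| ->
            `|(derive1n m phi) x| <= C * `|x| `^ (alpha - m%:R)].

Definition T1_class phi := T0_class phi /\ forall x, x * derive1 phi x <= 0.

Definition upper_value u phi (x : R) : \bar R :=
  limf_esup (fun t => (scaled_pairing (smooth_extension u) x t phi)%:E) 0^'+.

Definition lower_value u phi (x : R) : \bar R :=
  limf_einf (fun t => (scaled_pairing (smooth_extension u) x t phi)%:E) 0^'+.

End Distributions.

(** The distributional integral of [f] over [[a, b]]. Only the values of [f]
    on [[a, b]] matter. *)

Section DistributionalIntegral.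
Context {R : realType}.
Variables (a b : R) (f : R -> \bar R).
Implicit Types (u U v V : (R -> R) -> R).
Local Open Scope ereal_scope.

Definition major_pair u U :=
  [/\ compact_distribution a b u, lojasiewicz U,
      distributional_derivative U u, has_point_value U a 0%R &
      exists E Z : set R,
        [/\ countable E, lebesgue_measure.-negligible Z,
            (forall x phi, x \in `[a, b] `\` Z -> T0_class phi ->
               f x <= lower_value u phi x) &
            (forall x phi, x \in `[a, b] `\` E -> T1_class phi ->
               -oo < lower_value u phi x)]].

Definition minor_pair v V :=
  [/\ compact_distribution a b v, lojasiewicz V,
      distributional_derivative V v, has_point_value V a 0%R &
      exists E Z : set R,
        [/\ countable E, lebesgue_measure.-negligible Z,
            (forall x phi, x \in `[a, b] `\` Z -> T0_class phi ->
               upper_value v phi x <= f x) &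
            (forall x phi, x \in `[a, b] `\` E -> T1_class phi ->
               upper_value v phi x < +oo)]].

Definition major_ends : set (\bar R) :=
  [set y | exists u U (c : R),
     [/\ major_pair u U, has_point_value U b c & y = c%:E]].

Definition minor_ends : set (\bar R) :=
  [set y | exists v V (c : R),
     [/\ minor_pair v V, has_point_value V b c & y = c%:E]].

Definition dist_integrable :=
  [/\ major_ends !=set0, minor_ends !=set0 &
      ereal_sup minor_ends = ereal_inf major_ends].

(* Meaningful, and then finite, when [f] is integrable. *)
Definition dist_integral : \bar R := ereal_sup minor_ends.

End DistributionalIntegral.

(** The Denjoy-Perron-Henstock-Kurzweil integral over [[a, b]], in Perron's
    form, which applies directly to functions with infinite values. Major and
    minor functions are not required to be continuous. *)

Section PerronIntegral.
Context {R : realType}.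
Variables (a b : R) (f : R -> \bar R).
Implicit Types (U V : R -> R).
Local Open Scope ereal_scope.

(* Derivates relative to [a, b]: one-sided at the endpoints. *)
Definition lower_derivate U (x : R) : \bar R :=
  limf_einf (fun y => ((U y - U x) / (y - x))%:E) (within `[a, b] x^').

Definition upper_derivate U (x : R) : \bar R :=
  limf_esup (fun y => ((U y - U x) / (y - x))%:E) (within `[a, b] x^').

Definition perron_major U := forall x, x \in `[a, b] ->
  -oo < lower_derivate U x /\ f x <= lower_derivate U x.

Definition perron_minor V := forall x, x \in `[a, b] ->
  upper_derivate V x < +oo /\ upper_derivate V x <= f x.

Definition perron_major_ends : set (\bar R) :=
  [set (U b - U a)%:E | U in perron_major].

Definition perron_minor_ends : set (\bar R) :=
  [set (V b - V a)%:E | V in perron_minor].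

Definition DPHK_integrable :=
  [/\ perron_major_ends !=set0, perron_minor_ends !=set0 &
      ereal_sup perron_minor_ends = ereal_inf perron_major_ends].

(* Meaningful, and then finite, when [f] is integrable. *)
Definition DPHK_integral : \bar R := ereal_sup perron_minor_ends.

End PerronIntegral.

(* Main.v *)
(** Both integrals are squeezed between major and minor objects, so two facts
    suffice: every distributional major pair (u, U) and minor pair (v, V) of f
    satisfy V(b) <= U(b), and Perron major functions yield major pairs whose end
    exceeds the Perron integral by arbitrarily little (minor pairs are opposites
    of major pairs of -f).

    For the first fact add to U - V a small continuous increasing
    function, infinitely steep on the exceptional null set.
    The result W has point values everywhere, and its heat extension has a
    nonnegative space derivative near t = 0 along all but countably many
    vertical lines. Let P be the set of points near which W' is not a
    nonnegative distribution. An isolated point of P is impossible because no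
    distribution supported at a point has a primitive with a point value there.
    By the Baire category theorem the derivative of the heat extension is
    nonnegative, uniformly in t, over some portion of P; on the complementary
    intervals W' is nonnegative and the same sign propagates by a two-point
    maximum principle, which needs continuity of the heat extension up to the
    corners: this is where the uniform boundedness of the scaled pairings, a
    gliding hump argument, enters. Hence W' >= 0 on an interval meeting P, a
    contradiction, and W(a) <= W(b).

    For the second fact, the indefinite Perron integral F is continuous and
    F' = f off a null set Z. For a major function U the increasing function
    U - F need not be continuous, but together with a function steep on Z it
    shows that the constraints h(d) - h(c) >= F(c) - F(d), for c in Z and d
    close to the right of c, have a nondecreasing solution of small total
    variation; the least solution is continuous because F is. With the mirrored
    constraints on the left, F + h is a continuous function whose derivative is
    a major pair. *)
Require Import Defs.
From HB Require Import structures.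
From mathcomp Require Import all_boot all_order all_algebra.
From mathcomp Require Import all_classical all_reals all_analysis.
From mathcomp Require Import measurable_realfun ring lra.

Set Implicit Arguments.
Unset Strict Implicit.
Unset Printing Implicit Defensive.

Import Order.TTheory GRing.Theory Num.Theory.
Import numFieldNormedType.Exports.

Local Open Scope classical_set_scope.
Local Open Scope ring_scope.

(** * Smooth functions, integrals and cutoffs *)

(** A point value controls one test function at a time, whereas the heat kernel has unbounded
    support and its profile, seen from [x0] at scale [t], is shifted by [xi = (x - x0) / t], which
    need not stay bounded as [(x, t)] tends to [(x0, 0)]. For bounded [xi], equicontinuity and
    compactness suffice. For large [xi] the scale becomes [xi * t] and the kernel a narrow bump
    around 1, on which only an estimate by total mass helps; it comes from monotonicity on one side
    of [x0]. Time enters as [theta = t^-1], so that kernels are powers of [theta] times dilated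
    derivatives of the Gaussian. In the construction of major pairs the two test classes call for
    different arguments. For [phi] in [T1_class], [y - x] times minus the derivative of the kernel
    is nonnegative, so lower bounds on difference quotients pass to the pairings. For [phi] in
    [T0_class] a true derivative of [F] is needed, which exists off a null set, and the increasing
    correction [h] can only raise the values. The exceptional countable set is [{a, b}], beyond
    which primitives are prolonged by constants. *)

Section SmoothFunctions.
Context {R : realType}.
Implicit Types (f g k phi psi chi : R -> R) (p : {poly R}).

Lemma derive1n_S n f : derive1n n.+1 f = derive1n n (derive1 f).
Proof. by rewrite /derive1n iterSr. Qed.

Lemma derive1n_add m n f : derive1n m (derive1n n f) = derive1n (m + n) f.
Proof. by rewrite /derive1n -iterD. Qed.

Lemma is_derive_eq1 f (x d : R) : is_derive x 1 f d -> derive1 f x = d.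
Proof. by move=> fd; rewrite derive1E; apply: derive_val. Qed.

Lemma derive1_fun f g : (forall x : R, is_derive x 1 f (g x)) -> derive1 f = g.
Proof. by move=> fg; apply/funext => x; apply: is_derive_eq1. Qed.

Lemma is_derive_derive1 f (x : R) : derivable f x 1 -> is_derive x 1 f (derive1 f x).
Proof. by move=> df; split => //; rewrite derive1E. Qed.

Lemma smooth_derive1n n f : smooth f -> smooth (derive1n n f).
Proof. by move=> sf m x; rewrite derive1n_add; apply: sf. Qed.

Lemma smooth_derive1 f : smooth f -> smooth (derive1 f).
Proof. exact: (@smooth_derive1n 1). Qed.

Lemma smooth_derivable f (x : R) : smooth f -> derivable f x 1.
Proof. by move=> sf; apply: (sf 0%N). Qed.

Lemma smooth_is_derive f (x : R) : smooth f -> is_derive x 1 f (derive1 f x).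
Proof. by move=> sf; apply/is_derive_derive1/smooth_derivable. Qed.

Lemma is_derive_continuous f (x d : R) : is_derive x 1 f d -> {for x, continuous f}.
Proof.
by move=> fd; apply: differentiable_continuous; rewrite -derivable1_diffP; case: fd.
Qed.

Lemma smooth_continuous f : smooth f -> continuous f.
Proof. by move=> sf x; apply: is_derive_continuous (smooth_is_derive x sf). Qed.

(** Smoothness by coinduction: it is enough to exhibit a class of differentiable functions that is
    stable under derivation. No closed form of the higher derivatives is then needed. *)
Lemma smooth_coind (P : (R -> R) -> Prop) :
  (forall f, P f -> (forall x : R, derivable f x 1) /\ P (derive1 f)) ->
  forall f, P f -> smooth f.
Proof.
move=> HP f Pf n; elim: n f Pf => [|n IH] f Pf x; first exact: (HP _ Pf).1.
by rewrite derive1n_S; apply: IH; exact: (HP _ Pf).2.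
Qed.

Lemma smooth_of f g : (forall x : R, is_derive x 1 f (g x)) -> smooth g -> smooth f.
Proof.
move=> fg sg [|n] x; first by case: (fg x).
by rewrite derive1n_S (derive1_fun fg); apply: sg.
Qed.

Lemma is_derive_add f g (x a b : R) : is_derive x 1 f a -> is_derive x 1 g b ->
  is_derive x 1 (fun y => f y + g y) (a + b).
Proof. by move=> fa gb; apply: is_deriveD. Qed.

Lemma is_derive_sub f g (x a b : R) : is_derive x 1 f a -> is_derive x 1 g b ->
  is_derive x 1 (fun y => f y - g y) (a - b).
Proof. by move=> fa gb; apply: is_deriveB. Qed.

Lemma is_derive_opp f (x a : R) : is_derive x 1 f a -> is_derive x 1 (fun y => - f y) (- a).
Proof. by move=> fa; apply: is_deriveN. Qed.

Lemma is_derive_mul f g (x a b : R) : is_derive x 1 f a -> is_derive x 1 g b ->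
  is_derive x 1 (fun y => f y * g y) (a * g x + f x * b).
Proof.
move=> fa gb; apply: (is_derive_eq (is_deriveM fa gb)).
by rewrite /GRing.scale /= addrC (mulrC (g x)).
Qed.

Lemma is_derive_const (c x : R) : is_derive x 1 (fun _ : R => c) 0.
Proof. exact: is_derive_cst. Qed.

Lemma is_derive_idr (x : R) : is_derive x 1 (fun y : R => y) 1.
Proof. exact: is_derive_id. Qed.

Lemma is_derive_affine (a b x : R) : is_derive x 1 (fun y : R => a * y + b) a.
Proof.
have H := is_derive_add (is_derive_mul (is_derive_const a x) (is_derive_idr x))
  (is_derive_const b x).
by apply: (is_derive_eq H); ring.
Qed.

Lemma is_derive_comp f g (x a b : R) : is_derive (g x) 1 f a -> is_derive x 1 g b ->
  is_derive x 1 (fun y => f (g y)) (a * b).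
Proof. by move=> fa gb; apply: is_derive1_comp. Qed.

Lemma is_derive_comp_affine f (a b x d : R) : is_derive (a * x + b) 1 f d ->
  is_derive x 1 (fun y => f (a * y + b)) (a * d).
Proof.
move=> fd; rewrite mulrC.
by apply: (@is_derive_comp f (fun y => a * y + b) x) => //; apply: is_derive_affine.
Qed.

Lemma smooth_cst (c : R) : smooth (fun _ : R => c).
Proof.
apply: (@smooth_coind (fun f => exists c, f = fun _ => c)); last by exists c.
move=> _ [d ->]; split=> [x|]; first exact: derivable_cst.
by exists 0; apply: derive1_fun => x; apply: is_derive_const.
Qed.

Lemma derive1n_cst n (c : R) : derive1n n.+1 (fun _ : R => c) = fun _ => 0.
Proof.
elim: n c => [|n IH] c; first by apply: derive1_fun => x; apply: is_derive_const.
rewrite derive1n_S (_ : derive1 _ = fun=> 0) ?IH //.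
by apply: derive1_fun => x; apply: is_derive_const.
Qed.

Lemma smooth_id : smooth (fun x : R => x).
Proof. by apply: (@smooth_of _ (fun=> 1)); exact: smooth_cst. Qed.

Lemma smooth_affine (a b : R) : smooth (fun x : R => a * x + b).
Proof. by apply: (@smooth_of _ (fun=> a)); [exact: is_derive_affine|exact: smooth_cst]. Qed.

Lemma smoothD f g : smooth f -> smooth g -> smooth (fun x => f x + g x).
Proof.
move=> sf sg.
apply: (@smooth_coind (fun h => exists f g, [/\ smooth f, smooth g & h = fun x => f x + g x]));
  last by exists f, g.
move=> _ [{sf sg}f [{}g [sf sg ->]]].
have H x := is_derive_add (smooth_is_derive x sf) (smooth_is_derive x sg).
split=> [x|]; first by case: (H x).
rewrite (derive1_fun H); exists (derive1 f), (derive1 g).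
by split; [exact: (smooth_derive1 sf)|exact: (smooth_derive1 sg)|reflexivity].
Qed.

Lemma derive1nD n f g : smooth f -> smooth g ->
  derive1n n (fun x => f x + g x) = fun x => derive1n n f x + derive1n n g x.
Proof.
elim: n f g => [//|n IH] f g sf sg; rewrite !derive1n_S.
have H x := is_derive_add (smooth_is_derive x sf) (smooth_is_derive x sg).
rewrite (derive1_fun H); exact: (IH _ _ (smooth_derive1 sf) (smooth_derive1 sg)).
Qed.

(** Differentiability up to order [n.+1]. The product rule is proved order by order because the
    derivative of a product is a sum of products in which only one factor has been
    differentiated. *)
Definition cn n f := forall i, (i <= n)%N -> forall x : R, derivable (derive1n i f) x 1.

Lemma cnS n f : cn n.+1 f <-> (forall x : R, derivable f x 1) /\ cn n (derive1 f).
Proof.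
split=> [H|[H0 H1] [|i] lein x]; last by rewrite derive1n_S; apply: H1.
  split=> [x|i lein x]; first exact: (H 0%N).
  by rewrite -derive1n_S; apply: H.
exact: H0.
Qed.

Lemma cnW n f : cn n.+1 f -> cn n f.
Proof. by move=> H i lein; apply: H; apply: leqW. Qed.

Lemma cnD n f g : cn n f -> cn n g -> cn n (fun x => f x + g x).
Proof.
elim: n f g => [|n IH] f g cf cg.
  move=> [|//] _ x.
  by case: (is_derive_add (is_derive_derive1 (cf 0%N isT x)) (is_derive_derive1 (cg 0%N isT x))).
have /cnS[df cf'] := cf; have /cnS[dg cg'] := cg; apply/cnS.
have H x := is_derive_add (is_derive_derive1 (df x)) (is_derive_derive1 (dg x)).
by split=> [x|]; [case: (H x)|rewrite (derive1_fun H); apply: IH].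
Qed.

Lemma cnM n f g : cn n f -> cn n g -> cn n (fun x => f x * g x).
Proof.
elim: n f g => [|n IH] f g cf cg.
  move=> [|//] _ x.
  by case: (is_derive_mul (is_derive_derive1 (cf 0%N isT x)) (is_derive_derive1 (cg 0%N isT x))).
have /cnS[df cf'] := cf; have /cnS[dg cg'] := cg; apply/cnS.
have H x := is_derive_mul (is_derive_derive1 (df x)) (is_derive_derive1 (dg x)).
split=> [x|]; first by case: (H x).
rewrite (derive1_fun H).
exact: (cnD (IH _ _ cf' (cnW cg)) (IH _ _ (cnW cf) cg')).
Qed.

Lemma smoothM f g : smooth f -> smooth g -> smooth (fun x => f x * g x).
Proof. by move=> sf sg n x; apply: (@cnM n). Qed.

Lemma smoothZ (c : R) f : smooth f -> smooth (fun x => c * f x).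
Proof. by move=> sf; exact: (smoothM (@smooth_cst c) sf). Qed.

Lemma derive1nZ n (c : R) f : smooth f ->
  derive1n n (fun x => c * f x) = fun x => c * derive1n n f x.
Proof.
elim: n f => [//|n IH] f sf; rewrite !derive1n_S.
have H x := is_derive_mul (is_derive_const c x) (smooth_is_derive x sf).
rewrite (derive1_fun H) -IH; last exact: smooth_derive1.
by congr derive1n; apply/funext => x; rewrite mul0r add0r.
Qed.

Lemma smoothN f : smooth f -> smooth (fun x => - f x).
Proof.
move=> sf; rewrite (_ : (fun x => - f x) = fun x => -1 * f x); first exact: smoothZ.
by apply/funext => x; rewrite mulN1r.
Qed.

Lemma smoothB f g : smooth f -> smooth g -> smooth (fun x => f x - g x).
Proof. by move=> sf sg; exact: (smoothD sf (smoothN sg)). Qed.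

Lemma derive1nN n f : smooth f -> derive1n n (fun x => - f x) = fun x => - derive1n n f x.
Proof.
move=> sf; rewrite (_ : (fun x => - f x) = fun x => -1 * f x).
  by rewrite derive1nZ //; apply/funext => x; rewrite mulN1r.
by apply/funext => x; rewrite mulN1r.
Qed.

Lemma derive1nB n f g : smooth f -> smooth g ->
  derive1n n (fun x => f x - g x) = fun x => derive1n n f x - derive1n n g x.
Proof. by move=> sf sg; rewrite (derive1nD n sf (smoothN sg)) (derive1nN n sg). Qed.

Lemma derive1n_comp_affine n (a b : R) f : smooth f ->
  derive1n n (fun x => f (a * x + b)) = fun x => a ^+ n * derive1n n f (a * x + b).
Proof.
elim: n f => [|n IH] f sf; first by apply/funext => x; rewrite mul1r.
have H x := is_derive_comp_affine (smooth_is_derive (a * x + b) sf).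
rewrite derive1n_S (derive1_fun H) derive1nZ.
  rewrite IH; last exact: smooth_derive1.
  by apply/funext => x; rewrite exprS derive1n_S mulrA.
apply: (@smooth_coind (fun h => exists c f, smooth f /\ h = fun x => c * f (a * x + b))); last first.
  exists 1, (derive1 f); split; first exact: smooth_derive1.
  by apply/funext => x; rewrite mul1r.
move=> _ [c [k [sk ->]]].
have K x := is_derive_mul (is_derive_const c x)
  (is_derive_comp_affine (smooth_is_derive (a * x + b) sk)).
split=> [x|]; first by case: (K x).
rewrite (derive1_fun K); exists (c * a), (derive1 k); split; first exact: smooth_derive1.
by apply/funext => x; rewrite mul0r add0r mulrA.
Qed.

Lemma smooth_comp_affine (a b : R) f : smooth f -> smooth (fun x => f (a * x + b)).
Proof.
move=> sf.
apply: (@smooth_coind (fun h => exists c f, smooth f /\ h = fun x => c * f (a * x + b))); last first.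
  by exists 1, f; split=> //; apply/funext => x; rewrite mul1r.
move=> _ [c [k [sk ->]]].
have K x := is_derive_mul (is_derive_const c x)
  (is_derive_comp_affine (smooth_is_derive (a * x + b) sk)).
split=> [x|]; first by case: (K x).
rewrite (derive1_fun K); exists (c * a), (derive1 k); split; first exact: smooth_derive1.
by apply/funext => x; rewrite mul0r add0r mulrA.
Qed.

Lemma derive1n_local n f g (x e : R) : 0 < e -> (forall y, `|y - x| < e -> f y = g y) ->
  derive1n n f x = derive1n n g x.
Proof.
elim: n x e f g => [|n IH] x e f g e0 fg; first by apply: fg; rewrite subrr normr0.
rewrite !derive1n_S; apply: (IH _ (e / 2)); first by rewrite divr_gt0.
move=> y yx; rewrite !derive1E; apply: near_eq_derive => //.
exists (e / 2) => /=; first by rewrite divr_gt0.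
move=> z; rewrite /ball_ /= => yz; apply: fg.
by rewrite (splitr e) (_ : z - x = (y - x) - (y - z)) ?(le_lt_trans (ler_normB _ _)) ?ltrD //; ring.
Qed.

(** The Leibniz expansion of order [n] has [2 ^+ n] terms when equal ones are not grouped. *)
Lemma derive1nM_le n f g (x A B : R) : smooth f -> smooth g ->
  (forall i, (i <= n)%N -> `|derive1n i f x| <= A) ->
  (forall i, (i <= n)%N -> `|derive1n i g x| <= B) ->
  `|derive1n n (fun y => f y * g y) x| <= 2 ^+ n * (A * B).
Proof.
elim: n f g => [|n IH] f g sf sg fA gB.
  by rewrite mul1r /= normrM ler_pM //; [exact: (fA 0%N)|exact: (gB 0%N)].
have H y := is_derive_mul (smooth_is_derive y sf) (smooth_is_derive y sg).
have sf' := smooth_derive1 sf; have sg' := smooth_derive1 sg.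
rewrite derive1n_S (derive1_fun H) derive1nD; try exact: smoothM.
rewrite exprS -mulrA mulrDl !mul1r; apply: (le_trans (ler_normD _ _)); apply: lerD.
  apply: IH => // i lein; first by rewrite -derive1n_S; apply: fA.
  by apply: gB; apply: leqW.
apply: IH => // i lein; last by rewrite -derive1n_S; apply: gB.
by apply: fA; apply: leqW.
Qed.

End SmoothFunctions.

(** * Flat functions *)

Section Bump.
Context {R : realType}.
Implicit Types (f g k phi psi chi : R -> R) (p : {poly R}).

(** A quadratic bound on the Taylor remainder determines the derivative. This form survives the
    summation of a series and the application of a distribution, where [taylor2_le] supplies the
    bound. *)
Lemma is_derive_rem2 f (x d M e : R) : 0 < e ->
  (forall h, `|h| < e -> `|f (x + h) - f x - h * d| <= M * h ^+ 2) -> is_derive x 1 f d.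
Proof.
move=> e0 H.
have M0 : 0 <= M.
  have he : `|e / 2| < e by rewrite ger0_norm; lra.
  have := le_trans (normr_ge0 _) (H _ he).
  by rewrite pmulr_lge0 // exprn_gt0 // divr_gt0.
have L : h^-1 *: (f (h *: 1 + x) - f x) @[h --> 0^'] --> d.
  apply/cvgrPdist_lt => eps eps0.
  exists (Num.min e (eps / (M + 1))) => /=.
    by rewrite lt_min e0 divr_gt0 // ltr_wpDl.
  move=> h; rewrite /ball_ /= sub0r normrN lt_min => /andP[he hM] h0.
  rewrite (_ : d - _ = - (h^-1 * (f (x + h) - f x - h * d))); last first.
    by rewrite /GRing.scale /= mulr1 (addrC x h) !mulrBr mulrA mulVf // mul1r; ring.
  rewrite normrN normrM normfV mulrC ltr_pdivrMr ?normr_gt0 //.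
  apply: (le_lt_trans (H _ he)); rewrite -(real_normK (num_real h)) expr2 mulrA ltr_pM2r ?normr_gt0 //.
  move: hM; rewrite ltr_pdivlMr ?ltr_wpDl // => hM.
  apply: le_lt_trans hM; rewrite mulrDr mulr1 mulrC lerDl //.
by split; [apply/cvg_ex; exists d|apply/cvg_lim].
Qed.

Lemma expr_expR_le n (y : R) : 0 <= y -> y ^+ n * expR (- y) <= n`!%:R.
Proof.
move=> y0; rewrite expRN ler_pdivrMr ?expR_gt0 //.
case: n => [|n]; first by rewrite expr0 fact0 mul1r -expR0 ler_expR.
have := expR_ge1Dxn n y0; have f0 : 0 < (n.+1)`!%:R :> R by rewrite ltr0n fact_gt0.
move=> H; rewrite mulrC -ler_pdivrMr //; apply: le_trans H.
by rewrite lerDr.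
Qed.

Lemma poly_expR_bounded p : exists2 C : R, 0 <= C &
  forall y, 0 <= y -> `|p.[y]| * expR (- y) <= C.
Proof.
exists (\sum_(i < size p) `|p`_i| * (i`!)%:R).
  by apply: sumr_ge0 => i _; apply: mulr_ge0.
move=> y y0; rewrite horner_coef.
apply: (@le_trans _ _ ((\sum_(i < size p) `|p`_i * y ^+ i|) * expR (- y))).
  by rewrite ler_wpM2r ?expR_ge0 // ler_norm_sum.
rewrite mulr_suml; apply: ler_sum => i _.
rewrite normrM -mulrA ler_wpM2l // ger0_norm ?exprn_ge0 //.
exact: expr_expR_le.
Qed.

(** With a polynomial in [x^-1] as a factor the family is stable under derivation; [flat 1] is the
    classical flat function. *)
Definition flat p (x : R) : R := if x <= 0 then 0 else p.[x^-1] * expR (- x^-1).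

Lemma is_derive_horner p (x : R) : is_derive x 1 (fun y => p.[y]) (p^`()).[x].
Proof.
elim/poly_ind: p => [|p c IH].
  rewrite deriv0 horner0 (_ : (fun y => _) = fun=> 0); first exact: is_derive_const.
  by apply/funext => y; rewrite horner0.
rewrite (_ : (fun y => _) = fun y => p.[y] * y + c); last first.
  by apply/funext => y; rewrite !hornerE.
have H := is_derive_add (is_derive_mul IH (is_derive_idr x)) (is_derive_const c x).
by apply: (is_derive_eq H); rewrite derivD derivM derivX derivC !hornerE.
Qed.

Lemma is_derive_local f g (x d e : R) : 0 < e -> (forall y, `|y - x| < e -> f y = g y) ->
  is_derive x 1 g d -> is_derive x 1 f d.
Proof.
move=> e0 fg gd; apply: near_eq_is_derive gd.
exists e => //= z; rewrite /ball_ /= distrC => /fg ->; exact.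
Qed.

Lemma is_derive_flat p (x : R) :
  is_derive x 1 (flat p) (flat ('X^2 * (p - p^`())) x).
Proof.
have [x0|x0|->] := ltgtP x 0.
- rewrite {2}/flat (ltW x0); apply: (@is_derive_local _ (fun=> 0) x 0 (- x)).
  + by rewrite oppr_gt0.
  + move=> y /ltr_normlP[_ yx]; rewrite /flat ifT //; lra.
- rewrite {2}/flat leNgt x0 /=.
  apply: (@is_derive_local _ (fun y => p.[y^-1] * expR (- y^-1)) x _ x) => //.
    move=> y /ltr_normlP[yx _]; rewrite /flat ifF //; apply/negbTE; rewrite -ltNge; lra.
  have V : is_derive x 1 (fun y : R => y^-1) (- x ^- 2).
    have V := is_deriveV (lt0r_neq0 x0) (is_derive_idr x).
    by apply: (is_derive_eq V); rewrite /GRing.scale /= mulr1.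
  have H := is_derive_mul (is_derive_comp (is_derive_horner p x^-1) V)
     (is_derive_comp (is_derive_expR _) (is_derive_opp V)).
  apply: (is_derive_eq H); rewrite hornerM hornerXn hornerD hornerN -exprVn; ring.
- rewrite {2}/flat lexx.
  (* At 0 the factor ['X^2], evaluated at [h^-1], turns a bound by [C] into a remainder of size
     [C * h ^+ 2]. *)
  have [C C0 HC] := poly_expR_bounded ('X^2 * p).
  apply: (@is_derive_rem2 _ _ _ C 1) => // h _; rewrite add0r mulr0 subr0 {2}/flat lexx subr0 /flat.
  case: ifPn => [_|]; first by rewrite normr0 mulr_ge0 // sqr_ge0.
  rewrite -ltNge => h0; have := HC h^-1; rewrite invr_ge0 ltW // => /(_ isT).
  rewrite normrM (ger0_norm (expR_ge0 _)) hornerM hornerXn normrM exprVn => H.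
  have h20 : 0 < h ^+ 2 by rewrite exprn_gt0.
  move: H; rewrite (ger0_norm (ltW _)) ?invr_gt0 // -mulrA mulrC ler_pdivrMr //.
Qed.

Lemma smooth_flat p : smooth (flat p).
Proof.
apply: (@smooth_coind _ (fun f => exists p, f = flat p)); last by exists p.
move=> _ [q ->]; split=> [x|]; first by case: (is_derive_flat q x).
by eexists; apply: derive1_fun => x; apply: is_derive_flat.
Qed.

Lemma flat1_gt0 (x : R) : 0 < x -> 0 < flat 1 x.
Proof. by move=> x0; rewrite /flat leNgt x0 /= hornerC mul1r expR_gt0. Qed.

Lemma flat_le0 p (x : R) : x <= 0 -> flat p x = 0.
Proof. by rewrite /flat => ->. Qed.

Lemma flat1_ge0 (x : R) : 0 <= flat 1 x.
Proof. by have [/flat_le0->//|/flat1_gt0/ltW] := leP x 0. Qed.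

End Bump.

(** * Integrals of continuous functions of compact support *)

Section Integral.
Context {R : realType}.
Implicit Types (f g k F G : R -> R) (a b c d x t : R).
Notation mu := (@lebesgue_measure R).

Definition supp_in c d f := forall x, x < c \/ d < x -> f x = 0.

Definition IT f : R := Rintegral mu setT f.

Lemma supp_inW c d c' d' f : c' <= c -> d <= d' -> supp_in c d f -> supp_in c' d' f.
Proof.
move=> cc dd sf x [xc|dx]; apply: sf; [left|right].
  exact: lt_le_trans cc.
exact: le_lt_trans dx.
Qed.

Lemma IT_seg c d f : supp_in c d f -> IT f = \int[mu]_(x in `[c, d]) f x.
Proof.
move=> sf; rewrite /IT [in RHS]Rintegral_mkcond; apply: eq_Rintegral => x _.
rewrite /patch; case: ifPn => //; rewrite notin_setE /= in_itv /= => /negP.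
by rewrite negb_and -!ltNge => /orP[xc|dx]; apply: sf; [left|right].
Qed.

Lemma cont_integrable c d f : continuous f -> mu.-integrable `[c, d] (EFin \o f).
Proof.
move=> cf; apply: continuous_compact_integrable; first exact: segment_compact.
exact: continuous_subspaceT.
Qed.

(** A primitive that vanishes left of the support and equals the integral right of it. Through it
    linearity, substitution, integration by parts and bounds for [IT] become differential
    calculus. *)
Lemma IT_prim c d f : c < d -> continuous f -> supp_in c d f ->
  exists F, [/\ forall x, is_derive x 1 F (f x), forall x, x <= c -> F x = 0 &
    forall x, d <= x -> F x = IT f].
Proof.
(* Integrating from [c - 1] makes [c] an interior point, where the fundamental theorem of calculus
   applies. *)
move=> cd cf sf; pose F x := \int[mu]_(t in `[c - 1, x]) f t.
have F0 x : x < c -> F x = 0.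
  move=> xc; rewrite /F (@eq_Rintegral _ _ _ mu _ (fun=> 0)); last first.
    move=> y; rewrite inE /= in_itv /= => /andP[_ yx]; apply: sf; left.
    exact: le_lt_trans xc.
  by rewrite Rintegral_cst // mul0r.
have Fd x : is_derive x 1 F (f x).
  have [xc|cx] := ltP x c.
    rewrite sf; last by left.
    apply: (@is_derive_local _ _ (fun=> 0) x _ (c - x)); first lra.
    move=> y /ltr_normlP[_ yx]; apply: F0; lra.
  have [] := @continuous_FTC1_closed _ f (c - 1) x (x + 1) ltac:(lra) (cont_integrable _ _ cf)
    ltac:(lra) (cf x).
  by move=> dF <-; apply: is_derive_derive1.
exists F; split => //.
- move=> x; rewrite le_eqVlt => /orP[/eqP ->|]; last exact: F0.
  have cF : F x @[x --> c^'-] --> F c.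
    by apply: cvg_at_left_filter; apply: is_derive_continuous (Fd c).
  have L0 : F x @[x --> c^'-] --> (0 : R).
    apply: (@cvg_trans _ ((fun=> 0 : R) @ c^'-)); last exact: cvg_cst.
    by apply: near_eq_cvg; near=> y; rewrite F0 //; near: y; apply: nbhs_left_lt.
  exact: (@cvg_unique _ (@Rhausdorff R) _ _ _ _ cF L0).
- move=> x dx; rewrite (@IT_seg (c - 1) x) //; apply: supp_inW sf => //; lra.
Unshelve. all: end_near. Qed.

Lemma zero_derive_cst F x y : (forall x, is_derive x 1 F 0) -> F x = F y.
Proof. by move=> H; apply: is_derive_0_is_cst. Qed.

Lemma IT_eq c d f F : c < d -> continuous f -> supp_in c d f ->
  (forall x, is_derive x 1 F (f x)) -> IT f = F d - F c.
Proof.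
move=> cd cf sf dF; have [G [dG Gc Gd]] := IT_prim cd cf sf.
have H : G d - F d = G c - F c.
  apply: (@zero_derive_cst (fun x => G x - F x)) => x.
  by apply: is_derive_eq (is_derive_sub (dG x) (dF x)) _; rewrite subrr.
by move: H; rewrite (Gc c) // (Gd d) // => H; lra.
Qed.

Lemma ndecr_of_derive F f x y : (forall x, is_derive x 1 F (f x)) ->
  (forall z, x < z < y -> 0 <= f z) -> x <= y -> F x <= F y.
Proof.
move=> dF f0; rewrite le_eqVlt => /orP[/eqP ->//|xy].
have [z] := MVT xy (fun z _ => dF z) (continuous_subspaceT (fun z => is_derive_continuous (dF z))).
rewrite in_itv /= => /f0 fz E; rewrite -subr_ge0 E mulr_ge0 // subr_ge0 ltW //.
Qed.

Lemma incr_of_derive F f x y : (forall x, is_derive x 1 F (f x)) ->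
  (forall z, x < z < y -> 0 < f z) -> x < y -> F x < F y.
Proof.
move=> dF f0 xy.
have [z] := MVT xy (fun z _ => dF z) (continuous_subspaceT (fun z => is_derive_continuous (dF z))).
rewrite in_itv /= => /f0 fz E; rewrite -subr_gt0 E mulr_gt0 // subr_gt0 //.
Qed.

Lemma mean_value F f x y : (forall x, is_derive x 1 F (f x)) ->
  exists2 z, (Num.min x y <= z <= Num.max x y) & F y - F x = f z * (y - x).
Proof.
move=> dF; have cF := continuous_subspaceT (fun z => is_derive_continuous (dF z)).
have [xy|yx|->] := ltgtP x y; last by exists y; rewrite ?lexx // !subrr mulr0.
- have [z] := MVT xy (fun z _ => dF z) (cF _).
  by rewrite in_itv /= => /andP[/ltW xz /ltW zy] E; exists z => //; apply/andP.
- have [z] := MVT yx (fun z _ => dF z) (cF _).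
  rewrite in_itv /= => /andP[/ltW xz /ltW zy] E; exists z; first exact/andP.
  by rewrite -(opprB x y) mulrN -E opprB.
Qed.

Lemma mean_le F f x y (M : R) : (forall x, is_derive x 1 F (f x)) ->
  (forall z, Num.min x y <= z <= Num.max x y -> `|f z| <= M) -> `|F y - F x| <= M * `|y - x|.
Proof.
by move=> dF H; have [z /H Hz ->] := mean_value x y dF; rewrite normrM ler_wpM2r.
Qed.

Lemma taylor2_le F f g x h (M : R) : (forall x, is_derive x 1 F (f x)) ->
  (forall x, is_derive x 1 f (g x)) ->
  (forall z, Num.min x (x + h) <= z <= Num.max x (x + h) -> `|g z| <= M) ->
  `|F (x + h) - F x - h * f x| <= M * h ^+ 2.
Proof.
move=> dF df H; have [z zx E] := mean_value x (x + h) dF.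
rewrite E (addrC x h) addrK mulrC -mulrBr normrM -(real_normK (num_real h)) expr2.
rewrite mulrCA ler_wpM2l //.
have zI w : Num.min x z <= w <= Num.max x z -> Num.min x (x + h) <= w <= Num.max x (x + h).
  move: zx; rewrite !minElt !maxElt; do !case: ifP; lra.
apply: (le_trans (mean_le df (fun w Hw => H w (zI w Hw)))).
have M0 : 0 <= M by apply: le_trans (normr_ge0 _) (H z zx).
rewrite ler_wpM2l //; move: zx; rewrite minElt maxElt; case: ltP => xh /andP[z1 z2].
- rewrite !ger0_norm; lra.
- rewrite !ler0_norm; lra.
Qed.

Lemma contD f g : continuous f -> continuous g -> continuous (fun x => f x + g x).
Proof. by move=> cf cg x; apply: cvgD; [apply: cf|apply: cg]. Qed.

Lemma contM f g : continuous f -> continuous g -> continuous (fun x => f x * g x).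
Proof. by move=> cf cg x; apply: cvgM; [apply: cf|apply: cg]. Qed.

Lemma contN f : continuous f -> continuous (fun x => - f x).
Proof. by move=> cf x; apply: cvgN; apply: cf. Qed.

Lemma contB f g : continuous f -> continuous g -> continuous (fun x => f x - g x).
Proof. by move=> cf cg x; apply: cvgB; [apply: cf|apply: cg]. Qed.

Lemma cont_cst (c : R) : continuous (fun _ : R => c).
Proof. by move=> x; apply: cvg_cst. Qed.

Lemma contZ (c : R) f : continuous f -> continuous (fun x => c * f x).
Proof. by move=> cf; apply: contM => //; apply: cont_cst. Qed.

Lemma cont_comp f g : continuous f -> continuous g -> continuous (fun x => f (g x)).
Proof. by move=> cf cg x; apply: continuous_comp; [apply: cg|apply: cf]. Qed.

Lemma cont_norm f : continuous f -> continuous (fun x => `|f x|).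
Proof. by move=> cf x; apply: cvg_norm; apply: cf. Qed.

Lemma cont_affine (a b : R) : continuous (fun x : R => a * x + b).
Proof. exact: smooth_continuous (@smooth_affine _ a b). Qed.

Lemma supp_inM c d f g : supp_in c d g -> supp_in c d (fun x => f x * g x).
Proof. by move=> sg x /sg ->; rewrite mulr0. Qed.

Lemma supp_inMl c d f g : supp_in c d f -> supp_in c d (fun x => f x * g x).
Proof. by move=> sg x /sg ->; rewrite mul0r. Qed.

Lemma supp_inD c d f g : supp_in c d f -> supp_in c d g -> supp_in c d (fun x => f x + g x).
Proof. by move=> sf sg x H; rewrite sf // sg // addr0. Qed.

Lemma IT_lin c d (r : R) f g : c < d -> continuous f -> continuous g ->
  supp_in c d f -> supp_in c d g -> IT (fun x => r * f x + g x) = r * IT f + IT g.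
Proof.
move=> cd cf cg sf sg.
have [F [dF Fc Fd]] := IT_prim cd cf sf; have [G [dG Gc Gd]] := IT_prim cd cg sg.
rewrite (@IT_eq c d _ (fun x => r * F x + G x)) //.
- by rewrite (Fc c) // (Gc c) // (Fd d) // (Gd d) //; ring.
- by apply: contD => //; apply: contZ.
- by apply: supp_inD => //; apply: supp_inM.
Qed.

Lemma IT_ge0 f : (forall x, 0 <= f x) -> 0 <= IT f.
Proof. by move=> f0; apply: Rintegral_ge0. Qed.

Lemma IT_sub c d f g : c < d -> continuous f -> continuous g ->
  supp_in c d f -> supp_in c d g -> IT (fun x => f x - g x) = IT f - IT g.
Proof.
move=> cd cf cg sf sg; rewrite -mulN1r addrC -(@IT_lin c d) //.
by congr IT; apply/funext => x; rewrite mulN1r addrC.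
Qed.

Lemma IT_le c d f g : c < d -> continuous f -> continuous g ->
  supp_in c d f -> supp_in c d g -> (forall x, f x <= g x) -> IT f <= IT g.
Proof.
move=> cd cf cg sf sg fg; rewrite -subr_ge0 -(@IT_sub c d) //.
by apply: IT_ge0 => x; rewrite subr_ge0.
Qed.

Lemma IT0 : IT (fun _ => 0) = 0.
Proof. by rewrite (@IT_eq 0 1 _ (fun=> 0)) ?subrr //; exact: cont_cst. Qed.

Lemma ITZ c d (r : R) f : c < d -> continuous f -> supp_in c d f ->
  IT (fun x => r * f x) = r * IT f.
Proof.
move=> cd cf sf; rewrite -[RHS]addr0 -IT0 -(@IT_lin c d) //; last exact: cont_cst.
by congr IT; apply/funext => x; rewrite addr0.
Qed.

Lemma IT_norm c d f g : c < d -> continuous f -> continuous g ->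
  supp_in c d f -> supp_in c d g -> (forall x, `|f x| <= g x) -> `|IT f| <= IT g.
Proof.
move=> cd cf cg sf sg fg; rewrite ler_norml; apply/andP; split.
  rewrite -mulN1r -(@ITZ c d) //; apply: (@IT_le c d) => //.
  - exact: contZ.
  - exact: supp_inM.
  - by move=> x; rewrite mulN1r lerNl; have /ler_normlP[] := fg x.
by apply: (@IT_le c d) => // x; apply: le_trans (ler_norm _) (fg x).
Qed.

Lemma IT_bound c d f (M : R) : c < d -> continuous f -> supp_in c d f ->
  (forall x, `|f x| <= M) -> `|IT f| <= M * (d - c).
Proof.
move=> cd cf sf fM; have [F [dF Fc Fd]] := IT_prim cd cf sf.
rewrite -(Fd d) // -[F d]subr0 -(Fc c) //.
by have := mean_le dF (fun z (_ : Num.min c d <= z <= Num.max c d) => fM z); rewrite (ger0_norm (_ : 0 <= d - c)) // subr_ge0 ltW.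
Qed.

Lemma IT_affine c d f t b : t != 0 -> c < d -> continuous f -> supp_in c d f ->
  IT (fun x => f ((x - b) / t)) = `|t| * IT f.
Proof.
move=> t0 cd cf sf; have [F [dF Fc Fd]] := IT_prim cd cf sf.
have E (z : R) : (z - b) / t = t^-1 * z + - b / t by field.
have dG x : is_derive x 1 (fun x => t * F ((x - b) / t)) (f ((x - b) / t)).
  rewrite (_ : (fun x => _) = fun x => t * F (t^-1 * x + - b / t)); last first.
    by apply/funext => z; rewrite E.
  have H := is_derive_mul (is_derive_const t x) (is_derive_comp_affine (dF (t^-1 * x + - b / t))).
  by apply: is_derive_eq H _; rewrite -E mul0r add0r mulVKf.
have cG : continuous (fun x => f ((x - b) / t)).
  rewrite (_ : (fun x => _) = fun x => f (t^-1 * x + - b / t)); last first.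
    by apply/funext => z; rewrite E.
  by apply: cont_comp => //; apply: cont_affine.
have [tp|tn] := ltP 0 t.
  rewrite (@IT_eq (t * c + b) (t * d + b) _ _ _ cG _ dG).
  - rewrite !addrK ![t * _]mulrC !mulfK // (Fd d) // (Fc c) // (ger0_norm (ltW tp)); ring.
  - by rewrite ltrD2r ltr_pM2l.
  - move=> x [xc|dx]; apply: sf; [left|right].
      by rewrite ltr_pdivrMr // ltrBlDr mulrC.
    by rewrite ltr_pdivlMr // ltrBrDr mulrC.
have {}tn : t < 0 by rewrite lt_neqAle t0.
rewrite (@IT_eq (t * d + b) (t * c + b) _ _ _ cG _ dG).
- rewrite !addrK ![t * _]mulrC !mulfK // (Fd d) // (Fc c) // (ltr0_norm tn); ring.
- by rewrite ltrD2r ltr_nM2l.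
- move=> x [xc|dx]; apply: sf; [right|left].
    by rewrite ltr_ndivlMr // ltrBlDr mulrC.
  by rewrite ltr_ndivrMr // ltrBrDr mulrC.
Qed.

Lemma IT_derive c d F f : c < d -> continuous f -> (forall x, is_derive x 1 F (f x)) ->
  supp_in c d F -> IT f = 0.
Proof.
move=> cd cf dF sF.
have sf : supp_in c d f.
  move=> x [xc|dx].
    have : is_derive x 1 F 0.
      apply: (@is_derive_local _ _ (fun=> 0) x _ (c - x)); first lra.
      by move=> y /ltr_normlP[_ yx]; apply: sF; left; lra.
    by move=> /is_derive_eq1 <-; rewrite (is_derive_eq1 (dF x)).
  have : is_derive x 1 F 0.
    apply: (@is_derive_local _ _ (fun=> 0) x _ (x - d)); first lra.
    by move=> y /ltr_normlP[yx _]; apply: sF; right; lra.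
  by move=> /is_derive_eq1 <-; rewrite (is_derive_eq1 (dF x)).
rewrite (@IT_eq (c - 1) (d + 1) f F) //; last by apply: supp_inW sf; lra.
- by rewrite !sF ?subrr //; [left; lra|right; lra].
- lra.
Qed.

End Integral.

(** * Bumps, steps and cutoffs *)

Section Cutoffs.
Context {R : realType}.
Implicit Types (f g k phi psi chi : R -> R) (p : {poly R}) (a b c d x : R).

Lemma supp_in_derive1 c d f : supp_in c d f -> supp_in c d (derive1 f).
Proof.
move=> sf x [xc|dx]; apply: is_derive_eq1.
  apply: (@is_derive_local _ _ (fun=> 0) x _ (c - x)); first lra.
  by move=> y /ltr_normlP[_ yx]; apply: sf; left; lra.
apply: (@is_derive_local _ _ (fun=> 0) x _ (x - d)); first lra.
by move=> y /ltr_normlP[yx _]; apply: sf; right; lra.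
Qed.

Lemma supp_in_derive1n c d f n : supp_in c d f -> supp_in c d (derive1n n f).
Proof. by move=> sf; elim: n => // n IH; apply: supp_in_derive1. Qed.

Lemma bump_ex c d : c < d ->
  exists beta : R -> R, [/\ smooth beta, forall x, 0 <= beta x, supp_in c d beta & IT beta = 1].
Proof.
move=> cd; pose b0 x := flat 1 (1 * x + - c) * flat 1 (- 1 * x + d).
have sb : smooth b0 by apply: smoothM; apply: smooth_comp_affine; apply: smooth_flat.
have b_ge0 x : 0 <= b0 x by rewrite mulr_ge0 // flat1_ge0.
have supb : supp_in c d b0.
  move=> x [xc|dx]; rewrite /b0; first by rewrite flat_le0 ?mul0r //; lra.
  by rewrite [flat 1 (-1 * _ + _)]flat_le0 ?mulr0 //; lra.
have [F [dF Fc Fd]] := IT_prim cd (smooth_continuous sb) supb.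
have I0 : 0 < IT b0.
  rewrite -(Fd d) // -(Fc c) //; apply: (incr_of_derive dF) => // z /andP[cz zd].
  by rewrite mulr_gt0 // flat1_gt0 //; lra.
exists (fun x => (IT b0)^-1 * b0 x); split.
- exact: smoothZ.
- by move=> x; rewrite mulr_ge0 // invr_ge0 ltW.
- exact: supp_inM.
- by rewrite (@ITZ _ c d) ?mulVf ?lt0r_neq0 //; exact: smooth_continuous.
Qed.

Lemma step_ex : exists s : R -> R, [/\ smooth s, forall x, 0 <= derive1 s x,
  (forall x, x <= 0 -> s x = 0 /\ derive1 s x = 0) &
  forall x, 1 <= x -> s x = 1 /\ derive1 s x = 0].
Proof.
have [b [sb b0 supb Ib]] := bump_ex ltr01.
have [F [dF Fc Fd]] := IT_prim ltr01 (smooth_continuous sb) supb.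
have bc : continuous b by exact: smooth_continuous.
have b_0 x : x <= 0 -> b x = 0.
  rewrite le_eqVlt => /orP[/eqP ->|x0]; last by apply: supb; left.
  apply/eqP; rewrite eq_le b0 andbT leNgt; apply/negP => bp.
  have /cvgrPdist_lt/(_ _ bp)[e /= e0 H] := bc 0.
  have := H (- (e / 2)); rewrite /ball_ /= sub0r opprK ger0_norm; last lra.
  move=> /(_ ltac:(lra)); rewrite (supb (- (e / 2))); last by left; lra.
  by rewrite subr0 ger0_norm // ltxx.
have b_1 x : 1 <= x -> b x = 0.
  rewrite le_eqVlt => /orP[/eqP <-|x0]; last by apply: supb; right.
  apply/eqP; rewrite eq_le b0 andbT leNgt; apply/negP => bp.
  have /cvgrPdist_lt/(_ _ bp)[e /= e0 H] := bc 1.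
  have E : 1 - (1 + e / 2) = - (e / 2) by ring.
  have := H (1 + e / 2); rewrite /ball_ /= E normrN ger0_norm; last lra.
  move=> /(_ ltac:(lra)); rewrite (supb (1 + e / 2)); last by right; lra.
  by rewrite subr0 ger0_norm // ltxx.
exists F; rewrite (derive1_fun dF); split.
- exact: smooth_of dF sb.
- exact: b0.
- by move=> x x0; rewrite Fc // b_0.
- by move=> x x1; rewrite Fd // b_1.
Qed.

(** The last clause is meant for radially decreasing kernels centred at a point [y] with [|y| <= A]:
    multiplied by the cutoff, they keep a derivative of constant sign on each side of [y]. *)
Lemma cutoff_ex (A : R) : 0 <= A -> exists chi : R -> R,
  [/\ smooth chi, forall x, 0 <= chi x <= 1, forall x, `|x| <= A -> chi x = 1,
      supp_in (- (A + 1)) (A + 1) chi &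
      forall x y, `|y| <= A -> (x - y) * derive1 chi x <= 0].
Proof.
move=> A0; have [s [ss s'0 s0 s1]] := step_ex.
have s01 x : 0 <= s x <= 1.
  have [x0|x0] := leP x 0; first by rewrite (s0 _ x0).1 lexx ler01.
  have [x1|x1] := leP 1 x; first by rewrite (s1 _ x1).1 lexx ler01.
  have D z := smooth_is_derive z ss.
  apply/andP; split.
    by rewrite -(s0 0 _).1 //; apply: (ndecr_of_derive D) => //; exact: ltW.
  by rewrite -(s1 1 _).1 //; apply: (ndecr_of_derive D) => //; exact: ltW.
pose chi x := s (-1 * x + (A + 1)) * s (1 * x + (A + 1)).
have D x : is_derive x 1 chi (-1 * derive1 s (-1 * x + (A + 1)) * s (1 * x + (A + 1))
    + s (-1 * x + (A + 1)) * (1 * derive1 s (1 * x + (A + 1)))).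
  by apply: is_derive_mul; apply: is_derive_comp_affine; apply: smooth_is_derive.
exists chi; split.
- by apply: smoothM; apply: smooth_comp_affine.
- move=> x; rewrite /chi; set u := s _; set v := s _.
  have /andP[u0 u1] : 0 <= u <= 1 by apply: s01.
  have /andP[v0 v1] : 0 <= v <= 1 by apply: s01.
  by rewrite mulr_ge0 //= mulr_ile1.
- move=> x /ler_normlP[x1 x2]; rewrite /chi (s1 _ _).1 ?(s1 _ _).1 ?mul1r //; lra.
- move=> x [xc|dx]; rewrite /chi; first by rewrite [s (1 * _ + _)](s0 _ _).1 ?mulr0 //; lra.
  by rewrite (s0 _ _).1 ?mul0r //; lra.
- move=> x y /ler_normlP[y1 y2]; rewrite (is_derive_eq1 (D x)).
  have /andP[u0 _] := s01 (-1 * x + (A + 1)); have /andP[v0 _] := s01 (1 * x + (A + 1)).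
  have [xy|xy] := leP y x.
    rewrite [derive1 s (1 * x + _)](s1 _ _).2 ?mulr0 ?addr0; last lra.
    by apply: mulr_ge0_le0; rewrite ?subr_ge0 // mulN1r mulNr oppr_le0 mulr_ge0.
  rewrite [derive1 s (-1 * x + _)](s1 _ _).2 ?mulr0 ?mul0r ?add0r; last lra.
  by apply: mulr_le0_ge0; rewrite ?subr_le0 ?(ltW xy) // mul1r mulr_ge0.
Qed.

Lemma fsupp_in c d f : supp_in c d f -> fsupp f `<=` `[c, d].
Proof.
move=> sf; rewrite /fsupp (_ : `[c, d]%classic = closure `[c, d]); last first.
  exact/closure_id/interval_closed.
apply: closure_subset => x /= fx; rewrite in_itv /=; apply/andP; split; rewrite leNgt; apply/negP => H.
  by move: fx; rewrite sf ?eqxx //; left.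
by move: fx; rewrite sf ?eqxx //; right.
Qed.

Lemma test_of_supp c d f : smooth f -> supp_in c d f -> test_function f.
Proof.
move=> sf suf; split => //.
apply: (@subclosed_compact _ _ `[c, d]%classic (@closed_closure _ _) (@segment_compact _ c d)).
exact: fsupp_in.
Qed.

Lemma test_supp f : test_function f -> exists2 A : R, 0 < A & supp_in (- A) A f.
Proof.
move=> [sf /compact_bounded[M [_ HM]]].
exists (`|M| + 1); first by rewrite ltr_wpDl.
move=> x Hx; apply/eqP/negPn/negP => fx.
have xs : fsupp f x by apply: subset_closure.
have HM1 := ler_norm M.
have := HM (`|M| + 1) ltac:(lra) x xs.
by move=> /= /ler_normlP[h2 h3]; case: Hx => Hx; lra.
Qed.

Lemma test_smooth f : test_function f -> smooth f.
Proof. by case. Qed.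

End Cutoffs.

(** * The Gaussian and its derivatives *)

Section Gaussian.
Context {R : realType}.
Implicit Types (f g k phi psi chi : R -> R) (p : {poly R}) (a b c d x z : R).

(** A family stable under derivation, so that every derivative of the Gaussian belongs to it and
    decays faster than any power. *)
Definition polygauss p x : R := p.[x] * expR (- x ^+ 2).

Lemma is_derive_polygauss p x :
  is_derive x 1 (polygauss p) (polygauss (p^`() - 'X * p *+ 2) x).
Proof.
have X2 : is_derive x 1 (fun y => - y ^+ 2) (- (1 * x + x * 1)).
  by apply: is_derive_opp; apply: is_derive_mul; apply: is_derive_idr.
have H := is_derive_mul (is_derive_horner p x) (is_derive_comp (is_derive_expR _) X2).
apply: is_derive_eq H _; rewrite /polygauss hornerD hornerN hornerMn hornerM hornerX; ring.
Qed.

Lemma smooth_polygauss p : smooth (polygauss p).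
Proof.
apply: (@smooth_coind _ (fun f => exists p, f = polygauss p)); last by exists p.
move=> _ [q ->]; split=> [x|]; first by case: (is_derive_polygauss q x).
by eexists; apply: derive1_fun => x; apply: is_derive_polygauss.
Qed.

Lemma polygauss_bounded p m : exists2 C : R, 0 <= C &
  forall x, (1 + `|x|) ^+ m * `|polygauss p x| <= C.
Proof.
set S := \sum_(i < size p) `|p`_i|.
have pS x : `|p.[x]| <= S * (1 + `|x|) ^+ size p.
  rewrite horner_coef mulr_suml; apply: le_trans (ler_norm_sum _ _ _) _.
  apply: ler_sum => i _; rewrite normrM ler_wpM2l // normrX.
  apply: (@le_trans _ _ ((1 + `|x|) ^+ i)); first by rewrite lerXn2r ?nnegrE ?addr_ge0 ?lerDr.
  by rewrite ler_weXn2l ?lerDl // ltnW.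
have S0 : 0 <= S by apply: sumr_ge0.
have [C C0 HC] := poly_expR_bounded ((1 + 'X : {poly R}) ^+ (m + size p)).
exists (S * 2 ^+ (m + size p) * C); first by rewrite !mulr_ge0.
move=> x; rewrite /polygauss normrM (ger0_norm (expR_ge0 _)).
have X0 : 0 <= (1 + x ^+ 2) ^+ (m + size p) by rewrite exprn_ge0 // addr_ge0 // sqr_ge0.
have := HC (x ^+ 2) (sqr_ge0 _); rewrite horner_exp hornerD hornerX hornerC (ger0_norm X0).
move=> H; rewrite -mulrA; apply: (@le_trans _ _ (S * (2 ^+ (m + size p) * (1 + x ^+ 2) ^+ (m + size p)
  * expR (- x ^+ 2)))); last first.
  by rewrite ler_wpM2l // -mulrA ler_wpM2l.
rewrite !mulrA ler_wpM2r ?expR_ge0 //.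
apply: (@le_trans _ _ ((1 + `|x|) ^+ m * (S * (1 + `|x|) ^+ size p))).
  by rewrite ler_wpM2l // exprn_ge0 // addr_ge0.
rewrite mulrCA -exprD -mulrA ler_wpM2l // -exprMn lerXn2r ?nnegrE ?addr_ge0 //.
  by rewrite mulr_ge0 // addr_ge0 // sqr_ge0.
rewrite -(real_normK (num_real x)); have := normr_ge0 x.
by have := sqr_ge0 (`|x| - 1/2); nra.
Qed.

Definition gauss_cst : R := (Num.sqrt pi)^-1.

Lemma gauss_cst_gt0 : 0 < gauss_cst.
Proof. by rewrite invr_gt0 sqrtr_gt0 pi_gt0. Qed.

Definition gauss : R -> R := polygauss gauss_cst%:P.

Lemma gaussE x : gauss x = gauss_cst * expR (- x ^+ 2).
Proof. by rewrite /gauss /polygauss hornerC. Qed.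

Lemma gauss_gt0 x : 0 < gauss x.
Proof. by rewrite gaussE mulr_gt0 ?gauss_cst_gt0 ?expR_gt0. Qed.

Lemma gaussN x : gauss (- x) = gauss x.
Proof. by rewrite !gaussE sqrrN. Qed.

Lemma smooth_gauss : smooth gauss.
Proof. exact: smooth_polygauss. Qed.

Lemma derive1_gauss x : derive1 gauss x = - (2 * x * gauss x).
Proof.
rewrite (is_derive_eq1 (is_derive_polygauss _ x)) /gauss /polygauss.
by rewrite derivC sub0r hornerN hornerMn hornerM hornerX !hornerC; ring.
Qed.

Lemma derive1n_gauss_ex n : exists p, derive1n n gauss = polygauss p.
Proof.
elim: n => [|n [p IH]]; first by exists gauss_cst%:P.
exists (p^`() - 'X * p *+ 2); rewrite [derive1n _ _]/= -/(derive1n n gauss) IH.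
exact: derive1_fun (is_derive_polygauss p).
Qed.

Lemma gauss_bounded n m : exists2 C : R, 0 <= C &
  forall x, (1 + `|x|) ^+ m * `|derive1n n gauss x| <= C.
Proof. by have [p ->] := derive1n_gauss_ex n; apply: polygauss_bounded. Qed.

Lemma derive1n_gauss_is_derive n x :
  is_derive x 1 (derive1n n gauss) (derive1n n.+1 gauss x).
Proof. exact/smooth_is_derive/smooth_derive1n/smooth_gauss. Qed.

(* the heat equation for the self-similar kernel, differentiated n times *)
Lemma gauss_heat n x :
  n.+1%:R * derive1n n gauss x + x * derive1n n.+1 gauss x = - (2^-1 * derive1n n.+2 gauss x).
Proof.
elim: n x => [|n IH] x.
  have D (y : R) : is_derive y 1 (derive1 gauss) (- (2 * 1 * gauss y + 2 * y * derive1 gauss y)).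
    rewrite (_ : derive1 gauss = fun y => - (2 * y * gauss y)); last first.
      by apply/funext => z; rewrite derive1_gauss.
    have H := is_derive_opp (is_derive_mul (is_derive_mul (is_derive_const 2 y) (is_derive_idr y))
        (smooth_is_derive y smooth_gauss)).
    by apply: is_derive_eq H _; rewrite derive1_gauss; ring.
  by rewrite /derive1n /= (is_derive_eq1 (D x)) !derive1_gauss; field.
have D1 : is_derive x 1 (fun x => n.+1%:R * derive1n n gauss x + x * derive1n n.+1 gauss x)
   (n.+2%:R * derive1n n.+1 gauss x + x * derive1n n.+2 gauss x).
  have H := is_derive_add (is_derive_mul (is_derive_const n.+1%:R x) (derive1n_gauss_is_derive n x))
    (is_derive_mul (is_derive_idr x) (derive1n_gauss_is_derive n.+1 x)).
  by apply: is_derive_eq H _; rewrite -(natr1 n.+1); ring.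
rewrite -(is_derive_eq1 D1) (_ : (fun x => _) = fun x => - (2^-1 * derive1n n.+2 gauss x)); last first.
  by apply/funext => z; rewrite IH.
have H := is_derive_opp (is_derive_mul (is_derive_const 2^-1 x) (derive1n_gauss_is_derive n.+2 x)).
by rewrite (is_derive_eq1 H) mul0r add0r.
Qed.

Lemma gauss_T1 : T1_class gauss.
Proof.
split; last first.
  move=> x; rewrite derive1_gauss mulrN oppr_le0 (_ : x * _ = 2 * x ^+ 2 * gauss x); last by ring.
  by rewrite mulr_ge0 ?(ltW (gauss_gt0 _)) // mulr_ge0 // sqr_ge0.
split.
- exact: smooth_gauss.
- by move=> x; apply/ltW/gauss_gt0.
- rewrite (_ : (fun x => _) = fun x => (gauss_cst%:E * (gauss_fun x)%:E)%E); last first.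
    by apply/funext => x; rewrite gaussE EFinM /gauss_fun.
  rewrite ge0_integralZl //=.
  + rewrite integralT_gauss -EFinM mulVf // gt_eqF // sqrtr_gt0 pi_gt0 //.
  + by apply/measurable_EFinP; apply: measurable_gauss_fun.
  + by move=> x _; rewrite lee_fin gauss_fun_ge0.
  + by rewrite lee_fin ltW // gauss_cst_gt0.
(* Any exponent below -1 would serve: the Gaussian decays faster than every power. *)
exists (-2); first lra.
move=> m; have [C C0 HC] := gauss_bounded m (m + 2); exists C, 1; split => // x x1.
rewrite (_ : -2 - m%:R = - (m + 2)%:R); last by rewrite natrD; lra.
have xp : 0 < `|x| by lra.
rewrite powRN powR_mulrn // ler_pdivlMr ?exprn_gt0 // mulrC; apply: le_trans (HC x).
by rewrite ler_wpM2r // lerXn2r ?nnegrE ?addr_ge0 // lerDr.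
Qed.

End Gaussian.

(** * Equicontinuity at a point value *)

Section GeometricSeries.
Context {R : realType}.
Implicit Types (a b : nat -> R) (F : nat -> R -> R).

Definition sumr a : R := limn (series a).

Definition gdom (M : R) a := forall l, `|a l| <= M * 2^-1 ^+ l.

Let half1 : `|2^-1 : R| < 1.
Proof. by rewrite ger0_norm // invf_lt1 // ltr1n. Qed.

Lemma gdom_normed_cvg M a : gdom M a -> cvgn [normed series a].
Proof.
move=> H; apply: (@series_le_cvg _ _ (geometric M 2^-1)).
- by move=> n /=; apply: normr_ge0.
- by move=> n; apply: le_trans (H n).
- by move=> n; rewrite /geometric /=; apply: H.
- exact: is_cvg_geometric_series.
Qed.

Lemma gdom_cvg M a : gdom M a -> cvgn (series a).
Proof. by move=> /gdom_normed_cvg/normed_cvg. Qed.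

Lemma gdom_le M a : gdom M a -> `|sumr a| <= 2 * M.
Proof.
move=> H; apply: le_trans (lim_series_norm (gdom_normed_cvg H)) _.
have cg := @is_cvg_geometric_series _ M _ half1.
apply: le_trans (lim_series_le (gdom_normed_cvg H) cg H) _.
have := @cvg_geometric_series _ M _ half1 => /cvg_lim -> //.
by rewrite (_ : 1 - 2^-1 = 2^-1) ?invrK 1?mulrC //; field.
Qed.

Lemma sumrB M N a b : gdom M a -> gdom N b -> sumr (fun l => a l - b l) = sumr a - sumr b.
Proof. by move=> /gdom_cvg ca /gdom_cvg cb; rewrite /sumr -lim_seriesB. Qed.

Lemma sumrZ M a k : gdom M a -> sumr (fun l => k * a l) = k * sumr a.
Proof. by move=> /gdom_cvg ca; rewrite /sumr -[RHS]/(k *: _) -lim_seriesZ. Qed.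

Lemma gdomB M N a b : gdom M a -> gdom N b -> gdom (M + N) (fun l => a l - b l).
Proof.
move=> ca cb l; apply: le_trans (ler_normB _ _) _; rewrite mulrDl.
exact: lerD.
Qed.

Lemma gdomZ M a k : gdom M a -> gdom (`|k| * M) (fun l => k * a l).
Proof. by move=> ca l; rewrite normrM -mulrA ler_wpM2l. Qed.

Lemma sumrS M a : gdom M a -> sumr a = a 0%N + sumr (fun l => a l.+1).
Proof.
move=> H; have ca := gdom_cvg H.
have H' : gdom M (fun l => a l.+1).
  move=> l; apply: le_trans (H l.+1) _; rewrite ler_wpM2l //.
    by have := le_trans (normr_ge0 _) (H 0%N); rewrite expr0 mulr1.
  by rewrite ler_wiXn2l // ?invr_ge0 // invf_le1 // ler1n.
have ca' := gdom_cvg H'.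
rewrite /sumr; apply: cvg_lim => //; rewrite -cvg_shiftS.
have -> : [sequence series a n.+1]_n = (fun n => a 0%N + series (fun l => a l.+1) n).
  by apply/funext => n /=; rewrite /series /= big_nat_recl.
by apply: cvgD; [apply: cvg_cst|apply: ca'].
Qed.

Lemma gdom_shift M a n : gdom M a -> gdom M (fun l => a (n + l)%N).
Proof.
move=> H l; apply: le_trans (H _) _; rewrite ler_wpM2l //.
  by have := le_trans (normr_ge0 _) (H 0%N); rewrite expr0 mulr1.
by rewrite ler_wiXn2l // ?invr_ge0 ?leq_addl // invf_le1 // ler1n.
Qed.

Lemma sumr_split M a n : gdom M a ->
  sumr a = \sum_(l < n) a l + sumr (fun l => a (n + l)%N).
Proof.
move=> H; elim: n => [|n IH]; first by rewrite big_ord0 add0r.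
rewrite IH big_ord_recr /= -addrA; congr (_ + _).
rewrite (sumrS (gdom_shift n H)) addn0; congr (_ + sumr _).
by apply/funext => l; rewrite addnS.
Qed.

(** For each order the derivatives are dominated by one geometric series, uniformly in [x]; this is
    what termwise differentiation to all orders needs. *)
Definition gsmooth F := (forall l, smooth (F l)) /\
  forall j, exists M, forall x, gdom M (fun l => derive1n j (F l) x).

Lemma gsmooth_derive F : gsmooth F -> gsmooth (fun l => derive1 (F l)).
Proof.
move=> [sF HF]; split=> [l|j]; first exact: smooth_derive1.
by have [M HM] := HF j.+1; exists M => x l; rewrite -derive1n_S; apply: HM.
Qed.

Lemma gsmooth_is_derive F : gsmooth F -> forall x : R,
  is_derive x 1 (fun x => sumr (fun l => F l x)) (sumr (fun l => derive1 (F l) x)).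
Proof.
move=> [sF HF] x; have [M0 H0] := HF 0%N; have [M1 H1] := HF 1%N; have [M2 H2] := HF 2%N.
apply: (@is_derive_rem2 _ _ _ _ (2 * M2) 1) => // h _.
rewrite -(sumrB (H0 (x + h)) (H0 x)) -(sumrZ h (H1 x)).
rewrite -(sumrB (gdomB (H0 (x + h)) (H0 x)) (gdomZ h (H1 x))) -mulrA; apply: gdom_le => l /=.
rewrite mulrAC; apply: (@taylor2_le _ _ (derive1 (F l)) (derive1n 2 (F l))).
- by move=> y; apply: smooth_is_derive.
- by move=> y; apply: (smooth_is_derive y (smooth_derive1 (sF l))).
- by move=> z _; apply: H2.
Qed.

Lemma gsmooth_smooth F : gsmooth F -> smooth (fun x => sumr (fun l => F l x)).
Proof.
move=> gF.
apply: (@smooth_coind _ (fun f => exists F, gsmooth F /\ f = fun x => sumr (fun l => F l x)));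
  last by exists F.
move=> _ [{gF}F [gF ->]]; have D := gsmooth_is_derive gF.
split=> [x|]; first by case: (D x).
exists (fun l => derive1 (F l)); split; first exact: gsmooth_derive.
exact: derive1_fun.
Qed.

Lemma gsmooth_derive1n F n : gsmooth F ->
  derive1n n (fun x => sumr (fun l => F l x)) = fun x => sumr (fun l => derive1n n (F l) x).
Proof.
elim: n F => [//|n IH] F gF; rewrite derive1n_S (derive1_fun (gsmooth_is_derive gF)).
rewrite IH; last exact: gsmooth_derive.
by apply/funext => x; congr sumr; apply/funext => l; rewrite derive1n_S.
Qed.

Lemma gsmooth_shift F n : gsmooth F -> gsmooth (fun l => F (n + l)%N).
Proof.
move=> [sF HF]; split=> [l|j]; first exact: sF.
by have [M HM] := HF j; exists M => x; apply: (gdom_shift n (HM x)).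
Qed.

End GeometricSeries.

(** * Seminorm bounds, linearity and dilations *)

Section Distributions.
Context {R : realType}.
Implicit Types (g : (R -> R) -> R) (phi psi : R -> R) (p e M gamma : R).

Definition bnd n M phi := forall j, (j <= n)%N -> forall x, `|derive1n j phi x| <= M.

Lemma bndW n m M phi : (m <= n)%N -> bnd n M phi -> bnd m M phi.
Proof. by move=> mn H j jm; apply: H; apply: leq_trans mn. Qed.

Lemma bnd_ge0 n M phi : bnd n M phi -> 0 <= M.
Proof. by move=> /(_ 0%N (leq0n _) 0); apply: le_trans. Qed.

Lemma bndM n M N phi psi : smooth phi -> smooth psi -> bnd n M phi -> bnd n N psi ->
  bnd n (2 ^+ n * (M * N)) (fun x => phi x * psi x).
Proof.
move=> sp sq Hp Hq j jn x.
apply: (@le_trans _ _ (2 ^+ j * (M * N))).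
  apply: derive1nM_le => // i ij; [apply: Hp|apply: Hq]; exact: leq_trans jn.
rewrite ler_wpM2r ?mulr_ge0 ?(bnd_ge0 Hp) ?(bnd_ge0 Hq) //.
by rewrite ler_weXn2l // ler1n.
Qed.

Lemma bndZ n M c phi : smooth phi -> bnd n M phi -> bnd n (`|c| * M) (fun x => c * phi x).
Proof. by move=> sp H j jn x; rewrite derive1nZ // normrM ler_wpM2l // H. Qed.

Lemma cont_supp_bounded c d (f : R -> R) : c < d -> continuous f -> supp_in c d f ->
  exists M, forall x, `|f x| <= M.
Proof.
move=> cd cf sf.
have /= [z _ Hz] := @EVT_max R (fun x => `|f x|) c d (ltW cd)
  (continuous_subspaceT (cont_norm cf)).
exists `|f z| => x; have [xi|xi] := boolP (x \in `[c, d]); first exact: Hz.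
rewrite sf ?normr0 //; move: xi; rewrite in_itv /= negb_and -!ltNge.
by case/orP; [left|right].
Qed.

Lemma bnd_ex n c d phi : c < d -> smooth phi -> supp_in c d phi -> exists M, bnd n M phi.
Proof.
move=> cd sp su; elim: n => [|n [M HM]].
  have [M HM] := cont_supp_bounded cd (smooth_continuous sp) su.
  by exists M => -[|//] _; apply: HM.
have [N HN] := cont_supp_bounded cd (smooth_continuous (@smooth_derive1n _ n.+1 _ sp))
  (@supp_in_derive1n _ _ _ _ n.+1 su).
exists (Num.max M N) => j; rewrite leq_eqVlt => /orP[/eqP -> x|jn x].
  by rewrite le_max HN orbT.
by rewrite le_max HM.
Qed.

(** The continuity seminorms are replaced by a single bound on the derivatives up to order [N]; the
    factor [N.+1] in the constant counts them. *)
Lemma schwartz_bound g c d : schwartz_distribution g -> exists (N : nat) (C : R), 0 <= C /\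
  forall phi M, smooth phi -> supp_in c d phi -> bnd N M phi -> `|g phi| <= C * M.
Proof.
move=> [_ /(_ `[c, d]%classic (@segment_compact _ c d))[N [C H]]].
exists N, (`|C| * N.+1%:R); split=> [|phi M sp su Hb]; first by rewrite mulr_ge0.
apply: le_trans (H phi (test_of_supp sp su) (fsupp_in su)) _.
have supM (k : 'I_N.+1) : 0 <= sup (range (fun x => `|derive1n k phi x|)) <= M.
  have ub : ubound (range (fun x => `|derive1n k phi x|)) M.
    by move=> _ [x _ <-]; apply: Hb; rewrite -ltnS.
  have ne : (range (fun x => `|derive1n k phi x|)) !=set0 by exists (`|derive1n k phi 0|), 0.
  apply/andP; split; last exact: ge_sup.
  by apply: (le_trans (normr_ge0 (derive1n k phi 0))); apply: ub_le_sup; [exists M|exists 0].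
apply: (@le_trans _ _ (`|C| * \sum_(k < N.+1) sup (range (fun x => `|derive1n k phi x|)))).
  rewrite ler_wpM2r ?ler_norm // sumr_ge0 // => k _; by have /andP[] := supM k.
rewrite -mulrA ler_wpM2l // mulr_natl -[N.+1 in leRHS]card_ord -sumr_const.
by apply: ler_sum => k _; have /andP[] := supM k.
Qed.

Lemma schwartz_lin g c phi psi : schwartz_distribution g -> test_function phi ->
  test_function psi -> g (fun x => c * phi x + psi x) = c * g phi + g psi.
Proof. by move=> [H _]; apply: H. Qed.

Lemma test_cst0 : test_function (fun _ : R => 0).
Proof. by apply: (@test_of_supp _ 0 1) => [|//]; apply: smooth_cst. Qed.

Lemma schwartz0 g : schwartz_distribution g -> g (fun _ => 0) = 0.
Proof.
move=> sg; have := schwartz_lin 1 sg test_cst0 test_cst0.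
rewrite (_ : (fun _ : R => _) = fun=> 0); last by apply/funext => x; rewrite mulr0 addr0.
rewrite mul1r; lra.
Qed.

Lemma schwartzZ g c phi : schwartz_distribution g -> test_function phi ->
  g (fun x => c * phi x) = c * g phi.
Proof.
move=> sg tp; have := schwartz_lin c sg tp test_cst0; rewrite schwartz0 // addr0 => <-.
by congr g; apply/funext => x; rewrite addr0.
Qed.

Lemma schwartzD g phi psi : schwartz_distribution g -> test_function phi ->
  test_function psi -> g (fun x => phi x + psi x) = g phi + g psi.
Proof.
move=> sg tp tq; have := schwartz_lin 1 sg tp tq; rewrite mul1r => <-.
by congr g; apply/funext => x; rewrite mul1r.
Qed.

Lemma schwartzB g phi psi : schwartz_distribution g -> test_function phi ->
  test_function psi -> g (fun x => phi x - psi x) = g phi - g psi.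
Proof.
move=> sg tp tq; rewrite addrC -mulN1r -(schwartz_lin _ sg tq tp).
by congr g; apply/funext => x; rewrite mulN1r addrC.
Qed.

Lemma test_sum (n : nat) (F : nat -> R -> R) c d : (forall l, smooth (F l)) ->
  (forall l, supp_in c d (F l)) ->
  smooth (fun x => \sum_(l < n) F l x) /\ supp_in c d (fun x => \sum_(l < n) F l x).
Proof.
move=> sF suF; elim: n => [|n [IH1 IH2]].
  rewrite (_ : (fun x => _) = fun=> 0); first by split=> [|x _]; [exact: smooth_cst|].
  by apply/funext => x; rewrite big_ord0.
rewrite (_ : (fun x => _) = fun x => \sum_(l < n) F l x + F n x); last first.
  by apply/funext => x; rewrite big_ord_recr.
by split; [exact: (smoothD IH1 (sF n))|apply: supp_inD].
Qed.

Lemma schwartz_sum g (n : nat) (F : nat -> R -> R) c d : schwartz_distribution g ->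
  (forall l, smooth (F l)) -> (forall l, supp_in c d (F l)) ->
  g (fun x => \sum_(l < n) F l x) = \sum_(l < n) g (F l).
Proof.
move=> sg sF suF; elim: n => [|n IH].
  rewrite [RHS]big_ord0 -[RHS](schwartz0 sg); congr g.
  by apply/funext => x; rewrite big_ord0.
rewrite big_ord_recr /= -IH -schwartzD //.
- by congr g; apply/funext => x; rewrite big_ord_recr.
- by have [s1 s2] := test_sum n sF suF; apply: test_of_supp s1 s2.
- exact: test_of_supp (sF n) (suF n).
Qed.

Definition dil p e phi : R -> R := fun y => phi ((y - p) / e).

Lemma dilE p e phi : dil p e phi = fun y => phi (e^-1 * y + - p / e).
Proof. by apply/funext => y; rewrite /dil; congr phi; ring. Qed.

Lemma smooth_dil p e phi : smooth phi -> smooth (dil p e phi).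
Proof. by move=> sp; rewrite dilE; apply: smooth_comp_affine. Qed.

Lemma derive1n_dil n p e phi : smooth phi ->
  derive1n n (dil p e phi) = fun y => e^-1 ^+ n * derive1n n phi ((y - p) / e).
Proof.
move=> sp; rewrite dilE derive1n_comp_affine //; apply/funext => y.
by congr (_ * derive1n n phi _); ring.
Qed.

Lemma supp_dil p e phi A : e != 0 -> supp_in (- A) A phi ->
  supp_in (p - A * `|e|) (p + A * `|e|) (dil p e phi).
Proof.
move=> e0 su y Hy; rewrite /dil.
have ep : 0 < `|e| by rewrite normr_gt0.
have : A < `|(y - p) / e|.
  rewrite normrM normfV ltr_pdivlMr //.
  by rewrite lter_normr; apply/orP; case: Hy => Hy; [right|left]; lra.
by rewrite lter_normr => /orP[H|H]; apply: su; [right|left; lra].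
Qed.

Lemma bnd_dil N M p e phi : smooth phi -> 0 < `|e| <= 1 -> bnd N M phi ->
  bnd N (`|e|^-1 ^+ N * M) (dil p e phi).
Proof.
move=> sp /andP[e0 e1] Hb j jN y; rewrite derive1n_dil // normrM normrX normfV.
rewrite ler_pM ?exprn_ge0 ?invr_ge0 ?Hb //.
by rewrite ler_weXn2l // invf_ge1.
Qed.

(** The order [N] is the same at every scale, while the constant found here grows like a power of
    [|e|^-1]. Making the constant uniform near 0 is the purpose of the gliding hump. *)
Lemma scaled_pairing_bound g p : schwartz_distribution g -> exists N : nat,
  forall e, 0 < `|e| <= 1 -> exists D : R, 0 < D /\ forall phi M, smooth phi ->
    supp_in (-2) 2 phi -> bnd N M phi -> `|scaled_pairing g p e phi| <= D * M.
Proof.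
move=> sg; have [N [C [C0 H]]] := schwartz_bound (p - 2) (p + 2) sg.
exists N => e /andP[e0 e1]; have ne0 : e != 0 by rewrite -normr_gt0.
exists (`|e|^-1 * (C * `|e|^-1 ^+ N) + 1); split.
  by rewrite ltr_wpDl // !mulr_ge0 ?exprn_ge0 ?invr_ge0.
move=> phi M sp su Hb; rewrite /scaled_pairing normrM (ger0_norm (_ : 0 <= `|e|^-1)); last first.
  by rewrite invr_ge0.
apply: (@le_trans _ _ (`|e|^-1 * (C * `|e|^-1 ^+ N) * M)); last first.
  by rewrite ler_wpM2r ?(bnd_ge0 Hb) // lerDl.
rewrite -mulrA ler_wpM2l ?invr_ge0 // -mulrA; apply: H; first exact: smooth_dil.
  by apply: (supp_inW _ _ (supp_dil ne0 su)); nra.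
by apply: bnd_dil; rewrite ?e0.
Qed.

End Distributions.

(** * Uniform boundedness of the scaled pairings *)

Section UniformBoundedness.
Context {R : realType}.
Implicit Types (g : (R -> R) -> R) (phi psi : R -> R) (p e M gamma : R).

Lemma point_value_limit g p gamma phi : has_point_value g p gamma -> test_function phi ->
  forall eta, 0 < eta -> exists2 delta, 0 < delta &
    forall e, 0 < `|e| < delta -> `|scaled_pairing g p e phi - gamma * IT phi| < eta.
Proof.
move=> H tp eta eta0; have /cvgrPdist_lt/(_ _ eta0)[d /= d0 Hd] := H phi tp.
exists d => // e /andP[e0 ed]; rewrite distrC; apply: Hd; last by rewrite -normr_gt0.
by rewrite /ball_ /= sub0r normrN.
Qed.

(** Pointwise boundedness along a null sequence of scales, the input of the uniform boundedness
    argument. *)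
Lemma point_value_seq_bounded g p gamma phi (e_ : nat -> R) :
  has_point_value g p gamma -> test_function phi ->
  (forall m, 0 < `|e_ m| < m.+1%:R^-1) ->
  exists B : R, 0 <= B /\ forall m, `|scaled_pairing g p (e_ m) phi| <= B.
Proof.
move=> H tp He; set u := fun m => scaled_pairing g p (e_ m) phi.
have cu : cvgn u.
  apply/cvg_ex; exists (gamma * IT phi); apply/cvgrPdist_lt => eta eta0.
  have [d d0 Hd] := point_value_limit H tp eta0.
  near=> m; rewrite distrC; apply: Hd; have /andP[-> /=] := He m => /lt_trans; apply.
  by near: m; apply: (near_infty_natSinv_lt (PosNum d0)).
have [M [_ HM]] := cvg_seq_bounded cu.
exists (`|M| + 1); split; first by rewrite addr_ge0.
by move=> m; apply: HM => //; have := ler_norm M; lra.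
Unshelve. all: end_near. Qed.

Lemma test_dil p e phi : e != 0 -> test_function phi -> test_function (dil p e phi).
Proof.
move=> e0 tp; have [A _ sA] := test_supp tp.
exact: test_of_supp (smooth_dil (test_smooth tp)) (supp_dil e0 sA).
Qed.

Lemma scaled_pairingE g p e phi : scaled_pairing g p e phi = `|e|^-1 * g (dil p e phi).
Proof. by []. Qed.

Lemma scaled_pairingZ g p e c phi : schwartz_distribution g -> e != 0 -> test_function phi ->
  scaled_pairing g p e (fun x => c * phi x) = c * scaled_pairing g p e phi.
Proof.
move=> sg e0 tp; rewrite !scaled_pairingE mulrCA; congr (_ * _).
by rewrite -(schwartzZ c sg (test_dil p e0 tp)).
Qed.

Lemma scaled_pairingD g p e phi psi : schwartz_distribution g -> e != 0 ->
  test_function phi -> test_function psi -> scaled_pairing g p e (fun x => phi x + psi x) =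
  scaled_pairing g p e phi + scaled_pairing g p e psi.
Proof.
move=> sg e0 tp tq; rewrite !scaled_pairingE -mulrDr; congr (_ * _).
by rewrite -(schwartzD sg (test_dil p e0 tp) (test_dil p e0 tq)).
Qed.

Lemma scaled_pairing_sum g p e (n : nat) (F : nat -> R -> R) A : schwartz_distribution g ->
  e != 0 -> (forall l, smooth (F l)) -> (forall l, supp_in (- A) A (F l)) ->
  scaled_pairing g p e (fun x => \sum_(l < n) F l x) = \sum_(l < n) scaled_pairing g p e (F l).
Proof.
move=> sg e0 sF suF; rewrite scaled_pairingE -mulr_sumr; congr (_ * _).
rewrite -(@schwartz_sum _ g n (fun l => dil p e (F l)) (p - A * `|e|) (p + A * `|e|)) //.
- by move=> l; apply: smooth_dil.
- by move=> l; apply: supp_dil.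
Qed.

Section GlidingHump.
Variables (g : (R -> R) -> R) (p gamma : R).
Hypotheses (sg : schwartz_distribution g) (pg : has_point_value g p gamma).
Variables (e_ : nat -> R) (psi_ : nat -> R -> R).
Hypothesis (He : forall n, 0 < `|e_ n| < n.+1%:R^-1).
Hypotheses (spsi : forall n, smooth (psi_ n)) (supsi : forall n, supp_in (-2) 2 (psi_ n)).
Hypothesis (bpsi : forall n, bnd n (2^-1 ^+ n) (psi_ n)).
Notation T := (scaled_pairing g p).

Let ene0 n : e_ n != 0.
Proof. by rewrite -normr_gt0; have /andP[] := He n. Qed.

Let tpsi n : test_function (psi_ n).
Proof. by apply: (@test_of_supp _ (-2) 2). Qed.

(** Otherwise a sparse subsequence of the bumps [psi_ n] sums to a test function. At the scale of a
    selected bump the earlier terms are bounded because the distribution has a point value, the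
    later ones because their seminorms are tiny, and the bump itself exceeds [2 ^+ m]. Hence the
    pairings of the sum are unbounded along the scales, against the point value. *)
Lemma gliding_hump : exists n, `|T (e_ n) (psi_ n)| <= 2 ^+ n.
Proof.
apply: contrapT => Hbig.
have {}Hbig n : 2 ^+ n < `|T (e_ n) (psi_ n)|.
  by rewrite ltNge; apply/negP => H; apply: Hbig; exists n.
have [B HB] := choice (fun j => point_value_seq_bounded pg (tpsi j) He).
have [N0 HN0] := scaled_pairing_bound p sg.
have He1 n : 0 < `|e_ n| <= 1.
  have /andP[-> /ltW H] /= := He n; apply: le_trans H _.
  by rewrite invf_le1 // ler1n.
have [D HD] := choice (fun m => HN0 (e_ m) (He1 m)).
pose b k := \sum_(j < k.+1) B j; pose dd k := \sum_(j < k.+1) D j.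
have Bb j k : (j <= k)%N -> B j <= b k.
  move=> jk; rewrite /b (bigD1 (Ordinal (jk : (j < k.+1)%N))) //= lerDl sumr_ge0 // => i _.
  exact: (HB i).1.
have Dd j k : (j <= k)%N -> D j <= dd k.
  move=> jk; rewrite /dd (bigD1 (Ordinal (jk : (j < k.+1)%N))) //= lerDl sumr_ge0 // => i _.
  exact/ltW/(HD i).1.
(* [b k] bounds the pairings of the bumps up to [k] at all the scales, [dd k] the constants of the
   scales up to [k]. The next index makes its hump beat the former and its bump negligible at the
   latter. *)
have /choice[nxt Hnxt] : forall k, exists n : nat, [/\ (k < n)%N,
    k%:R + 3 + (k.+1)%:R * b k <= 2 ^+ n & dd k * 2 ^+ k <= 2 ^+ n].
  move=> k.
  exists (maxn k.+1 (maxn (Num.bound (k%:R + 3 + (k.+1)%:R * b k)) (Num.bound (dd k * 2 ^+ k)))).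
  split; first by rewrite leq_maxl.
    by apply/ltW/upper_nthrootP; rewrite !leq_max leqnn orbT.
  by apply/ltW/upper_nthrootP; rewrite !leq_max leqnn !orbT.
(* Starting at [N0], every selected bump is small up to the order [N0] in which the constants [D]
   are expressed. *)
pose n_ i := iter i nxt N0.
have n_S i : n_ i.+1 = nxt (n_ i) by [].
have n_lt i : (n_ i < n_ i.+1)%N by rewrite n_S; have [] := Hnxt (n_ i).
have n_mono i l : (i <= l)%N -> (n_ i <= n_ l)%N.
  by move=> il; rewrite -(subnK il); elim: (l - i)%N => // m IH; apply: leq_trans IH (ltnW (n_lt _)).
have n_ge i : (i <= n_ i)%N by elim: i => // i IH; apply: leq_ltn_trans IH (n_lt _).
have N0_le i : (N0 <= n_ i)%N by apply: (n_mono 0%N).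
have /andP[half0 half1] : 0 <= (2^-1 : R) <= 1 by rewrite invr_ge0 ler0n invf_le1 // ler1n.
have gs : gsmooth (fun l => psi_ (n_ l)).
  split=> // j; have lt22 : -2 < 2 :> R by lra.
  have [M HM] := choice (fun l => bnd_ex j lt22 (@spsi (n_ l)) (supsi (n_ l))).
  have M0 l : 0 <= M l by exact: bnd_ge0 (HM l).
  exists (1 + \sum_(l < j) M l * 2 ^+ l) => x l.
  have [jl|lj] := leqP j l.
    apply: (@le_trans _ _ (2^-1 ^+ l)); last first.
      rewrite -[leLHS]mul1r ler_wpM2r ?exprn_ge0 ?invr_ge0 // lerDl sumr_ge0 // => i _.
      by rewrite mulr_ge0 // exprn_ge0.
    apply: le_trans (bpsi (leq_trans jl (n_ge l)) x) _.
    by rewrite ler_wiXn2l.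
  apply: (le_trans (HM l j (leqnn j) x)).
  rewrite exprVn ler_pdivlMr ?exprn_gt0 //.
  apply: (@le_trans _ _ (\sum_(i < j) M i * 2 ^+ i)); last by rewrite lerDr.
  rewrite (bigD1 (Ordinal lj)) //= lerDl sumr_ge0 // => i _.
  by rewrite mulr_ge0 // exprn_ge0.
have sS k : smooth (fun x => sumr (fun l => psi_ (n_ (k + l)%N) x)).
  by apply: gsmooth_smooth; apply: (gsmooth_shift k gs).
have suS k : supp_in (-2) 2 (fun x => sumr (fun l => psi_ (n_ (k + l)%N) x)).
  move=> x Hx; rewrite (_ : (fun l => _) = fun=> 0); last first.
    by apply/funext => l; apply: supsi.
  have : gdom 0 (fun _ : nat => 0 : R) by move=> l; rewrite normr0 mul0r.
  by move=> /gdom_le; rewrite mulr0 normr_le0 => /eqP.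
have tS k : test_function (fun x => sumr (fun l => psi_ (n_ (k + l)%N) x)).
  by apply: (@test_of_supp _ (-2) 2); [apply: sS|apply: suS].
have [BS [BS0 HBS]] := point_value_seq_bounded pg (tS 0%N) He.
(* [i] exceeds the bound [BS] on the pairings of the sum, and [m] is the next selected index; the
   margin 3 in the choice of [nxt] leaves room for the tail, which is at most 2. *)
set i := Num.bound BS; set m := n_ i.+1.
have Ssplit : (fun x => sumr (fun l => psi_ (n_ (0 + l)%N) x)) =
    fun x => (\sum_(l < i.+1) psi_ (n_ l) x + psi_ m x) + sumr (fun l => psi_ (n_ (i.+2 + l)%N) x).
  apply/funext => x; have [M HM] := gs.2 0%N.
  by rewrite (sumr_split i.+2 (HM x)) big_ord_recr.
have [sm1 su1] := test_sum i.+1 (fun l => @spsi (n_ l)) (fun l => @supsi (n_ l)).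
have t1 : test_function (fun x => \sum_(l < i.+1) psi_ (n_ l) x) by apply: (@test_of_supp _ (-2) 2).
have t2 : test_function (fun x => \sum_(l < i.+1) psi_ (n_ l) x + psi_ m x).
  by apply: (@test_of_supp _ (-2) 2); [apply: smoothD|apply: supp_inD].
have := HBS m.
rewrite Ssplit (scaled_pairingD p sg (ene0 m) t2 (tS i.+2)) (scaled_pairingD p sg (ene0 m) t1 (tpsi m)).
rewrite (@scaled_pairing_sum g p (e_ m) i.+1 (fun l => psi_ (n_ l)) 2 sg (ene0 m)
  (fun l => @spsi (n_ l)) (fun l => @supsi (n_ l))).
set X := \sum_(l < _) _; set Y := T _ _; set Z := T _ _ => HXYZ.
have [h1 h2 h3] := Hnxt (n_ i).
have HX : `|X| <= (n_ i).+1%:R * b (n_ i).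
  apply: le_trans (ler_norm_sum _ _ _) _.
  apply: (@le_trans _ _ (\sum_(l < i.+1) b (n_ i))).
    apply: ler_sum => l _; apply: le_trans ((HB (n_ l)).2 m) _; apply: Bb.
    by apply: n_mono; rewrite -ltnS.
  rewrite sumr_const card_ord -[_ *+ _]mulr_natl ler_wpM2r //.
    by apply: le_trans (HB 0%N).1 (Bb _ _ _).
  by rewrite ler_nat ltnS n_ge.
have HZ : `|Z| <= 2.
  have [Dm HDm] := HD m.
  have gd j x : (j <= N0)%N -> gdom (D m)^-1 (fun l => derive1n j (psi_ (n_ (i.+2 + l)%N)) x).
    move=> jN l; apply: le_trans (bpsi (leq_trans jN (N0_le _)) x) _.
    rewrite !exprVn -invfM lef_pV2 ?posrE ?mulr_gt0 ?exprn_gt0 //.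
    have [_ _] := Hnxt (n_ (i.+1 + l)%N); rewrite -n_S -addSn; apply: le_trans.
    apply: ler_pM; rewrite ?exprn_ge0 ?(ltW Dm) //.
      by apply: Dd; apply: n_mono; rewrite leq_addr.
    rewrite ler_weXn2l ?ler1n //; apply: leq_trans (n_ge _).
    exact: leq_addl.
  have := HDm _ (2 * (D m)^-1) (sS i.+2) (@suS i.+2).
  rewrite mulrCA mulfV ?mulr1 ?gt_eqF //; apply => j jN x.
  rewrite (gsmooth_derive1n _ (gsmooth_shift i.+2 gs)); apply: gdom_le; exact: gd.
have HY : 2 ^+ m < `|Y| by apply: Hbig.
have : `|Y| <= `|X + Y + Z| + `|X| + `|Z|.
  rewrite {1}(_ : Y = (X + Y + Z) - X - Z); last by ring.
  by apply: le_trans (ler_normB _ _) _; rewrite lerD2r; apply: ler_normB.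
have : BS < i%:R by apply: archi_boundP.
have : i%:R <= (n_ i)%:R :> R by rewrite ler_nat.
move: h2; rewrite -n_S -/m; lra.
Qed.

End GlidingHump.

(** A Banach-Steinhaus theorem at one point: failure for every order and every constant would
    provide scales and bumps contradicting [gliding_hump]. *)
Lemma point_value_equicontinuous g p gamma : schwartz_distribution g -> has_point_value g p gamma ->
  exists (N : nat) (C e0 : R), [/\ 0 < e0, e0 <= 1, 0 <= C &
    forall e phi M, 0 < `|e| < e0 -> smooth phi -> supp_in (-2) 2 phi -> bnd N M phi ->
      `|scaled_pairing g p e phi| <= C * M].
Proof.
move=> sg pg; apply: contrapT => Hn.
have /choice[t Ht] : forall n, exists t : R * (R -> R), [/\ 0 < `|t.1| < n.+1%:R^-1, smooth t.2,
    supp_in (-2) 2 t.2, bnd n (2^-1 ^+ n) t.2 & 2 ^+ n < `|scaled_pairing g p t.1 t.2| ].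
  (* [4 ^+ n] is [2 ^+ n * 2 ^+ n]: one factor is spent on scaling the bump down to size
     [2^-1 ^+ n], the other is left on its pairing. *)
  move=> n; apply: contrapT => Hc; apply: Hn; exists n, (4 ^+ n), n.+1%:R^-1; split.
  - by rewrite invr_gt0.
  - by rewrite invf_le1 // ler1n.
  - by rewrite exprn_ge0.
  move=> e phi M He sp su Hb; rewrite leNgt; apply/negP => HT.
  have e0 : e != 0 by rewrite -normr_gt0; have /andP[] := He.
  have tp : test_function phi by apply: (@test_of_supp _ (-2) 2).
  have M0 := bnd_ge0 Hb.
  have Mp : 0 < M.
    rewrite lt_neqAle M0 andbT; apply/eqP => M0'.
    have phi0 : phi = fun=> 0.
      by apply/funext => x; apply/eqP; rewrite -normr_le0 M0'; apply: (Hb 0%N).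
    move: HT; rewrite -M0' mulr0 scaled_pairingE phi0 (_ : dil _ _ _ = fun=> 0) //.
    by rewrite schwartz0 // mulr0 normr0 ltxx.
  have c0 : 0 < (2 ^+ n * M)^-1 by rewrite invr_gt0 mulr_gt0 // exprn_gt0.
  apply: Hc; exists (e, fun x => (2 ^+ n * M)^-1 * phi x); split => //=.
  - exact: smoothZ.
  - exact: supp_inM.
  - rewrite (_ : 2^-1 ^+ n = `|(2 ^+ n * M)^-1| * M); first exact: bndZ.
    by rewrite (gtr0_norm c0) exprVn; field; rewrite gt_eqF ?exprn_gt0 //= gt_eqF.
  - rewrite scaled_pairingZ // normrM (gtr0_norm c0) mulrC ltr_pdivlMr ?mulr_gt0 ?exprn_gt0 //.
    by rewrite mulrA -exprMn (_ : 2 * 2 = 4) //; lra.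
have [||||n] := @gliding_hump g p gamma sg pg (fun n => (t n).1) (fun n => (t n).2).
- by move=> n; have [] := Ht n.
- by move=> n; have [] := Ht n.
- by move=> n; have [] := Ht n.
- by move=> n; have [] := Ht n.
by have [_ _ _ _] := Ht n; rewrite ltNge => /negP.
Qed.

End UniformBoundedness.

(** * Equicontinuity on rapidly decreasing kernels *)

Section CutoffExtension.
Context {R : realType}.
Implicit Types (k phi psi : R -> R) (p e M B gamma : R).
Variables (W : (R -> R) -> R) (chi0 : R -> R) (A : R).
Hypotheses (sW : schwartz_distribution W) (A0 : 0 <= A) (schi : smooth chi0)
  (chi01 : forall x, `|x| <= A -> chi0 x = 1) (suchi : supp_in (- (A + 1)) (A + 1) chi0).

(** [W] need not have compact support, so it acts on kernels of unbounded support through a fixed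
    cutoff. *)
Definition cutp k : R := W (fun y => chi0 y * k y).

Lemma test_cut k : smooth k -> test_function (fun y => chi0 y * k y).
Proof.
move=> sk; apply: (@test_of_supp _ (- (A + 1)) (A + 1)); first exact: smoothM.
exact: supp_inMl.
Qed.

Lemma cutpD k l : smooth k -> smooth l -> cutp (fun y => k y + l y) = cutp k + cutp l.
Proof.
move=> sk sl; rewrite /cutp -(schwartzD sW (test_cut sk) (test_cut sl)).
by congr W; apply/funext => y; rewrite mulrDr.
Qed.

Lemma cutpZ c k : smooth k -> cutp (fun y => c * k y) = c * cutp k.
Proof.
move=> sk; rewrite /cutp -(schwartzZ c sW (test_cut sk)).
by congr W; apply/funext => y; rewrite mulrCA.
Qed.

Lemma cutpB k l : smooth k -> smooth l -> cutp (fun y => k y - l y) = cutp k - cutp l.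
Proof.
move=> sk sl; rewrite /cutp -(schwartzB sW (test_cut sk) (test_cut sl)).
by congr W; apply/funext => y; rewrite mulrBr.
Qed.

Lemma cutp_bound : exists (N : nat) (C : R), 0 <= C /\ forall k M, smooth k -> 0 <= M ->
  (forall j, (j <= N)%N -> forall y, `|y| <= A + 1 -> `|derive1n j k y| <= M) ->
  `|cutp k| <= C * M.
Proof.
have [N [C [C0 HC]]] := schwartz_bound (- (A + 1)) (A + 1) sW.
have lt0 : - (A + 1) < A + 1 by have := A0; lra.
have [X HX] := bnd_ex N lt0 schi suchi.
have X0 := bnd_ge0 HX.
exists N, (C * (2 ^+ N * X)); split=> [|k M sk M0 HM]; first by rewrite !mulr_ge0 ?exprn_ge0.
rewrite -mulrA; apply: HC; [exact: smoothM|exact: supp_inMl|].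
move=> j jN y; have [yA|yA] := leP `|y| (A + 1).
  apply: (@le_trans _ _ (2 ^+ j * (X * M))).
    apply: derive1nM_le => // i ij; first exact: (HX _ (leq_trans ij jN)).
    by apply: HM => //; apply: leq_trans jN.
  by rewrite -mulrA ler_wpM2r ?mulr_ge0 // ler_weXn2l // ler1n.
rewrite (supp_in_derive1n _ (supp_inMl _ suchi)); first by rewrite normr0 !mulr_ge0 ?exprn_ge0.
by move: yA; rewrite lter_normr => /orP[H|H]; [right; lra|left; lra].
Qed.

(** A bound on a seminorm of the Schwartz space, with [N] derivatives and a weight of degree [m]. *)
Definition wnorm (N m : nat) B k :=
  forall j, (j <= N)%N -> forall z, (1 + `|z|) ^+ m * `|derive1n j k z| <= B.

Lemma wnorm_ge0 N m B k : wnorm N m B k -> 0 <= B.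
Proof. by move=> /(_ 0%N (leq0n _) 0); apply: le_trans; rewrite mulr_ge0 // exprn_ge0 // addr_ge0. Qed.

Lemma wnormW N N' m m' B k : (N' <= N)%N -> (m' <= m)%N -> wnorm N m B k -> wnorm N' m' B k.
Proof.
move=> NN mm H j jN z; apply: le_trans (H j (leq_trans jN NN) z).
by rewrite ler_wpM2r // ler_weXn2l // lerDl.
Qed.

Lemma wnorm_bnd N m B k : wnorm N m B k -> bnd N B k.
Proof.
move=> H j jN z; have := wnormW (leqnn _) (leq0n _) H jN z; by rewrite expr0 mul1r.
Qed.

Definition cut_scaled p e k : R := `|e|^-1 * cutp (dil p e k).

Lemma cut_scaledD p e k l : smooth k -> smooth l ->
  cut_scaled p e (fun y => k y + l y) = cut_scaled p e k + cut_scaled p e l.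
Proof.
move=> sk sl; rewrite /cut_scaled -mulrDr; congr (_ * _).
by rewrite -(cutpD (@smooth_dil _ p e _ sk) (@smooth_dil _ p e _ sl)).
Qed.

Lemma cut_scaledB p e k l : smooth k -> smooth l ->
  cut_scaled p e (fun y => k y - l y) = cut_scaled p e k - cut_scaled p e l.
Proof.
move=> sk sl; rewrite /cut_scaled -mulrBr; congr (_ * _).
by rewrite -(cutpB (@smooth_dil _ p e _ sk) (@smooth_dil _ p e _ sl)).
Qed.

Lemma cut_scaled_near p e k L : `|p| <= A - L -> 0 < `|e| -> supp_in (- (L / `|e|)) (L / `|e|) k ->
  cut_scaled p e k = scaled_pairing W p e k.
Proof.
move=> pA e0 su; rewrite /cut_scaled /cutp scaled_pairingE; congr (_ * W _).
apply/funext => y; have [yA|yA] := leP `|y| A; first by rewrite chi01 // mul1r.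
rewrite (_ : dil p e k y = 0) ?mulr0 // /dil; apply: su.
have : L / `|e| < `|(y - p) / e|.
  rewrite normrM normfV ltr_pM2r ?invr_gt0 //.
  have : `|y| <= `|y - p| + `|p| by rewrite -{1}(subrK p y) ler_normD.
  lra.
by rewrite lter_normr => /orP[H|H]; [right; lra|left; lra].
Qed.

Lemma derive1n_away n k (z r : R) : (forall y, `|y| < r -> k y = 0) -> `|z| < r ->
  derive1n n k z = 0.
Proof.
move=> H zr; rewrite (@derive1n_local _ n k (fun=> 0) z (r - `|z|)) ?subr_gt0 //.
  by case: n => [//|n]; rewrite derive1n_cst.
move=> y yz; apply: H; have : `|y| <= `|y - z| + `|z| by rewrite -{1}(subrK z y) ler_normD.
lra.
Qed.

(* Splitting off the part of k near 0 and doubling the scale of the remainder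
   contracts the weighted norm, so the equicontinuity on test functions
   supported in [-2, 2] extends to rapidly decreasing functions. *)
Lemma cut_scaled_equicontinuous p gamma : has_point_value W p gamma -> `|p| <= A - 1 ->
  exists (N m : nat) (C e1 : R), [/\ 0 < e1, 0 <= C &
    forall e k B, 0 < `|e| < e1 -> smooth k -> wnorm N m B k -> `|cut_scaled p e k| <= C * B].
Proof.
move=> pg pA; have [N1 [C1 [e0' [e0'0 e01' C10 H1]]]] := point_value_equicontinuous sW pg.
pose e0 := Num.min e0' 2^-1.
have e00 : 0 < e0 by rewrite lt_min e0'0 /=.
have e02 : e0 <= 2^-1 by rewrite ge_min lexx orbT.
have [N2 [C2 [C20 H2]]] := cutp_bound.
pose N := maxn N1 N2.
have [chi [sc c01 c1 suc _]] := @cutoff_ex R 1 ler01.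
have suc2 : supp_in (-2) 2 chi by apply: supp_inW suc; lra.
have lt22 : -2 < 2 :> R by lra.
have [X HX] := bnd_ex N lt22 sc suc2.
have X0 := bnd_ge0 HX.
(* [kt] carries a factor 2; of the three powers [2 ^+ N] in [8 ^+ N] one is the Leibniz rule and two
   come from the dilation inside each factor. *)
pose K := 2 * (8 ^+ N * (X + 1)).
have K0 : 0 <= K by rewrite !mulr_ge0 ?exprn_ge0 ?addr_ge0.
(* On the support of the doubled remainder [|z| >= 1/2], whence [(1 + |z|) / (1 + 2 |z|) <= 3/4]: a
   weight of high degree [m] makes the doubling of the scale a contraction by 1/2. *)
have [m Hm] : exists m : nat, K * (3 / 4) ^+ m <= 2^-1.
  have : (fun m => K * (3 / 4) ^+ m : R) @ \oo --> (K * 0 : R).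
    apply: cvgM; first exact: cvg_cst.
    by apply: cvg_expr; rewrite ger0_norm //; lra.
  rewrite mulr0 => /cvgrPdist_lt/(_ 2^-1); rewrite invr_gt0 ltr0n => /(_ isT)[m _ /(_ m (leqnn _))].
  rewrite /= sub0r normrN => /ltW/(le_trans (ler_norm _)) ?.
  by exists m.
pose Ca := C1 * (2 ^+ N1 * X); pose Cf := (2 / e0) ^+ N2.+1 * C2.
have Ca0 : 0 <= Ca by rewrite !mulr_ge0 ?exprn_ge0.
have e20 : 0 <= 2 / e0 by rewrite divr_ge0 // ltW.
have Cf0 : 0 <= Cf by rewrite !mulr_ge0 ?exprn_ge0.
(* [C] satisfies [Ca + C / 2 <= C], which is the induction step, and dominates [Cf], which is its
   base. *)
pose C := 2 * Ca + Cf.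
pose rem k : R -> R := fun z => k z * (1 - chi z).
pose kt k : R -> R := fun z => 2 * (k (2 * z + 0) * (1 - chi (2 * z + 0))).
have s1c : smooth (fun z => 1 - chi z) by apply: smoothB; [exact: smooth_cst|exact: sc].
have s1c2 : smooth (fun z => 1 - chi (2 * z + 0)).
  exact: (@smooth_comp_affine _ 2 0 (fun z => 1 - chi z) s1c).
have srem k : smooth k -> smooth (rem k) by move=> sk; apply: smoothM.
have skt k : smooth k -> smooth (kt k).
  by move=> sk; apply: smoothZ; apply: smoothM; [exact: smooth_comp_affine|exact: s1c2].
have b1c : bnd N (X + 1) (fun z => 1 - chi z).
  move=> j jN z; rewrite (derive1nB _ (@smooth_cst _ 1) sc).
  apply: le_trans (ler_normB _ _) _; rewrite addrC lerD ?HX //.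
  by case: j {jN} => [|j]; [rewrite normr1|rewrite derive1n_cst normr0].
have Hkt k B : smooth k -> wnorm N m B k -> wnorm N m (B / 2) (kt k).
  move=> sk Hk j jN z; have B0 := wnorm_ge0 Hk.
  have [z2|z2] := ltP `|z| 2^-1.
    rewrite (@derive1n_away _ _ _ 2^-1) // ?normr0 ?mulr0 ?divr_ge0 // => y y2.
    rewrite /kt c1 ?subrr ?mulr0 // addr0 normrM (ger0_norm (ler0n _ 2)); lra.
  rewrite /kt derive1nZ; last by apply: smoothM; [exact: smooth_comp_affine|exact: s1c2].
  have zp : 0 < 1 + 2 * `|z| by rewrite ltr_wpDr // mulr_ge0.
  have hD : `|derive1n j (fun z => k (2 * z + 0) * (1 - chi (2 * z + 0))) z| <=
     2 ^+ j * ((2 ^+ N * (B / (1 + 2 * `|z|) ^+ m)) * (2 ^+ N * (X + 1))).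
    have p2 i : (i <= N)%N -> (2 : R) ^+ i <= 2 ^+ N by move=> iN; rewrite ler_weXn2l // ler1n.
    have p2n i : (i <= N)%N -> `|(2 : R) ^+ i| <= 2 ^+ N.
      by move=> iN; rewrite ger0_norm ?exprn_ge0 // p2.
    apply: derive1nM_le; [exact: smooth_comp_affine|exact: s1c2| |].
      move=> i ij; have iN := leq_trans ij jN.
      rewrite (derive1n_comp_affine _ _ _ sk) normrM; apply: ler_pM; rewrite ?normr_ge0 ?p2n //.
      rewrite (ler_pdivlMr _ _ (exprn_gt0 _ zp)).
      rewrite mulrC; apply: le_trans (Hk i iN (2 * z + 0)).
      by rewrite addr0 normrM (ger0_norm (ler0n _ 2)).
    move=> i ij; have iN := leq_trans ij jN.
    rewrite (@derive1n_comp_affine _ i 2 0 (fun z => 1 - chi z) s1c) normrM.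
    by apply: ler_pM; rewrite ?normr_ge0 ?p2n ?b1c.
  rewrite normrM (ger0_norm (ler0n _ 2)).
  have q34 : (1 + `|z|) / (1 + 2 * `|z|) <= 3 / 4.
    by rewrite ler_pdivrMr //; lra.
  have q0 : 0 <= (1 + `|z|) / (1 + 2 * `|z|) by rewrite divr_ge0 ?addr_ge0 // ltW.
  apply: (@le_trans _ _ (K * ((1 + `|z|) / (1 + 2 * `|z|)) ^+ m * B)); last first.
    rewrite mulrC ler_wpM2l //; apply: le_trans Hm.
    by rewrite ler_wpM2l // lerXn2r ?nnegrE //; lra.
  apply: (@le_trans _ _ ((1 + `|z|) ^+ m * (2 * (2 ^+ N * ((2 ^+ N * (B / (1 + 2 * `|z|) ^+ m)) * (2 ^+ N * (X + 1))))))).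
    rewrite ler_wpM2l ?exprn_ge0 ?addr_ge0 // ler_wpM2l //; apply: le_trans hD _.
    rewrite ler_wpM2r ?ler_weXn2l ?ler1n //.
    by rewrite !mulr_ge0 ?exprn_ge0 ?addr_ge0 ?invr_ge0 ?exprn_ge0 ?(ltW zp).
  rewrite /K (_ : 8 = 2 * 2 * 2); last by ring.
  rewrite !exprMn exprVn le_eqVlt; apply/orP; left; apply/eqP; ring.
have near k B e : 0 < `|e| < e0 -> smooth k -> wnorm N m B k ->
    `|cut_scaled p e (fun z => k z * chi z)| <= Ca * B.
  move=> /andP[ep ee] sk Hk; have suk : supp_in (-2) 2 (fun z => k z * chi z) by apply: supp_inM.
  have ee' : `|e| < e0' by apply: lt_le_trans ee _; rewrite ge_min lexx.
  rewrite (@cut_scaled_near p e _ 1) //; last first.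
    apply: supp_inW suk; rewrite ?lerN2 ler_pdivlMr //; lra.
  rewrite /Ca -!mulrA (mulrC X); apply: H1; [by rewrite ep|exact: smoothM|exact: suk|].
  apply: (bndM sk sc); first exact: (bndW (leq_maxl _ _) (wnorm_bnd Hk)).
  exact: (bndW (leq_maxl _ _) HX).
have base k B e : e0 / 2 <= `|e| < e0 -> smooth k -> wnorm N m B k -> `|cut_scaled p e k| <= Cf * B.
  move=> /andP[e2 ee] sk Hk; have ep : 0 < `|e| by apply: lt_le_trans e2; rewrite divr_gt0.
  have B0 := wnorm_ge0 Hk.
  have ie : `|e|^-1 <= 2 / e0 by rewrite -[2 / e0]invf_div lef_pV2 ?posrE // divr_gt0.
  rewrite /cut_scaled normrM (ger0_norm (_ : 0 <= `|e|^-1)) ?invr_ge0 // /Cf exprS.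
  rewrite -(mulrA (2 / e0)) -(mulrA (2 / e0)); apply: ler_pM => //.
  rewrite (mulrC _ C2) -(mulrA C2); apply: H2; first exact: smooth_dil.
    by rewrite mulr_ge0 // exprn_ge0.
  move=> j jN y _; have b := bnd_dil p sk (_ : 0 < `|e| <= 1) (bndW (leq_maxr _ _) (wnorm_bnd Hk)).
  apply: le_trans (b _ j jN y) _; first by rewrite ep /=; lra.
  by rewrite ler_wpM2r // lerXn2r ?nnegrE // invr_ge0.
(* Induction on the number of doublings that bring [|e|] above [e0 / 2], where the scale is bounded
   below and [cutp_bound] applies. *)
have main n : forall k B e, e0 / 2 ^+ n.+1 <= `|e| < e0 -> smooth k -> wnorm N m B k ->
    `|cut_scaled p e k| <= C * B.
  elim: n => [|n IH] k B e /andP[en ee] sk Hk.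
    have B0 := wnorm_ge0 Hk.
    apply: le_trans (base k B e _ sk Hk) _; first by rewrite ee andbT -[2]expr1.
    by rewrite ler_wpM2r // /C lerDr mulr_ge0.
  have B0 := wnorm_ge0 Hk.
  have [e2|e2] := leP (e0 / 2) `|e|.
    apply: le_trans (base k B e _ sk Hk) _; first by rewrite ee andbT.
    by rewrite ler_wpM2r // /C lerDr mulr_ge0.
  have ep : 0 < `|e| by apply: lt_le_trans en; rewrite divr_gt0 // exprn_gt0.
  have -> : cut_scaled p e k = cut_scaled p e (fun z => k z * chi z) + cut_scaled p (2 * e) (kt k).
    have -> : cut_scaled p (2 * e) (kt k) = cut_scaled p e (rem k).
      rewrite /cut_scaled normrM (ger0_norm (ler0n _ 2)) invfM.
      have -> : dil p (2 * e) (kt k) = fun y => 2 * dil p e (rem k) y.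
        apply/funext => y; rewrite /dil /kt /rem; have e0n : e != 0 by rewrite -normr_gt0.
        by rewrite (_ : 2 * ((y - p) / (2 * e)) + 0 = (y - p) / e) //; field.
      rewrite cutpZ; last by apply: smooth_dil; apply: srem.
      by rewrite mulrACA mulVf ?mul1r.
    rewrite -cut_scaledD; [|exact: smoothM|exact: srem].
    by congr (cut_scaled p e _); apply/funext => z; rewrite /rem; ring.
  apply: le_trans (ler_normD _ _) _.
  apply: (@le_trans _ _ (Ca * B + C * (B / 2))).
    apply: lerD; first by apply: near => //; rewrite ep.
    apply: IH; [|exact: skt|exact: Hkt].
    rewrite normrM (ger0_norm (ler0n _ 2)); apply/andP; split; last by lra.
    move: en; rewrite exprS invfM mulrCA => en; rewrite -(ler_pM2l (_ : 0 < 2^-1)) ?mulKf //.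
  rewrite -subr_ge0 (_ : _ - _ = Cf / 2 * B); first by rewrite mulr_ge0 // divr_ge0.
  by rewrite /C; field.
exists N, m, C, e0; split => //; first by rewrite addr_ge0 // mulr_ge0.
move=> e k B /andP[ep ee] sk Hk.
apply: (main (Num.bound (e0 / `|e|))) => //; rewrite ee andbT ler_pdivrMr ?exprn_gt0 //.
by rewrite mulrC -ler_pdivrMr //; apply/ltW/upper_nthrootP/leqnSn.
Qed.

End CutoffExtension.

(** * Primitives of integrable kernels *)

Section KernelPrimitive.
Context {R : realType}.
Implicit Types (k phi : R -> R).
Notation mu := (@lebesgue_measure R).

(** Kernels of the test classes need not have compact support; a primitive with limits 0 and 1 lets
    their mass be computed by integration by parts against a cutoff. *)
Lemma kernel_primitive phi : continuous phi -> (forall x, 0 <= phi x) ->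
  (\int[mu]_(x in setT) (phi x)%:E = 1)%E ->
  exists F : R -> R, [/\ forall x : R, is_derive x 1 F (phi x), forall x, 0 <= F x <= 1 &
    forall eta : R, 0 < eta -> exists2 A : R, 0 < A &
      forall x, A <= x -> 1 - eta <= F x /\ F (- x) <= eta].
Proof.
move=> cp p0 I1.
have mp : measurable_fun setT (EFin \o phi).
  by apply/measurable_EFinP; apply: continuous_measurable_fun.
have ip : mu.-integrable setT (EFin \o phi).
  apply/integrableP; split => //.
  rewrite (_ : (fun x => _) = (fun x => (phi x)%:E)); first by rewrite I1 ltry.
  by apply/funext => x; rewrite /= ger0_norm.
have ipx D : measurable D -> mu.-integrable D (EFin \o phi).
  by move=> mD; apply: integrableS ip.
pose F x := \int[mu]_(t in `]-oo, x]) phi t.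
have FE x : ((F x)%:E = \int[mu]_(t in `]-oo, x]) (phi t)%:E)%E.
  by rewrite /F /Rintegral fineK // integrable_fin_num //; apply: ipx.
have dF (x : R) : is_derive x 1 F (phi x).
  have [] := @continuous_FTC1 R phi -oo%O x (x + 1) ltac:(lra) (ipx _ (measurable_itv _)) (ltNyr _) (cp x).
  by move=> dF <-; apply: is_derive_derive1.
have F01 x : 0 <= F x <= 1.
  rewrite -!lee_fin FE -I1; apply/andP; split.
    by apply: integral_ge0 => t _; rewrite lee_fin.
  apply: ge0_subset_integral => //=.
  by move=> t _; rewrite lee_fin.
have Fnd x y : x <= y -> F x <= F y by move=> xy; apply: (ndecr_of_derive dF) => // z _.
exists F; split => // eta eta0.
have up : exists n : nat, 1 - eta <= F n%:R.
  have : (\int[mu]_(x in `]-oo, (n%:R : R)]) (phi x)%:E)%E @[n --> \oo] --> (1 : \bar R)%E.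
    rewrite -I1; have -> : setT = \bigcup_n `]-oo, (n%:R : R)]%classic.
      apply/seteqP; split => // x _; exists (Num.bound `|x : R|) => //=; rewrite in_itv /=.
      exact: ltW (le_lt_trans (ler_norm _) (archi_boundP (normr_ge0 (x : R)))).
    apply: (@ge0_nondecreasing_set_cvg_integral _ (measurableTypeR R)) => //.
    - by move=> n m nm; apply/subsetPset => x /=; rewrite !in_itv /= => /le_trans; apply; rewrite ler_nat.
    - by move=> n; apply: measurable_funTS.
    - by move=> n x _; rewrite lee_fin.
  rewrite (_ : (fun n : nat => _) = (fun n => (F n%:R)%:E)); last first.
    by apply/funext => n; rewrite FE.
  move=> /fine_cvgP[_ /cvgrPdist_lt/(_ _ eta0)[n _ /(_ n (leqnn _))]].
  by move=> /= /ltr_normlP[_ H]; exists n; lra.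
have dn : exists n : nat, F (- n%:R) <= eta.
  have : (\int[mu]_(x in `](- (n%:R : R))%R, +oo[) (phi x)%:E)%E @[n --> \oo] --> (1 : \bar R)%E.
    rewrite -I1; have -> : setT = \bigcup_n `](- (n%:R : R))%R, +oo[%classic.
      apply/seteqP; split => // x _; exists (Num.bound `|x : R|) => //=; rewrite in_itv /= andbT.
      rewrite ltrNl; apply: le_lt_trans (archi_boundP (normr_ge0 (x : R))).
      by rewrite -normrN ler_norm.
    apply: (@ge0_nondecreasing_set_cvg_integral _ (measurableTypeR R)) => //.
    - move=> n m nm; apply/subsetPset => x /=; rewrite !in_itv /= !andbT; apply: le_lt_trans.
      by rewrite lerN2 ler_nat.
    - by move=> n; apply: measurable_funTS.
    - by move=> n x _; rewrite lee_fin.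
  have E n : (\int[mu]_(x in `](- (n%:R : R))%R, +oo[) (phi x)%:E = (1 - F (- n%:R))%:E)%E.
    have D0 : [disjoint `]-oo, (- n%:R)%R]%classic & `](- (n%:R : R))%R, +oo[%classic].
      apply/disj_setPS => x [] /=; rewrite !in_itv /= andbT => h1.
      by rewrite ltNge h1.
    have := @Rintegral_setU _ _ R mu _ _ phi (measurable_itv _) (measurable_itv _)
      (ipx _ (measurableU _ _ (measurable_itv _) (measurable_itv _))) D0.
    rewrite itv_setU_setT -/(F _) [X in X = _](_ : _ = 1); last by rewrite /Rintegral I1.
    set I := (X in _ = _ + X) => E1; have -> : 1 - F (- n%:R) = I by apply/eqP; rewrite subr_eq addrC -E1.
    by rewrite /I /Rintegral fineK //; apply: integrable_fin_num => //; apply: ipx.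
  rewrite (_ : (fun n : nat => _) = (fun n => (1 - F (- n%:R))%:E)); last first.
    by apply/funext => n; rewrite E.
  move=> /fine_cvgP[_ /cvgrPdist_lt/(_ _ eta0)[n _ /(_ n (leqnn _))]].
  by move=> /= /ltr_normlP[_ H]; exists n; lra.
have [n Hn] := up; have [m Hm] := dn.
exists (n%:R + m%:R + 1); first by rewrite ltr_wpDl // addr_ge0.
move=> x Hx; split.
  by apply: le_trans Hn (Fnd _ _ _); have := ler0n R m; lra.
by apply: le_trans (Fnd _ _ _) Hm; have := ler0n R n; lra.
Qed.

End KernelPrimitive.

(** * The heat extension near a point of the boundary *)

Section Corner.
Context {R : realType}.
Implicit Types (k l phi psi : R -> R) (p e M B gamma : R).

(** The kernel as seen from a base point [p] at scale [t]: [xi] is the distance from [p] to the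
    centre of the kernel in units of [t]. *)
Definition shiftg (n : nat) (xi z : R) : R := derive1n n gauss (xi - z).

Lemma shiftgE n xi : shiftg n xi = fun z => derive1n n gauss (-1 * z + xi).
Proof. by apply/funext => z; rewrite /shiftg; congr derive1n; ring. Qed.

Lemma smooth_shiftg n xi : smooth (shiftg n xi).
Proof. by rewrite shiftgE; apply: smooth_comp_affine; apply: smooth_derive1n; apply: smooth_gauss. Qed.

Lemma derive1n_shiftg j n xi : derive1n j (shiftg n xi) = fun z => (-1) ^+ j * shiftg (j + n) xi z.
Proof.
rewrite shiftgE derive1n_comp_affine; last by apply: smooth_derive1n; apply: smooth_gauss.
by rewrite derive1n_add shiftgE.
Qed.

Lemma weight_shift (xi z Rb : R) m : `|xi| <= Rb ->
  (1 + `|z|) ^+ m <= (1 + Rb) ^+ m * (1 + `|xi - z|) ^+ m.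
Proof.
move=> xR; have R0 : 0 <= Rb by apply: le_trans xR.
rewrite -exprMn lerXn2r ?nnegrE ?addr_ge0 ?mulr_ge0 ?addr_ge0 //.
have : `|z| <= `|xi - z| + `|xi|.
  by rewrite -normrN -[X in `|X|](_ : (xi - z) - xi = - z) ?ler_normB //; ring.
by have := normr_ge0 (xi - z); nra.
Qed.

Lemma wnorm_shiftg N m n (Rb : R) : 0 <= Rb -> exists B, forall xi, `|xi| <= Rb ->
  wnorm N m B (shiftg n xi).
Proof.
move=> R0; have /choice[C HC] : forall j, exists C : R, 0 <= C /\ forall x : R, (1 + `|x|) ^+ m * `|derive1n j gauss x| <= C.
  by move=> j; have [C C0 HC] := @gauss_bounded R j m; exists C.
exists ((1 + Rb) ^+ m * \sum_(j < N.+1) C (j + n)%N) => xi xR j jN z.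
rewrite derive1n_shiftg normrM normrX normrN normr1 expr1n mul1r.
apply: (@le_trans _ _ ((1 + Rb) ^+ m * C (j + n)%N)).
  apply: le_trans (ler_wpM2r (normr_ge0 _) (weight_shift z m xR)) _.
  rewrite -mulrA ler_wpM2l ?exprn_ge0 ?addr_ge0 //; exact: (HC _).2.
rewrite ler_wpM2l ?exprn_ge0 ?addr_ge0 //.
rewrite (bigD1 (Ordinal (jN : (j < N.+1)%N))) //= lerDl sumr_ge0 // => i _; exact: (HC _).1.
Qed.

Lemma wnorm_shiftg_lip N m n (Rb : R) : 0 <= Rb -> exists2 L : R, 0 <= L &
  forall xi xi', `|xi| <= Rb -> `|xi'| <= Rb ->
    wnorm N m (L * `|xi - xi'|) (fun z => shiftg n xi z - shiftg n xi' z).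
Proof.
move=> R0; have [L HL] := wnorm_shiftg N m n.+1 R0.
have L0 : 0 <= L by apply: (wnorm_ge0 (HL 0 _)); rewrite normr0.
exists L => // xi xi' xR xR' j jN z.
rewrite derive1nB; [|exact: smooth_shiftg|exact: smooth_shiftg].
rewrite !derive1n_shiftg -mulrBr normrM normrX normrN normr1 expr1n mul1r.
have D (y : R) : is_derive y 1 (fun y => derive1n (j + n) gauss (y - z)) (derive1n (j + n).+1 gauss (y - z)).
  have E : (fun y => derive1n (j + n) gauss (y - z)) = fun y => derive1n (j + n) gauss (1 * y + - z).
    by apply/funext => w; rewrite mul1r.
  have H := is_derive_comp_affine (derive1n_gauss_is_derive (j + n) (1 * y + - z)).
  by rewrite E; apply: is_derive_eq H _; rewrite !mul1r.
have [w Hw E] := mean_value xi' xi D.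
rewrite /shiftg E normrM mulrA ler_wpM2r //.
have wR : `|w| <= Rb.
  move: Hw xR xR' => /andP[]; rewrite ge_min le_max !ler_norml.
  by move=> /orP[] h1 /orP[] h2 /andP[h3 h4] /andP[h5 h6]; apply/andP; split; lra.
have := HL w wR j jN z.
by rewrite derive1n_shiftg normrM normrX normrN normr1 expr1n mul1r addnS.
Qed.

Lemma wnormM_off N m B X k l (S : R -> bool) : smooth k -> smooth l -> bnd N X l ->
  (forall z, ~~ S z -> forall j, (j <= N)%N -> derive1n j (fun z => k z * l z) z = 0) ->
  (forall z, S z -> forall i, (i <= N)%N -> (1 + `|z|) ^+ m * `|derive1n i k z| <= B) ->
  0 <= B -> wnorm N m (2 ^+ N * (B * X)) (fun z => k z * l z).
Proof.
move=> sk sl bl H0 H1 B0 j jN z; have X0 := bnd_ge0 bl.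
have [Sz|nSz] := boolP (S z); last first.
  by rewrite H0 // normr0 mulr0 !mulr_ge0 ?exprn_ge0.
have zp : 0 < (1 + `|z|) ^+ m by rewrite exprn_gt0 // ltr_wpDr.
rewrite mulrC -ler_pdivlMr //.
apply: (@le_trans _ _ (2 ^+ j * ((B / (1 + `|z|) ^+ m) * X))).
  apply: (derive1nM_le sk sl) => i ij; have iN := leq_trans ij jN; last exact: bl.
  by rewrite ler_pdivlMr // mulrC H1.
rewrite -!mulrA (mulrC _ X) ler_wpM2r ?mulr_ge0 ?invr_ge0 ?(ltW zp) //.
by rewrite ler_weXn2l // ler1n.
Qed.

Variables (W : (R -> R) -> R) (chi0 : R -> R) (A : R).
Hypotheses (sW : schwartz_distribution W) (A0 : 0 <= A) (schi : smooth chi0)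
  (chi01 : forall x, `|x| <= A -> chi0 x = 1) (suchi : supp_in (- (A + 1)) (A + 1) chi0).
Variables (p : R).
Hypotheses (pW : has_point_value W p 0) (pA : `|p| <= A - 1).
Notation Q := (cut_scaled W chi0 p).

(** The vanishing point value passes from test functions to rapidly decreasing kernels: the part of
    [k] within a radius of order [r] is a test function, and the far part has weighted norm of order
    [1 / r], since one more power of the weight is available. *)
Lemma cut_scaled_limit k : smooth k -> (forall N m, exists B, wnorm N m B k) ->
  forall eta : R, 0 < eta -> exists2 delta : R, 0 < delta &
    forall e, 0 < `|e| < delta -> `|Q e k| < eta.
Proof.
move=> sk rk eta eta0.
have [N [m [C [e1 [e10 C0 HC]]]]] := cut_scaled_equicontinuous sW A0 schi chi01 suchi pW pA.
have [B HB] := rk N m.+1; have B0 := wnorm_ge0 HB.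
have [chi [sc c01 c1 suc _]] := @cutoff_ex R 1 ler01.
have suc2 : supp_in (-2) 2 chi by apply: (supp_inW _ _ suc); lra.
have lt22 : -2 < 2 :> R by lra.
have [X HX] := bnd_ex N lt22 sc suc2; have X0 := bnd_ge0 HX.
pose K := C * (2 ^+ N * (B * (X + 1))).
have K0 : 0 <= K by rewrite !mulr_ge0 ?exprn_ge0 ?addr_ge0.
(* Large enough for the far part, bounded by [K / r], to cost at most [eta / 2]. *)
pose r := 1 + 2 * K / eta.
have r1 : 1 <= r.
  by rewrite /r lerDl; apply: divr_ge0; [apply: mulr_ge0|apply: ltW].
have r0 : 0 < r by lra.
pose chir := fun z => chi (r^-1 * z + 0).
have schir : smooth chir by apply: smooth_comp_affine; exact: sc.
have s1 : smooth (fun z => 1 - chir z) by apply: smoothB; [exact: smooth_cst|exact: schir].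
have b1 : bnd N (X + 1) (fun z => 1 - chir z).
  move=> j jN z; rewrite (derive1nB _ (@smooth_cst _ 1) schir).
  apply: le_trans (ler_normB _ _) _; rewrite addrC lerD //.
    rewrite /chir (derive1n_comp_affine _ _ _ sc) normrM -[leRHS]mul1r ler_pM ?HX //.
    by rewrite normrX ger0_norm ?invr_ge0 ?(ltW r0) // exprn_ile1 // ?invr_ge0 ?(ltW r0) // invf_le1.
  by case: j {jN} => [|j]; [rewrite normr1|rewrite derive1n_cst normr0].
have far : wnorm N m (2 ^+ N * (B / r * (X + 1))) (fun z => k z * (1 - chir z)).
  apply: (@wnormM_off N m (B / r) (X + 1) k _ (fun z => r <= `|z|) sk s1 b1).
  - move=> z; rewrite -ltNge => zr j jN; apply: (@derive1n_away _ _ _ _ r) => // y yr.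
    rewrite /chir c1 ?subrr ?mulr0 // addr0 normrM ger0_norm ?invr_ge0 ?(ltW r0) //.
    by rewrite mulrC ler_pdivrMr // mul1r ltW.
  - move=> z rz i iN; rewrite ler_pdivlMr //; apply: le_trans (HB i iN z).
    rewrite exprSr -!mulrA ler_wpM2l ?exprn_ge0 ?addr_ge0 // mulrC ler_wpM2r //.
    by apply: le_trans rz _; rewrite lerDr.
  - by rewrite divr_ge0 // ltW.
have sknear : smooth (fun z => k z * chir z) by apply: smoothM; [exact: sk|exact: schir].
have skfar : smooth (fun z => k z * (1 - chir z)) by apply: smoothM; [exact: sk|exact: s1].
have sunear : supp_in (- (2 * r)) (2 * r) (fun z => k z * chir z).
  apply: supp_inM => z Hz; apply: suc2; rewrite addr0 mulrC.
  by case: Hz => Hz; [left; rewrite ltr_pdivrMr|right; rewrite ltr_pdivlMr]; lra.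
have tnear := test_of_supp sknear sunear.
have [d d0 Hd] := point_value_limit pW tnear (divr_gt0 eta0 (ltr0n R 2)).
exists (Num.min (Num.min e1 d) (2 * r)^-1).
  by rewrite !lt_min e10 d0 invr_gt0 mulr_gt0.
move=> e /andP[e0]; rewrite !lt_min => /andP[/andP[ee1 ed] er].
have -> : k = (fun z => k z * chir z + k z * (1 - chir z)) by apply/funext => z; ring.
rewrite (cut_scaledD sW schi suchi _ _ sknear skfar).
apply: le_lt_trans (ler_normD _ _) _; rewrite (splitr eta); apply: ltr_leD.
  rewrite (@cut_scaled_near _ W chi0 A chi01 p e _ 1) //; last first.
    apply: (supp_inW _ _ sunear); rewrite ?lerN2 ler_pdivlMr //.
      by move: er; rewrite -div1r ltr_pdivlMr ?mulr_gt0 // => ?; lra.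
    by move: er; rewrite -div1r ltr_pdivlMr ?mulr_gt0 // => ?; lra.
  by have := Hd e; rewrite e0 ed mul0r subr0; apply.
apply: le_trans (HC e _ _ _ skfar far) _; first by rewrite e0.
have -> : C * (2 ^+ N * (B / r * (X + 1))) = K / r by rewrite /K; field; lra.
rewrite ler_pdivrMr // /r mulrDr mulr1 (_ : eta / 2 * (2 * K / eta) = K); last by field; lra.
by rewrite lerDr divr_ge0 // ltW.
Qed.

(** The limit is 0 for each [xi], the pairings are Lipschitz in [xi] uniformly in the scale, and
    [[0, Rb]] is compact. *)
Lemma corner_nontangential (Rb : R) : 0 <= Rb -> forall eta : R, 0 < eta ->
  exists2 delta : R, 0 < delta & forall e xi, 0 < `|e| < delta -> 0 <= xi <= Rb ->
    `|Q e (shiftg 0 xi)| < eta.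
Proof.
move=> R0 eta eta0.
have [N [m [C [e1 [e10 C0 HC]]]]] := cut_scaled_equicontinuous sW A0 schi chi01 suchi pW pA.
have R10 : 0 <= Rb + 1 by rewrite addr_ge0.
have [L L0 HL] := wnorm_shiftg_lip N m 0 R10.
have /compact_near_coveringP cov := @segment_compact R 0 Rb.
have : \forall e \near (0 : R)^', `[0, Rb]%classic `<=` (fun xi => `|Q e (shiftg 0 xi)| < eta).
  apply: (cov _ _ (fun e xi => `|Q e (shiftg 0 xi)| < eta)) => xi0 /=; rewrite in_itv /= => /andP[x0 xR].
  have xR0 : `|xi0| <= Rb + 1 by rewrite ger0_norm //; lra.
  have rk : forall N m, exists B, wnorm N m B (shiftg 0 xi0).
    by move=> N' m'; have [B HB] := wnorm_shiftg N' m' 0 R10; exists B; apply: HB.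
  have [d d0 Hd] := cut_scaled_limit (@smooth_shiftg 0 xi0) rk (divr_gt0 eta0 (ltr0n R 2)).
  pose r := Num.min 1 (eta / 2 / (C * L + 1)).
  have CL : 0 < C * L + 1 by rewrite ltr_wpDl // mulr_ge0.
  have r0 : 0 < r by rewrite lt_min ltr01 !divr_gt0.
  exists ([set x | `|xi0 - x| < r], [set e | 0 < `|e| < Num.min e1 d]).
    split; first by exists r.
    exists (Num.min e1 d) => /=; first by rewrite lt_min e10.
    by move=> e; rewrite /ball_ /= sub0r normrN normr_gt0 => -> ->.
  move=> [x e] /= [xr /andP[e0]]; rewrite lt_min => /andP[ee1 ed].
  have xR' : `|x| <= Rb + 1.
    have : `|x| <= `|xi0 - x| + `|xi0|.
      by rewrite -normrN -[X in `|X|](_ : (xi0 - x) - xi0 = - x) ?ler_normB //; ring.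
    have : r <= 1 by rewrite ge_min lexx.
    by rewrite [`|xi0|]ger0_norm //; lra.
  have -> : shiftg 0 x = (fun z => shiftg 0 xi0 z - (shiftg 0 xi0 z - shiftg 0 x z)).
    by apply/funext => z; ring.
  have sd : smooth (fun z => shiftg 0 xi0 z - shiftg 0 x z).
    by apply: smoothB; apply: smooth_shiftg.
  rewrite (cut_scaledB sW schi suchi _ _ (@smooth_shiftg 0 xi0) sd).
  apply: le_lt_trans (ler_normB _ _) _; rewrite (splitr eta); apply: ltr_leD.
    by apply: Hd; rewrite e0.
  apply: le_trans (HC e _ _ _ sd (HL _ _ xR0 xR')) _; first by rewrite e0.
  have : `|xi0 - x| <= eta / 2 / (C * L + 1).
    by apply: le_trans (ltW xr) _; rewrite /r ge_min lexx orbT.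
  rewrite ler_pdivlMr // mulrC mulrA => H; apply: le_trans H.
  by rewrite ler_wpM2r // lerDl.
move=> [d /= d0 Hd]; exists d => // e xi /andP[e0 ed] xiR; apply: (Hd e).
- by rewrite /ball_ /= sub0r normrN.
- by rewrite -normr_gt0.
- by rewrite /= in_itv.
Qed.

Variable s : R.
(** On the side [s] of [p] the pairings with nonnegative bumps are controlled by their mass alone,
    without derivatives. Equicontinuity cannot give this; it will come from the monotonicity of [W]
    on that side. *)
Hypothesis Hside : forall eta : R, 0 < eta -> exists2 delta : R, 0 < delta &
  forall e, 0 < `|e| < delta -> 0 < s * e -> forall psi, smooth psi -> (forall z, 0 <= psi z) ->
    supp_in 2^-1 (3 / 2) psi -> `|scaled_pairing W p e psi| <= eta * IT psi.

(** The profile of the kernel when the scale [t] is replaced by [xi * t]: a Gaussian of mass 1 and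
    width of order [xi^-1] around [z = 1]. *)
Definition narrow (xi z : R) : R := xi * gauss (- xi * z + xi).

Lemma smooth_narrow xi : smooth (narrow xi).
Proof. by apply: smoothZ; apply: smooth_comp_affine; apply: smooth_gauss. Qed.

Lemma derive1n_narrow i xi : derive1n i (narrow xi) =
  fun z => xi * ((- xi) ^+ i * derive1n i gauss (- xi * z + xi)).
Proof.
rewrite /narrow derive1nZ; last by apply: smooth_comp_affine; apply: smooth_gauss.
by rewrite (derive1n_comp_affine _ _ _ smooth_gauss).
Qed.

Lemma IT_narrow_le xi (om : R -> R) : continuous om -> (forall z, 0 <= om z <= 1) -> 0 < xi ->
  supp_in 2^-1 (3 / 2) om -> IT (fun z => narrow xi z * om z) <= 1.
Proof.
move=> com om01 xi0 suom; have lt12 : 2^-1 < 3 / 2 :> R by lra.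
have [[sg g0 Ig _] _] := @gauss_T1 R.
have [F [dF F01 _]] := kernel_primitive (smooth_continuous sg) g0 Ig.
have ck : continuous (fun z => narrow xi z * om z).
  by apply: contM; [exact: smooth_continuous (@smooth_narrow xi)|exact: com].
have [H [dH H0 H1]] := IT_prim lt12 ck (supp_inM _ suom).
have dG (z : R) : is_derive z 1 (fun z => - F (- xi * z + xi) - H z) (narrow xi z - narrow xi z * om z).
  apply: is_derive_sub (dH z).
  have D := is_derive_opp (is_derive_comp_affine (dF (- xi * z + xi))).
  by apply: is_derive_eq D _; rewrite /narrow mulNr opprK.
have : - F (- xi * 2^-1 + xi) - H 2^-1 <= - F (- xi * (3 / 2) + xi) - H (3 / 2).
  apply: (ndecr_of_derive dG (y := 3 / 2)); last exact: ltW.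
  move=> z _; rewrite -[X in X - _]mulr1 -mulrBr mulr_ge0 //.
    by rewrite /narrow mulr_ge0 // ltW.
  by rewrite subr_ge0; have /andP[] := om01 z.
rewrite (H0 2^-1) // (H1 (3 / 2)) // subr0.
have /andP[_] := F01 (- xi * 2^-1 + xi); have /andP[+ _] := F01 (- xi * (3 / 2) + xi).
lra.
Qed.

(** The derivatives of [narrow xi] blow up with [xi], but near [z = 1] only the mass counts, by
    [Hside], and away from 1 the Gaussian decay beats every power of [xi]. *)
Lemma corner_tangential (eta : R) : 0 < eta -> exists Rb delta : R,
  [/\ 1 <= Rb, 0 < delta & forall e xi, 0 < `|e| < delta -> 0 < s * e -> Rb <= xi ->
    `|Q e (narrow xi)| < eta].
Proof.
move=> eta0.
have [N [m [C [e1 [e10 C0 HC]]]]] := cut_scaled_equicontinuous sW A0 schi chi01 suchi pW pA.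
have [Cg [Cg0 HCg]] : exists Cg : R, 0 <= Cg /\ forall i, (i <= N)%N -> forall x : R,
    (1 + `|x|) ^+ (m + N.+2) * `|derive1n i gauss x| <= Cg.
  have /choice[D HD] : forall j, exists D : R, 0 <= D /\
      forall x : R, (1 + `|x|) ^+ (m + N.+2) * `|derive1n j gauss x| <= D.
    by move=> j; have [D D0 HD] := @gauss_bounded R j (m + N.+2); exists D.
  exists (\sum_(j < N.+1) D j); split; first by apply: sumr_ge0 => j _; exact: (HD j).1.
  move=> i iN x; apply: le_trans ((HD i).2 x) _.
  rewrite (bigD1 (Ordinal (iN : (i < N.+1)%N))) //= lerDl sumr_ge0 // => j _; exact: (HD _).1.
have [chi [sc c01 c1 suc _]] := @cutoff_ex R 1 ler01.
pose om := fun z => chi (4 * z + -4).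
have som : smooth om by apply: smooth_comp_affine; exact: sc.
have suom : supp_in 2^-1 (3 / 2) om.
  by move=> z Hz; apply: suc; case: Hz => Hz; [left|right]; lra.
have lt12 : 2^-1 < 3 / 2 :> R by lra.
have [X HX] := bnd_ex N lt12 som suom; have X0 := bnd_ge0 HX.
have s1 : smooth (fun z => 1 - om z) by apply: smoothB; [exact: smooth_cst|exact: som].
have b1 : bnd N (X + 1) (fun z => 1 - om z).
  move=> j jN z; rewrite (derive1nB _ (@smooth_cst _ 1) som).
  apply: le_trans (ler_normB _ _) _; rewrite addrC lerD //; first exact: HX.
  by case: j {jN} => [|j]; [rewrite normr1|rewrite derive1n_cst normr0].
(* With [v = xi (1 - z)], [xi >= 1] and [|z - 1| >= 1/4] one has [1 + |z| <= 2 (1 + |v|)] and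
   [xi <= 4 (1 + |v|)]. The [N.+2] powers of [xi] are the prefactor, at most [N] derivatives, and
   one more for the gain [1 / xi]. *)
pose B0 := 2 ^+ m * (4 ^+ N.+2 * Cg).
have B00 : 0 <= B0.
  rewrite /B0; apply: mulr_ge0; [exact: exprn_ge0|apply: mulr_ge0]; [exact: exprn_ge0|exact: Cg0].
have far xi : 1 <= xi -> wnorm N m (2 ^+ N * (B0 / xi * (X + 1))) (fun z => narrow xi z * (1 - om z)).
  move=> xi1; have xi0 : 0 < xi by lra.
  apply: (@wnormM_off N m _ _ _ _ (fun z => 4^-1 <= `|z - 1|) (@smooth_narrow xi) s1 b1).
  - move=> z; rewrite -ltNge => z1 j jN.
    rewrite (@derive1n_local _ j _ (fun=> 0) z (4^-1 - `|z - 1|)) ?subr_gt0 //.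
      by case: j {jN} => [//|j]; rewrite derive1n_cst.
    move=> y yz; rewrite /om c1 ?subrr ?mulr0 //.
    have : `|y - 1| <= `|y - z| + `|z - 1|.
      by rewrite (_ : y - 1 = (y - z) + (z - 1)) ?ler_normD //; ring.
    rewrite (_ : 4 * y + -4 = 4 * (y - 1)); last by ring.
    by rewrite normrM (ger0_norm (ler0n _ 4)); lra.
  - move=> z z1 i iN; rewrite derive1n_narrow; set v := - xi * z + xi.
    have Ev : `|v| = xi * `|z - 1|.
      rewrite (_ : v = - (xi * (z - 1))); last by rewrite /v; ring.
      by rewrite normrN normrM (gtr0_norm xi0).
    have v1 : `|z - 1| <= `|v| by rewrite Ev ler_peMl.
    have v4 : xi <= 4 * (1 + `|v|).
      by have : xi * 4^-1 <= `|v|; [rewrite Ev ler_wpM2l // ltW|lra].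
    have z2 : 1 + `|z| <= 2 * (1 + `|v|).
      have : `|z| <= `|z - 1| + `|1 : R| by rewrite -{1}(subrK 1 z) ler_normD.
      by rewrite normr1; have := normr_ge0 v; lra.
    rewrite ler_pdivlMr // !normrM normrX normrN (gtr0_norm xi0) /B0.
    set D := `|derive1n _ _ _|.
    have vp : 0 <= 1 + `|v| by rewrite addr_ge0.
    have pz : (1 + `|z|) ^+ m <= 2 ^+ m * (1 + `|v|) ^+ m.
      by rewrite -exprMn lerXn2r ?nnegrE ?mulr_ge0 ?addr_ge0.
    have px : xi * xi ^+ i * xi <= 4 ^+ N.+2 * (1 + `|v|) ^+ N.+2.
      rewrite -exprMn; apply: (@le_trans _ _ (xi ^+ N.+2)).
        by rewrite mulrC mulrA -expr2 -exprD ler_weXn2l // add2n !ltnS.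
      by apply: lerXn2r => //; rewrite nnegrE; lra.
    have D0 : 0 <= D by exact: normr_ge0.
    apply: (@le_trans _ _ ((2 ^+ m * (1 + `|v|) ^+ m) * (4 ^+ N.+2 * (1 + `|v|) ^+ N.+2) * D)).
      rewrite (_ : (1 + `|z|) ^+ m * (xi * (xi ^+ i * D)) * xi =
        (1 + `|z|) ^+ m * (xi * xi ^+ i * xi) * D); last by ring.
      apply: (ler_wpM2r D0); apply: ler_pM => //.
      by have xi00 := ltW xi0; rewrite mulr_ge0 // mulr_ge0 // exprn_ge0.
    have := HCg i iN v; rewrite -/D exprD => H.
    rewrite (_ : _ * _ * D = 2 ^+ m * (4 ^+ N.+2 * ((1 + `|v|) ^+ m * (1 + `|v|) ^+ N.+2 * D))); last by ring.
    by rewrite ler_wpM2l ?exprn_ge0 // ler_wpM2l ?exprn_ge0.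
  - by rewrite divr_ge0 // ltW.
have eta4 : 0 < eta / 2 by rewrite divr_gt0.
have [d d0 Hd] := Hside (divr_gt0 eta4 (ltr0n R 2)).
pose K := C * (2 ^+ N * (B0 * (X + 1))).
have X10 : 0 <= X + 1 by lra.
have K0 : 0 <= K by do !apply: mulr_ge0 => //; apply: exprn_ge0.
exists (1 + 2 * K / eta), (Num.min (Num.min e1 d) 2^-1); split.
- by rewrite lerDl; apply: divr_ge0; [apply: mulr_ge0|apply: ltW].
- by rewrite !lt_min e10 d0 invr_gt0 ltr0n.
move=> e xi /andP[e0]; rewrite !lt_min => /andP[/andP[ee1 ed] e2] se xiR.
have xi1 : 1 <= xi.
  by apply: le_trans xiR; rewrite lerDl; apply: divr_ge0; [apply: mulr_ge0|apply: ltW].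
have xi0 : 0 < xi by lra.
have sfar : smooth (fun z => narrow xi z * (1 - om z)).
  by apply: smoothM; [exact: smooth_narrow|exact: s1].
have snear : smooth (fun z => narrow xi z * om z).
  by apply: smoothM; [exact: smooth_narrow|exact: som].
have -> : narrow xi = (fun z => narrow xi z * om z + narrow xi z * (1 - om z)).
  by apply/funext => z; ring.
rewrite (cut_scaledD sW schi suchi _ _ snear sfar).
apply: le_lt_trans (ler_normD _ _) _; rewrite (splitr eta); apply: ltr_leD.
  rewrite (@cut_scaled_near _ W chi0 A chi01 p e _ 1) //; last first.
    have e1' : 2 <= 1 / `|e| by rewrite ler_pdivlMr //; lra.
    by apply: (supp_inW _ _ (supp_inM _ suom)); lra.
  apply: (@le_lt_trans _ _ (eta / 2 / 2 * 1)); last by lra.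
  have om01 z : 0 <= om z <= 1 by apply: c01.
  apply: le_trans (Hd e _ se _ snear _ (supp_inM _ suom)) _; first by rewrite e0.
    move=> z; have /andP[om0 _] := om01 z; rewrite /narrow; apply: mulr_ge0 => //.
    by apply: mulr_ge0; [exact: ltW|exact/ltW/gauss_gt0].
  apply: ler_wpM2l; first lra.
  exact: IT_narrow_le (smooth_continuous som) om01 xi0 suom.
apply: le_trans (HC e _ _ _ sfar (far xi xi1)) _; first by rewrite e0.
have -> : C * (2 ^+ N * (B0 / xi * (X + 1))) = K / xi by rewrite /K; field; lra.
rewrite ler_pdivrMr //; apply: (@le_trans _ _ (eta / 2 * (1 + 2 * K / eta))).
  rewrite mulrDr mulr1 (_ : eta / 2 * (2 * K / eta) = K); last by field; lra.
  by rewrite lerDr ltW.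
by rewrite ler_wpM2l // ltW.
Qed.

(** For [xi] beyond [Rb] the scale [t] is exchanged for [xi * t]; the hypothesis [xi * t < delta]
    keeps the new scale small. *)
Lemma corner (eta : R) : `|s| = 1 -> 0 < eta -> exists2 delta : R, 0 < delta &
  forall t xi, 0 < t < delta -> 0 <= xi -> xi * t < delta ->
    `|Q (s * t) (shiftg 0 xi)| < eta.
Proof.
move=> s1 eta0; have [Rb [d1 [R1 d10 H1]]] := corner_tangential eta0.
have R0 : 0 <= Rb by lra.
have [d2 d20 H2] := corner_nontangential R0 eta0.
have ss : s * s = 1 by rewrite -expr2 -(real_normK (num_real s)) s1 expr1n.
exists (Num.min d1 d2); first by rewrite lt_min d10.
move=> t xi /andP[t0]; rewrite !lt_min => /andP[td1 td2] xi0 /andP[xd1 xd2].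
have [xiR|xiR] := leP xi Rb.
  by apply: H2; rewrite ?xi0 // normrM s1 mul1r (gtr0_norm t0) t0.
have xip : 0 < xi by lra.
have sn0 : s != 0 by rewrite -normr_gt0 s1.
have -> : Q (s * t) (shiftg 0 xi) = Q (s * (xi * t)) (narrow xi).
  rewrite /cut_scaled !normrM s1 !mul1r (gtr0_norm t0) (gtr0_norm xip).
  have -> : dil p (s * (xi * t)) (narrow xi) = fun y => xi * dil p (s * t) (shiftg 0 xi) y.
    apply/funext => y; rewrite /dil /narrow /shiftg /=; congr (_ * gauss _).
    by field; rewrite sn0 !lt0r_neq0.
  rewrite (cutpZ sW schi suchi); last by apply: smooth_dil; apply: smooth_shiftg.
  by rewrite invfM mulrACA mulVf ?mul1r // lt0r_neq0.
apply: H1; last exact: ltW.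
  by rewrite normrM s1 mul1r gtr0_norm ?mulr_gt0.
by rewrite mulrA ss mul1r mulr_gt0.
Qed.

End Corner.

(** * The heat extension *)

Section MaximumPrinciple.
Context {R : realType}.
Implicit Types (f g : R -> R) (c d x y t p q kappa theta : R).

Lemma derive_lt0_right f c d : is_derive c 1 f d -> d < 0 ->
  exists2 delta : R, 0 < delta & forall z, c < z < c + delta -> f z < f c.
Proof.
move=> [df <-] d0; have /cvgrPdist_lt := df.
move=> /(_ (- 'D_1 f c)); rewrite oppr_gt0 => /(_ d0)[e /= e0 He].
exists e => // z /andP[cz zc].
have zc0 : 0 < z - c by rewrite subr_gt0.
have := He (z - c); rewrite /ball_ /= sub0r normrN (gtr0_norm zc0) lt0r_neq0 //.
move=> /(_ ltac:(lra) isT).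
set q := (z - c)^-1 *: _ => /ltr_normlP[H1 H2].
have qE : q = (z - c)^-1 * (f z - f c).
  by rewrite /q /=; congr (_ * (f _ - _)); rewrite -[LHS]/((z - c) * 1 + c) mulr1 subrK.
have : q < 0 by rewrite /derive in H1; lra.
by rewrite qE pmulr_rlt0 ?invr_gt0 // subr_lt0.
Qed.

Lemma derive_gt0_left f c d : is_derive c 1 f d -> 0 < d ->
  exists2 delta : R, 0 < delta & forall z, c - delta < z < c -> f z < f c.
Proof.
move=> fd d0.
have D : is_derive (- c) 1 (fun z => f (-1 * z + 0)) (-1 * d).
  by apply: is_derive_comp_affine; rewrite mulN1r opprK addr0.
have [|e e0 He] := derive_lt0_right D; first by rewrite mulN1r oppr_lt0.
exists e => // z zc; have := He (- z); rewrite !mulN1r !opprK !addr0; apply.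
by move: zc => /andP[? ?]; apply/andP; split; lra.
Qed.

Lemma min_second_derive f g c d (r : R) : 0 < r -> (forall x, is_derive x 1 f (g x)) ->
  is_derive c 1 g d -> (forall z, `|z - c| < r -> f c <= f z) -> 0 <= d.
Proof.
move=> r0 fg gd fmin; rewrite leNgt; apply/negP => d0.
have gc : g c = 0.
  apply/eqP; rewrite eq_le !leNgt; apply/andP; split; apply/negP => gc.
    have [e e0 He] := derive_gt0_left (fg c) gc.
    pose z := c - Num.min e r / 2.
    have m0 : 0 < Num.min e r by rewrite lt_min e0.
    have me : Num.min e r <= e by rewrite ge_min lexx.
    have mr : Num.min e r <= r by rewrite ge_min lexx orbT.
    have /He : c - e < z < c by rewrite /z; apply/andP; split; lra.
    by apply/negP; rewrite -leNgt fmin // /z ltr_norml; apply/andP; split; lra.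
  have [e e0 He] := derive_lt0_right (fg c) gc.
  pose z := c + Num.min e r / 2.
  have m0 : 0 < Num.min e r by rewrite lt_min e0.
  have me : Num.min e r <= e by rewrite ge_min lexx.
  have mr : Num.min e r <= r by rewrite ge_min lexx orbT.
  have /He : c < z < c + e by rewrite /z; apply/andP; split; lra.
  by apply/negP; rewrite -leNgt fmin // /z ltr_norml; apply/andP; split; lra.
have [e e0 He] := derive_lt0_right gd d0.
pose z := c + Num.min e r / 2.
have m0 : 0 < Num.min e r by rewrite lt_min e0.
have me : Num.min e r <= e by rewrite ge_min lexx.
have mr : Num.min e r <= r by rewrite ge_min lexx orbT.
have : f c <= f z by apply: fmin; rewrite /z ltr_norml; apply/andP; split; lra.
apply/negP; rewrite -ltNge -ltrN2.
apply: (@incr_of_derive _ (fun x => - f x) (fun x => - g x)).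
- move=> w /andP[cw wz]; rewrite oppr_gt0 -gc; apply: He; rewrite cw /=.
  by rewrite /z in wz; lra.
- by rewrite /z; lra.
Qed.

Variables (P0 P1 P2 : R -> R -> R) (h : R -> R) (p q t0 : R).
Hypotheses (pq : p < q) (t00 : 0 < t0).
Hypothesis (D1 : forall theta, 0 < theta -> forall x, is_derive x 1 (P0 theta) (P1 theta x)).
Hypothesis (D2 : forall theta, 0 < theta -> forall x, is_derive x 1 (P1 theta) (P2 theta x)).
Hypothesis (heat : forall theta, 0 < theta -> forall x,
  is_derive theta 1 (P0^~ x) (- (2^-1 * theta ^- 3 * P2 theta x))).
Hypothesis (sides : forall theta, t0^-1 <= theta -> 0 <= P1 theta p /\ 0 <= P1 theta q).
Definition heat_ext (x t : R) : R := if 0 < t then P0 t^-1 x else h x.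
Hypothesis (cont : forall x0 t1, p <= x0 <= q -> 0 <= t1 <= t0 -> forall eta : R, 0 < eta ->
  exists2 delta : R, 0 < delta & forall x t, p <= x <= q -> 0 <= t <= t0 ->
    `|x - x0| < delta -> `|t - t1| < delta -> `|heat_ext x t - heat_ext x0 t1| < eta).
Hypothesis (hmono : forall x y, p <= x -> x <= y -> y <= q -> h x <= h y).

(* The minimum of D(x, y, t) = Psi(y, t) - Psi(x, t) + kappa (y - x) + kappa t over
   p <= x <= y <= q, 0 <= t <= t0 cannot be negative. *)
Lemma two_point_min kappa theta x y : 0 < kappa -> t0^-1 <= theta ->
  p <= x -> x <= y -> y <= q ->
  0 <= P0 theta y - P0 theta x + kappa * (y - x) + kappa * theta^-1.
Proof.
move=> k0 th px xy yq.
pose D (z : R * R * R) := heat_ext z.1.2 z.2 - heat_ext z.1.1 z.2 + kappa * (z.1.2 - z.1.1) + kappa * z.2.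
pose K := [set z : R * R * R | [/\ p <= z.1.1, z.1.1 <= z.1.2, z.1.2 <= q & 0 <= z.2 <= t0]].
have cK : compact K.
  have c1 : compact (`[p, q] `*` `[p, q] `*` `[0, t0])%classic.
    by apply: compact_setX; [apply: compact_setX|]; apply: segment_compact.
  apply: (subclosed_compact _ c1); last first.
    move=> [[u v] t] [/= h1 h2 h3 h4]; rewrite !in_itv /=; split => //; split; apply/andP; split => //.
      exact: le_trans h3.
    exact: le_trans h2.
  rewrite (_ : K = [set z | p <= z.1.1] `&` [set z | 0 <= z.1.2 - z.1.1] `&` [set z | z.1.2 <= q] `&`
     ([set z | 0 <= z.2] `&` [set z | z.2 <= t0])); last first.
    apply/seteqP; split => [z [h1 h2 h3 /andP[h4 h5]]|z [[[/= h1 h2] h3] [h4 h5]]].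
      by do !split => //=; rewrite subr_ge0.
    by split => //; [rewrite -subr_ge0|rewrite h4].
  have c11 : continuous (fun z : R * R * R => z.1.1).
    by move=> z; apply: (@continuous_comp _ _ _ fst fst); apply: cvg_fst.
  have c12 : continuous (fun z : R * R * R => z.1.2).
    by move=> z; apply: (@continuous_comp _ _ _ fst snd); [apply: cvg_fst|apply: cvg_snd].
  have c2 : continuous (fun z : R * R * R => z.2) by move=> z; apply: cvg_snd.
  apply: closedI; first apply: closedI; first apply: closedI; last apply: closedI.
  - exact: (closed_comp (fun z _ => c11 z) (@closed_ge _ p)).
  - apply: (closed_comp (f := fun z : R * R * R => z.1.2 - z.1.1) _ (@closed_ge _ 0)) => z _.
    by apply: cvgB; [apply: c12|apply: c11].
  - exact: (closed_comp (fun z _ => c12 z) (@closed_le _ q)).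
  - exact: (closed_comp (fun z _ => c2 z) (@closed_ge _ 0)).
  - exact: (closed_comp (fun z _ => c2 z) (@closed_le _ t0)).
have contD : {within K, continuous D}.
  apply/subspace_continuousP => -[[u v] t] [/= h1 h2 h3 h4].
  apply/cvgrPdist_lt => eta eta0.
  have e4 : 0 < eta / 4 by rewrite divr_gt0.
  have uq : u <= q by apply: le_trans h3. have pv : p <= v by apply: le_trans h2.
  have [d1 d10 H1] := @cont u t ltac:(by rewrite h1) h4 _ e4.
  have [d2 d20 H2] := @cont v t ltac:(by rewrite pv) h4 _ e4.
  have [d3 [d30 k3d]] : exists d3 : R, 0 < d3 /\ 3 * kappa * d3 = eta / 4.
    exists (eta / 4 / (3 * kappa)); split; first by rewrite !divr_gt0 // mulr_gt0.
    by field; lra.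
  pose d := Num.min (Num.min d1 d2) d3.
  have dd1 : d <= d1 by rewrite /d !ge_min lexx.
  have dd2 : d <= d2 by rewrite /d !ge_min lexx orbT.
  have dd3 : d <= d3 by rewrite /d !ge_min lexx orbT.
  have d0 : 0 < d by rewrite !lt_min d10 d20.
  rewrite /within /=; apply/nbhs_ballP; exists d => //= -[[u' v'] t'] [[/= b1 b2] b3].
  move=> [/= k1 k2 k3 k4].
  move: b1 b2 b3; rewrite /ball_ => b1 b2 b3.
  have m1 : `|heat_ext u' t' - heat_ext u t| < eta / 4.
    apply: H1 => //; first by rewrite k1 (le_trans k2 k3).
      by rewrite distrC (lt_le_trans b1).
    by rewrite distrC (lt_le_trans b3).
  have m2 : `|heat_ext v' t' - heat_ext v t| < eta / 4.
    apply: H2 => //; first by rewrite k3 (le_trans k1 k2).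
      by rewrite distrC (lt_le_trans b2).
    by rewrite distrC (lt_le_trans b3).
  have n1 : kappa * `|u - u'| <= kappa * d3 by rewrite ler_wpM2l ?(ltW k0) // ltW // (lt_le_trans b1).
  have n2 : kappa * `|v - v'| <= kappa * d3 by rewrite ler_wpM2l ?(ltW k0) // ltW // (lt_le_trans b2).
  have n3 : kappa * `|t - t'| <= kappa * d3 by rewrite ler_wpM2l ?(ltW k0) // ltW // (lt_le_trans b3).
  move: n1 n2 n3; rewrite -(gtr0_norm k0) -!normrM (gtr0_norm k0) => /ler_normlP[n1 n1'] /ler_normlP[n2 n2'] /ler_normlP[n3 n3'].
  move: m1 m2 => /ltr_normlP[m1 m1'] /ltr_normlP[m2 m2'].
  change (`|D (u, v, t) - D (u', v', t')| < eta); rewrite /D /=.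
  by rewrite ltr_norml; apply/andP; split; lra.
have th0 : 0 < theta by apply: lt_le_trans th; rewrite invr_gt0.
have Kz : K (x, y, theta^-1).
  by split => //=; rewrite invr_ge0 (ltW th0) /= -(invrK t0) lef_pV2 ?posrE ?invr_gt0.
have Dz : D (x, y, theta^-1) = P0 theta y - P0 theta x + kappa * (y - x) + kappa * theta^-1.
  by rewrite /D /heat_ext /= invr_gt0 th0 invrK.
rewrite -Dz leNgt; apply/negP => Dneg.
have [[[u v] t]] := compact_EVT_min (ex_intro _ _ Kz) cK contD.
rewrite inE => -[/= pu uv vq /andP[t_0 tt0]] Dmin.
have {Dneg}Dneg : D (u, v, t) < 0 by apply: le_lt_trans (Dmin _ _) Dneg; rewrite inE.
have {}Dmin z : K z -> D (u, v, t) <= D z by move=> Kz'; apply: Dmin; rewrite inE.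
have tp : 0 < t.
  rewrite lt_neqAle t_0 andbT; apply/eqP => t0'; move: Dneg; rewrite /D /heat_ext /= -t0' ltxx.
  apply/negP; rewrite -leNgt mulr0 addr0 addr_ge0 ?subr_ge0 ?hmono //.
  by rewrite mulr_ge0 ?subr_ge0 // ltW.
have uv' : u < v.
  rewrite lt_neqAle uv andbT; apply/eqP => uv0; move: Dneg; rewrite /D /= uv0 !subrr mulr0 !add0r.
  by apply/negP; rewrite -leNgt mulr_ge0 // ltW.
have tm0 : 0 < t^-1 by rewrite invr_gt0.
have t0m : t0^-1 <= t^-1 by rewrite lef_pV2 ?posrE.
have [sp sq] := sides t0m.
have DE u' v' : D (u', v', t) = P0 t^-1 v' - P0 t^-1 u' + kappa * (v' - u') + kappa * t.
  by rewrite /D /heat_ext /= tp.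
have Du (w : R) : is_derive w 1 (fun u' => D (u', v, t)) (- P1 t^-1 w - kappa).
  rewrite (_ : (fun u' => _) = fun u' => (P0 t^-1 v + kappa * v + kappa * t) - (P0 t^-1 u' + kappa * u')).
    have H := is_derive_sub (is_derive_const (P0 t^-1 v + kappa * v + kappa * t) w)
      (is_derive_add (D1 tm0 w) (is_derive_mul (is_derive_const kappa w) (is_derive_idr w))).
    by apply: is_derive_eq H _; ring.
  by apply/funext => u'; rewrite DE; ring.
have Dv (w : R) : is_derive w 1 (fun v' => D (u, v', t)) (P1 t^-1 w + kappa).
  rewrite (_ : (fun v' => _) = fun v' => (P0 t^-1 v' + kappa * v') - (P0 t^-1 u + kappa * u - kappa * t)).
    have H := is_derive_sub 
      (is_derive_add (D1 tm0 w) (is_derive_mul (is_derive_const kappa w) (is_derive_idr w)))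
       (is_derive_const (P0 t^-1 u + kappa * u - kappa * t) w).
    by apply: is_derive_eq H _; ring.
  by apply/funext => v'; rewrite DE; ring.
(* On the sides only [P1 >= 0] is known; the term [kappa * (y - x)] makes an inward move a strict
   decrease, so that the minimum cannot lie there. *)
have pu' : p < u.
  rewrite lt_neqAle pu andbT; apply/eqP => pu0.
  have [|e e0 He] := derive_lt0_right (Du u); first by rewrite -pu0; lra.
  pose w := u + Num.min e (v - u) / 2.
  have m0 : 0 < Num.min e (v - u) by rewrite lt_min e0 subr_gt0.
  have me : Num.min e (v - u) <= e by rewrite ge_min lexx.
  have mr : Num.min e (v - u) <= v - u by rewrite ge_min lexx orbT.
  have /He : u < w < u + e by rewrite /w; apply/andP; split; lra.
  by apply/negP; rewrite -leNgt; apply: Dmin; split; rewrite /= ?t_0 // /w; lra.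
have vq' : v < q.
  rewrite lt_neqAle vq andbT; apply/eqP => vq0.
  have [|e e0 He] := derive_gt0_left (Dv v); first by rewrite vq0; lra.
  pose w := v - Num.min e (v - u) / 2.
  have m0 : 0 < Num.min e (v - u) by rewrite lt_min e0 subr_gt0.
  have me : Num.min e (v - u) <= e by rewrite ge_min lexx.
  have mr : Num.min e (v - u) <= v - u by rewrite ge_min lexx orbT.
  have /He : v - e < w < v by rewrite /w; apply/andP; split; lra.
  by apply/negP; rewrite -leNgt; apply: Dmin; split; rewrite /= ?t_0 // /w; lra.
have P2u : 0 <= - P2 t^-1 u.
  apply: (@min_second_derive (fun u' => D (u', v, t)) (fun w => - P1 t^-1 w - kappa) u _
    (Num.min (u - p) (v - u)) _ Du).
  - by rewrite lt_min !subr_gt0 pu'.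
  - apply: is_derive_eq (is_derive_sub (is_derive_opp (D2 tm0 u)) (is_derive_const kappa u)) _.
    by rewrite subr0.
  - move=> z; rewrite lt_min !ltr_norml => /andP[/andP[h1 h2] /andP[h3 h4]].
    by apply: Dmin; split; rewrite /= ?t_0 //; lra.
have P2v : 0 <= P2 t^-1 v.
  apply: (@min_second_derive (fun v' => D (u, v', t)) (fun w => P1 t^-1 w + kappa) v _
    (Num.min (q - v) (v - u)) _ Dv).
  - by rewrite lt_min !subr_gt0 vq'.
  - apply: is_derive_eq (is_derive_add (D2 tm0 v) (is_derive_const kappa v)) _.
    by rewrite addr0.
  - move=> z; rewrite lt_min !ltr_norml => /andP[/andP[h1 h2] /andP[h3 h4]].
    by apply: Dmin; split; rewrite /= ?t_0 //; lra.
have Vd : is_derive t^-1 1 (fun w : R => w^-1) (- (t^-1) ^- 2).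
  have V := @is_deriveV _ (fun y : R => y) t^-1 1 1 (lt0r_neq0 tm0) (is_derive_idr t^-1).
  by apply: (is_derive_eq V); rewrite /GRing.scale /= mulr1.
have Dt : is_derive t^-1 1 (fun w => P0 w v - P0 w u + kappa * (v - u) + kappa * w^-1)
   (- (2^-1 * t^-1 ^- 3 * P2 t^-1 v) - - (2^-1 * t^-1 ^- 3 * P2 t^-1 u) + 0 + (0 * t + kappa * - (t^-1) ^- 2)).
  apply: is_derive_add; first apply: is_derive_add; first apply: is_derive_sub.
  - exact: heat.
  - exact: heat.
  - have H := is_derive_mul (is_derive_const kappa t^-1) Vd.
    by rewrite invrK in H.
(* Increasing [theta] goes back in time. The second derivatives have the signs of an interior
   minimum, and the term [kappa * t] makes the decrease strict. *)
have [|e e0 He] := derive_lt0_right Dt.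
  have a3 : 0 < 2^-1 * t^-1 ^- 3 by rewrite mulr_gt0 ?invr_gt0 ?exprn_gt0 ?invr_gt0.
  have a2 : 0 < t^-1 ^- 2 by rewrite invr_gt0 exprn_gt0.
  have b1 := mulr_ge0 (ltW a3) P2u; have b2 := mulr_ge0 (ltW a3) P2v; have b3 := mulr_gt0 k0 a2.
  by move: b1 b2 b3; rewrite mul0r mulrN; lra.
pose w := t^-1 + e / 2.
have wt : t^-1 < w < t^-1 + e by rewrite /w; apply/andP; split; lra.
have wp : 0 < w by rewrite /w; lra.
have wt' : w^-1 <= t.
  by rewrite -[leRHS]invrK lef_pV2 ?posrE // ltW //; have /andP[] := wt.
have := He w wt; rewrite [X in _ < X](_ : _ = D (u, v, t)); last by rewrite DE invrK.
rewrite [X in X < _](_ : _ = D (u, v, w^-1)); last by rewrite /D /heat_ext /= invr_gt0 wp invrK.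
apply/negP; rewrite -leNgt; apply: Dmin; split => //=.
by rewrite invr_ge0 (ltW wp) /=; apply: le_trans wt' tt0.
Qed.

End MaximumPrinciple.

(** * Kernels, the heat equation and the error of the cutoff *)

Section HeatExtension.
Context {R : realType}.
Implicit Types (k l phi psi : R -> R) (x y z theta M : R).

(** The [n]-th derivative in [x] of the kernel [t^-1 gauss ((x - y) / t)], with [theta = t^-1]. *)
Definition kern (n : nat) theta x y : R := theta ^+ n.+1 * derive1n n gauss (theta * (x - y)).

Lemma kernE n theta x :
  kern n theta x = fun y => theta ^+ n.+1 * derive1n n gauss (- theta * y + theta * x).
Proof. by apply/funext => y; rewrite /kern; congr (_ * derive1n n gauss _); ring. Qed.

Lemma smooth_dgauss n : smooth (derive1n n (@gauss R)).
Proof. by apply: smooth_derive1n; apply: smooth_gauss. Qed.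

Lemma smooth_kern n theta x : smooth (kern n theta x).
Proof. by rewrite kernE; apply: smoothZ; apply: smooth_comp_affine; apply: smooth_dgauss. Qed.

Lemma derive1n_kern j n theta x :
  derive1n j (kern n theta x) = fun y => (-1) ^+ j * kern (n + j) theta x y.
Proof.
rewrite kernE derive1nZ; last by apply: smooth_comp_affine; apply: smooth_dgauss.
rewrite derive1n_comp_affine; last exact: smooth_dgauss.
rewrite derive1n_add kernE; apply/funext => y; rewrite addnC -addSn exprD [(- theta) ^+ j]exprNn; ring.
Qed.

Lemma gauss_sup n : exists C : R, 0 <= C /\ forall z : R, `|derive1n n gauss z| <= C.
Proof. by have [C C0 HC] := @gauss_bounded R n 0; exists C; split => // z; have := HC z; rewrite expr0 mul1r. Qed.

Lemma is_derive_kern_x n theta x y :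
  is_derive x 1 (fun x => kern n theta x y) (kern n.+1 theta x y).
Proof.
rewrite /kern (_ : (fun x => _) = fun x => theta ^+ n.+1 * derive1n n gauss (theta * x + - theta * y)); last first.
  by apply/funext => z; congr (_ * derive1n n gauss _); ring.
have H := is_derive_mul (is_derive_const (theta ^+ n.+1) x)
  (is_derive_comp_affine (derive1n_gauss_is_derive n (theta * x + - theta * y))).
apply: is_derive_eq H _; rewrite mul0r add0r mulrA -exprSr; congr (_ * derive1n n.+1 gauss _); ring.
Qed.

Lemma is_derive_expr n theta : is_derive theta 1 (fun t : R => t ^+ n) (n%:R * theta ^+ n.-1).
Proof.
elim: n => [|n IH].
  rewrite mul0r (_ : (fun t => _) = fun=> 1); first exact: is_derive_const.
  by apply/funext => t; rewrite expr0.
rewrite (_ : (fun t => _) = fun t => t * t ^+ n); last by apply/funext => t; rewrite exprS.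
have H := is_derive_mul (is_derive_idr theta) IH.
apply: is_derive_eq H _; rewrite -(natr1 n) mulrDl !mul1r addrC; congr (_ + _).
by case: n {IH} => [|n]; rewrite ?mul0r ?mulr0 //= mulrCA -exprS.
Qed.

Lemma is_derive_gauss_dil n theta z :
  is_derive theta 1 (fun t : R => derive1n n gauss (t * z)) (z * derive1n n.+1 gauss (theta * z)).
Proof.
rewrite (_ : (fun t => _) = fun t => derive1n n gauss (z * t + 0)); last first.
  by apply/funext => t; rewrite addr0 mulrC.
have H := is_derive_comp_affine (derive1n_gauss_is_derive n (z * theta + 0)).
by apply: is_derive_eq H _; rewrite addr0 (mulrC z theta).
Qed.

Lemma is_derive_kern_theta n theta z :
  is_derive theta 1 (fun t : R => t ^+ n.+1 * derive1n n gauss (t * z))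
    (- (2^-1 * theta ^+ n * derive1n n.+2 gauss (theta * z))).
Proof.
have H := is_derive_mul (is_derive_expr n.+1 theta) (is_derive_gauss_dil n theta z).
apply: is_derive_eq H _; set X := derive1n n.+2 _ _.
have -> : - (2^-1 * theta ^+ n * X) = theta ^+ n * - (2^-1 * X) by ring.
by rewrite /X -gauss_heat /= exprS; ring.
Qed.

Lemma is_derive2_kern_theta n theta z :
  is_derive theta 1 (fun t : R => - (2^-1 * t ^+ n * derive1n n.+2 gauss (t * z)))
    (- (2^-1 * (n%:R * theta ^+ n.-1 * derive1n n.+2 gauss (theta * z) +
       theta ^+ n * (z * derive1n n.+3 gauss (theta * z))))).
Proof.
rewrite (_ : (fun t => _) = fun t => - (2^-1 * (t ^+ n * derive1n n.+2 gauss (t * z)))); last first.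
  by apply/funext => t; rewrite mulrA.
have H := is_derive_opp (is_derive_mul (is_derive_const 2^-1 theta)
  (is_derive_mul (is_derive_expr n theta) (is_derive_gauss_dil n.+2 theta z))).
by apply: is_derive_eq H _; rewrite mul0r add0r.
Qed.

Variables (W : (R -> R) -> R) (chi0 : R -> R) (A : R).
Hypotheses (sW : schwartz_distribution W) (A0 : 0 <= A) (schi : smooth chi0)
  (chi01 : forall x, `|x| <= A -> chi0 x = 1) (suchi : supp_in (- (A + 1)) (A + 1) chi0).
Notation T := (cutp W chi0).

(** Differentiation under the pairing: by [cutp_bound], quadratic remainders for finitely many
    derivatives of the family give a quadratic remainder for the pairing. *)
Lemma cutp_is_derive (K : R -> R -> R) (K' : R -> R) z (e : R) : 0 < e ->
  (forall z, smooth (K z)) -> smooth K' ->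
  (forall j, exists M, 0 <= M /\ forall h, `|h| < e -> forall y, `|y| <= A + 1 ->
    `|derive1n j (K (z + h)) y - derive1n j (K z) y - h * derive1n j K' y| <= M * h ^+ 2) ->
  is_derive z 1 (fun z => T (K z)) (T K').
Proof.
move=> e0 sK sK' /choice[M HM].
have [N [C [C0 HC]]] := cutp_bound sW A0 schi suchi.
apply: (@is_derive_rem2 _ _ _ _ (C * \sum_(j < N.+1) M j) e) => // h he.
have s1 : smooth (fun y => K (z + h) y - K z y) by exact: (smoothB (sK (z + h)) (sK z)).
have s2 : smooth (fun y => h * K' y) by apply: smoothZ.
rewrite -(cutpZ sW schi suchi h sK') -(cutpB sW schi suchi (sK (z + h)) (sK z)).
rewrite -(cutpB sW schi suchi s1 s2) -mulrA.
have M0 : 0 <= \sum_(j < N.+1) M j by apply: sumr_ge0 => j _; exact: (HM _).1.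
apply: HC; [exact: smoothB|by rewrite mulr_ge0 // sqr_ge0|].
move=> j jN y yA; rewrite (derive1nB _ s1 s2) (derive1nB _ (sK (z + h)) (sK z)) (derive1nZ _ _ sK').
apply: le_trans ((HM j).2 h he y yA) _; rewrite ler_wpM2r ?sqr_ge0 //.
rewrite (bigD1 (Ordinal (jN : (j < N.+1)%N))) //= lerDl sumr_ge0 // => i _; exact: (HM _).1.
Qed.

Definition heat (n : nat) theta x : R := T (kern n theta x).

Lemma heat_derive_x n theta x : 0 < theta ->
  is_derive x 1 (heat n theta) (heat n.+1 theta x).
Proof.
move=> th0; apply: (@cutp_is_derive (fun x => kern n theta x) _ x 1 ltr01).
- by move=> z; apply: smooth_kern.
- exact: smooth_kern.
move=> j; have [C [C0 HC]] := gauss_sup (n + j).+2.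
exists (theta ^+ (n + j).+3 * C); split=> [|h _ y _]; first by rewrite mulr_ge0 // exprn_ge0 // ltW.
rewrite !derive1n_kern addSn.
have -> : forall u v w : R, (-1) ^+ j * u - (-1) ^+ j * v - h * ((-1) ^+ j * w) =
    (-1) ^+ j * (u - v - h * w) by move=> u v w; ring.
rewrite normrM normrX normrN normr1 expr1n mul1r.
apply: (@taylor2_le _ (fun x => kern (n + j) theta x y) (fun x => kern (n + j).+1 theta x y)
  (fun x => kern (n + j).+2 theta x y)).
- by move=> z; apply: is_derive_kern_x.
- by move=> z; apply: is_derive_kern_x.
move=> z _; rewrite /kern normrM normrX (gtr0_norm th0) ler_wpM2l ?exprn_ge0 ?(ltW th0) //.
Qed.

(** In the variable [t = theta^-1] this reads [d/dt = (t/2) d^2/dx^2], the standard heat equation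
    for the time [t^2 / 4]. *)
Lemma heat_derive_theta theta x : 0 < theta ->
  is_derive theta 1 (fun t => heat 0 t x) (- (2^-1 * theta ^- 3 * heat 2 theta x)).
Proof.
move=> th0.
have -> : - (2^-1 * theta ^- 3 * heat 2 theta x) =
    T (fun y => - (2^-1 * theta ^- 3) * kern 2 theta x y).
  rewrite (cutpZ sW schi suchi); last exact: smooth_kern.
  by rewrite mulNr.
apply: (@cutp_is_derive (fun t => kern 0 t x) _ theta theta th0).
- by move=> z; apply: smooth_kern.
- by apply: smoothZ; apply: smooth_kern.
move=> j; have [C2 [C20 HC2]] := gauss_sup j.+2; have [C3 [C30 HC3]] := gauss_sup j.+3.
pose Z := `|x| + (A + 1).
have Z0 : 0 <= Z by rewrite !addr_ge0.
have t20 : 0 <= 2 * theta by rewrite mulr_ge0 // ltW.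
exists (2^-1 * (j%:R * (2 * theta) ^+ j.-1 * C2 + (2 * theta) ^+ j * (Z * C3))); split.
  by rewrite mulr_ge0 // addr_ge0 // mulr_ge0 ?mulr_ge0 ?exprn_ge0.
move=> h ht y yA.
rewrite (derive1nZ j (- (2^-1 * theta ^- 3)) (@smooth_kern 2 theta x)).
rewrite !derive1n_kern add0n.
have -> : (-1) ^+ j * kern j (theta + h) x y - (-1) ^+ j * kern j theta x y -
    h * (- (2^-1 / theta ^+ 3) * ((-1) ^+ j * kern (2 + j) theta x y)) =
  (-1) ^+ j * ((theta + h) ^+ j.+1 * derive1n j gauss ((theta + h) * (x - y)) -
    theta ^+ j.+1 * derive1n j gauss (theta * (x - y)) -
    h * (- (2^-1 * theta ^+ j * derive1n j.+2 gauss (theta * (x - y))))).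
  rewrite /kern add2n (_ : theta ^+ j.+3 = theta ^+ 3 * theta ^+ j); last by rewrite -exprD.
  by field; lra.
rewrite normrM normrX normrN normr1 expr1n mul1r.
apply: (@taylor2_le _ (fun t => t ^+ j.+1 * derive1n j gauss (t * (x - y)))
  (fun t => - (2^-1 * t ^+ j * derive1n j.+2 gauss (t * (x - y)))) _ theta h).
- by move=> t; apply: is_derive_kern_theta.
- by move=> t; apply: is_derive2_kern_theta.
move=> t Ht; have /andP[tn t2] : 0 <= t <= 2 * theta.
  move: ht => /ltr_normlP[h1 h2]; move: Ht => /andP[]; rewrite ge_min le_max.
  by move=> /orP[] a1 /orP[] a2; apply/andP; split; lra.
have yZ : `|x - y| <= Z by apply: le_trans (ler_normB _ _) _; rewrite lerD2l.
rewrite normrN normrM (ger0_norm (_ : 0 <= 2^-1)) // ler_wpM2l //.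
apply: le_trans (ler_normD _ _) _; rewrite !normrM !normrX (ger0_norm tn) (ger0_norm (ler0n _ j)).
apply: lerD.
  apply: ler_pM; rewrite ?mulr_ge0 ?exprn_ge0 //.
  by rewrite ler_wpM2l // lerXn2r // nnegrE.
apply: ler_pM; rewrite ?mulr_ge0 ?exprn_ge0 //; first by rewrite lerXn2r // nnegrE.
by apply: ler_pM.
Qed.

Lemma heat_bounded n (Th : R) : exists B : R, 0 <= B /\
  forall theta x, 0 < theta -> theta <= Th -> `|heat n theta x| <= B.
Proof.
have [N [C [C0 HC]]] := cutp_bound sW A0 schi suchi.
have /choice[G HG] := fun j => gauss_sup (n + j).
pose M := \sum_(j < N.+1) `|Th| ^+ (n + j).+1 * G j.
have M0 : 0 <= M by apply: sumr_ge0 => j _; rewrite mulr_ge0 ?exprn_ge0 //; exact: (HG _).1.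
exists (C * M); split; first by rewrite mulr_ge0.
move=> theta x th0 thT; apply: HC => //; first exact: smooth_kern.
move=> j jN y _; rewrite derive1n_kern normrM normrX normrN normr1 expr1n mul1r.
rewrite /kern normrM normrX (gtr0_norm th0).
apply: (@le_trans _ _ (`|Th| ^+ (n + j).+1 * G j)).
  apply: ler_pM; rewrite ?exprn_ge0 ?(ltW th0) //; last exact: (HG _).2.
  by apply: lerXn2r; rewrite ?nnegrE ?(ltW th0) //; apply: le_trans thT (ler_norm _).
rewrite /M (bigD1 (Ordinal (jN : (j < N.+1)%N))) //= lerDl sumr_ge0 // => i _.
by rewrite mulr_ge0 ?exprn_ge0 //; exact: (HG _).1.
Qed.

Lemma heat_continuous x0 theta0 (eta : R) : 0 < theta0 -> 0 < eta ->
  exists2 delta : R, 0 < delta & forall x theta, `|x - x0| < delta -> `|theta - theta0| < delta ->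
    `|heat 0 theta x - heat 0 theta0 x0| < eta.
Proof.
move=> th0 eta0; have [B [B0 HB]] := heat_bounded 1 (2 * theta0).
have cth : {for theta0, continuous (fun t => heat 0 t x0)}.
  exact: is_derive_continuous (heat_derive_theta x0 th0).
have eta2 : 0 < eta / 2 by rewrite divr_gt0.
have /cvgrPdist_lt/(_ _ eta2)[d /= d0 Hd] := cth.
exists (Num.min (Num.min d theta0) (eta / 2 / (B + 1))).
  by rewrite !lt_min d0 th0 /= divr_gt0 // ltr_wpDl.
move=> x theta; rewrite !lt_min => /andP[/andP[_ _] xB] /andP[/andP[td t0] _].
move: t0 => /ltr_normlP[t1 t2].
have thp : 0 < theta by lra.
have tht : theta <= 2 * theta0 by lra.
rewrite (splitr eta).
have -> : heat 0 theta x - heat 0 theta0 x0 =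
  (heat 0 theta x - heat 0 theta x0) - (heat 0 theta0 x0 - heat 0 theta x0) by ring.
apply: le_lt_trans (ler_normB _ _) _; apply: ler_ltD; last first.
  by apply: Hd; rewrite /ball_ /= distrC.
apply: le_trans (mean_le (fun z => heat_derive_x 0 z thp) (fun z _ => HB theta z thp tht)) _.
move: xB; rewrite ltr_pdivlMr ?ltr_wpDl // => xB; rewrite mulrC; apply: le_trans (ltW xB).
by rewrite ler_wpM2l // lerDl.
Qed.

(** The first term is the derivative of [W] tested on the cut kernel, the second the error due to
    the cutoff, which [heat1_tail] shows to be negligible. *)
Lemma heat1_split theta x : heat 1 theta x =
  - W (derive1 (fun y => chi0 y * kern 0 theta x y)) + W (fun y => derive1 chi0 y * kern 0 theta x y).
Proof.
have sk := @smooth_kern 0 theta x; have sc' := smooth_derive1 schi.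
have t1 : test_function (fun y => derive1 chi0 y * kern 0 theta x y).
  apply: (@test_of_supp _ (- (A + 1)) (A + 1)); first exact: smoothM.
  exact/supp_inMl/supp_in_derive1.
have t2 := test_cut schi suchi (@smooth_kern 1 theta x).
have -> : derive1 (fun y => chi0 y * kern 0 theta x y) =
    fun y => derive1 chi0 y * kern 0 theta x y - chi0 y * kern 1 theta x y.
  apply: derive1_fun => y.
  have D := smooth_is_derive y sk.
  have H := is_derive_mul (smooth_is_derive y schi) D.
  apply: is_derive_eq H _; congr (_ + _).
  have -> : derive1 (kern 0 theta x) y = derive1n 1 (kern 0 theta x) y by [].
  by rewrite derive1n_kern expr1 add0n mulN1r mulrN.
rewrite (schwartzB sW t1 t2) /heat /cutp; ring.
Qed.

(** The derivative of the cutoff lives where [|y| >= A], at distance at least 1 from [x], and there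
    the kernel and its derivatives up to the order of [W] are [O(1 / theta)]. *)
Lemma heat1_tail (eta : R) : 0 < eta -> exists2 Th : R, 0 < Th & forall theta x, Th <= theta ->
  `|x| <= A - 1 -> `|W (fun y => derive1 chi0 y * kern 0 theta x y)| <= eta.
Proof.
move=> eta0; have sc' := smooth_derive1 schi.
have sx' := supp_in_derive1 suchi.
have lt0 : - (A + 1) < A + 1 by have := A0; lra.
have [N [C [C0 HC]]] := schwartz_bound (- (A + 1)) (A + 1) sW.
have [X HX] := bnd_ex N lt0 sc' sx'; have X0 := bnd_ge0 HX.
have /choice[D HD] : forall j, exists D : R, 0 <= D /\
    forall z : R, (1 + `|z|) ^+ N.+2 * `|derive1n j gauss z| <= D.
  by move=> j; have [D D0 HD] := @gauss_bounded R j N.+2; exists D.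
pose G := \sum_(j < N.+1) D j.
have DG j : (j <= N)%N -> D j <= G.
  move=> jN; rewrite /G (bigD1 (Ordinal (jN : (j < N.+1)%N))) //= lerDl sumr_ge0 // => i _.
  exact: (HD _).1.
have G0 : 0 <= G by apply: le_trans (HD 0%N).1 (DG _ _).
pose K := C * (2 ^+ N * (X * G)).
have K0 : 0 <= K by do !apply: mulr_ge0 => //; apply: exprn_ge0.
exists (1 + K / eta); first by rewrite ltr_pwDl // divr_ge0 // ltW.
move=> theta x thT xA.
have th1 : 1 <= theta by apply: le_trans thT; rewrite lerDl divr_ge0 // ltW.
have th0 : 0 < theta by lra.
have sk := @smooth_kern 0 theta x.
apply: (@le_trans _ _ (C * (2 ^+ N * (X * (G / theta))))); last first.
  rewrite (_ : _ * _ = K / theta); last by rewrite /K; field; lra.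
  rewrite ler_pdivrMr //; apply: (@le_trans _ _ (eta * (1 + K / eta))); last by rewrite ler_wpM2l // ltW.
  by rewrite mulrDr mulr1 mulrCA mulfV ?mulr1 ?gt_eqF // lerDr ltW.
apply: HC; [exact: smoothM|exact: supp_inMl|].
have GX0 : 0 <= X * (G / theta) by rewrite mulr_ge0 // divr_ge0 // ltW.
move=> j jN y.
have [yA|yA] := ltP `|y| A.
  rewrite (@derive1n_away _ _ _ _ A) ?normr0 //; first by rewrite mulr_ge0 // exprn_ge0.
  move=> z zA; rewrite (_ : derive1 chi0 z = 0) ?mul0r //.
  apply: is_derive_eq1; apply: (@is_derive_local _ _ (fun=> 1) z _ (A - `|z|)); first by rewrite subr_gt0.
    move=> t tz; apply: chi01; apply: ltW; have : `|t| <= `|t - z| + `|z| by rewrite -{1}(subrK z t) ler_normD.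
    lra.
apply: (@le_trans _ _ (2 ^+ j * (X * (G / theta)))); last first.
  by rewrite ler_wpM2r // ler_weXn2l // ler1n.
apply: (derive1nM_le sc' sk) => i ij; have iN := leq_trans ij jN; first exact: HX.
rewrite derive1n_kern normrM normrX normrN normr1 expr1n mul1r add0n /kern normrM normrX (gtr0_norm th0).
set v := theta * (x - y).
have v1 : theta <= `|v|.
  rewrite /v normrM (gtr0_norm th0) ler_peMr ?(ltW th0) //.
  have : `|y| <= `|x - y| + `|x|.
    by rewrite -normrN -[X in `|X|](_ : (x - y) - x = - y) ?ler_normB //; ring.
  lra.
rewrite ler_pdivlMr //; apply: le_trans (DG i iN); apply: le_trans ((HD i).2 v).
rewrite mulrAC -exprSr ler_wpM2r //.
apply: (@le_trans _ _ (theta ^+ N.+2)); first by rewrite ler_weXn2l.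
by apply: lerXn2r; rewrite ?nnegrE; lra.
Qed.

End HeatExtension.

(** * Distributions given by continuous functions *)

Section RegularDistributions.
Context {R : realType}.
Implicit Types (F phi psi : R -> R) (g : (R -> R) -> R) (x y c d e : R).

Lemma IT_lin_test (r : R) F phi psi : continuous F -> test_function phi -> test_function psi ->
  IT (fun x => F x * (r * phi x + psi x)) =
  r * IT (fun x => F x * phi x) + IT (fun x => F x * psi x).
Proof.
move=> cF tp tq; have [A A0 sA] := test_supp tp; have [B B0 sB] := test_supp tq.
pose M := Num.max A B.
have AM : A <= M by rewrite /M le_max lexx. have BM : B <= M by rewrite /M le_max lexx orbT.
have M0 : - M < M by lra.
have cp := smooth_continuous (test_smooth tp); have cq := smooth_continuous (test_smooth tq).
rewrite -(@IT_lin _ (- M) M) //.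
- by congr IT; apply/funext => x; ring.
- exact: contM.
- exact: contM.
- by apply: supp_inM; apply: (supp_inW _ _ sA); lra.
- by apply: supp_inM; apply: (supp_inW _ _ sB); lra.
Qed.

Definition reg F : (R -> R) -> R := fun psi => IT (fun x => F x * psi x).

Lemma cont_bounded_on c d F : c <= d -> continuous F ->
  exists2 M : R, 0 <= M & forall x, c <= x <= d -> `|F x| <= M.
Proof.
move=> cd cF; have /= [z _ Hz] := @EVT_max R (fun x => `|F x|) c d cd (continuous_subspaceT (cont_norm cF)).
by exists `|F z| => // x xcd; apply: Hz; rewrite in_itv.
Qed.

Lemma reg_schwartz F : continuous F -> schwartz_distribution (reg F).
Proof.
move=> cF; split; first by move=> c phi psi tp tq; apply: IT_lin_test.
move=> K /compact_bounded[M0 [_ HM0]].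
pose M := `|M0| + 1; have M0' : 0 < M by rewrite ltr_wpDl.
have HK x : K x -> `|x| <= M.
  by move=> Kx; apply: HM0 => //; have := ler_norm M0; rewrite /M; lra.
have [B B0 HB] := @cont_bounded_on (- M) M F ltac:(lra) cF.
exists 0%N, (B * (2 * M)) => phi tp Kphi.
have su : supp_in (- M) M phi.
  move=> x Hx; apply/eqP/negPn/negP => px.
  have /HK : K x by apply: Kphi; apply: subset_closure.
  by move=> /ler_normlP[h1 h2]; case: Hx => Hx; lra.
have cp := smooth_continuous (test_smooth tp).
have MM : - M < M by lra.
rewrite big_ord_recl big_ord0 addr0 /=; set S := sup _.
have pS x : `|phi x| <= S.
  apply: ub_le_sup; last by exists x.
  have [X HX] := cont_supp_bounded MM cp su.
  by exists X => _ [y _ <-]; apply: HX.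
have S0 : 0 <= S by apply: le_trans (pS 0).
apply: (@le_trans _ _ (B * S * (M - - M))); last by rewrite le_eqVlt; apply/orP; left; apply/eqP; ring.
apply: IT_bound => //; [exact: contM|exact: supp_inM|].
move=> x; have [xM|xM] := boolP (- M <= x <= M).
  by rewrite normrM ler_pM // HB.
rewrite su ?mulr0 ?normr0 ?mulr_ge0 //.
by move: xM; rewrite negb_and -!ltNge => /orP[|]; [left|right].
Qed.

Lemma schwartz_comb g1 g2 (r : R) : schwartz_distribution g1 -> schwartz_distribution g2 ->
  schwartz_distribution (fun psi => r * g1 psi + g2 psi).
Proof.
move=> [l1 b1] [l2 b2]; split.
  by move=> c phi psi tp tq; rewrite l1 // l2 //; ring.
move=> K cK; have [N1 [C1 H1]] := b1 K cK; have [N2 [C2 H2]] := b2 K cK.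
exists (N1 + N2)%N, (`|r| * `|C1| + `|C2|) => phi tp Kp.
have [A A0 sA] := test_supp tp.
have sup0 k : 0 <= sup (range (fun x => `|derive1n k phi x|)).
  have AA : - A < A by lra.
  have [X HX] := cont_supp_bounded AA
    (smooth_continuous (@smooth_derive1n _ k _ (test_smooth tp))) (@supp_in_derive1n _ _ _ _ k sA).
  apply: (le_trans (normr_ge0 (derive1n k phi 0))); apply: ub_le_sup; last by exists 0.
  by exists X => _ [y _ <-]; apply: HX.
have mono n m : (n <= m)%N -> \sum_(k < n.+1) sup (range (fun x => `|derive1n k phi x|)) <=
    \sum_(k < m.+1) sup (range (fun x => `|derive1n k phi x|)).
  move=> nm; rewrite -!(big_mkord xpredT (fun k => sup (range (fun x => `|derive1n k phi x|)))).
  by rewrite [leRHS](big_cat_nat (n := n.+1)) //= lerDl sumr_ge0.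
apply: le_trans (ler_normD _ _) _; rewrite mulrDl normrM -mulrA.
have sum0 n : 0 <= \sum_(k < n.+1) sup (range (fun x => `|derive1n k phi x|)) by rewrite sumr_ge0.
apply: lerD.
  rewrite ler_wpM2l //; apply: le_trans (H1 phi tp Kp) _; apply: le_trans (ler_wpM2r (sum0 _) (ler_norm _)) _.
  by rewrite ler_wpM2l // mono // leq_addr.
apply: le_trans (H2 phi tp Kp) _; apply: le_trans (ler_wpM2r (sum0 _) (ler_norm _)) _.
by rewrite ler_wpM2l // mono // leq_addl.
Qed.

Lemma IT_dil p e phi A : e != 0 -> 0 < A -> continuous phi -> supp_in (- A) A phi ->
  IT (dil p e phi) = `|e| * IT phi.
Proof. by move=> e0 A0 cp sp; rewrite /dil (@IT_affine _ (- A) A) //; lra. Qed.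

Lemma reg_point_value F x0 : continuous F -> has_point_value (reg F) x0 (F x0).
Proof.
move=> cF phi tp; have [A A0 sA] := test_supp tp.
have AA : - A < A by lra.
have cp := smooth_continuous (test_smooth tp).
have [X HX] := cont_supp_bounded AA cp sA.
have X0 : 0 <= X by apply: le_trans (HX 0).
apply/cvgrPdist_lt => eta eta0.
pose eta' := eta / (X * (2 * A) + 1).
have XA : 0 < X * (2 * A) + 1 by rewrite ltr_wpDl // !mulr_ge0 // ltW.
have eta'0 : 0 < eta' by rewrite divr_gt0.
have /cvgrPdist_lt/(_ _ eta'0)[d /= d0 Hd] := cF x0.
exists (d / A) => /=; first by rewrite divr_gt0.
move=> e; rewrite /ball_ /= sub0r normrN ltr_pdivlMr // => eA e0.
have ep : 0 < `|e| by rewrite normr_gt0.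
have sd := supp_dil e0 sA : supp_in (x0 - A * `|e|) (x0 + A * `|e|) (dil x0 e phi).
have cd : continuous (dil x0 e phi) by apply/smooth_continuous/smooth_dil/test_smooth.
have lt1 : x0 - A * `|e| < x0 + A * `|e| by have := mulr_gt0 A0 ep; lra.
have E : F x0 * IT phi - scaled_pairing (reg F) x0 e phi =
    `|e|^-1 * IT (fun y => (F x0 - F y) * dil x0 e phi y).
  rewrite scaled_pairingE /reg.
  have -> : (fun y => (F x0 - F y) * dil x0 e phi y) = (fun y => F x0 * dil x0 e phi y - F y * dil x0 e phi y).
    by apply/funext => y; rewrite mulrBl.
  rewrite (@IT_sub _ (x0 - A * `|e|) (x0 + A * `|e|)) //.
  - rewrite (@ITZ _ (x0 - A * `|e|) (x0 + A * `|e|)) // (IT_dil _ e0 A0 cp sA) mulrBr.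
    by congr (_ - _); rewrite mulrCA mulKf // gt_eqF.
  - exact: contZ.
  - exact: contM.
  - exact: supp_inM.
  - exact: supp_inM.
rewrite [X in `|X|]E normrM (ger0_norm (_ : 0 <= `|e|^-1)) ?invr_ge0 //.
have B : `|IT (fun y => (F x0 - F y) * dil x0 e phi y)| <= eta' * X * ((x0 + A * `|e|) - (x0 - A * `|e|)).
  apply: IT_bound => //.
  - by apply: contM => //; apply: contB => //; apply: cont_cst.
  - exact: supp_inM.
  move=> y; have [yb|yb] := boolP (x0 - A * `|e| <= y <= x0 + A * `|e|).
    rewrite normrM ler_pM ?HX // ltW // Hd //= /ball_ /= ltr_norml.
    by move: yb => /andP[y1 y2]; apply/andP; split; lra.
  have -> : dil x0 e phi y = 0.
    apply: sd; by move: yb; rewrite negb_and -!ltNge => /orP[|]; [left|right].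
  by rewrite mulr0 normr0; apply: mulr_ge0 => //; exact: ltW.
apply: (@le_lt_trans _ _ (eta' * (X * (2 * A)))).
  rewrite mulrC ler_pdivrMr //; apply: le_trans B _.
  by rewrite le_eqVlt; apply/orP; left; apply/eqP; ring.
rewrite /eta' mulrAC ltr_pdivrMr // ltr_pM2l // ltrDl //.
Qed.

(** [F] need not be differentiable, so a translation takes the place of the derivative: moving [psi]
    to the right by [kap] does not decrease its integral against [F], and the Taylor error is of
    order [kap ^+ 2]. *)
Lemma reg_mono F psi : continuous F -> {homo F : x y / x <= y} -> test_function psi ->
  (forall x, 0 <= psi x) -> reg F (derive1 psi) <= 0.
Proof.
move=> cF mF tp p0; have [A A0 sA] := test_supp tp; have sp := test_smooth tp.
have [M M0 HM] := @cont_bounded_on (- (A + 1)) (A + 1) F ltac:(lra) cF.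
have AA : - A < A by lra.
have A1 : - (A + 1) < A + 1 by lra.
have sA1 : supp_in (- (A + 1)) (A + 1) psi by apply: (supp_inW _ _ sA); lra.
have [X HX] := cont_supp_bounded AA (smooth_continuous (smooth_derive1 (smooth_derive1 sp)))
   (supp_in_derive1 (supp_in_derive1 sA)).
have X0 : 0 <= X by apply: le_trans (HX 0).
pose C := M * X * (A + 1 - - (A + 1)).
have C0 : 0 <= C by rewrite !mulr_ge0 //; lra.
suff H kap : 0 < kap < 1 -> reg F (derive1 psi) <= kap * C.
  rewrite leNgt; apply/negP => r0.
  pose kap := Num.min 2^-1 (reg F (derive1 psi) / 2 / (C + 1)).
  have C1 : 0 < C + 1 by rewrite ltr_wpDl.
  have k0 : 0 < kap by rewrite lt_min invr_gt0 ltr0n !divr_gt0.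
  have k1 : kap < 1 by rewrite gt_min; apply/orP; left; lra.
  have := H kap; rewrite k0 k1 => /(_ isT).
  have : kap * (C + 1) <= reg F (derive1 psi) / 2.
    by rewrite -ler_pdivlMr // ge_min lexx orbT.
  by rewrite mulrDr mulr1; lra.
move=> /andP[k0 k1].
pose ps y := psi ((y - kap) / 1).
have psE : ps = dil kap 1 psi by [].
have sps : smooth ps by rewrite psE; apply: smooth_dil.
have supps : supp_in (- (A + 1)) (A + 1) ps.
  move=> y Hy; apply: sA; rewrite divr1; by case: Hy => Hy; [left|right]; lra.
have cp := smooth_continuous sp.
have E1 : IT (fun y => F y * ps y) = IT (fun y => F (y + kap) * psi y).
  pose G y := F (y + kap) * psi y.
  have cG : continuous G.
    by apply: contM => //; apply: cont_comp => //; apply: contD; [exact: smooth_continuous smooth_id|exact: cont_cst].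
  have sG : supp_in (- (A + 1)) (A + 1) G by apply: supp_inM.
  have := @IT_affine _ _ _ G 1 kap (oner_neq0 _) A1 cG sG.
  rewrite normr1 mul1r => <-; congr IT; apply/funext => y.
  by rewrite /G /ps divr1 subrK.
have le0 : IT (fun y => F y * psi y) - IT (fun y => F y * ps y) <= 0.
  rewrite E1 subr_le0; apply: (@IT_le _ _ _ _ _ A1).
  - exact: contM.
  - by apply: contM => //; apply: cont_comp => //; apply: contD; [exact: smooth_continuous smooth_id|exact: cont_cst].
  - exact: supp_inM.
  - exact: supp_inM.
  - by move=> y; rewrite ler_wpM2r // mF // lerDl ltW.
have cps := smooth_continuous sps.
have cd := smooth_continuous (smooth_derive1 sp).
have sd1 := supp_in_derive1 sA1.
have E2 : IT (fun y => F y * psi y) - IT (fun y => F y * ps y) =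
    kap * reg F (derive1 psi) - IT (fun y => F y * (ps y - psi y + kap * derive1 psi y)).
  have -> : (fun y => F y * (ps y - psi y + kap * derive1 psi y)) =
    (fun y => (F y * ps y - F y * psi y) + kap * (F y * derive1 psi y)) by apply/funext => y; ring.
  have c1 : continuous (fun y => F y * ps y) by exact: contM.
  have c2 : continuous (fun y => F y * psi y) by exact: contM.
  have c3 : continuous (fun y => F y * derive1 psi y) by exact: contM.
  have s1 : supp_in (- (A + 1)) (A + 1) (fun y => F y * ps y) by exact: supp_inM.
  have s2 : supp_in (- (A + 1)) (A + 1) (fun y => F y * psi y) by exact: supp_inM.
  have s3 : supp_in (- (A + 1)) (A + 1) (fun y => F y * derive1 psi y) by exact: supp_inM.
  rewrite (_ : (fun y => (F y * ps y - F y * psi y) + kap * (F y * derive1 psi y)) =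
    (fun y => kap * (F y * derive1 psi y) + (F y * ps y - F y * psi y))); last by apply/funext => y; rewrite addrC.
  rewrite (@IT_lin _ _ _ kap _ _ A1 c3 (contB c1 c2) s3); last by move=> y Hy; rewrite s1 // s2 // subrr.
  rewrite (@IT_sub _ _ _ _ _ A1) //; rewrite /reg; ring.
have B : `|IT (fun y => F y * (ps y - psi y + kap * derive1 psi y))| <= M * (X * kap ^+ 2) * (A + 1 - - (A + 1)).
  apply: IT_bound => //.
  - by apply: contM => //; apply: contD; [apply: contB|apply: contZ].
  - by apply: supp_inM => y Hy; rewrite supps // sA1 // sd1 // subrr mulr0 addr0.
  move=> y; have [yb|yb] := boolP (- (A + 1) <= y <= A + 1).
    rewrite normrM ler_pM ?HM //.
    have := @taylor2_le _ psi (derive1 psi) (derive1 (derive1 psi)) y (- kap) X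
     (fun z => smooth_is_derive z sp) (fun z => smooth_is_derive z (smooth_derive1 sp)) (fun z _ => HX z).
    by rewrite sqrrN mulNr opprK /ps divr1.
  have Hy : y < - (A + 1) \/ A + 1 < y.
    by move: yb; rewrite negb_and -!ltNge => /orP[|]; [left|right].
  by rewrite supps // sA1 // sd1 // subrr mulr0 addr0 mulr0 normr0; do !apply: mulr_ge0 => //; exact: ltW.
move: le0; rewrite E2 subr_le0 => le0.
have := le_trans le0 (le_trans (ler_norm _) B).
rewrite (_ : M * (X * kap ^+ 2) * _ = kap * (kap * C)); last by rewrite /C; ring.
by rewrite ler_pM2l.
Qed.

End RegularDistributions.

(** * Positivity of the derivative *)

Section Positivity.
Context {R : realType}.
Implicit Types (phi psi beta : R -> R) (a b c d p q x y e : R).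
Variable W : (R -> R) -> R.
Hypothesis sW : schwartz_distribution W.

(* The distribution W' is nonnegative on the open interval (a, b). *)
Definition pos a b := forall psi c d, smooth psi -> (forall x, 0 <= psi x) ->
  a < c -> d < b -> supp_in c d psi -> W (derive1 psi) <= 0.

Lemma pos_sub a b c d : a <= c -> d <= b -> pos a b -> pos c d.
Proof.
move=> ac db H psi c' d' sp p0 cc dd; apply: H => //; [exact: le_lt_trans ac cc|exact: lt_le_trans dd db].
Qed.

Lemma test_derive1 psi c d : smooth psi -> supp_in c d psi -> test_function (derive1 psi).
Proof.
move=> sp su; apply: (@test_of_supp _ c d); [exact: smooth_derive1|exact: supp_in_derive1].
Qed.

Lemma derive1D phi psi : smooth phi -> smooth psi ->
  derive1 (fun x => phi x + psi x) = fun x => derive1 phi x + derive1 psi x.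
Proof.
move=> sp sq; apply: derive1_fun => x; apply: is_derive_add; exact: smooth_is_derive.
Qed.

Lemma W_derive1D phi psi c1 d1 c2 d2 : smooth phi -> smooth psi -> supp_in c1 d1 phi -> supp_in c2 d2 psi ->
  W (derive1 (fun x => phi x + psi x)) = W (derive1 phi) + W (derive1 psi).
Proof.
move=> sp sq s1 s2; rewrite (derive1D sp sq); apply: (schwartzD sW); [exact: (test_derive1 sp s1)|exact: (test_derive1 sq s2)].
Qed.

Lemma step_between m n : m < n -> exists s : R -> R, [/\ smooth s, forall x, 0 <= s x <= 1,
  forall x, x <= m -> s x = 0 & forall x, n <= x -> s x = 1].
Proof.
move=> mn; have [s [ss s' s0 s1]] := @step_ex R.
have nm : 0 < n - m by rewrite subr_gt0.
exists (dil m (n - m) s); split.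
- exact: smooth_dil.
- move=> x; rewrite /dil; set z := _ / _.
  have mono u v : u <= v -> s u <= s v.
    by move=> uv; apply: (ndecr_of_derive (fun x => smooth_is_derive x ss)) uv => w _; apply: s'.
  have z1 : s (Num.min z 0) = 0 by apply: (proj1 (s0 _ _)); rewrite ge_min lexx orbT.
  have z2 : s (Num.max z 1) = 1 by apply: (proj1 (s1 _ _)); rewrite le_max lexx orbT.
  by rewrite -{1}z1 -z2 !mono // ?ge_min ?le_max lexx.
- by move=> x xm; apply: (proj1 (s0 _ _)); rewrite ler_pdivrMr // mul0r subr_le0.
- by move=> x nx; apply: (proj1 (s1 _ _)); rewrite ler_pdivlMr // mul1r; lra.
Qed.

(** A partition of unity whose transition takes place in the middle third of the overlap. *)
Lemma pos_glue a1 b1 a2 b2 : a2 < b1 -> pos a1 b1 -> pos a2 b2 -> pos a1 b2.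
Proof.
move=> ab H1 H2 psi c d sp p0 ac db su.
pose m := (2 * a2 + b1) / 3; pose n := (a2 + 2 * b1) / 3.
have mn : m < n by rewrite /m /n; lra.
have [s [ss s01 s0 s1]] := step_between mn.
pose p1 x := (1 - s x) * psi x; pose p2 x := s x * psi x.
have sp1 : smooth p1 by apply: smoothM sp; apply: smoothB ss; exact: smooth_cst.
have sp2 : smooth p2 by exact: smoothM.
have su1 : supp_in c n p1.
  move=> x [xc|nx]; rewrite /p1; first by rewrite su ?mulr0 //; left.
  by rewrite s1 ?subrr ?mul0r // ltW.
have su2 : supp_in m d p2.
  move=> x [xc|nx]; rewrite /p2; last by rewrite su ?mulr0 //; right.
  by rewrite s0 ?mul0r // ltW.
rewrite (_ : psi = fun x => p1 x + p2 x); last by apply/funext => x; rewrite /p1 /p2; ring.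
rewrite (W_derive1D sp1 sp2 su1 su2) -[leRHS]addr0; apply: lerD.
  apply: (H1 _ c n) => //; last by rewrite /n; lra.
  by move=> x; rewrite /p1 mulr_ge0 // subr_ge0; case/andP: (s01 x).
apply: (H2 _ m d) => //; last by rewrite /m; lra.
by move=> x; rewrite /p2 mulr_ge0 //; case/andP: (s01 x).
Qed.

(** A continuous induction along the support by means of [pos_glue], in place of a finite
    subcover. *)
Lemma pos_local a b : (forall x, a < x < b -> exists2 e, 0 < e & pos (x - e) (x + e)) -> pos a b.
Proof.
move=> H psi c d sp p0 ac db su.
have [cd|dc] := leP c d; last first.
  have E : psi = fun=> 0.
    by apply/funext => x; apply: su; have [xc|xc] := ltP x c; [left|right; lra].
  rewrite (_ : derive1 psi = fun=> 0) ?(schwartz0 sW) // E.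
  by apply: derive1_fun => x; apply: is_derive_const.
pose S := [set y | c <= y <= d /\ exists2 e, 0 < e & pos (c - e) (y + e)].
have Sc : S c by split; [rewrite lexx|apply: H; rewrite ac; lra].
have ubS : ubound S d by move=> y [/andP[]].
have hS : has_sup S by split; [exists c|exists d].
pose s := sup S.
have cs : c <= s by apply: ub_le_sup => //; exists d.
have sd : s <= d by apply: ge_sup => //; exists c.
have [e e0 He] := H s ltac:(apply/andP; split; lra).
have [y [/andP[cy yd] [e' e'0 He']] sy] := sup_adherent e0 hS.
rewrite -/s in sy.
have G : pos (c - e') (s + e) by apply: pos_glue He' He; lra.
have [sd'|ds] := ltP s d; last first.
  by apply: (G psi c d) => //; lra.
pose z := Num.min d (s + e / 2).
have zS : S z.
  have zd : z <= d by rewrite /z ge_min lexx.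
  have zs : z <= s + e / 2 by rewrite /z ge_min lexx orbT.
  split; first by rewrite zd andbT /z le_min cd /=; lra.
  exists (Num.min e' (e / 2)); first by rewrite lt_min e'0 divr_gt0.
  have m1 : Num.min e' (e / 2) <= e' by rewrite ge_min lexx.
  have m2 : Num.min e' (e / 2) <= e / 2 by rewrite ge_min lexx orbT.
  by apply: pos_sub G; lra.
have : z <= s by apply: ub_le_sup => //; exists d.
by rewrite leNgt /z lt_min sd' /=; have := e0; move=> ? /negP; case; lra.
Qed.

(** Since [phi1] lies to the left of [phi2] and has the same mass, [phi1 - phi2] is the derivative
    of a nonnegative function of compact support. *)
Lemma transport a b phi1 phi2 c1 d1 c2 d2 : pos a b -> smooth phi1 -> smooth phi2 ->
  (forall x, 0 <= phi1 x) -> (forall x, 0 <= phi2 x) ->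
  supp_in c1 d1 phi1 -> supp_in c2 d2 phi2 -> a < c1 -> c1 < d1 -> d1 <= c2 -> c2 < d2 -> d2 < b ->
  IT phi1 = IT phi2 -> W phi1 <= W phi2.
Proof.
move=> H s1 s2 p1 p2 su1 su2 ac cd1 dc cd2 db E.
have t1 := test_of_supp s1 su1; have t2 := test_of_supp s2 su2.
pose k x := phi1 x - phi2 x.
have sk : smooth k by exact: smoothB.
have suk : supp_in c1 d2 k.
  by move=> x Hx; rewrite /k su1 ?su2 ?subrr //; case: Hx => Hx; [left|right|left|right]; lra.
have lt12 : c1 < d2 by lra.
have [F [dF F0 F1]] := IT_prim lt12 (smooth_continuous sk) suk.
have Ik : IT k = 0.
  rewrite /k (@IT_sub _ c1 d2) //; first by rewrite E subrr.
  - exact: smooth_continuous.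
  - exact: smooth_continuous.
  - by apply: (supp_inW _ _ su1); lra.
  - by apply: (supp_inW _ _ su2); lra.
have Fk : derive1 F = k by apply: derive1_fun.
have sF : smooth F by exact: (smooth_of dF sk).
have F0' x : 0 <= F x.
  have [xc|xc] := leP x c2.
    have [xc1|xc1] := leP x c1; first by rewrite F0.
    rewrite -(F0 c1) //; apply: (ndecr_of_derive dF) (ltW xc1) => z /andP[_ zx].
    by rewrite /k su2 ?subr0 //; left; lra.
  have [xd|xd] := leP d2 x; first by rewrite F1 // Ik.
  have dN (z : R) : is_derive z 1 (fun x => - F x) (- k z) by apply: is_derive_opp.
  have := @ndecr_of_derive _ _ _ x d2 dN _ (ltW xd).
  rewrite (F1 d2) // Ik oppr0 oppr_le0; apply => z /andP[zx _].
  by rewrite /k su1 ?sub0r ?opprK //; right; lra.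
have := H F c1 d2 sF F0' ac db _.
have -> : W (derive1 F) = W phi1 - W phi2 by rewrite Fk; apply: (schwartzB sW t1 t2).
rewrite subr_le0; apply => x [xc|xc]; [by apply: F0; exact: ltW|by rewrite F1 // ltW].
Qed.

(* sg = 1 / sg = -1: unit masses immediately to the right / left of c *)
Lemma side_bump sg c v (eta r : R) : `|sg| = 1 -> has_point_value W c v -> 0 < eta -> 0 < r ->
  exists k, [/\ smooth k, forall x, 0 <= k x, IT k = 1, `|W k - v| < eta &
    exists u w, [/\ u < w, supp_in u w k & forall x, u <= x <= w -> 0 < sg * (x - c) < r]].
Proof.
move=> s1 pv eta0 r0.
have [beta [sb b0 sub Ib]] := @bump_ex R 2^-1 1 ltac:(lra).
have tb := test_of_supp sb sub.
have [delta d0 Hd] := point_value_limit pv tb eta0.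
pose e := Num.min (delta / 2) (r / 2).
have e0 : 0 < e by rewrite lt_min !divr_gt0.
have e1 : e <= delta / 2 by rewrite ge_min lexx.
have e2 : e <= r / 2 by rewrite ge_min lexx orbT.
pose f := sg * e.
have fe : `|f| = e by rewrite /f normrM s1 mul1r gtr0_norm.
have f0 : f != 0 by rewrite -normr_eq0 fe gt_eqF.
have sub1 : supp_in (- (1)) 1 beta by apply: (supp_inW _ _ sub); lra.
have sd : smooth (dil c f beta) by exact: smooth_dil.
have sgK : sg * sg = 1 by rewrite -expr2 -real_normK ?num_real // s1 expr1n.
have sg0 : sg != 0 by rewrite -normr_eq0 s1 oner_neq0.
have dz x : (x - c) / f = sg * (x - c) / e.
  by rewrite /f invfM (_ : sg^-1 = sg) ?mulrA ?(mulrC (x - c)) // -[LHS]mul1r -sgK mulfK.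
exists (fun x => e^-1 * dil c f beta x); split.
- exact: smoothZ.
- by move=> x; apply: mulr_ge0; [rewrite invr_ge0 ltW|apply: b0].
- have sud := supp_dil f0 sub1; rewrite fe in sud.
  rewrite (@ITZ _ (c - 1 * e) (c + 1 * e)) //; last 2 first.
  + by lra.
  + exact: smooth_continuous.
  by rewrite (IT_dil _ f0 ltr01 (smooth_continuous sb) sub1) fe Ib mulr1 mulVf // gt_eqF.
- rewrite (schwartzZ _ sW); last exact: test_dil.
  by have := Hd f; rewrite fe e0 Ib mulr1 scaled_pairingE fe /=; apply; lra.
pose u := if 0 < sg then c + e / 2 else c - e; pose w := if 0 < sg then c + e else c - e / 2.
have [[sgE sP]|[sgE sP]] : (sg = 1 /\ (0 < sg) = true) \/ (sg = -1 /\ (0 < sg) = false).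
    move: s1; case: (ltrgt0P sg) => _ H; [left|right|exfalso]; [split => //; lra..|lra].
  exists u, w; rewrite /u /w sP sgE; split.
  - lra.
  - move=> x Hx; rewrite (_ : dil c f beta x = 0) ?mulr0 // /dil dz sgE mul1r; apply: sub.
    by case: Hx => Hx; [left; rewrite ltr_pdivrMr //|right; rewrite ltr_pdivlMr //]; lra.
  - by move=> x /andP[? ?]; apply/andP; split; lra.
exists u, w; rewrite /u /w sP sgE; split.
- lra.
- move=> x Hx; rewrite (_ : dil c f beta x = 0) ?mulr0 // /dil dz sgE mulN1r; apply: sub.
  by case: Hx => Hx; [right; rewrite ltr_pdivlMr //|left; rewrite ltr_pdivrMr //]; lra.
- by move=> x /andP[? ?]; apply/andP; split; lra.
Qed.

Lemma transport1 a b phi1 phi2 c1 d1 c2 d2 : pos a b -> smooth phi1 -> smooth phi2 ->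
  (forall x, 0 <= phi1 x) -> (forall x, 0 <= phi2 x) ->
  supp_in c1 d1 phi1 -> supp_in c2 d2 phi2 -> a < c1 -> c1 < d1 -> d1 <= c2 -> c2 < d2 -> d2 < b ->
  IT phi1 = 1 -> W phi1 * IT phi2 <= W phi2.
Proof.
move=> H s1 s2 p1 p2 su1 su2 ac cd1 dc cd2 db I1.
have t1 := test_of_supp s1 su1.
have I2 : 0 <= IT phi2 by exact: IT_ge0.
rewrite mulrC -(schwartzZ (IT phi2) sW t1).
apply: (transport H (smoothZ (c := IT phi2) s1) s2 _ p2 _ su2 ac cd1 dc cd2 db).
- by move=> x; apply: mulr_ge0 => //; apply: p1.
- exact: supp_inM.
- by rewrite (@ITZ _ c1 d1) ?I1 ?mulr1 //; exact: smooth_continuous.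
Qed.

Lemma transport2 a b phi1 phi2 c1 d1 c2 d2 : pos a b -> smooth phi1 -> smooth phi2 ->
  (forall x, 0 <= phi1 x) -> (forall x, 0 <= phi2 x) ->
  supp_in c1 d1 phi1 -> supp_in c2 d2 phi2 -> a < c1 -> c1 < d1 -> d1 <= c2 -> c2 < d2 -> d2 < b ->
  IT phi2 = 1 -> W phi1 <= W phi2 * IT phi1.
Proof.
move=> H s1 s2 p1 p2 su1 su2 ac cd1 dc cd2 db I1.
have t2 := test_of_supp s2 su2.
have I2 : 0 <= IT phi1 by exact: IT_ge0.
rewrite mulrC -(schwartzZ (IT phi1) sW t2).
apply: (transport H s1 (smoothZ (c := IT phi1) s2) p1 _ su1 _ ac cd1 dc cd2 db).
- by move=> x; apply: mulr_ge0 => //; apply: p2.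
- exact: supp_inM.
- by rewrite (@ITZ _ c2 d2) ?I1 ?mulr1 //; exact: smooth_continuous.
Qed.

(** [phi] is compared by transport with bumps of unit mass just left of [c] and just right of [d],
    on which [W] is close to the point values there. *)
Lemma bracket a b phi c d (v w : R) : pos a b -> smooth phi -> (forall x, 0 <= phi x) ->
  supp_in c d phi -> a < c -> c < d -> d < b -> has_point_value W c v -> has_point_value W d w ->
  v * IT phi <= W phi <= w * IT phi.
Proof.
move=> H sp p0 su ac cd db pv pw.
have I0 : 0 <= IT phi by exact: IT_ge0.
have I1 : 0 < IT phi + 1 by rewrite ltr_wpDl.
have small (x eta : R) : 0 < eta -> x < eta / (IT phi + 1) -> IT phi * x <= eta.
  move=> eta0 /ltW xe; apply: le_trans (ler_wpM2l I0 xe) _.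
  by rewrite mulrCA ler_piMr ?(ltW eta0) // ler_pdivrMr // mul1r; lra.
apply/andP; split; apply/ler_addgt0Pr => eta eta0; have eta1 := divr_gt0 eta0 I1.
  have [k [sk k0 Ik Wk [u [x [ux suk Hux]]]]] := side_bump (sg := -1) (normrN1 _) pv eta1 (r := c - a) ltac:(lra).
  have /andP[u1 u2] := Hux u ltac:(rewrite lexx ltW //).
  have /andP[x1 x2] := Hux x ltac:(rewrite lexx ltW //).
  have le1 := transport1 H sk sp k0 p0 suk su ltac:(lra) ux ltac:(lra) cd db Ik.
  move: Wk => /ltr_normlP[Wk _]; have := small (v - W k) eta eta0 ltac:(lra).
  by rewrite mulrBr; lra.
have [k [sk k0 Ik Wk [u [x [ux suk Hux]]]]] := side_bump (sg := 1) (normr1 _) pw eta1 (r := b - d) ltac:(lra).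
have /andP[u1 u2] := Hux u ltac:(rewrite lexx ltW //).
have /andP[x1 x2] := Hux x ltac:(rewrite lexx ltW //).
have le1 := transport2 H sp sk p0 k0 su suk ac cd ltac:(lra) ux ltac:(lra) Ik.
move: Wk => /ltr_normlP[_ Wk]; have := small (W k - w) eta eta0 ltac:(lra).
by rewrite mulrBr; lra.
Qed.

End Positivity.

(** * The mass of a cut kernel *)

Section KernelMass.
Context {R : realType}.
Implicit Types (phi psi : R -> R) (x y c d t : R).

Lemma IT_by_parts c d (f g f' g' : R -> R) : c < d -> (forall x : R, is_derive x 1 f (f' x)) ->
  (forall x : R, is_derive x 1 g (g' x)) -> continuous f' -> continuous g' -> supp_in c d f ->
  supp_in c d f' -> IT (fun x => f x * g' x) = - IT (fun x => f' x * g x).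
Proof.
move=> cd df dg cf' cg' sf sf'.
have cf : continuous f by move=> x; apply: is_derive_continuous (df x).
have cg : continuous g by move=> x; apply: is_derive_continuous (dg x).
have H x : is_derive x 1 (fun x => f x * g x) (f' x * g x + f x * g' x).
  by have := is_derive_mul (df x) (dg x).
have s1 : supp_in c d (fun x => f' x * g x) by exact: supp_inMl.
have s2 : supp_in c d (fun x => f x * g' x) by exact: supp_inMl.
have c1 : continuous (fun x => f' x * g x) by exact: contM.
have c2 : continuous (fun x => f x * g' x) by exact: contM.
have := IT_derive cd (contD c1 c2) H (supp_inMl _ sf).
have := @IT_lin _ c d 1 _ _ cd c1 c2 s1 s2.
rewrite mul1r (_ : (fun x => 1 * _ + _) = (fun x => f' x * g x + f x * g' x)); last first.
  by apply/funext => x; rewrite mul1r.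
by move=> -> /eqP; rewrite addrC addr_eq0 => /eqP.
Qed.

Variables (chi : R -> R) (A : R).
Hypotheses (A1 : 1 <= A) (schi : smooth chi)
  (chi01 : forall x, `|x| <= A -> chi x = 1) (suchi : supp_in (- (A + 1)) (A + 1) chi).

Lemma cutoff_derive0 x : `|x| < A -> derive1 chi x = 0.
Proof.
move=> xA; have A0 : 0 < A - `|x| by rewrite subr_gt0.
rewrite -[derive1 chi]/(derive1n 1 chi) (@derive1n_local _ 1 chi (fun=> 1) x _ A0) ?derive1n_cst //.
move=> y yx; apply: chi01; have := ler_normD (y - x) x; rewrite subrK => H.
by apply: le_trans H _; lra.
Qed.

(** By parts, the mass is minus the integral of the derivative of [chi] against a primitive of the
    kernel. That derivative vanishes for [|y| < A]; elsewhere on its support the primitive is close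
    to a smooth step, and the step gives exactly 1. *)
Lemma kernel_mass phi : smooth phi -> (forall x, 0 <= phi x) ->
  (\int[@lebesgue_measure R]_(x in setT) (phi x)%:E = 1)%E -> forall eta : R, 0 < eta ->
  exists2 tau : R, 0 < tau & forall t x, 0 < t < tau -> `|x| <= A - 1 ->
    `|IT (fun y => chi y * (t^-1 * dil x t phi y)) - 1| <= eta.
Proof.
move=> sp p0 I1 eta eta0.
have cp := smooth_continuous sp.
have [F [dF F01 HF]] := kernel_primitive cp p0 I1.
have AA : - (A + 1) < A + 1 by have := A1; lra.
have sc' := smooth_derive1 schi; have cc' := smooth_continuous sc'.
have sx' := supp_in_derive1 suchi.
have [X HX] := cont_supp_bounded AA cc' sx'; have X0 : 0 <= X by apply: le_trans (HX 0).
pose D := X * (A + 1 - - (A + 1)).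
have D0 : 0 <= D by apply: mulr_ge0 => //; lra.
have D1 : 0 < D + 1 by rewrite ltr_wpDl.
have [B B0 HB] := HF _ (divr_gt0 eta0 D1).
have [s [ss s' s0 s1]] := @step_ex R.
exists B^-1; first by rewrite invr_gt0.
move=> t x /andP[t0 tB] xA.
pose G y := F (t^-1 * y + - x / t).
have dG (y : R) : is_derive y 1 G (t^-1 * dil x t phi y).
  rewrite dilE; exact: (is_derive_comp_affine (dF _)).
have sd : smooth (dil x t phi) by exact: smooth_dil.
have cd : continuous (fun y => t^-1 * dil x t phi y) by apply/contZ/smooth_continuous.
rewrite (@IT_by_parts _ _ _ _ _ _ AA (fun y => smooth_is_derive y schi) dG cc' cd suchi sx').
have Is : IT (derive1 s) = 1.
  have us : supp_in 0 1 (derive1 s).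
    by move=> y [yc|yc]; [exact: (s0 y (ltW yc)).2|exact: (s1 y (ltW yc)).2].
  rewrite (@IT_eq _ 0 1 (derive1 s) s ltr01 _ us (fun y => smooth_is_derive y ss)).
    by rewrite (s1 1 _).1 // (s0 0 _).1 // subr0.
  exact/smooth_continuous/smooth_derive1.
have Es : 1 = - IT (fun y => derive1 chi y * s y).
  rewrite -(@IT_by_parts _ _ _ _ _ _ AA (fun y => smooth_is_derive y schi)
    (fun y => smooth_is_derive y ss) cc' _ suchi sx'); last exact/smooth_continuous/smooth_derive1.
  rewrite -[LHS]Is; congr IT; apply/funext => y.
  have [yA|yA] := leP `|y| A; first by rewrite chi01 // mul1r.
  suff -> : derive1 s y = 0 by rewrite mulr0.
  move: yA; have [y0|y0] := leP 0 y; rewrite ?(ger0_norm y0) ?(ltr0_norm y0) => yA.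
    by apply: (s1 _ _).2; have := A1; lra.
  exact: (s0 _ (ltW y0)).2.
have cG : continuous G by move=> y; apply: is_derive_continuous (dG y).
have cs := smooth_continuous ss.
rewrite [X in _ - X]Es -opprD normrN.
rewrite (_ : IT _ + - IT _ = IT (fun y => derive1 chi y * (G y - s y))); last first.
  rewrite -(@IT_sub _ _ _ _ _ AA) //; [|exact: contM|exact: contM|exact: supp_inMl|exact: supp_inMl].
  by congr IT; apply/funext => y; rewrite mulrBr.
apply: (@le_trans _ _ (X * (eta / (D + 1)) * (A + 1 - - (A + 1)))); last first.
  rewrite (_ : X * _ * _ = eta * D / (D + 1)); last by rewrite /D; ring.
  by rewrite ler_pdivrMr // ler_pM2l //; lra.
apply: (IT_bound AA); [by apply: contM => //; exact: contB|exact: supp_inMl|].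
move=> y; rewrite normrM; have [yA|yA] := ltP `|y| A.
  by rewrite cutoff_derive0 // normr0 mul0r; apply: mulr_ge0 => //; apply: divr_ge0; exact: ltW.
apply: ler_pM => //.
have Gy : G y = F ((y - x) / t) by congr F; ring.
rewrite Gy; move: xA => /ler_normlP[x1 x2].
have tB' : B * t <= 1 by rewrite -ler_pdivlMl // mulr1 ltW.
move: yA; have [y0|y0] := leP 0 y; rewrite ?(ger0_norm y0) ?(ltr0_norm y0) => yA.
  have B1 : B <= (y - x) / t by rewrite ler_pdivlMr //; lra.
  have [H1 _] := HB _ B1; have /andP[_ H2] := F01 ((y - x) / t).
  by rewrite (s1 y _).1; [rewrite ler_norml; apply/andP; split; lra|have := A1; lra].
have B1 : B <= - ((y - x) / t) by rewrite -mulNr ler_pdivlMr //; lra.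
have [_ H1] := HB _ B1; have /andP[H2 _] := F01 ((y - x) / t).
rewrite opprK in H1.
by rewrite (s0 y (ltW y0)).1 subr0 ger0_norm.
Qed.

End KernelMass.

(** * Positivity across a single point *)

Section PositivityAtPoint.
Context {R : realType}.
Variable W : (R -> R) -> R.
Hypothesis sW : schwartz_distribution W.
Implicit Types (psi : R -> R) (a b p : R).

(* A nonzero distribution supported at p has no primitive with a point value at p. *)
Lemma pos_point a p b gamma : pos W a p -> pos W p b -> has_point_value W p gamma -> pos W a b.
Proof.
move=> H1 H2 pv psi c d sp p0 ac db su.
have [sa [ssa sa01 sa0 sa1]] := @step_between _ (-2) (-1) ltac:(lra).
have [sb [ssb sb01 sb0 sb1]] := @step_between _ 1 2 ltac:(lra).
pose beta (z : R) := sa z - sb z.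
have sbeta : smooth beta by exact: smoothB.
have ubeta : supp_in (-2) 2 beta.
  by move=> z [z2|z2]; rewrite /beta; [rewrite sa0 ?sb0|rewrite sa1 ?sb1]; rewrite ?subrr //; lra.
have [N [C [e0 [e00 e01 C0 HC]]]] := point_value_equicontinuous sW pv.
have lt2 : -2 < 2 :> R by lra.
have [Y HY] := bnd_ex N.+1 lt2 sbeta ubeta; have Y0 := bnd_ge0 HY.
have tpsi := test_of_supp sp su.
have [B B0 sB] := test_supp tpsi.
have [X HX] := bnd_ex N.+1 (ltac:(lra) : - B < B) sp sB; have X0 := bnd_ge0 HX.
have tb' : test_function (derive1 beta) by exact: test_derive1 ubeta.
have Ib' : IT (derive1 beta) = 0.
  apply: (IT_derive lt2 _ (fun z => smooth_is_derive z sbeta)) => //.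
  exact/smooth_continuous/smooth_derive1.
pose D := C * (2 ^+ N.+1 * (2 * X * Y)).
have D0 : 0 <= D by do !apply: mulr_ge0 => //; apply: exprn_ge0.
apply/ler_addgt0Pr => eta eta0; rewrite add0r.
have P1 : 0 < `|psi p| + 1 by rewrite ltr_wpDl.
have eta2 : 0 < eta / 2 by rewrite divr_gt0.
have [delta d0 Hd] := point_value_limit pv tb' (divr_gt0 eta2 P1).
have D1 : 0 < D + 1 by rewrite ltr_wpDl.
pose e := Num.min (Num.min (delta / 2) (e0 / 2)) (eta / 2 / (D + 1)).
have ep : 0 < e by rewrite !lt_min !divr_gt0.
have e1 : e <= delta / 2 by rewrite !ge_min lexx.
have e2 : e <= e0 / 2 by rewrite !ge_min lexx orbT.
have e3 : e <= eta / 2 / (D + 1) by rewrite !ge_min lexx orbT.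
have ene : e != 0 by rewrite gt_eqF.
pose q (z : R) := psi (e * z + p) - psi p.
have sq : smooth q.
  by apply: smoothB; [exact: smooth_comp_affine|exact: smooth_cst].
pose k (z : R) := q z * beta z.
have sk : smooth k by exact: smoothM.
have uk : supp_in (-2) 2 k by exact: supp_inM.
have qb i z : (i <= N.+1)%N -> `|z| <= 2 -> `|derive1n i q z| <= e * (2 * X).
  move=> iN z2; case: i iN => [|i] iN.
    have D' (w : R) : is_derive w 1 psi (derive1 psi w) by exact: smooth_is_derive.
    have := @mean_le _ psi (derive1 psi) p (e * z + p) X D' (fun w _ => HX 1%N isT w).
    rewrite addrK normrM (gtr0_norm ep) => H; apply: le_trans H _.
    by rewrite mulrC -mulrA ler_pM2l // ler_wpM2r.
  rewrite (@derive1nB _ i.+1 (fun z : R => psi (e * z + p)) (fun=> psi p) (@smooth_comp_affine _ e p psi sp) (@smooth_cst _ (psi p))).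
  rewrite derive1n_cst subr0 derive1n_comp_affine // normrM normrX (gtr0_norm ep).
  rewrite exprS -mulrA ler_pM2l //; apply: le_trans (_ : 1 * X <= _); last by lra.
  apply: ler_pM => //; [by rewrite exprn_ge0 // ltW|by rewrite exprn_ile1 ?ltW //; lra|].
  exact: HX.
have kb : bnd N (e * (2 ^+ N.+1 * (2 * X * Y))) (derive1 k).
  move=> j jN z; rewrite -derive1n_S.
  have [z2|z2] := leP `|z| 2; last first.
    have -> : derive1n j.+1 k z = 0.
      apply: (@supp_in_derive1n _ (-2) 2 k j.+1 uk).
      move: z2; have [z0|z0] := leP 0 z; rewrite ?(ger0_norm z0) ?(ltr0_norm z0); [right|left]; lra.
    rewrite normr0; apply: mulr_ge0; first exact: ltW.
    by apply: mulr_ge0; [exact: exprn_ge0|apply: mulr_ge0 => //; exact: mulr_ge0].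
  have j1 : (j.+1 <= N.+1)%N by [].
  apply: le_trans (@derive1nM_le _ j.+1 q beta z (e * (2 * X)) Y sq sbeta _ _) _.
  - by move=> i ij; apply: qb => //; exact: leq_trans ij j1.
  - by move=> i ij; apply: HY; exact: leq_trans ij j1.
  rewrite [leRHS](_ : _ = 2 ^+ N.+1 * (e * (2 * X) * Y)); last by ring.
  apply: ler_wpM2r; first by apply: mulr_ge0 => //; apply: mulr_ge0; [exact: ltW|exact: mulr_ge0].
  by rewrite ler_weXn2l //; lra.
(* The part of [psi] near [p], seen at scale [e], is [m = psi p * beta + k]. The derivative of
   [beta] has integral 0, so the point value makes its contribution tend to 0; the derivative of [k]
   is [O(e)], so equicontinuity does the same for the other. *)
pose m (z : R) := psi (e * z + p) * beta z.
have sm : smooth m by apply: smoothM sbeta; exact: smooth_comp_affine.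
have um : supp_in (-2) 2 m by exact: supp_inM.
have m' : derive1 m = fun z => psi p * derive1 beta z + derive1 k z.
  rewrite (_ : m = fun z => psi p * beta z + k z); last first.
    by apply/funext => z; rewrite /m /k /q; ring.
  apply: derive1_fun => z; apply: is_derive_add (smooth_is_derive z sk).
  have := is_derive_mul (is_derive_const (psi p) z) (smooth_is_derive z sbeta).
  by rewrite mul0r add0r.
have tk' : test_function (derive1 k) by exact: test_derive1 uk.
have spm : scaled_pairing W p e (derive1 m) =
    psi p * scaled_pairing W p e (derive1 beta) + scaled_pairing W p e (derive1 k).
  have tbz : test_function (fun z => psi p * derive1 beta z).
    apply: (@test_of_supp _ (-2) 2); first by apply: smoothZ; exact: smooth_derive1.
    by apply: supp_inM; exact: supp_in_derive1.
  by rewrite m' (@scaled_pairingD _ W p e _ _ sW ene tbz tk') (@scaled_pairingZ _ W p e (psi p) _ sW ene tb').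
have b1 : `|scaled_pairing W p e (derive1 m)| <= eta.
  rewrite spm; apply: le_trans (ler_normD _ _) _; rewrite normrM.
  have h1 := Hd e; rewrite gtr0_norm // ep /= Ib' mulr0 subr0 in h1.
  have h2 := HC e _ _ _ (smooth_derive1 sk) (supp_in_derive1 uk) kb.
  rewrite gtr0_norm // ep /= in h2.
  have {}h1 := h1 ltac:(lra); have {}h2 := h2 ltac:(lra).
  have h3 : `|psi p| * `|scaled_pairing W p e (derive1 beta)| <= eta / 2.
    apply: le_trans (ler_wpM2l (normr_ge0 _) (ltW h1)) _.
    by rewrite mulrCA ler_piMr ?(ltW eta2) // ler_pdivrMr // mul1r; lra.
  have h4 : C * (e * (2 ^+ N.+1 * (2 * X * Y))) <= eta / 2.
    rewrite (_ : C * _ = e * D); last by rewrite /D; ring.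
    apply: le_trans (ler_wpM2r D0 e3) _.
    rewrite (_ : _ * D = eta / 2 * (D / (D + 1))); last by ring.
    by rewrite ler_piMr ?(ltW eta2) // ler_pdivrMr // mul1r; lra.
  lra.
pose A1 y := psi y * (1 - dil p e sa y); pose A2 y := psi y * dil p e sb y.
pose A3 := dil p e m.
have A3E y : A3 y = psi y * (dil p e sa y - dil p e sb y).
  by rewrite /A3 /m /dil; congr (psi _ * _); rewrite mulrC divfK // subrK.
have ssa' : smooth (dil p e sa) by exact: smooth_dil.
have ssb' : smooth (dil p e sb) by exact: smooth_dil.
have sA1 : smooth A1 by apply: smoothM sp _; apply: smoothB ssa'; exact: smooth_cst.
have sA2 : smooth A2 by exact: smoothM.
have sA3 : smooth A3 by exact: smooth_dil.
have uA1 : supp_in c (p - e) A1.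
  move=> y [yc|yc]; rewrite /A1; first by rewrite su ?mul0r //; left.
  by rewrite /dil sa1 ?subrr ?mulr0 // ler_pdivlMr //; lra.
have uA2 : supp_in (p + e) d A2.
  move=> y [yc|yc]; rewrite /A2; last by rewrite su ?mul0r //; right.
  by rewrite /dil sb0 ?mulr0 // ler_pdivrMr //; lra.
have uA3 := supp_dil ene um.
have uA12 : supp_in (Num.min c (p + e)) (Num.max d (p - e)) (fun y => A1 y + A2 y).
  move=> y Hy; rewrite uA1 ?uA2 ?addr0 //; case: Hy; rewrite ?lt_min ?gt_max => /andP[? ?];
    by [left|right].
rewrite (_ : psi = fun y => (A1 y + A2 y) + A3 y); last first.
  by apply/funext => y; rewrite A3E /A1 /A2; ring.
rewrite (W_derive1D sW (smoothD sA1 sA2) sA3 uA12 (uA3 p)) (W_derive1D sW sA1 sA2 uA1 uA2).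
have w1 : W (derive1 A1) <= 0.
  apply: (H1 A1 c (p - e) sA1 _ ac _ uA1); last by lra.
  by move=> y; rewrite /A1 mulr_ge0 // subr_ge0; case/andP: (sa01 ((y - p) / e)).
have w2 : W (derive1 A2) <= 0.
  apply: (H2 A2 (p + e) d sA2 _ _ db uA2); last by lra.
  by move=> y; rewrite /A2 mulr_ge0 //; case/andP: (sb01 ((y - p) / e)).
have w3 : W (derive1 A3) = scaled_pairing W p e (derive1 m).
  rewrite -[derive1 A3]/(derive1n 1 A3) derive1n_dil // scaled_pairingE gtr0_norm // expr1.
  by rewrite (schwartzZ _ sW) //; apply: test_dil => //; exact: test_derive1 um.
rewrite w3; have := ler_norm (scaled_pairing W p e (derive1 m)); lra.
Qed.

End PositivityAtPoint.

Section PointValueLinear.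
Context {R : realType}.
Implicit Types (g : (R -> R) -> R) (x r v w : R).

Lemma point_value_comb g1 g2 r x v w : has_point_value g1 x v -> has_point_value g2 x w ->
  has_point_value (fun psi => r * g1 psi + g2 psi) x (r * v + w).
Proof.
move=> h1 h2 phi tp; have c1 := h1 phi tp; have c2 := h2 phi tp.
have -> : (fun eps => scaled_pairing (fun psi => r * g1 psi + g2 psi) x eps phi) =
    (fun eps => r * scaled_pairing g1 x eps phi + scaled_pairing g2 x eps phi).
  by apply/funext => e; rewrite /scaled_pairing; ring.
rewrite mulrDl -mulrA; apply: cvgD c2.
by apply: cvgM c1; apply: cvg_cst.
Qed.

End PointValueLinear.

(** * One-sided continuity on an interval of positivity *)

Section Hole.
Context {R : realType}.
Implicit Types (k phi psi : R -> R) (x e s r : R).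
Variables (W : (R -> R) -> R) (chi0 h : R -> R) (A p q : R).
Hypotheses (sW : schwartz_distribution W) (A1 : 1 <= A) (schi : smooth chi0)
  (chi01 : forall x, `|x| <= A -> chi0 x = 1) (suchi : supp_in (- (A + 1)) (A + 1) chi0).
Hypotheses (hv : forall x, has_point_value W x (h x)) (pq : p < q) (posW : pos W p q).
Hypotheses (Ap : - (A - 1) <= p) (Aq : q <= A - 1).

Definition inner_side s r x0 := [/\ `|s| = 1, 0 < r & forall e, 0 < s * e -> s * e < r -> p < x0 + e < q].

Lemma sign_cases s : `|s| = 1 -> s = 1 \/ s = -1.
Proof. by case: (ltrgt0P s) => _ H; [left|right|exfalso]; lra. Qed.

(** By monotonicity [h (x0 + e)] lies between the values of [W] on a fixed unit bump further from
    [x0] and on another one closer to it; both values are within [eta] of [h x0] because [W] has a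
    point value there. *)
Lemma side_continuous s r x0 (eta : R) : inner_side s r x0 -> 0 < eta ->
  exists2 delta : R, 0 < delta & forall e, 0 < s * e -> s * e < delta -> `|h (x0 + e) - h x0| < eta.
Proof.
move=> [s1 r0 Hs] eta0.
have [k1 [sk1 k10 Ik1 W1 [u [w [uw su1 Huw]]]]] := side_bump sW s1 (@hv x0) eta0 r0.
have /andP[u1 u2] := Huw u ltac:(rewrite lexx ltW //).
have /andP[w1 w2] := Huw w ltac:(rewrite lexx ltW //).
have /andP[pu uq] := Hs _ u1 u2; have /andP[pw wq] := Hs _ w1 w2.
rewrite !subrKC in pu uq pw wq.
exists (Num.min (s * (u - x0)) (s * (w - x0))); first by rewrite lt_min u1.
move=> e e0; rewrite lt_min => /andP[eu ew].
have /andP[px xq] := Hs e e0 ltac:(lra).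
have [k2 [sk2 k20 Ik2 W2 [u' [w' [uw' su2 Huw']]]]] := side_bump sW s1 (@hv x0) eta0 e0.
have /andP[u1' u2'] := Huw' u' ltac:(rewrite lexx ltW //).
have /andP[w1' w2'] := Huw' w' ltac:(rewrite lexx ltW //).
have /andP[pu' uq'] := Hs (u' - x0) u1' ltac:(lra).
have /andP[pw' wq'] := Hs (w' - x0) w1' ltac:(lra).
rewrite !subrKC in pu' uq' pw' wq'.
have b1 c d : p < c -> c < d -> d < q -> supp_in c d k1 -> h c <= W k1 <= h d.
  by move=> *; have := bracket sW posW sk1 k10 _ _ _ _ (@hv c) (@hv d); rewrite Ik1 !mulr1; apply.
have b2 c d : p < c -> c < d -> d < q -> supp_in c d k2 -> h c <= W k2 <= h d.
  by move=> *; have := bracket sW posW sk2 k20 _ _ _ _ (@hv c) (@hv d); rewrite Ik2 !mulr1; apply.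
move: W1 W2 => /ltr_normlP[W1 W1'] /ltr_normlP[W2 W2'].
have [sE|sE] := sign_cases s1; rewrite sE ?mul1r ?mulN1r in e0 eu ew u1' u2' w1' w2'.
  have /andP[B1 _] := b1 (x0 + e) w px ltac:(lra) wq ltac:(apply: (supp_inW _ _ su1); lra).
  have /andP[_ B2] := b2 u' (x0 + e) pu' ltac:(lra) xq ltac:(apply: (supp_inW _ _ su2); lra).
  by rewrite ltr_norml; apply/andP; split; lra.
have /andP[_ B1] := b1 u (x0 + e) pu ltac:(lra) xq ltac:(apply: (supp_inW _ _ su1); lra).
have /andP[B2 _] := b2 (x0 + e) w' px ltac:(lra) wq' ltac:(apply: (supp_inW _ _ su2); lra).
by rewrite ltr_norml; apply/andP; split; lra.
Qed.

Lemma h_mono_in x y : p < x -> x < y -> y < q -> h x <= h y.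
Proof.
move=> px xy yq; have [b [sb b0 ub Ib]] := @bump_ex R x y xy.
have /andP[] := bracket sW posW sb b0 ub px xy yq (@hv x) (@hv y).
by rewrite Ib !mulr1; apply: le_trans.
Qed.

Lemma inner_right x0 : p <= x0 -> x0 < q -> inner_side 1 (q - x0) x0.
Proof.
move=> px xq; split; [exact: normr1|lra|].
by move=> e; rewrite mul1r => e0 e1; apply/andP; split; lra.
Qed.

Lemma inner_left x0 : p < x0 -> x0 <= q -> inner_side (-1) (x0 - p) x0.
Proof.
move=> px xq; split; [by rewrite normrN1|lra|].
by move=> e; rewrite mulN1r => e0 e1; apply/andP; split; lra.
Qed.

Lemma h_mono x y : p <= x -> x <= y -> y <= q -> h x <= h y.
Proof.
move=> px; rewrite le_eqVlt => /orP[/eqP->//|xy] yq.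
have half x' y' : p <= x' -> x' < y' -> y' < q -> h x' <= h y'.
  rewrite le_eqVlt => /orP[/eqP E|px'] xy' yq'; last exact: h_mono_in.
  rewrite -{}E in xy' *.
  rewrite leNgt; apply/negP => hlt.
  have [d d0 Hd] := side_continuous (inner_right (lexx p) pq) (ltac:(by rewrite subr_gt0) : 0 < h p - h y').
  pose e := Num.min (d / 2) ((y' - p) / 2).
  have e0 : 0 < e by rewrite lt_min !divr_gt0 // subr_gt0.
  have e1 : e <= d / 2 by rewrite ge_min lexx.
  have e2 : e <= (y' - p) / 2 by rewrite ge_min lexx orbT.
  have := Hd e; rewrite mul1r e0 => /(_ isT ltac:(lra)) /ltr_normlP[H1 _].
  have := @h_mono_in (p + e) y' ltac:(lra) ltac:(lra) yq'; lra.
move: yq; rewrite le_eqVlt => /orP[/eqP yq|yq]; last exact: half.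
rewrite leNgt; apply/negP => hlt; rewrite yq in xy hlt *.
have [d d0 Hd] := side_continuous (inner_left pq (lexx q)) (ltac:(by rewrite subr_gt0) : 0 < h x - h q).
pose e := Num.min (d / 2) ((q - x) / 2).
have e0 : 0 < e by rewrite lt_min !divr_gt0 // subr_gt0.
have e1 : e <= d / 2 by rewrite ge_min lexx.
have e2 : e <= (q - x) / 2 by rewrite ge_min lexx orbT.
have := Hd (- e); rewrite mulN1r opprK e0 => /(_ isT ltac:(lra)) /ltr_normlP[_ H1].
have := @half x (q - e) px ltac:(lra) ltac:(lra); lra.
Qed.

Lemma heat_dil t x : 0 < t -> heat W chi0 0 t^-1 x = W (fun y => chi0 y * (t^-1 * dil x t gauss y)).
Proof.
move=> t0; rewrite /heat /cutp; congr W; apply/funext => y; rewrite /kern expr1 /dil.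
congr (_ * (_ * _)); rewrite /= -gaussN; congr gauss; ring.
Qed.

(** Subtracting the constant [h x0] from [W] makes the point value 0, as [corner] requires; the
    constant comes back multiplied by the mass of the cut kernel, which tends to 1. *)
Lemma hole_corner s r x0 (eta : R) : inner_side s r x0 -> p <= x0 <= q -> 0 < eta ->
  exists2 delta : R, 0 < delta & forall t x, 0 < t -> t < delta -> p <= x <= q ->
    0 <= s * (x - x0) -> s * (x - x0) < delta -> `|heat W chi0 0 t^-1 x - h x0| < eta.
Proof.
move=> Hin px0 eta0; have [s1 r0 Hs] := Hin.
pose v := h x0.
pose W0 (psi : R -> R) : R := - v * reg (fun=> 1) psi + W psi.
have sreg : schwartz_distribution (@reg R (fun=> 1)) by apply: reg_schwartz; exact: cont_cst.
have sW0 : schwartz_distribution W0 by exact: schwartz_comb.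
have pW0 : has_point_value W0 x0 0.
  have := @point_value_comb _ _ _ (- v) x0 _ _ (@reg_point_value _ (fun=> 1) x0 (@cont_cst R 1)) (@hv x0).
  by rewrite mulr1 addNr.
have A0 : 0 <= A by have := A1; lra.
have absA x : p <= x <= q -> `|x| <= A - 1.
  by move: Ap Aq => Ap' Aq' /andP[? ?]; rewrite ler_norml; apply/andP; split; lra.
have sg2 : s * s = 1 by have [->|->] := sign_cases s1; rewrite ?mul1r // mulrNN mul1r.
(* The estimate by mass: by [bracket] the value of [W] on a nonnegative bump lies between its mass
   times [h] at the two ends of its support, and these values of [h] tend to [h x0] from one
   side. *)
have Hside (et : R) : 0 < et -> exists2 delta : R, 0 < delta &
    forall e, 0 < `|e| < delta -> 0 < s * e -> forall psi, smooth psi -> (forall z, 0 <= psi z) ->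
    supp_in 2^-1 (3 / 2) psi -> `|scaled_pairing W0 x0 e psi| <= et * IT psi.
  move=> et0; have [d d0 Hd] := side_continuous Hin et0.
  exists (Num.min (d / 2) (r / 2)); first by rewrite lt_min !divr_gt0.
  move=> e; rewrite lt_min => /andP[e0 /andP[ed er]] se psi sp p0 su.
  have ene : e != 0 by rewrite -normr_gt0.
  have ne : `|e| = s * e by rewrite -(gtr0_norm se) normrM s1 mul1r.
  rewrite ne in e0 ed er.
  have su' : supp_in (- 2) 2 psi by apply: (supp_inW _ _ su); lra.
  have sd : smooth (dil x0 e psi) by exact: smooth_dil.
  have cp := smooth_continuous sp.
  have tp := test_of_supp sp su.
  have Id : IT (dil x0 e psi) = `|e| * IT psi by apply: (IT_dil _ ene _ cp su').
  have I0 : 0 <= IT psi by exact: IT_ge0.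
  have -> : scaled_pairing W0 x0 e psi = scaled_pairing W x0 e psi - v * IT psi.
    rewrite !scaled_pairingE /W0 /reg (_ : (fun x => 1 * _ x) = dil x0 e psi); last first.
      by apply/funext => x; rewrite mul1r.
    rewrite Id mulrDr addrC; congr (_ + _).
    by rewrite mulNr mulrN mulrCA mulKf // normr_eq0.
  pose c := if 0 < s then x0 + e / 2 else x0 + 3 * e / 2.
  pose d' := if 0 < s then x0 + 3 * e / 2 else x0 + e / 2.
  have [cd udil pc dq] : [/\ c < d', supp_in c d' (dil x0 e psi), p < c & d' < q].
    have Hsc (z : R) : 0 < z -> z <= 3 / 2 -> p < x0 + z * e < q.
      move=> z0 z1; have E : s * (z * e) = z * (s * e) by rewrite mulrCA.
      have l1 : 0 < s * (z * e) by rewrite E pmulr_rgt0.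
      have l2 : z * (s * e) <= 3 / 2 * (s * e) by rewrite ler_wpM2r // ltW.
      by apply: (Hs _ l1); rewrite E; lra.
    have := Hsc 2^-1 ltac:(lra) ltac:(lra); have := Hsc (3 / 2) ltac:(lra) ltac:(lra).
    rewrite /c /d'; have [sE|sE] := sign_cases s1; rewrite sE in se *.
      rewrite ltr01 => /andP[h1 h2] /andP[h3 h4]; split; try lra.
      move=> y Hy; rewrite /dil; apply: su.
      have e0' : 0 < e by lra.
      by case: Hy => Hy; [left; rewrite ltr_pdivrMr //|right; rewrite ltr_pdivlMr //]; lra.
    rewrite ltr0N1 => /andP[h1 h2] /andP[h3 h4]; split; try lra.
    move=> y Hy; rewrite /dil; apply: su.
    have e0' : e < 0 by lra.
    by case: Hy => Hy; [right; rewrite ltr_ndivlMr //|left; rewrite ltr_ndivrMr //]; lra.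
  have /andP[b1 b2] := bracket sW posW sd (fun y => p0 _) udil pc cd dq (@hv c) (@hv d').
  have spE : W (dil x0 e psi) = `|e| * scaled_pairing W x0 e psi.
    by rewrite scaled_pairingE mulVKf // normr_eq0.
  have ep : 0 < `|e| by rewrite normr_gt0.
  rewrite spE Id ![_ * (`|e| * _)]mulrCA !ler_pM2l // in b1 b2.
  have hc : `|h c - v| < et /\ `|h d' - v| < et.
    have e3 : s * (3 * e / 2) < d by rewrite (_ : _ * _ = 3 / 2 * (s * e)); [lra|ring].
    have e3' : 0 < s * (3 * e / 2) by rewrite (_ : _ * _ = 3 / 2 * (s * e)); [lra|ring].
    have e2 : s * (e / 2) < d by rewrite (_ : _ * _ = 2^-1 * (s * e)); [lra|ring].
    have e2' : 0 < s * (e / 2) by rewrite (_ : _ * _ = 2^-1 * (s * e)); [lra|ring].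
    by rewrite /c /d'; case: ifP => _; split; apply: Hd.
  case: hc => /ltr_normlP[hc1 hc2] /ltr_normlP[hd1 hd2].
  have m1 : (v - et) * IT psi <= h c * IT psi by rewrite ler_wpM2r //; lra.
  have m2 : h d' * IT psi <= (v + et) * IT psi by rewrite ler_wpM2r //; lra.
  by rewrite ler_norml; apply/andP; split; lra.
have eta2 : 0 < eta / 2 by rewrite divr_gt0.
have [d1 d10 Hd1] := corner sW0 A0 schi chi01 suchi pW0 (absA _ px0) Hside s1 eta2.
have V1 : 0 < `|v| + 1 by rewrite ltr_wpDl.
have [[gsm g0 gI _] _] := @gauss_T1 R.
have [tau tau0 Htau] := kernel_mass A1 schi chi01 suchi gsm g0 gI (divr_gt0 eta2 V1).
exists (Num.min d1 tau); first by rewrite lt_min d10.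
move=> t x t0; rewrite lt_min => /andP[td tt] pxq sx; rewrite lt_min => /andP[sxd _].
pose xi := s * (x - x0) / t.
have xi0 : 0 <= xi by apply: divr_ge0 => //; exact: ltW.
have xit : xi * t = s * (x - x0) by rewrite /xi divfK // gt_eqF.
have := Hd1 t xi; rewrite t0 td xit => /(_ isT xi0 sxd).
have ts : `|s * t| = t by rewrite normrM s1 mul1r gtr0_norm.
have dE y : dil x0 (s * t) (shiftg 0 xi) y = dil x t gauss y.
  rewrite /dil /shiftg /= /xi.
  have sne : s^-1 = s by rewrite -[LHS]mul1r -sg2 mulfK // -normr_eq0 s1 oner_neq0.
  rewrite invfM sne (_ : s * (x - x0) / t - (y - x0) * (s * t^-1) = s * - ((y - x) / t)); last by ring.
  by have [->|->] := sign_cases s1; rewrite ?mul1r ?mulN1r ?opprK ?gaussN.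
have -> : cut_scaled W0 chi0 x0 (s * t) (shiftg 0 xi) = heat W chi0 0 t^-1 x -
    v * IT (fun y => chi0 y * (t^-1 * dil x t gauss y)).
  have sg : smooth (dil x t gauss) by exact: smooth_dil.
  have tg := test_cut schi suchi sg.
  rewrite heat_dil // /cut_scaled ts (_ : dil x0 _ _ = dil x t gauss); last exact/funext.
  rewrite /cutp /W0 /reg.
  have -> : (fun y => chi0 y * (t^-1 * dil x t gauss y)) = (fun y => t^-1 * (chi0 y * dil x t gauss y)).
    by apply/funext => y; rewrite mulrCA.
  rewrite (schwartzZ _ sW tg) (_ : (fun x1 => 1 * _) = (fun y => chi0 y * dil x t gauss y)); last first.
    by apply/funext => y; rewrite mul1r.
  rewrite (@ITZ _ (- (A + 1)) (A + 1)); last first.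
  - exact: supp_inMl.
  - apply: contM; exact: smooth_continuous.
  - by have := A0; lra.
  ring.
set m := IT _; set H := heat _ _ _ _ _ => b1.
have b2 : `|m - 1| <= eta / 2 / (`|v| + 1) by apply: Htau; [rewrite t0|exact: absA].
have b3 : `|v * (m - 1)| <= eta / 2.
  rewrite normrM; apply: le_trans (ler_wpM2l (normr_ge0 _) b2) _.
  by rewrite mulrCA ler_piMr ?(ltW eta2) // ler_pdivrMr // mul1r; lra.
rewrite -/v (_ : H - v = (H - v * m) + v * (m - 1)); last by ring.
by apply: le_lt_trans (ler_normD _ _) _; lra.
Qed.

End Hole.

(** * The maximum principle on an interval of positivity *)

Section HoleHeat.
Context {R : realType}.
Implicit Types (k phi psi : R -> R) (x e s r : R).
Variables (W : (R -> R) -> R) (chi0 h : R -> R) (A p q : R).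
Hypotheses (sW : schwartz_distribution W) (A1 : 1 <= A) (schi : smooth chi0)
  (chi01 : forall x, `|x| <= A -> chi0 x = 1) (suchi : supp_in (- (A + 1)) (A + 1) chi0).
Hypotheses (hv : forall x, has_point_value W x (h x)) (pq : p < q) (posW : pos W p q).
Hypotheses (Ap : - (A - 1) <= p) (Aq : q <= A - 1).
Notation ext := (heat_ext (heat W chi0 0) h).

Lemma heat_ext_side s r x0 (eta : R) : inner_side p q s r x0 -> p <= x0 <= q -> 0 < eta ->
  exists2 delta : R, 0 < delta & forall x t, 0 <= t -> t < delta -> p <= x <= q ->
    0 <= s * (x - x0) -> s * (x - x0) < delta -> `|ext x t - h x0| < eta.
Proof.
move=> Hin px0 eta0.
have [d1 d10 H1] := side_continuous sW (@hv) posW Hin eta0.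
have [d2 d20 H2] := hole_corner sW A1 schi chi01 suchi (@hv) posW Ap Aq Hin px0 eta0.
exists (Num.min d1 d2); first by rewrite lt_min d10.
move=> x t; rewrite le_eqVlt => t0; rewrite lt_min => /andP[_ td] pxq s0; rewrite lt_min => /andP[sd1 sd2].
rewrite /heat_ext; move: t0 => /orP[/eqP <-|t0]; last by rewrite t0; apply: H2.
rewrite ltxx; move: s0; rewrite le_eqVlt => /orP[|s0].
  have [s1 _ _] := Hin; have sne : s != 0 by rewrite -normr_eq0 s1 oner_neq0.
  by rewrite eq_sym mulf_eq0 (negbTE sne) /= subr_eq0 => /eqP ->; rewrite subrr normr0.
by have := H1 _ s0 sd1; rewrite subrKC.
Qed.

Lemma heat_ext_cont0 x0 (eta : R) : p <= x0 <= q -> 0 < eta ->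
  exists2 delta : R, 0 < delta & forall x t, p <= x <= q -> 0 <= t -> `|x - x0| < delta -> t < delta ->
    `|ext x t - h x0| < eta.
Proof.
move=> /andP[px xq] eta0; have pxq : p <= x0 <= q by rewrite px.
have R0 : x0 < q -> exists2 delta : R, 0 < delta & forall x t, 0 <= t -> t < delta -> p <= x <= q ->
    x0 <= x -> x - x0 < delta -> `|ext x t - h x0| < eta.
  move=> xq'; have [d d0 Hd] := heat_ext_side (inner_right px xq') pxq eta0.
  by exists d => // x t t0 td pxq' xx xd; apply: Hd; rewrite ?mul1r ?subr_ge0.
have L0 : p < x0 -> exists2 delta : R, 0 < delta & forall x t, 0 <= t -> t < delta -> p <= x <= q ->
    x <= x0 -> x0 - x < delta -> `|ext x t - h x0| < eta.
  move=> px'; have [d d0 Hd] := heat_ext_side (inner_left px' xq) pxq eta0.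
  by exists d => // x t t0 td pxq' xx xd; apply: Hd; rewrite ?mulN1r ?opprB ?subr_ge0.
have [xq'|xq'] := ltP x0 q; last first.
  have {}xq' : x0 = q by apply/eqP; rewrite eq_le xq.
  have [d d0 Hd] := L0 ltac:(rewrite xq'; exact: pq); exists d => // x t pxq' t0 /ltr_normlP[h1 h2] td.
  by apply: Hd => //; [rewrite xq'; case/andP: pxq'|lra].
have [px'|px'] := ltP p x0; last first.
  have {}px' : x0 = p by apply/eqP; rewrite eq_le px px'.
  have [d d0 Hd] := R0 xq'; exists d => // x t pxq' t0 /ltr_normlP[h1 h2] td.
  by apply: Hd => //; rewrite px'; case/andP: pxq'.
have [d1 d10 H1] := R0 xq'; have [d2 d20 H2] := L0 px'.
exists (Num.min d1 d2); first by rewrite lt_min d10.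
move=> x t pxq' t0; rewrite !lt_min => /andP[/ltr_normlP[h1 h2] /ltr_normlP[h3 h4]] /andP[t1 t2].
have [xx|xx] := leP x0 x; first exact: H1.
by apply: H2 => //; [exact: ltW|lra].
Qed.

Lemma inv_close (t1 eta : R) : 0 < t1 -> 0 < eta -> exists2 delta : R, 0 < delta &
  forall t, `|t - t1| < delta -> 0 < t /\ `|t^-1 - t1^-1| < eta.
Proof.
move=> t10 eta0; exists (Num.min (t1 / 2) (eta * (t1 ^+ 2 / 2))).
  by rewrite lt_min divr_gt0 // mulr_gt0 // divr_gt0 // exprn_gt0.
move=> t; rewrite lt_min => /andP[/ltr_normlP[h1 h2] h3].
have t0 : 0 < t by lra.
split=> //.
have tt : 0 < t * t1 by exact: mulr_gt0.
have -> : t^-1 - t1^-1 = - ((t - t1) / (t * t1)) by field; apply/andP; split; rewrite gt_eqF.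
rewrite normrN normrM (gtr0_norm (_ : 0 < (t * t1)^-1)) ?invr_gt0 // ltr_pdivrMr //.
apply: lt_le_trans h3 _; rewrite ler_pM2l // expr2 mulrAC ler_pM2r //; lra.
Qed.

Lemma heat_ext_cont x0 t1 : p <= x0 <= q -> 0 <= t1 -> forall eta : R, 0 < eta ->
  exists2 delta : R, 0 < delta & forall x t, p <= x <= q -> 0 <= t ->
    `|x - x0| < delta -> `|t - t1| < delta -> `|ext x t - ext x0 t1| < eta.
Proof.
move=> px t10 eta eta0; move: t10; rewrite le_eqVlt => /orP[/eqP <-|t10].
  have [d d0 Hd] := heat_ext_cont0 px eta0; exists d => // x t pxq t0 xd.
  rewrite subr0 => /ltr_normlP[_ td]; rewrite {2}/heat_ext ltxx; exact: Hd.
have A0 : 0 <= A by have := A1; lra.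
have ti0 : 0 < t1^-1 by rewrite invr_gt0.
have [d d0 Hd] := heat_continuous sW A0 schi suchi x0 ti0 eta0.
have [d' d'0 Hd'] := inv_close t10 d0.
exists (Num.min d d'); first by rewrite lt_min d0.
move=> x t _ _; rewrite !lt_min => /andP[xd _] /andP[_ /Hd'[t0 td]].
by rewrite /heat_ext t0 t10; apply: Hd.
Qed.

Lemma hole_heat (Th : R) : 0 < Th ->
  (forall theta, Th <= theta -> 0 <= heat W chi0 1 theta p /\ 0 <= heat W chi0 1 theta q) ->
  forall theta x, Th <= theta -> p <= x <= q -> 0 <= heat W chi0 1 theta x.
Proof.
move=> Th0 sides theta x Thth /andP[px xq].
have th0 : 0 < theta by lra.
have A0 : 0 <= A by have := A1; lra.
move: px; rewrite [p <= x]le_eqVlt => /orP[/eqP <-|px]; first by case: (sides _ Thth).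
move: xq; rewrite [x <= q]le_eqVlt => /orP[/eqP ->|xq]; first by case: (sides _ Thth).
have mono y : x < y -> y <= q -> heat W chi0 0 theta x <= heat W chi0 0 theta y.
  move=> xy yq; apply/ler_addgt0Pr => eta eta0.
  have D0 : 0 < (y - x) + theta^-1 by apply: addr_gt0; [lra|rewrite invr_gt0].
  have ThI : Th^-1^-1 <= theta by rewrite invrK.
  have := @two_point_min _ (heat W chi0 0) (heat W chi0 1) (heat W chi0 2) h p q Th^-1
    (ltac:(by rewrite invr_gt0)) (fun th th0 z => heat_derive_x sW A0 schi suchi 0 z th0)
    (fun th th0 z => heat_derive_x sW A0 schi suchi 1 z th0)
    (fun th th0 z => heat_derive_theta sW A0 schi suchi z th0) _ _ _
    (eta / ((y - x) + theta^-1)) theta x y (divr_gt0 eta0 D0) ThI (ltW px) (ltW xy) yq.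
  rewrite -addrA -mulrDr divfK ?gt_eqF // => H; rewrite -subr_ge0 addrAC; apply: H.
  - by move=> th; rewrite invrK; apply: sides.
  - move=> x0 t1 px0 /andP[t10 _] et et0; have [d d0 Hd] := heat_ext_cont px0 t10 et0.
    by exists d => // z t pz /andP[t0' _]; apply: Hd.
  - by move=> z w pz zw wq; apply: (h_mono sW (@hv) pq posW).
rewrite leNgt; apply/negP => h0.
have [d d0 Hd] := derive_lt0_right (heat_derive_x sW A0 schi suchi 0 x th0) h0.
pose e := Num.min (d / 2) (q - x).
have e0 : 0 < e by rewrite lt_min divr_gt0 //= subr_gt0.
have e1 : e <= d / 2 by rewrite ge_min lexx.
have e2 : e <= q - x by rewrite ge_min lexx orbT.
have := Hd (x + e); rewrite !ltrD2l ltrDl e0 => /(_ ltac:(rewrite /=; lra)).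
by apply/negP; rewrite -leNgt; apply: mono; lra.
Qed.

End HoleHeat.

(** * Mollification by the heat kernel *)

Section ApproximateIdentity.
Context {R : realType}.
Implicit Types (psi rho : R -> R) (x y theta : R).
Variables (c d : R).
Hypothesis cd : c < d.

Lemma gauss_sup_cont n (theta y : R) : continuous (fun x => kern n theta x y).
Proof.
by move=> x; apply: is_derive_continuous (is_derive_kern_x n theta x y).
Qed.

Lemma is_derive_kern_y n theta x y :
  is_derive y 1 (kern n theta x) (- kern n.+1 theta x y).
Proof.
have := smooth_is_derive y (@smooth_kern _ n theta x).
by rewrite -[derive1 _]/(derive1n 1 _) derive1n_kern addn1 expr1 mulN1r.
Qed.

Lemma kern_sup n theta : exists2 M : R, 0 <= M & forall x y, `|kern n theta x y| <= M.
Proof.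
have [C [C0 HC]] := @gauss_sup R n; exists (`|theta| ^+ n.+1 * C).
  by apply: mulr_ge0 => //; apply: exprn_ge0.
by move=> x y; rewrite /kern normrM normrX ler_wpM2l ?exprn_ge0.
Qed.

Section Primitive.
Variables (psi : R -> R) (theta : R).
Hypotheses (spsi : smooth psi) (supsi : supp_in c d psi).

(** Primitives in [x], with [y] as a parameter. All orders [n] are carried at once because
    derivation in [y] raises [n]; the family is thus smooth in [y] and the distribution can be
    applied to it. *)
Lemma kern_prim_ex : exists K : nat -> R -> R -> R, forall n y,
  [/\ forall x : R, is_derive x 1 (K n y) (kern n theta x y * psi x), forall x, x <= c -> K n y x = 0 &
    forall x, d <= x -> K n y x = IT (fun x => kern n theta x y * psi x)].
Proof.
have /choice[K HK] : forall z : nat * R, exists F : R -> R,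
  [/\ forall x : R, is_derive x 1 F (kern z.1 theta x z.2 * psi x), forall x, x <= c -> F x = 0 &
    forall x, d <= x -> F x = IT (fun x => kern z.1 theta x z.2 * psi x)].
  move=> [n y] /=; apply: IT_prim => //; last exact: supp_inM.
  by apply: contM; [exact: gauss_sup_cont|exact: smooth_continuous].
by exists (fun n y => K (n, y)) => n y; apply: (HK (n, y)).
Qed.

Variable K : nat -> R -> R -> R.
Hypothesis HK : forall n y,
  [/\ forall x : R, is_derive x 1 (K n y) (kern n theta x y * psi x), forall x, x <= c -> K n y x = 0 &
    forall x, d <= x -> K n y x = IT (fun x => kern n theta x y * psi x)].

Lemma kern_prim_derive n x y : is_derive y 1 (fun y => K n y x) (- K n.+1 y x).
Proof.
have [M M0 HM] := kern_sup n.+2 theta.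
have [Y HY] := cont_supp_bounded cd (smooth_continuous spsi) supsi.
have Y0 : 0 <= Y by apply: le_trans (HY 0).
apply: (@is_derive_rem2 _ _ _ _ (M * Y * `|x - c|) 1) => // e _.
have [H0 H0' _] := HK n (y + e); have [H1 H1' _] := HK n y; have [H2 H2' _] := HK n.+1 y.
pose r z := K n (y + e) z - K n y z - e * - K n.+1 y z.
have dr (z : R) : is_derive z 1 r ((kern n theta z (y + e) - kern n theta z y - e * - kern n.+1 theta z y) * psi z).
  have := is_derive_sub (is_derive_sub (H0 z) (H1 z))
    (is_derive_mul (is_derive_const e z) (is_derive_opp (H2 z))).
  by move=> H; apply: is_derive_eq H _; ring.
have rc : r c = 0 by rewrite /r (H0' c (lexx c)) (H1' c (lexx c)) (H2' c (lexx c)); ring.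
have := @mean_le _ r _ c x (M * e ^+ 2 * Y) dr.
rewrite rc subr0 => H; apply: le_trans (H _) _; last first.
  by rewrite le_eqVlt; apply/orP; left; apply/eqP; ring.
move=> z _; rewrite normrM; apply: ler_pM => //.
apply: (@taylor2_le _ (kern n theta z) (fun w => - kern n.+1 theta z w) (kern n.+2 theta z)).
- by move=> w; apply: is_derive_kern_y.
- by move=> w; rewrite -[kern _ _ _ _]opprK; apply: is_derive_opp; apply: is_derive_kern_y.
- by move=> w _; apply: HM.
Qed.

Lemma smooth_kern_prim n x : smooth (fun y => K n y x).
Proof.
apply: (@smooth_coind _ (fun f => exists n (s : R), f = fun y => s * K n y x)).
  move=> _ [m [s ->]].
  have H (y : R) : is_derive y 1 (fun y => s * K m y x) (- s * K m.+1 y x).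
    have := is_derive_mul (is_derive_const s y) (kern_prim_derive m x y).
    by rewrite mul0r add0r mulrN mulNr.
  split; first by move=> y; case: (H y).
  by exists m.+1, (- s); exact: derive1_fun.
by exists n, 1; apply/funext => y; rewrite mul1r.
Qed.

Lemma derive1n_kern_prim j n x : derive1n j (fun y => K n y x) = fun y => (-1) ^+ j * K (n + j) y x.
Proof.
elim: j => [|j IH]; first by apply/funext => y; rewrite expr0 mul1r addn0.
rewrite [LHS]/= -/(derive1n j _) IH; apply: derive1_fun => y.
have := is_derive_mul (is_derive_const ((-1) ^+ j) y) (kern_prim_derive (n + j) x y).
by rewrite mul0r add0r addnS exprSr mulrN1 mulNr mulrN.
Qed.

Variables (W : (R -> R) -> R) (chi0 : R -> R) (A : R).
Hypotheses (sW : schwartz_distribution W) (A0 : 0 <= A) (schi : smooth chi0)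
  (suchi : supp_in (- (A + 1)) (A + 1) chi0).

Lemma cutp_kern_prim_derive n x :
  is_derive x 1 (fun x => cutp W chi0 (fun y => K n y x)) (heat W chi0 n theta x * psi x).
Proof.
have -> : heat W chi0 n theta x * psi x = cutp W chi0 (fun y => psi x * kern n theta x y).
  by rewrite (cutpZ sW schi suchi (psi x) (@smooth_kern _ n theta x)) mulrC.
apply: (@cutp_is_derive _ W chi0 A sW A0 schi suchi (fun x y => K n y x) _ x 1 ltr01).
- by move=> z; apply: smooth_kern_prim.
- by apply: smoothZ; exact: smooth_kern.
move=> j; have [M M0 HM] := kern_sup (n + j) theta; have [M' M'0 HM'] := kern_sup (n + j).+1 theta.
have [Y HY] := bnd_ex 1 cd spsi supsi; have Y0 := bnd_ge0 HY.
exists (M' * Y + M * Y); split; first by rewrite addr_ge0 // mulr_ge0.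
move=> e _ y _; rewrite !derive1n_kern_prim (@derive1nZ _ j (psi x) _ (@smooth_kern _ n theta x)) derive1n_kern.
rewrite (_ : _ - _ - _ = (-1) ^+ j * (K (n + j) y (x + e) - K (n + j) y x - e * (kern (n + j) theta x y * psi x))); last by ring.
rewrite normrM normrX normrN normr1 expr1n mul1r.
have [H0 _ _] := HK (n + j) y.
apply: (@taylor2_le _ (K (n + j) y) (fun x => kern (n + j) theta x y * psi x)
  (fun x => kern (n + j).+1 theta x y * psi x + kern (n + j) theta x y * derive1 psi x)) => //.
  by move=> z; apply: is_derive_mul (is_derive_kern_x (n + j) theta z y) (smooth_is_derive z spsi).
move=> z _; apply: le_trans (ler_normD _ _) _.
rewrite (normrM (kern (n + j).+1 theta z y)) (normrM (kern (n + j) theta z y)); apply: lerD.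
  by apply: ler_pM (normr_ge0 _) (normr_ge0 _) (HM' _ _) (HY 0%N isT z).
by apply: ler_pM (normr_ge0 _) (normr_ge0 _) (HM _ _) (HY 1%N isT z).
Qed.

(** This replaces Fubini: the pairing of [W] with the primitive up to [x] vanishes at [c] and has
    derivative [heat 1 theta x * psi x] in [x], so it is nonnegative at [d], where the primitive is
    the whole integral. *)
Lemma exchange_prim : (forall x, c <= x <= d -> 0 <= heat W chi0 1 theta x) -> (forall x, 0 <= psi x) ->
  0 <= cutp W chi0 (fun y => IT (fun x => kern 1 theta x y * psi x)).
Proof.
move=> h0 p0.
have -> : (fun y => IT (fun x => kern 1 theta x y * psi x)) = (fun y => K 1 y d).
  by apply/funext => y; have [_ _ E] := HK 1%N y; rewrite (E d (lexx d)).
have -> : 0 = cutp W chi0 (fun y => K 1 y c).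
  rewrite (_ : (fun y => K 1 y c) = fun=> 0); last by apply/funext => y; have [_ E _] := HK 1%N y; rewrite (E c (lexx c)).
  by rewrite /cutp (_ : (fun y => _) = fun=> 0) ?(schwartz0 sW) //; apply/funext => y; rewrite mulr0.
apply: (ndecr_of_derive (cutp_kern_prim_derive 1)) (ltW cd) => z /andP[z1 z2].
by apply: mulr_ge0 => //; apply: h0; rewrite !ltW.
Qed.

End Primitive.

Definition conv theta psi y := IT (fun x => kern 0 theta x y * psi x).

Lemma kern_by_parts n theta psi y : smooth psi -> supp_in c d psi ->
  IT (fun x => kern n.+1 theta x y * psi x) = - IT (fun x => kern n theta x y * derive1 psi x).
Proof.
move=> sp su; have := @IT_by_parts _ c d psi (fun x => kern n theta x y) (derive1 psi)
  (fun x => kern n.+1 theta x y) cd (fun x => smooth_is_derive x sp)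
  (fun x => is_derive_kern_x n theta x y) (smooth_continuous (smooth_derive1 sp))
  (@gauss_sup_cont n.+1 theta y) su (supp_in_derive1 su).
rewrite (_ : (fun x => psi x * _) = fun x => kern n.+1 theta x y * psi x); last by apply/funext => x; rewrite mulrC.
by move=> ->; congr (- IT _); apply/funext => x; rewrite mulrC.
Qed.

Lemma conv_smooth theta psi : smooth psi -> supp_in c d psi -> smooth (conv theta psi).
Proof.
move=> sp su; have [K HK] := kern_prim_ex theta sp su.
rewrite (_ : conv theta psi = fun y => K 0%N y d); first exact: (smooth_kern_prim sp su HK).
by apply/funext => y; have [_ _ E] := HK 0%N y; rewrite (E d (lexx d)).
Qed.

Lemma derive1n_conv j theta psi : smooth psi -> supp_in c d psi ->
  derive1n j (conv theta psi) = conv theta (derive1n j psi).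
Proof.
elim: j psi => [//|j IH] psi sp su.
rewrite !derive1n_S -IH; [|exact: smooth_derive1|exact: supp_in_derive1].
congr derive1n; have [K HK] := kern_prim_ex theta sp su.
rewrite (_ : conv theta psi = fun y => K 0%N y d); last first.
  by apply/funext => y; have [_ _ E] := HK 0%N y; rewrite (E d (lexx d)).
apply: derive1_fun => y; have := kern_prim_derive sp su HK 0 d y.
have [_ _ E] := HK 1%N y; rewrite (E d (lexx d)) kern_by_parts // opprK; exact.
Qed.

(** The mass of the cut kernel tends to 1 and its second moment is [O(1 / theta)]. No splitting into
    near and far parts is made: the Lipschitz bound on the increments of [rho] is absorbed by a
    small constant plus a multiple of [|x - y| ^+ 2]. *)
Lemma conv_close rho (Y eta : R) : smooth rho -> supp_in c d rho -> 0 < eta -> exists2 Th : R, 0 < Th &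
  forall theta y, Th <= theta -> `|y| <= Y -> `|conv theta rho y - rho y| <= eta.
Proof.
move=> sp su eta0.
pose A := `|Y| + `|c| + `|d| + 2.
have A1 : 1 <= A by rewrite /A; have := normr_ge0 Y; have := normr_ge0 c; have := normr_ge0 d; lra.
have A0 : 0 <= A by lra.
have [chi [schi chi01 chi1 suchi _]] := cutoff_ex A0.
have [[gsm g0 gI _] _] := @gauss_T1 R.
have [X HX] := bnd_ex 1 cd sp su; have X0 := bnd_ge0 HX.
have cp := smooth_continuous sp; have cchi := smooth_continuous schi.
pose e1 := eta / 3 / (X + 1).
have X1 : 0 < X + 1 by rewrite ltr_wpDl.
have e10 : 0 < e1 by rewrite !divr_gt0.
have [tau tau0 Htau] := kernel_mass A1 schi chi1 suchi gsm g0 gI e10.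
have [C C0 HC] := @gauss_bounded R 0 2.
(* |rho x - rho y| <= X |x - y| <= e2 + k |x - y|^2 *)
pose e2 := eta / 3 / (1 + e1); pose k := X ^+ 2 / e2.
have e20 : 0 < e2 by rewrite !divr_gt0 // addr_gt0.
have k0 : 0 <= k by rewrite /k divr_ge0 ?sqr_ge0 // ltW.
pose L := k * C * (A + 1 - - (A + 1)).
have L0 : 0 <= L by do !apply: mulr_ge0 => //; lra.
have L1 : 0 < L + 1 by rewrite ltr_wpDl.
exists (Num.max (2 / tau) (Num.max 1 (3 * (L + 1) / eta))).
  by rewrite lt_max divr_gt0.
move=> theta y; rewrite !ge_max => /andP[th1 /andP[th2 th3]] yY.
have th0 : 0 < theta by lra.
have AA : - (A + 1) < A + 1 by lra.
have yA : `|y| <= A - 1.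
  by rewrite /A; have := ler_norm Y; have := normr_ge0 c; have := normr_ge0 d; lra.
have mE : (fun x => chi x * kern 0 theta x y) = (fun x => chi x * (theta^-1^-1 * dil y theta^-1 gauss x)).
  apply/funext => x; rewrite /kern /dil !invrK expr1; congr (_ * (_ * _)).
  by rewrite /= mulrC.
have m1 : `|IT (fun x => chi x * kern 0 theta x y) - 1| <= e1.
  rewrite mE; apply: Htau => //; rewrite invr_gt0 th0 /=.
  rewrite -[tau]invrK ltf_pV2 ?posrE ?invr_gt0 //.
  by apply: lt_le_trans th1; rewrite ltr_pMl ?invr_gt0 //; lra.
set m := IT (fun x => chi x * kern 0 theta x y) in m1.
have ck : continuous (fun x => kern 0 theta x y) by exact: gauss_sup_cont.
have cm : continuous (fun x => chi x * kern 0 theta x y) by exact: contM.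
have sm : supp_in (- (A + 1)) (A + 1) (fun x => chi x * kern 0 theta x y) by exact: supp_inMl.
have rE x : chi x * rho x = rho x.
  have [xcd|xcd] := boolP (c <= x <= d).
    rewrite chi1 ?mul1r // ler_norml; move: xcd => /andP[h1 h2].
    have := ler_norm d; have := normr_ge0 Y; have := normr_ge0 c; have := normr_ge0 d.
    have : - `|c| <= c by rewrite lerNl -normrN ler_norm.
    by move=> *; rewrite /A; apply/andP; split; lra.
  by rewrite su ?mulr0 //; move: xcd; rewrite negb_and -!ltNge => /orP[|]; [left|right].
have E : conv theta rho y - rho y =
   IT (fun x => chi x * kern 0 theta x y * (rho x - rho y)) + rho y * (m - 1).
  have -> : (fun x => chi x * kern 0 theta x y * (rho x - rho y)) =
      (fun x => kern 0 theta x y * (chi x * rho x) - rho y * (chi x * kern 0 theta x y)).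
    by apply/funext => x; ring.
  rewrite (@IT_sub _ (- (A + 1)) (A + 1)) //.
  - rewrite (@ITZ _ (- (A + 1)) (A + 1)) // -/m /conv.
    rewrite (_ : (fun x => kern 0 theta x y * (chi x * rho x)) = fun x => kern 0 theta x y * rho x); last first.
      by apply/funext => x; rewrite rE.
    ring.
  - by apply: contM => //; exact: contM.
  - exact: contZ.
  - by apply: supp_inM; exact: supp_inMl.
  - exact: supp_inM.
rewrite E; apply: le_trans (ler_normD _ _) _.
have b2 : `|rho y * (m - 1)| <= eta / 3.
  rewrite normrM; apply: (@le_trans _ _ (X * e1)); first by apply: ler_pM => //; exact: (HX 0%N).
  by rewrite /e1 mulrA ler_pdivrMr // [leRHS]mulrC ler_wpM2r //; [rewrite divr_ge0 // ltW|lra].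
have b1 : `|IT (fun x => chi x * kern 0 theta x y * (rho x - rho y))| <= e2 * m + L / theta.
  have kge x : 0 <= kern 0 theta x y by rewrite /kern expr1 /= mulr_ge0 ?(ltW th0) // ltW // gauss_gt0.
  apply: le_trans (_ : IT (fun x => e2 * (chi x * kern 0 theta x y) + (k * C / theta) * chi x) <= _).
    apply: (IT_norm AA).
    - by apply: contM => //; apply: contB => //; exact: cont_cst.
    - by apply: contD; exact: contZ.
    - by apply: supp_inMl.
    - by apply: supp_inD; exact: supp_inM.
    move=> x; rewrite normrM normrM (ger0_norm (kge x)) (ger0_norm (_ : 0 <= chi x)); last by case/andP: (chi01 x).
    rewrite (_ : e2 * _ + _ = chi x * (e2 * kern 0 theta x y + k * C / theta)); last by ring.
    rewrite -mulrA; apply: ler_wpM2l; first by case/andP: (chi01 x).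
    have D (z : R) : is_derive z 1 rho (derive1 rho z) by exact: smooth_is_derive.
    have l1 := @mean_le _ rho (derive1 rho) y x X D (fun w _ => HX 1%N isT w).
    have l2 : X * `|x - y| <= e2 + k * `|x - y| ^+ 2.
      have e2n : e2 != 0 by rewrite gt_eqF.
      have : 0 <= (X * `|x - y| / e2 - 1) ^+ 2 * e2 by rewrite mulr_ge0 ?sqr_ge0 // ltW.
      have -> : (X * `|x - y| / e2 - 1) ^+ 2 * e2 = k * `|x - y| ^+ 2 - 2 * (X * `|x - y|) + e2.
        by rewrite /k; field.
      have : 0 <= X * `|x - y| by exact: mulr_ge0.
      lra.
    apply: le_trans (ler_wpM2l (kge x) (le_trans l1 l2)) _.
    rewrite mulrDr mulrC lerD2l mulrCA -[leRHS]mulrA ler_wpM2l //.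
    rewrite ler_pdivlMr // /kern expr1 /=.
    have -> : theta * gauss (theta * (x - y)) * `|x - y| ^+ 2 * theta =
      (theta * `|x - y|) ^+ 2 * gauss (theta * (x - y)) by ring.
    have Hg := HC (theta * (x - y)).
    rewrite normrM (gtr0_norm th0) /= (ger0_norm (ltW (gauss_gt0 _))) in Hg.
    apply: le_trans Hg; apply: ler_wpM2r; first exact/ltW/gauss_gt0.
    by apply: lerXn2r; rewrite ?nnegrE ?addr_ge0 ?mulr_ge0 ?(ltW th0) //; lra.
  rewrite (@IT_lin _ (- (A + 1)) (A + 1)) //; [|exact: contZ|exact: supp_inM].
  rewrite -/m lerD2l (@ITZ _ (- (A + 1)) (A + 1)) // /L.
  rewrite [leRHS](_ : _ = k * C / theta * (A + 1 - - (A + 1))); last by ring.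
  apply: ler_wpM2l; first by apply: divr_ge0; [exact: mulr_ge0|exact: ltW].
  rewrite -[leRHS]mul1r; apply: le_trans (ler_norm _) _; apply: IT_bound => // x.
  by have /andP[h1 h2] := chi01 x; rewrite ger0_norm.
have b3 : e2 * m <= eta / 3.
  have mm : m <= 1 + e1 by move: m1 => /ler_normlP[_]; lra.
  apply: le_trans (ler_wpM2l (ltW e20) mm) _.
  by rewrite /e2 divfK // gt_eqF // addr_gt0.
have b4 : L / theta <= eta / 3.
  have : 3 * (L + 1) <= eta * theta by rewrite -ler_pdivrMl // mulrC.
  by rewrite ler_pdivrMr //; lra.
lra.
Qed.

End ApproximateIdentity.

Section Exchange.
Context {R : realType}.
Variables (W : (R -> R) -> R) (chi0 : R -> R) (A : R).
Hypotheses (sW : schwartz_distribution W) (A0 : 0 <= A) (schi : smooth chi0)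
  (chi01 : forall x, `|x| <= A -> chi0 x = 1) (suchi : supp_in (- (A + 1)) (A + 1) chi0).

(** [W] on the derivative of [psi] is the limit of [W] on its mollification, and the latter is minus
    the integral of [heat 1 * psi] by the exchange. *)
Lemma heat1_pos a b (Th : R) : - A <= a -> b <= A ->
  (forall theta x, Th <= theta -> a < x < b -> 0 <= heat W chi0 1 theta x) -> pos W a b.
Proof.
move=> Aa bA h0 psi c d sp p0 ac db su.
have [cb|bc] := ltP c b; last first.
  have E : psi = fun=> 0.
    by apply/funext => x; apply: su; have [xc|xc] := ltP x c; [left|right; lra].
  rewrite (_ : derive1 psi = fun=> 0) ?(schwartz0 sW) // E.
  by apply: derive1_fun => x; apply: is_derive_const.
wlog cd : d db su / c < d.
  move=> H; apply: (H (Num.max d ((c + b) / 2))).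
  - by rewrite gt_max db; lra.
  - by apply: (supp_inW _ _ su) => //; rewrite le_max lexx.
  - by rewrite lt_max; apply/orP; right; lra.
have sp' := smooth_derive1 sp; have su' := supp_in_derive1 su.
have -> : W (derive1 psi) = cutp W chi0 (derive1 psi).
  congr W; apply/funext => x; have [xcd|xcd] := boolP (c <= x <= d).
    rewrite chi01 ?mul1r // ler_norml; move: xcd => /andP[h1 h2]; apply/andP; split; lra.
  by rewrite su' ?mulr0 //; move: xcd; rewrite negb_and -!ltNge => /orP[|]; [left|right].
have [N [C [C0 HC]]] := cutp_bound sW A0 schi suchi.
apply/ler_addgt0Pr => eta eta0; rewrite add0r.
have C1 : 0 < C + 1 by rewrite ltr_wpDl.
have eC := divr_gt0 eta0 C1.
have /choice[T HT] : forall j, exists Th : R, 0 < Th /\ forall theta y, Th <= theta -> `|y| <= A + 1 ->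
    `|conv theta (derive1n j (derive1 psi)) y - derive1n j (derive1 psi) y| <= eta / (C + 1).
  move=> j; have [T T0 HT] := @conv_close _ c d cd _ (A + 1) _ (@smooth_derive1n _ j _ sp')
    (@supp_in_derive1n _ _ _ _ j su') eC.
  by exists T.
pose theta := `|Th| + \sum_(j < N.+1) T j + 1.
have sT : 0 <= \sum_(j < N.+1) T j by apply: sumr_ge0 => j _; apply/ltW; case: (HT j).
have thT : Th <= theta by rewrite /theta; have := ler_norm Th; lra.
have thj j : (j <= N)%N -> T j <= theta.
  move=> jN; rewrite /theta (bigD1 (Ordinal (jN : (j < N.+1)%N))) //=.
  have : 0 <= \sum_(i < N.+1 | i != Ordinal (jN : (j < N.+1)%N)) T i.
    by apply: sumr_ge0 => i _; apply/ltW; case: (HT i).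
  by have := normr_ge0 Th; lra.
have sc : smooth (conv theta (derive1 psi)) by exact: (conv_smooth cd sp' su').
have b1 : `|cutp W chi0 (conv theta (derive1 psi)) - cutp W chi0 (derive1 psi)| <= eta.
  rewrite -(cutpB sW schi suchi sc sp'); apply: le_trans (HC _ _ _ (ltW eC) _) _.
  - exact: smoothB.
  - move=> j jN y yA; rewrite (@derive1nB _ j _ _ sc sp') (@derive1n_conv _ c d cd j theta _ sp' su').
    by apply: (HT j).2 => //; exact: thj.
  by rewrite mulrCA ler_piMr ?(ltW eta0) // ler_pdivrMr // mul1r; lra.
have [K HK] := kern_prim_ex cd theta sp su.
have := exchange_prim cd sp su HK sW A0 schi suchi _ p0.
have -> : (fun y => IT (fun x => kern 1 theta x y * psi x)) = (fun y => -1 * conv theta (derive1 psi) y).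
  by apply/funext => y; rewrite (@kern_by_parts _ c d cd 0 theta psi y sp su) mulN1r.
rewrite (cutpZ sW schi suchi _ sc) mulN1r oppr_ge0 => H.
have {}H : cutp W chi0 (conv theta (derive1 psi)) <= 0.
  by apply: H => x /andP[x1 x2]; apply: h0 => //; apply/andP; split; lra.
by move: b1 => /ler_normlP[b1 _]; lra.
Qed.

End Exchange.

(** * The Baire category argument *)

Section Monotone.
Context {R : realType}.
Implicit Types (x y e r u v theta : R).
Variables (W : (R -> R) -> R) (chi0 h : R -> R) (A al be a b : R) (E : set R).
Hypotheses (sW : schwartz_distribution W) (A1 : 1 <= A) (schi : smooth chi0)
  (chi01 : forall x, `|x| <= A -> chi0 x = 1) (suchi : supp_in (- (A + 1)) (A + 1) chi0).
Hypotheses (hv : forall x, has_point_value W x (h x)).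
Hypotheses (Aal : - (A - 1) <= al) (Abe : be <= A - 1).
Hypotheses (posl : pos W al a) (posr : pos W b be).
Hypotheses (cE : countable E) (Hheat : forall x, a <= x <= b -> ~ E x ->
  exists2 Th : R, 0 < Th & forall theta, Th <= theta -> 0 <= heat W chi0 1 theta x).

(** The part in [(al, be)] of the complement of the largest open set on which [W'] is
    nonnegative. *)
Definition bad x := al < x < be /\ forall e, 0 < e -> ~ pos W (x - e) (x + e).

Lemma not_bad x : al < x < be -> ~ bad x -> exists2 e, 0 < e & pos W (x - e) (x + e).
Proof.
move=> xab nb; apply: contrapT => H; apply: nb; split=> // e e0 He; apply: H; by exists e.
Qed.

Lemma no_bad u v : al <= u -> v <= be -> (forall x, u < x < v -> ~ bad x) -> pos W u v.
Proof.
move=> au vb H; apply: pos_local => // x xuv; apply: not_bad; last exact: H.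
by move: xuv => /andP[? ?]; apply/andP; split; lra.
Qed.

Lemma bad_ab x : bad x -> a <= x <= b.
Proof.
move=> [/andP[ax xb] H]; rewrite leNgt [x <= b]leNgt; apply/andP; split; apply/negP => lt.
  apply: (H (Num.min (x - al) (a - x))); first by rewrite lt_min !subr_gt0 ax.
  have m1 : Num.min (x - al) (a - x) <= x - al by rewrite ge_min lexx.
  have m2 : Num.min (x - al) (a - x) <= a - x by rewrite ge_min lexx orbT.
  by apply: (pos_sub _ _ posl); lra.
apply: (H (Num.min (x - b) (be - x))); first by rewrite lt_min !subr_gt0 lt.
have m1 : Num.min (x - b) (be - x) <= x - b by rewrite ge_min lexx.
have m2 : Num.min (x - b) (be - x) <= be - x by rewrite ge_min lexx orbT.
by apply: (pos_sub _ _ posr); lra.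
Qed.

Lemma bad_not_isolated x e : bad x -> 0 < e -> exists y, [/\ bad y, y != x & `|y - x| < e].
Proof.
move=> [xab H] e0; apply: contrapT => N.
have nb y : y != x -> `|y - x| < e -> ~ bad y by move=> yx ye by'; apply: N; exists y.
move: (xab) => /andP[ax xb].
pose r := Num.min e (Num.min (x - al) (be - x)).
have r0 : 0 < r by rewrite !lt_min e0 !subr_gt0 ax.
have r1 : r <= e by rewrite ge_min lexx.
have r2 : r <= x - al by rewrite /r !ge_min lexx orbT.
have r3 : r <= be - x by rewrite /r !ge_min lexx !orbT.
apply: (H r r0); apply: (@pos_point _ W sW (x - r) x (x + r) (h x)) => //.
- apply: no_bad; [lra|lra|move=> y /andP[y1 y2]]; apply: nb; first by rewrite lt_eqF.
  by rewrite ltr_norml; apply/andP; split; lra.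
- apply: no_bad; [lra|lra|move=> y /andP[y1 y2]]; apply: nb; first by rewrite gt_eqF.
  by rewrite ltr_norml; apply/andP; split; lra.
Qed.

(** The bad set has no isolated point. Three points are wanted because positivity will be derived on
    the open interval between the outer two, which contradicts the badness of the middle one. *)
Lemma bad_three x u v : bad x -> u < x < v -> exists x1 x2 x3,
  [/\ u < x1, x1 < x2, x2 < x3, x3 < v & [/\ bad x1, bad x2 & bad x3]].
Proof.
move=> bx /andP[ux xv].
have e0 : 0 < Num.min (x - u) (v - x) by rewrite lt_min !subr_gt0 ux.
have m1 : Num.min (x - u) (v - x) <= x - u by rewrite ge_min lexx.
have m2 : Num.min (x - u) (v - x) <= v - x by rewrite ge_min lexx orbT.
have [y [bY yx ye]] := bad_not_isolated bx e0.
have e1 : 0 < `|y - x| by rewrite normr_gt0 subr_eq0.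
have [z [bZ zx ze]] := bad_not_isolated bx e1.
have zy : z != y by apply/eqP => zy; rewrite zy ltxx in ze.
move: ye ze => /ltr_normlP[y1 y2] ze.
have /ltr_normlP[z1 z2] : `|z - x| < Num.min (x - u) (v - x).
  by apply: lt_trans ze _; rewrite ltr_norml; apply/andP; split; lra.
have lt3 p q r : u < p -> r < v -> p < q -> q < r -> bad p -> bad q -> bad r -> exists x1 x2 x3,
  [/\ u < x1, x1 < x2, x2 < x3, x3 < v & [/\ bad x1, bad x2 & bad x3]].
  by move=> *; exists p, q, r.
have ux' : u < y by lra. have uz : u < z by lra. have yv : y < v by lra. have zv : z < v by lra.
move: yx zx zy; rewrite !neq_lt => /orP[?|?] /orP[?|?] /orP[?|?].
- exact: (lt3 z y x).
- exact: (lt3 y z x).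
- lra.
- exact: (lt3 y x z).
- exact: (lt3 z x y).
- lra.
- exact: (lt3 x z y).
- exact: (lt3 x y z).
Qed.

(** This is closedness of the bad set: if [W'] were nonnegative near the supremum, the bad points
    close to it would not be bad. Together with [bad_inf] it yields the complementary interval
    around a good point. *)
Lemma bad_sup x1 x : bad x1 -> x1 <= x -> x < be -> exists p, [/\ bad p, x1 <= p, p <= x &
  forall y, p < y -> y <= x -> ~ bad y].
Proof.
move=> b1 x1x xbe; pose S := [set y | [/\ bad y, x1 <= y & y <= x]].
have hS : has_sup S by split; [exists x1|exists x => y []].
have ubS y : S y -> y <= sup S by move=> Sy; apply: ub_le_sup => //; case: hS.
have S1 : S x1 by [].
have l1 := ubS _ S1; have l2 : sup S <= x by apply: ge_sup; [exists x1|move=> y []].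
exists (sup S); split=> //; last first.
  move=> y y1 y2 by'; have : y <= sup S by apply: ubS; split=> //; lra.
  by rewrite leNgt y1.
apply: contrapT => nb; have [[/andP[ax xb] _]] := b1.
have [|e e0 He] := not_bad (x := sup S) _ nb; first by apply/andP; split; lra.
have [y Sy ye] := sup_adherent e0 hS; have [[yab yb] y1 y2] := Sy.
have ys := ubS _ Sy.
apply: (yb (Num.min (y - (sup S - e)) e)); first by rewrite lt_min subr_gt0 ye.
have m1 : Num.min (y - (sup S - e)) e <= y - (sup S - e) by rewrite ge_min lexx.
have m2 : Num.min (y - (sup S - e)) e <= e by rewrite ge_min lexx orbT.
by apply: (pos_sub _ _ He); lra.
Qed.

Lemma bad_inf x3 x : bad x3 -> x <= x3 -> al < x -> exists q, [/\ bad q, x <= q, q <= x3 &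
  forall y, x <= y -> y < q -> ~ bad y].
Proof.
move=> b3 xx3 alx; pose S := [set y | [/\ bad y, x <= y & y <= x3]].
have hS : has_inf S by split; [exists x3|exists x => y []].
have lbS y : S y -> inf S <= y by move=> Sy; apply: ge_inf => //; case: hS.
have S3 : S x3 by [].
have l1 := lbS _ S3; have l2 : x <= inf S by apply: lb_le_inf; [exists x3|move=> y []].
exists (inf S); split=> //; last first.
  move=> y y1 y2 by'; have : inf S <= y by apply: lbS; split=> //; lra.
  by rewrite leNgt y2.
apply: contrapT => nb; have [/andP[ax xb] _] := b3.
have [|e e0 He] := not_bad (x := inf S) _ nb; first by apply/andP; split; lra.
have [y Sy ye] := inf_adherent e0 hS; have [[yab yb] y1 y2] := Sy.
have ys := lbS _ Sy.
apply: (yb (Num.min (inf S + e - y) e)); first by rewrite lt_min subr_gt0 ye.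
have m1 : Num.min (inf S + e - y) e <= inf S + e - y by rewrite ge_min lexx.
have m2 : Num.min (inf S + e - y) e <= e by rewrite ge_min lexx orbT.
by apply: (pos_sub _ _ He); lra.
Qed.

(* With a uniform threshold Th on the bad points of an interval, the maximum
   principle propagates heat 1 >= 0 across the complementary intervals. *)
Lemma bad_uniform u v (Th : R) x0 : bad x0 -> u < x0 < v -> 0 < Th ->
  (forall x theta, bad x -> u < x < v -> Th <= theta -> 0 <= heat W chi0 1 theta x) -> False.
Proof.
move=> b0 x0uv Th0 H; have [x1 [x2 [x3 [u1 l12 l23 u3 [b1 b2 b3]]]]] := bad_three b0 x0uv.
have A0 : 0 <= A by have := A1; lra.
have [/andP[a1 _] _] := b1; have [/andP[_ a3] _] := b3.
have P : pos W x1 x3.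
  apply: (@heat1_pos _ W chi0 A sW A0 schi chi01 suchi x1 x3 Th).
  - by move: Aal A1; lra.
  - by move: Abe A1; lra.
  move=> theta x thT /andP[l1 l3].
  have [bx|nbx] := pselect (bad x); first by apply: H => //; apply/andP; split; lra.
  have [p [bp p1 p2 Hp]] := bad_sup b1 (ltW l1) (lt_trans l3 a3).
  have [q [bq q1 q2 Hq]] := bad_inf b3 (ltW l3) (lt_trans a1 l1).
  have px : p < x by rewrite lt_neqAle p2 andbT; apply/eqP => px; rewrite px in bp.
  have xq : x < q by rewrite lt_neqAle q1 andbT; apply/eqP => xq; rewrite -xq in bq.
  have PW : pos W p q.
    apply: no_bad; [lra|lra|move=> y /andP[py yq]].
    by have [yx|xy] := leP y x; [exact: Hp|apply: Hq => //; exact: ltW].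
  apply: (@hole_heat _ W chi0 h A p q sW A1 schi chi01 suchi hv _ PW _ _ Th Th0) => //.
  - by lra.
  - by move: Aal; lra.
  - by move: Abe; lra.
  - move=> th thT'; split; apply: H => //; apply/andP; split; lra.
  - by apply/andP; split; lra.
have [_ nb2] := b2; apply: (nb2 (Num.min (x2 - x1) (x3 - x2))).
  by rewrite lt_min !subr_gt0 l12.
have m1 : Num.min (x2 - x1) (x3 - x2) <= x2 - x1 by rewrite ge_min lexx.
have m2 : Num.min (x2 - x1) (x3 - x2) <= x3 - x2 by rewrite ge_min lexx orbT.
by apply: (pos_sub _ _ P); lra.
Qed.

Definition meets (z : R * R) := exists2 x, bad x & z.1 < x < z.2.

(** By [bad_uniform] the threshold [n%:R + 1] cannot serve all the bad points of [z]. So the sign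
    fails at some bad point at a scale [theta >= n], by continuity in a neighbourhood too, and this
    neighbourhood is shrunk to avoid the [n]-th exceptional point. *)
Lemma baire_step (en : nat -> R) n (z : R * R) : meets z -> exists z' : R * R,
  [/\ meets z', z.1 < z'.1, z'.2 < z.2, ~ (z'.1 <= en n <= z'.2) &
    exists2 theta, n%:R <= theta & forall x, z'.1 <= x <= z'.2 -> heat W chi0 1 theta x < 0].
Proof.
move=> [x0 b0 x0z].
have [x [theta [bx xz thn hx]]] : exists x theta, [/\ bad x, z.1 < x < z.2, n%:R <= theta &
    0 < theta /\ heat W chi0 1 theta x < 0].
  apply: contrapT => N; apply: (@bad_uniform z.1 z.2 (n%:R + 1) x0 b0 x0z).
    by rewrite ltr_wpDl.
  move=> x theta bx xz th; rewrite leNgt; apply/negP => h0; apply: N; exists x, theta; split=> //.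
    by lra.
  by split=> //; apply: lt_le_trans th; rewrite ltr_wpDl.
case: hx => th0 hx; have A0 : 0 <= A by have := A1; lra.
have cx := is_derive_continuous (@heat_derive_x _ W chi0 A sW A0 schi suchi 1 theta x th0).
have /cvgrPdist_lt/(_ (- heat W chi0 1 theta x)) := cx.
rewrite oppr_gt0 => /(_ hx)[r /= r0 Hr].
have hneg y : `|y - x| < r -> heat W chi0 1 theta y < 0.
  move=> yx; have := Hr y; rewrite /ball_ /= distrC => /(_ yx) /ltr_normlP[].
  by move: (heat W chi0 1 theta x) (heat W chi0 1 theta y) => p q; lra.
move: xz => /andP[z1 z2].
pose r' := Num.min r (Num.min (x - z.1) (z.2 - x)).
have r'0 : 0 < r' by rewrite !lt_min r0 !subr_gt0 z1.
have r1 : r' <= r by rewrite ge_min lexx.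
have r2 : r' <= x - z.1 by rewrite /r' !ge_min lexx orbT.
have r3 : r' <= z.2 - x by rewrite /r' !ge_min lexx !orbT.
have r4 : 0 < r' / 2 by rewrite divr_gt0.
(* If the point found is [en n] itself, another bad point nearby replaces it, since bad points are
   not isolated. *)
have [y [bY yx yr]] : exists y, [/\ bad y, y != en n & `|y - x| < r' / 2].
  have [xe|xe] := eqVneq x (en n); last by exists x; split=> //; rewrite subrr normr0.
  by have [y [? ? ?]] := bad_not_isolated bx r4; exists y; split=> //; rewrite -xe.
pose s := Num.min (r' / 4) (`|y - en n| / 2).
have s0 : 0 < s by rewrite lt_min !divr_gt0 // normr_gt0 subr_eq0.
have s1 : s <= r' / 4 by rewrite ge_min lexx.
have s2 : s <= `|y - en n| / 2 by rewrite ge_min lexx orbT.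
move: yr => /ltr_normlP[yr1 yr2].
exists (y - s, y + s); split=> /=.
- by exists y => //=; apply/andP; split; lra.
- lra.
- lra.
- move=> /andP[e1 e2].
  have : `|y - en n| <= s by rewrite ler_norml; apply/andP; split; lra.
  have : 0 < `|y - en n| by rewrite normr_gt0 subr_eq0.
  lra.
- exists theta; first exact: thn.
  move=> w /andP[w1 w2]; apply: hneg; rewrite ltr_norml; apply/andP; split; lra.
Qed.

Lemma countable_enum (S : set R) : countable S -> exists en : nat -> R, forall x, S x -> exists n, en n = x.
Proof.
move=> /countable_injP[f fi]; exists (fun n => get [set x | S x /\ f x = n]) => x Sx.
exists (f x); have := getI (P := [set y | S y /\ f y = f x]) (x := x).
move=> /(_ (conj Sx erefl))[Sg fg]; apply: fi => //; exact/mem_set.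
Qed.

Theorem positive_derivative : pos W al be.
Proof.
apply: no_bad => // x xab bx.
have [en Hen] := countable_enum cE.
have /choice[st Hst] : forall nz : nat * (R * R), exists z' : R * R, meets nz.2 ->
  [/\ meets z', nz.2.1 < z'.1, z'.2 < nz.2.2, ~ (z'.1 <= en nz.1 <= z'.2) &
    exists2 theta, nz.1%:R <= theta & forall x, z'.1 <= x <= z'.2 -> heat W chi0 1 theta x < 0].
  move=> [n z] /=; have [m|m] := pselect (meets z); last by exists (0, 0).
  by have [z' ?] := baire_step en n m; exists z'.
pose z := fix z n := if n is m.+1 then st (m, z m) else (al, be).
have mz n : meets (z n).
  elim: n => [|n IH]; first by exists x.
  by case: (Hst (n, z n) IH).
have z1 n : (z n).1 < (z n.+1).1 by case: (Hst (n, z n) (mz n)).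
have z2 n : (z n.+1).2 < (z n).2 by case: (Hst (n, z n) (mz n)).
have m1 n m : (n <= m)%N -> (z n).1 <= (z m).1.
  by elim: m => [|m IH]; [case: n|rewrite leq_eqVlt => /predU1P[->//|nm]; apply: le_trans (IH nm) (ltW (z1 m))].
have m2 n m : (n <= m)%N -> (z m).2 <= (z n).2.
  by elim: m => [|m IH]; [case: n|rewrite leq_eqVlt => /predU1P[->//|nm]; apply: le_trans (ltW (z2 m)) (IH nm)].
have lt12 n : (z n).1 < (z n).2 by have [y _ /andP[? ?]] := mz n; lra.
have cross n m : (z n).1 <= (z m).2.
  have l1 := m1 _ _ (leq_maxl n m); have l2 := m2 _ _ (leq_maxr n m); have := lt12 (maxn n m).
  lra.
have zb n : (z n).1 <= b /\ a <= (z n).2.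
  by have [y /bad_ab/andP[y1 y2] /andP[y3 y4]] := mz n; split; lra.
pose S := range (fun n => (z n).1).
have hS : has_sup S by split; [exists (z 0%N).1; exists 0%N|exists (z 0%N).2 => _ [n _ <-]].
(* The supremum of the left ends lies in all the closed intervals. Each of them meets [[a, b]], so
   the maximum with [a] stays in them and also lies in [[a, b]], where [Hheat] is available. *)
pose xs := Num.max (sup S) a.
have xs1 n : (z n).1 <= xs.
  by rewrite le_max; apply/orP; left; apply: ub_le_sup; [case: hS|exists n].
have xs2 n : xs <= (z n).2.
  rewrite ge_max (zb n).2 andbT; apply: ge_sup; first by case: hS.
  by move=> _ [m _ <-]; apply: cross.
have ab : a <= b by have [y /bad_ab/andP[y1 y2] _] := mz 0%N; exact: le_trans y1 y2.
have xab' : a <= xs <= b.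
  rewrite le_max lexx orbT /= ge_max ab andbT; apply: ge_sup; first by case: hS.
  by move=> _ [m _ <-]; case: (zb m).
have nE : ~ E xs.
  move=> /Hen[n en']; have [_ _ _ N _] := Hst (n, z n) (mz n); apply: N.
  by rewrite /= en' (xs1 n.+1) (xs2 n.+1).
have [Th Th0 HTh] := Hheat xab' nE.
(* At [xs] the sign is right from [Th] on, but the interval built at stage [n] carries the wrong
   sign at some [theta >= n]. *)
have [n nTh] : exists n : nat, Th <= n%:R.
  by exists (Num.bound Th); apply: ltW; apply: le_lt_trans (archi_boundP (ltW Th0)).
have [_ _ _ _ [theta tn Ht]] := Hst (n, z n) (mz n).
have := HTh theta (le_trans nTh tn); have := Ht xs; rewrite (xs1 n.+1) (xs2 n.+1) => /(_ isT); lra.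
Qed.

End Monotone.

(** * Kernel values of regular distributions *)

Section Evaluation.
Context {R : realType}.
Implicit Types (phi psi chi : R -> R) (x y t A B : R).

(** [smooth_extension] picks a number common to all large cutoffs. Two cutoffs equal to 1 on a
    neighbourhood of [[a, b]] differ by a function supported off [[a, b]], so that any of them
    computes this number. *)
Lemma smooth_ext_eval (u : (R -> R) -> R) (a b A B : R) chi phi : compact_distribution a b u ->
  a < A -> b < A -> - A < a -> - A < b -> smooth chi -> (forall x, `|x| <= A -> chi x = 1) ->
  supp_in (- B) B chi -> smooth phi -> smooth_extension u phi = u (fun x => chi x * phi x).
Proof.
move=> [su supu] aA bA Aa Ab sc c1 scB sp.
have tc : test_function (fun x => chi x * phi x).
  by apply: (@test_of_supp _ (- B) B); [exact: smoothM|exact: supp_inMl].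
have key c : test_function c -> (forall x, `|x| <= A -> c x = 1) ->
    u (fun x => c x * phi x) = u (fun x => chi x * phi x).
  move=> tc' c1'; have [B' B'0 sB'] := test_supp tc'.
  have tcp : test_function (fun x => c x * phi x).
    by apply: (@test_of_supp _ (- B') B'); [exact: (smoothM (test_smooth tc') sp)|exact: supp_inMl].
  apply/eqP; rewrite -subr_eq0 -(schwartzB su tcp tc); apply/eqP/supu.
    apply: (@test_of_supp _ (- Num.max B B') (Num.max B B')).
      by exact: (smoothB (smoothM (test_smooth tc') sp) (smoothM sc sp)).
    have m1 : B <= Num.max B B' by rewrite le_max lexx.
    have m2 : B' <= Num.max B B' by rewrite le_max lexx orbT.
    by move=> x Hx; rewrite scB ?sB' ?mul0r ?subrr //; case: Hx => Hx; [left|right|left|right]; lra.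
  rewrite -subset0 => x [/= Hx]; rewrite in_itv /= => /andP[ax xb].
  have clA : closed [set y : R | A <= `|y|].
    apply: (@closed_comp _ _ (fun y : R => `|y|) [set z | A <= z]); last exact: closed_ge.
    by move=> y _; exact: norm_continuous.
  have : [set y : R | A <= `|y|] x.
    apply: (clA) => //; move: Hx; apply: closure_subset => y /= Hy.
    rewrite leNgt; apply/negP => yA; move: Hy; rewrite c1 ?c1' ?(ltW yA) // mul1r subrr eqxx //.
  by rewrite /= leNgt ltr_norml => /negP; apply; apply/andP; split; lra.
rewrite /smooth_extension.
have H0 : [set v : R | \forall M \near +oo, forall chi, test_function chi ->
    (forall x, `|x| <= M -> chi x = 1) -> u (fun x => chi x * phi x) = v] (u (fun x => chi x * phi x)).
  exists A; split; first exact: num_real.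
  move=> M AM c tc' cM; apply: key => // x xA; apply: cM; exact: le_trans xA (ltW AM).
have [M0 [_ HM0]] := getI H0; set v := get _ in HM0 *.
pose M := `|M0| + `|A| + 1.
have M1 : 0 <= M by rewrite !addr_ge0.
have [c [sc' _ cM sM _]] := cutoff_ex M1.
have tc' : test_function c by exact: test_of_supp sM.
rewrite -(HM0 M _ c tc' cM).
  apply: key => // x xA; apply: cM; apply: le_trans xA _.
  by rewrite /M; have := ler_norm A; have := normr_ge0 M0; lra.
by rewrite /M; have := ler_norm M0; have := normr_ge0 A; lra.
Qed.

Definition tker t x phi : R -> R := fun y => t^-1 * dil x t phi y.

Lemma smooth_tker t x phi : smooth phi -> smooth (tker t x phi).
Proof. by move=> sp; apply: smoothZ; exact: smooth_dil. Qed.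

(** Carries the estimates on [u] over to its primitive [U], tested on the derivative of the cut
    kernel. *)
Lemma pair_eval (u U : (R -> R) -> R) (a b A : R) chi phi t x : compact_distribution a b u ->
  distributional_derivative U u ->
  a < A -> b < A -> - A < a -> - A < b -> smooth chi -> (forall x, `|x| <= A -> chi x = 1) ->
  supp_in (- (A + 1)) (A + 1) chi -> smooth phi -> 0 < t ->
  scaled_pairing (smooth_extension u) x t phi = - U (derive1 (fun y => chi y * tker t x phi y)).
Proof.
move=> cu dU aA bA Aa Ab sc c1 suc sp t0.
have sd : smooth (dil x t phi) by exact: smooth_dil.
rewrite /scaled_pairing (smooth_ext_eval cu aA bA Aa Ab sc c1 suc sd) gtr0_norm //.
have tc : test_function (fun y => chi y * dil x t phi y).
  by apply: (@test_of_supp _ (- (A + 1)) (A + 1)); [exact: smoothM|exact: supp_inMl].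
rewrite -(schwartzZ _ cu.1 tc) -dU.
  by congr u; apply/funext => y; rewrite /tker mulrCA.
apply: (@test_of_supp _ (- (A + 1)) (A + 1)); last exact: supp_inMl.
by apply: smoothM sc _; exact: smooth_tker.
Qed.

(** The product is of order [|z|^(alpha + 1)], a negative power because [alpha < -1]. After
    rescaling, the kernel and its derivatives are small at a fixed distance from the centre. *)
Lemma T0_decay n phi (eta : R) : T0_class phi -> 0 < eta -> exists2 B : R, 0 < B &
  forall z, B <= `|z| -> `|z| ^+ n.+1 * `|derive1n n phi z| <= eta.
Proof.
move=> [_ _ _ [al al1 H]] eta0; have [C [A0 [A00 HA]]] := H n.
have C0 : 0 <= `|C| by [].
(* |z|^(1 + al) <= q for |z| >= q^(1 / (1 + al)) *)
have C1 : 0 < `|C| + 1 by rewrite ltr_wpDl.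
pose q := eta / (`|C| + 1); have q0 : 0 < q by rewrite divr_gt0.
have al0 : al + 1 != 0 by rewrite lt_eqF //; lra.
pose B1 := q `^ (al + 1)^-1.
have B10 : 0 < B1 by exact: powR_gt0.
exists (Num.max A0 B1); first by rewrite lt_max A00.
move=> z; rewrite ge_max => /andP[zA zB].
have z0 : 0 < `|z| by exact: lt_le_trans A00 zA.
have zn : 0 <= `|z| ^+ n.+1 by exact: exprn_ge0.
apply: le_trans (ler_wpM2l zn (HA z zA)) _.
have -> : `|z| ^+ n.+1 * (C * `|z| `^ (al - n%:R)) = C * `|z| `^ (al + 1).
  rewrite mulrCA -powR_mulrn ?(ltW z0) // -powRD; last by rewrite (gt_eqF z0) implybT.
  by congr (_ * _ `^ _); rewrite -natr1; ring.
have le1 : `|z| `^ (al + 1) <= q.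
  have -> : q = B1 `^ (al + 1) by rewrite /B1 -powRrM mulVf // powRr1 // ltW.
  rewrite -[leLHS]invrK -[leRHS]invrK lef_pV2 ?posrE ?invr_gt0 ?powR_gt0 //.
  by rewrite -!powRN ge0_ler_powR ?nnegrE ?(ltW B10) ?(ltW z0) //; lra.
apply: le_trans (ler_wpM2r (powR_ge0 _ _) (ler_norm C)) _.
apply: le_trans (ler_wpM2l C0 le1) _.
by rewrite /q mulrA ler_pdivrMr // mulrC ler_pM2l //; lra.
Qed.

Section Kernels.
Variables (chi : R -> R) (A : R).
Hypotheses (A1 : 1 <= A) (schi : smooth chi) (chi01 : forall x, 0 <= chi x <= 1)
  (chi1 : forall x, `|x| <= A -> chi x = 1) (suchi : supp_in (- (A + 1)) (A + 1) chi).

Let AA : - (A + 1) < A + 1. Proof. by have := A1; lra. Qed.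

Notation rho t x phi := (fun y => chi y * tker t x phi y).

Lemma smooth_rho t x phi : smooth phi -> smooth (rho t x phi).
Proof. by move=> sp; apply: smoothM schi _; exact: smooth_tker. Qed.

Lemma supp_rho t x phi : supp_in (- (A + 1)) (A + 1) (rho t x phi).
Proof. exact: supp_inMl. Qed.

Lemma rho_ge0 t x phi y : 0 < t -> (forall x, 0 <= phi x) -> 0 <= rho t x phi y.
Proof.
move=> t0 p0; apply: mulr_ge0; first by case/andP: (chi01 y).
by apply: mulr_ge0; [rewrite invr_ge0 ltW|exact: p0].
Qed.

Lemma IT_rho phi (eta : R) : T0_class phi -> 0 < eta -> exists2 tau : R, 0 < tau & forall t x,
  0 < t < tau -> `|x| <= A - 1 -> `|IT (rho t x phi) - 1| <= eta.
Proof.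
move=> [sp p0 I1 _] eta0; exact: (kernel_mass A1 schi chi1 suchi sp p0 I1 eta0).
Qed.

Lemma rho_away phi (delta eta : R) : T0_class phi -> 0 < delta -> 0 < eta ->
  exists2 tau : R, 0 < tau & forall t x y, 0 < t < tau -> delta <= `|y - x| -> rho t x phi y <= eta.
Proof.
move=> T0 d0 eta0; have [_ p0 _ _] := T0.
have [B B0 HB] := T0_decay 0 T0 (mulr_gt0 eta0 d0).
exists (delta / B); first exact: divr_gt0.
move=> t x y /andP[t0 tB] dy.
have z0 : 0 < `|y - x| by exact: lt_le_trans d0 dy.
have Bz : B <= `|(y - x) / t|.
  rewrite normrM (gtr0_norm (_ : 0 < t^-1)) ?invr_gt0 // ler_pdivlMr //.
  by apply: le_trans dy; rewrite mulrC -ler_pdivlMr // ltW.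
have := HB _ Bz; rewrite expr1 /= (ger0_norm (p0 _)) normrM (gtr0_norm (_ : 0 < t^-1)) ?invr_gt0 // => H.
have K0 : 0 <= tker t x phi y by apply: mulr_ge0; [rewrite invr_ge0 ltW|exact: p0].
apply: (@le_trans _ _ (tker t x phi y)).
  by rewrite ler_piMl //; case/andP: (chi01 y).
rewrite -(ler_pM2r d0); apply: le_trans H.
rewrite [leRHS](_ : _ = tker t x phi y * `|y - x|); last by rewrite /tker /dil; ring.
exact: ler_wpM2l.
Qed.

(* -IT((y - x) k rho') only sees rho away from x when k vanishes near x *)
Lemma IT_omega phi (delta Y eta : R) : T0_class phi -> 0 < delta -> 0 < eta -> 0 <= Y ->
  exists2 tau : R, 0 < tau & forall t x (om om' : R -> R), 0 < t < tau ->
    (forall z : R, is_derive z 1 om (om' z)) -> continuous om' ->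
    (forall y, `|y - x| < delta -> om' y = 0) -> (forall y, `|y| <= A + 1 -> `|om' y| <= Y) ->
    `|IT (fun y => om y * derive1 (rho t x phi) y)| <= eta.
Proof.
move=> T0 d0 eta0 Y0; have [sp p0 _ _] := T0.
pose D := Y * (A + 1 - - (A + 1)).
have D0 : 0 <= D by apply: mulr_ge0 => //; have := AA; lra.
have D1 : 0 < D + 1 by rewrite ltr_wpDl.
have [tau tau0 H] := rho_away T0 d0 (divr_gt0 eta0 D1).
exists tau => // t x om om' tt dom com om0 omY; have /andP[t0 _] := tt.
have sr := @smooth_rho t x phi sp; have cr := smooth_continuous sr.
have -> : (fun y => om y * derive1 (rho t x phi) y) = (fun y => derive1 (rho t x phi) y * om y).
  by apply/funext => y; rewrite mulrC.
have -> : IT (fun y => derive1 (rho t x phi) y * om y) = - IT (fun y => rho t x phi y * om' y).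
  rewrite (@IT_by_parts _ (- (A + 1)) (A + 1) (rho t x phi) om (derive1 (rho t x phi)) om' AA
    (fun y => smooth_is_derive y sr) dom _ com (@supp_rho t x phi) (supp_in_derive1 (@supp_rho t x phi))) ?opprK //.
  exact/smooth_continuous/smooth_derive1.
rewrite normrN; apply: (@le_trans _ _ (eta / (D + 1) * Y * (A + 1 - - (A + 1)))); last first.
  rewrite -mulrA -/D mulrAC ler_pdivrMr // ler_pM2l //; lra.
apply: (IT_bound AA); [exact: contM|exact/supp_inMl/supp_rho|].
move=> y; have [yd|yd] := ltP `|y - x| delta.
  rewrite om0 // mulr0 normr0; apply: mulr_ge0 => //; apply: divr_ge0; exact: ltW.
have [yA|yA] := leP `|y| (A + 1).
  rewrite normrM (ger0_norm (rho_ge0 _ _ t0 p0)); apply: ler_pM => //; first exact: rho_ge0.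
    exact: H.
  exact: omY.
rewrite (_ : rho t x phi y = 0); first by rewrite mul0r normr0; apply: mulr_ge0 => //; apply: divr_ge0; exact: ltW.
apply: supp_rho; move: yA; have [y0|y0] := leP 0 y; rewrite ?(ger0_norm y0) ?(ltr0_norm y0) => ?; [right|left]; lra.
Qed.

Lemma IT_affine_rho phi (eta : R) : T0_class phi -> 0 < eta -> exists2 tau : R, 0 < tau & forall t x,
  0 < t < tau -> `|x| <= A - 1 -> `|- IT (fun y => (y - x) * derive1 (rho t x phi) y) - 1| <= eta.
Proof.
move=> T0 eta0; have [sp _ _ _] := T0; have [tau tau0 H] := IT_rho T0 eta0.
exists tau => // t x tt xA; have sr := @smooth_rho t x phi sp.
have dx (y : R) : is_derive y 1 (fun y => y - x) 1.
  have := is_derive_sub (is_derive_idr y) (is_derive_const x y); by rewrite subr0.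
rewrite (_ : (fun y => _) = (fun y => derive1 (rho t x phi) y * (y - x))); last first.
  by apply/funext => y; rewrite mulrC.
rewrite -(@IT_by_parts _ (- (A + 1)) (A + 1) (rho t x phi) (fun y => y - x) (derive1 (rho t x phi)) (fun=> 1) AA
    (fun y => smooth_is_derive y sr) dx _ (@cont_cst _ 1) (@supp_rho t x phi) (supp_in_derive1 (@supp_rho t x phi))).
  rewrite (_ : (fun y => rho t x phi y * 1) = rho t x phi); first exact: H.
  by apply/funext => y; rewrite mulr1.
exact/smooth_continuous/smooth_derive1.
Qed.

End Kernels.
End Evaluation.

(** * Auxiliary functions for kernel estimates *)

Section KernelValues.
Context {R : realType}.
Implicit Types (F phi : R -> R) (x y z t : R).

Lemma omega_ex x (delta : R) : 0 < delta -> exists om : R -> R, [/\ smooth om, forall y, 0 <= om y <= 1,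
  forall y, delta <= `|y - x| -> om y = 1 & forall y, `|y - x| < delta / 2 -> om y = 0].
Proof.
move=> d0.
have [sa [ssa sa01 sa0 sa1]] := @step_between _ (x - delta) (x - delta / 2) ltac:(lra).
have [sb [ssb sb01 sb0 sb1]] := @step_between _ (x + delta / 2) (x + delta) ltac:(lra).
exists (fun y => 1 - (sa y - sb y)); split.
- by apply: smoothB; [exact: smooth_cst|exact: smoothB].
- move=> y; have /andP[a0 a1] := sa01 y; have /andP[b0 b1] := sb01 y.
  have [yx|yx] := leP y x.
    by rewrite (sb0 y); [apply/andP; split; lra|lra].
  by rewrite (sa1 y); [apply/andP; split; lra|lra].
- move=> y; have [yx|yx] := leP 0 (y - x); rewrite ?(ger0_norm yx) ?(ltr0_norm yx) => h.
    by rewrite sa1 ?sb1; [ring|lra|lra].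
  by rewrite sa0 ?sb0; [ring|lra|lra].
- by move=> y /ltr_normlP[h1 h2]; rewrite sa1 ?sb0; [ring|lra|lra].
Qed.

(** [|z| |phi'(z)|] is [O(|z|^alpha)], hence integrable, and its integral is handled through an
    explicit bounded primitive. With [eps = -1 - alpha], [G] is [z (1 + z^2)^(-1/2) (1 - (1 +
    z^2)^(-eps/2) / 2)], whose derivative is nonnegative and at infinity at least a positive
    multiple of [|z|^alpha]. *)
Lemma T0_majorant phi : T0_class phi -> exists (G G' : R -> R) (D : R),
  [/\ 0 <= D, forall z : R, is_derive z 1 G (G' z), continuous G', forall z, 0 <= G' z /\ `|G z| <= 1 &
      forall z, `|z| * `|derive1 phi z| <= D * G' z].
Proof.
move=> T0; have [sp _ _ [al al1 H]] := T0; have [C [A1 [A10 HA1]]] := H 1%N.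
(* Enlarged so that [|z| >= 1] throughout the tail. *)
pose A0 := A1 + 1; have A01 : 1 <= A0 by rewrite /A0; lra.
have HA z : A0 <= `|z| -> `|derive1 phi z| <= C * `|z| `^ (al - 1).
  by move=> zA; apply: HA1; rewrite /A0 in zA; lra.
pose eps := - 1 - al; have eps0 : 0 < eps by rewrite /eps; lra.
pose w z := 1 + z ^+ 2 : R; have w1 z : 1 <= w z by rewrite lerDl sqr_ge0.
have w0 z : 0 < w z by exact: lt_le_trans (w1 z).
pose l z := ln (w z) : R; have l0 z : 0 <= l z by exact: ln_ge0.
pose q z := expR (- 2^-1 * l z) : R; pose q2 z := expR (- (eps / 2) * l z) : R.
have q0 z : 0 < q z by exact: expR_gt0.
have q20 z : 0 < q2 z by exact: expR_gt0.
have q21 z : q2 z <= 1.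
  by rewrite /q2 -[leRHS]expR0 ler_expR mulNr oppr_le0; apply: mulr_ge0 => //; rewrite divr_ge0 // ltW.
have dw (z : R) : is_derive z 1 w (2 * z).
  have := is_derive_add (is_derive_const 1 z) (is_derive_expr 2 z).
  by rewrite add0r expr1.
have dl (z : R) : is_derive z 1 l (2 * z / w z).
  have := is_derive_comp (is_derive1_ln (w0 z)) (dw z); by rewrite mulrC.
have dexp (c z : R) : is_derive z 1 (fun z => expR (c * l z)) (c * (2 * z / w z) * expR (c * l z)).
  have dc : is_derive z 1 (fun z => c * l z) (c * (2 * z / w z)).
    by have := is_derive_mul (is_derive_const c z) (dl z); rewrite mul0r add0r.
  by have := @is_derive_comp _ expR (fun z => c * l z) z _ _ (is_derive_expR (c * l z)) dc; rewrite mulrC.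
pose G z := z * q z * (1 - 2^-1 * q2 z).
pose G' z := q z / w z * (1 - 2^-1 * q2 z + eps / 2 * q2 z * z ^+ 2).
have dG (z : R) : is_derive z 1 G (G' z).
  have D1 := is_derive_mul (is_derive_idr z) (dexp (- 2^-1) z).
  have D2 := is_derive_sub (is_derive_const 1 z) (is_derive_mul (is_derive_const 2^-1 z) (dexp (- (eps / 2)) z)).
  apply: is_derive_eq (is_derive_mul D1 D2) _; rewrite -/(q z) -/(q2 z) /G'.
  have wn : w z != 0 by rewrite gt_eqF.
  by move: wn; rewrite /w => wn; field.
have G'lb z : 2^-1 * (q z / w z) * (1 + eps * q2 z * z ^+ 2) <= G' z.
  rewrite /G' (_ : 2^-1 * _ * _ = q z / w z * (2^-1 + eps / 2 * q2 z * z ^+ 2)); last by field; rewrite gt_eqF.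
  rewrite ler_wpM2l ?lerD2r //; first by rewrite divr_ge0 // ltW.
  by have := q21 z; lra.
have G'0 z : 0 <= G' z.
  apply: le_trans (G'lb z); apply: mulr_ge0; first by rewrite mulr_ge0 // divr_ge0 // ltW.
  by apply: addr_ge0 => //; apply: mulr_ge0 (sqr_ge0 z); apply: mulr_ge0; exact: ltW.
have cl : continuous l by move=> z; apply: is_derive_continuous (dl z).
have cq : continuous q by move=> z; apply: is_derive_continuous (dexp (- 2^-1) z).
have cq2 : continuous q2 by move=> z; apply: is_derive_continuous (dexp (- (eps / 2)) z).
have cw : continuous w by move=> z; apply: is_derive_continuous (dw z).
have cid : continuous (fun z : R => z) by exact: smooth_continuous smooth_id.
have csq : continuous (fun z : R => z ^+ 2).
  by rewrite (_ : (fun z => _) = fun z => z * z); [exact: contM|apply/funext => z; rewrite expr2].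
have cG' : continuous G'.
  apply: contM; first by apply: contM => //; move=> z; apply: cvgV; [rewrite gt_eqF|exact: cw].
  apply: contD; first by apply: contB; [exact: cont_cst|exact: contZ].
  by apply: contM => //; exact: contZ.
have G1 z : `|G z| <= 1.
  have h1 : `|z * q z| <= 1.
    rewrite -(@expr_le1 _ 2) // -normrX exprMn ger0_norm; last by apply: mulr_ge0; exact: sqr_ge0.
    have -> : q z ^+ 2 = (w z)^-1.
      by rewrite expr2 -expRD (_ : _ + _ = - l z); [rewrite expRN /l lnK ?posrE|field].
    by rewrite ler_pdivrMr // mul1r /w lerDr.
  have h2 : `|1 - 2^-1 * q2 z| <= 1.
    by rewrite ler_norml; have := q20 z; have := q21 z => ? ?; apply/andP; split; lra.
  by rewrite /G normrM mulr_ile1.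
have [X X0 HX] := @cont_bounded_on _ (- A0) A0 (derive1 phi) ltac:(lra) (smooth_continuous (smooth_derive1 sp)).
(* [D1] serves for [|z| <= A0], where [G'] is bounded below by a positive constant; [D2] serves in
   the tail, where [expR (- (al / 2) * ln 2)] is the cost of [1 + z^2 <= 2 z^2]. *)
pose D1 := A0 * X * (2 * (1 + A0 ^+ 2) ^+ 2).
pose D2 := `|C| * (4 / eps * expR (- (al / 2) * ln 2)).
have D10 : 0 <= D1.
  apply: mulr_ge0; first by apply: mulr_ge0 => //; lra.
  by apply: mulr_ge0 => //; apply: exprn_ge0; rewrite addr_ge0 // sqr_ge0.
have D20 : 0 <= D2.
  apply: mulr_ge0 => //; apply: mulr_ge0; [by apply: divr_ge0 => //; exact: ltW|exact/ltW/expR_gt0].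
exists G, G', (D1 + D2); split=> //; first exact: addr_ge0.
move=> z; rewrite mulrDl; have [zA|zA] := leP `|z| A0.
  apply: (@le_trans _ _ (D1 * G' z)); last by rewrite lerDl; exact: mulr_ge0.
  have lb : 1 <= 2 * (1 + A0 ^+ 2) ^+ 2 * G' z.
    have h1 : 2^-1 * (q z / w z) <= G' z.
      apply: le_trans (G'lb z); rewrite ler_peMr //.
        by apply: mulr_ge0 => //; apply: divr_ge0; exact: ltW.
      rewrite lerDl; apply: mulr_ge0; last exact: sqr_ge0.
      by apply: mulr_ge0; exact: ltW.
    have h2 : (w z)^-1 <= q z.
      rewrite /q -[w z]lnK ?posrE // -expRN ler_expR -/(l z) mulNr lerN2.
      by have := l0 z; lra.
    have wA : w z <= 1 + A0 ^+ 2.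
      rewrite lerD2l -[z ^+ 2]real_normK ?num_real //; apply: lerXn2r => //; rewrite nnegrE; lra.
    have h3 : 1 <= 2 * (1 + A0 ^+ 2) ^+ 2 * (2^-1 * (q z / w z)).
      rewrite mulrACA mulfV ?pnatr_eq0 // mul1r mulrA ler_pdivlMr // mul1r.
      have wwq : 1 <= w z * q z by rewrite -ler_pdivrMl // mulr1.
      rewrite expr2; apply: (@le_trans _ _ (w z * (w z * q z))); first by rewrite ler_peMr // ltW.
      rewrite mulrA ler_wpM2r ?(ltW (q0 z)) //; apply: ler_pM => //; exact: ltW.
    apply: le_trans h3 _; apply: ler_wpM2l => //.
    by apply: mulr_ge0 => //; apply: exprn_ge0; rewrite addr_ge0 // sqr_ge0.
  apply: (@le_trans _ _ (A0 * X)).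
    by apply: ler_pM => //; apply: HX; rewrite -ler_norml.
  rewrite /D1 -mulrA -[leLHS]mulr1 ler_wpM2l //; apply: mulr_ge0 => //; lra.
apply: (@le_trans _ _ (D2 * G' z)); last by rewrite lerDr; exact: mulr_ge0.
have z0 : 0 < `|z| by lra.
have z1 : 1 <= `|z| by lra.
have h1 : `|z| * `|derive1 phi z| <= `|C| * `|z| `^ al.
  apply: le_trans (ler_wpM2l (ltW z0) (HA z (ltW zA))) _.
  have -> : `|z| * (C * `|z| `^ (al - 1)) = C * `|z| `^ al.
    rewrite mulrCA -{1}(powRr1 (ltW z0)) -powRD; last by rewrite (gt_eqF z0) implybT.
    by congr (_ * _ `^ _); ring.
  by rewrite ler_wpM2r ?powR_ge0 // ler_norm.
apply: le_trans h1 _; rewrite /D2 -mulrA ler_wpM2l //.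
have sq : `|z| ^+ 2 = z ^+ 2 by rewrite real_normK ?num_real.
have z21 : 1 <= z ^+ 2 by rewrite -sq exprn_ege1.
have h2 : eps / 4 * (q z * q2 z) <= G' z.
  apply: le_trans (G'lb z).
  rewrite (_ : 2^-1 * _ * _ = eps / 4 * (q z * q2 z) * (2 * z ^+ 2 / w z) + 2^-1 * (q z / w z)); last first.
    by field; rewrite gt_eqF.
  apply: (@le_trans _ _ (eps / 4 * (q z * q2 z) * (2 * z ^+ 2 / w z))); last first.
    rewrite lerDl; apply: mulr_ge0 => //; apply: divr_ge0; exact: ltW.
  rewrite -[leLHS]mulr1; apply: ler_wpM2l.
    by apply: mulr_ge0; [apply: divr_ge0 => //; exact: ltW|apply: mulr_ge0; exact: ltW].
  by rewrite ler_pdivlMr // mul1r /w; lra.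
have h3 : `|z| `^ al <= expR (- (al / 2) * ln 2) * (q z * q2 z).
  rewrite /powR (gt_eqF z0) /q /q2 -!expRD ler_expR.
  have : l z <= ln 2 + 2 * ln `|z|.
    have -> : 2 * ln `|z| = ln (z ^+ 2) by rewrite -sq lnXn // mulr_natl.
    rewrite -lnM ?posrE //; last by lra.
    by rewrite /l ler_ln ?posrE // /w; lra.
  rewrite /eps => hl.
  have -> : - 2^-1 * l z + - ((-1 - al) / 2) * l z = al / 2 * l z by field.
  have : - (al / 2) * l z <= - (al / 2) * (ln 2 + 2 * ln `|z|) by rewrite ler_wpM2l //; lra.
  lra.
apply: le_trans h3 _; rewrite (mulrC (4 / eps)) -mulrA ler_wpM2l ?(ltW (expR_gt0 _)) //.
rewrite -ler_pdivrMl ?divr_gt0 //; apply: le_trans h2.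
by rewrite invf_div.
Qed.

End KernelValues.

(** * Values of the derivative of a continuous function on kernels *)

Section RegularValues.
Context {R : realType}.
Implicit Types (F phi : R -> R) (x y z t : R).
Variables (chi : R -> R) (A : R).
Hypotheses (A1 : 1 <= A) (schi : smooth chi) (chi01 : forall x, 0 <= chi x <= 1)
  (chi1 : forall x, `|x| <= A -> chi x = 1) (suchi : supp_in (- (A + 1)) (A + 1) chi).

Let AA : - (A + 1) < A + 1. Proof. by have := A1; lra. Qed.

Notation rho t x phi := (fun y => chi y * tker t x phi y).

Lemma derive1_rho t x phi y : smooth phi ->
  derive1 (rho t x phi) y = derive1 chi y * tker t x phi y + chi y * (t^-1 * (t^-1 * derive1 phi ((y - x) / t))).
Proof.
move=> sp; apply: is_derive_eq1; apply: is_derive_mul (smooth_is_derive y schi) _.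
have D : is_derive y 1 (dil x t phi) (t^-1 * derive1 phi ((y - x) / t)).
  have sd : smooth (dil x t phi) by exact: smooth_dil.
  have := smooth_is_derive y sd; rewrite -[derive1 (dil x t phi)]/(derive1n 1 (dil x t phi)).
  by rewrite (@derive1n_dil _ 1 x t phi sp) expr1.
by have := is_derive_mul (is_derive_const t^-1 y) D; rewrite mul0r add0r.
Qed.

Lemma IT_derive1_rho t x phi : smooth phi -> IT (derive1 (rho t x phi)) = 0.
Proof.
move=> sp; have sr := @smooth_rho _ chi schi t x phi sp.
apply: (IT_derive AA _ (fun y => smooth_is_derive y sr)); first exact/smooth_continuous/smooth_derive1.
exact: supp_rho.
Qed.

Lemma bounded_on_supp F : continuous F -> exists2 M : R, 0 <= M & forall y, `|y| <= A + 1 -> `|F y| <= M.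
Proof.
move=> cF; have [M M0 HM] := @cont_bounded_on _ (- (A + 1)) (A + 1) F (ltW AA) cF.
by exists M => // y; rewrite ler_norml => yA; apply: HM.
Qed.

Lemma out_supp (f : R -> R) y : supp_in (- (A + 1)) (A + 1) f -> A + 1 < `|y| -> f y = 0.
Proof.
move=> sf yA; apply: sf; move: yA; have [y0|y0] := leP 0 y; rewrite ?(ger0_norm y0) ?(ltr0_norm y0) => ?;
  [right|left]; lra.
Qed.

(* -reg F rho' against the affine comparison x |-> K (y - x), the error being
   localized away from x by om *)
Lemma reg_rho_split F (om : R -> R) (K B : R) t x phi : smooth phi -> continuous F -> continuous om ->
  - reg F (derive1 (rho t x phi)) =
  K * - IT (fun y => (y - x) * derive1 (rho t x phi) y) +
  B * IT (fun y => om y * derive1 (rho t x phi) y) +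
  IT (fun y => (F y - F x - K * (y - x) + B * om y) * - derive1 (rho t x phi) y).
Proof.
move=> sp cF com; have sr := @smooth_rho _ chi schi t x phi sp.
set r := derive1 _; have cr : continuous r by exact/smooth_continuous/smooth_derive1.
have sur : supp_in (- (A + 1)) (A + 1) r by exact/supp_in_derive1/supp_rho.
have cx : continuous (fun y : R => y - x).
  by apply: contB; [exact: smooth_continuous smooth_id|exact: cont_cst].
have Ir : IT r = 0 by exact: IT_derive1_rho.
pose f1 y := F y * r y; pose f2 y := (y - x) * r y; pose f3 y := om y * r y.
have c1 : continuous f1 by exact: contM.
have c2 : continuous f2 by exact: contM.
have c3 : continuous f3 by exact: contM.
have s1 : supp_in (- (A + 1)) (A + 1) f1 by exact: supp_inM.
have s2 : supp_in (- (A + 1)) (A + 1) f2 by exact: supp_inM.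
have s3 : supp_in (- (A + 1)) (A + 1) f3 by exact: supp_inM.
have -> : (fun y => (F y - F x - K * (y - x) + B * om y) * - r y) =
    (fun y => -1 * f1 y + (F x * r y + (K * f2 y + (- B) * f3 y))).
  by apply/funext => y; rewrite /f1 /f2 /f3; ring.
have c4 : continuous (fun y => (- B) * f3 y) by exact: contZ.
have s4 : supp_in (- (A + 1)) (A + 1) (fun y => (- B) * f3 y) by exact: supp_inM.
have c5 : continuous (fun y => K * f2 y + (- B) * f3 y) by apply: contD => //; exact: contZ.
have s5 : supp_in (- (A + 1)) (A + 1) (fun y => K * f2 y + (- B) * f3 y) by apply: supp_inD => //; exact: supp_inM.
have c6 : continuous (fun y => F x * r y + (K * f2 y + (- B) * f3 y)) by apply: contD => //; exact: contZ.
have s6 : supp_in (- (A + 1)) (A + 1) (fun y => F x * r y + (K * f2 y + (- B) * f3 y)) by apply: supp_inD => //; exact: supp_inM.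
rewrite (IT_lin (-1) AA c1 c6 s1 s6) (IT_lin (F x) AA cr c5 sur s5) (IT_lin K AA c2 c4 s2 s4) (ITZ (- B) AA c3 s3) Ir.
rewrite /reg -/f1; ring.
Qed.

(** [om] is meant to absorb the behaviour of [F] away from [x], where the difference quotients are
    not controlled: it has the sign of [y - x] where it does not vanish, and its own pairing tends
    to 0 by [IT_omega] because it vanishes near [x]. *)
Lemma omega_data x (delta : R) : 0 < delta -> exists (om om' : R -> R) (Y : R),
  [/\ forall y : R, is_derive y 1 om (om' y), continuous om', 0 <= Y, forall y, `|y| <= A + 1 -> `|om' y| <= Y &
   [/\ forall y, `|y - x| < delta / 2 -> om' y = 0,
       forall y, delta <= `|y - x| -> om y = y - x &
       forall y, exists2 k : R, 0 <= k & om y = k * (y - x)]].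
Proof.
move=> d0; have [k [smo o01 o1 o0]] := omega_ex x d0.
pose om y := k y * (y - x).
have som : smooth om by apply: smoothM smo _; apply: smoothB; [exact: smooth_id|exact: smooth_cst].
have [Y Y0 HY] := bounded_on_supp (smooth_continuous (smooth_derive1 som)).
exists om, (derive1 om), Y; split=> //.
- by move=> y; exact: smooth_is_derive.
- exact/smooth_continuous/smooth_derive1.
split.
- move=> y yd; have e0 : 0 < delta / 2 - `|y - x| by rewrite subr_gt0.
  rewrite -[derive1 om]/(derive1n 1 om) (@derive1n_local _ 1 om (fun=> 0) y _ e0) ?derive1n_cst //.
  move=> z zy; rewrite /om o0 ?mul0r //.
  have := ler_normD (z - y) (y - x); rewrite subrKA => H; apply: le_lt_trans H _; lra.
- by move=> y yd; rewrite /om o1 // mul1r.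
- by move=> y; exists (k y) => //; case/andP: (o01 y).
Qed.

(** For a radially decreasing kernel, cut off monotonically, [y - x] times minus the derivative of
    the cut kernel is nonnegative. Once [F y - F x - K (y - x) + B om y] has the sign of [y - x],
    its pairing is therefore nonnegative, and the remaining terms tend to [K] and 0. *)
Lemma T1_lower F x (K delta eta : R) phi : continuous F -> `|x| <= A - 1 -> T1_class phi ->
  (forall x y, `|y| <= A -> (x - y) * derive1 chi x <= 0) -> 0 < delta ->
  (forall y, 0 < `|y - x| < delta -> K <= (F y - F x) / (y - x)) -> 0 < eta ->
  exists2 tau : R, 0 < tau & forall t, 0 < t < tau -> K - eta <= - reg F (derive1 (rho t x phi)).
Proof.
move=> cF xA [T0 uni] unichi d0 HK eta0; have [sp p0 _ _] := T0.
have [M M0 HM] := bounded_on_supp cF.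
have [om [om1' [Y [dom com1 Y0 HY [om0 om1 omk]]]]] := omega_data x d0.
have com : continuous om by move=> y; apply: is_derive_continuous (dom y).
(* [B] outweighs both [|K|] and the quotients of [F] beyond distance [delta], which are at most
   [2 * M / delta] in absolute value. *)
pose B := `|K| + 2 * M / delta.
have B0 : 0 <= B by apply: addr_ge0 => //; apply: divr_ge0; [exact: mulr_ge0|exact: ltW].
have B1 : 0 < B + 1 by lra.
have K1 : 0 < `|K| + 1 by rewrite ltr_wpDl.
have eta2 : 0 < eta / 2 by rewrite divr_gt0.
have d2 : 0 < delta / 2 by rewrite divr_gt0.
have [t1 t10 H1] := @IT_affine_rho _ chi A A1 schi chi1 suchi phi _ T0 (divr_gt0 eta2 K1).
have [t2 t20 H2] := @IT_omega _ chi A A1 schi chi01 suchi phi _ Y _ T0 d2 (divr_gt0 eta2 B1) Y0.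
exists (Num.min t1 t2); first by rewrite lt_min t10.
move=> t /andP[t0]; rewrite lt_min => /andP[tt1 tt2].
have {}H1 := H1 t x ltac:(by rewrite t0) xA.
have {}H2 := H2 t x om om1' ltac:(by rewrite t0) dom com1 om0 HY.
rewrite (@reg_rho_split F om K B t x phi sp cF com).
set I1 := - IT _ in H1 *; set I2 := IT _ in H2 *; set I3 := IT _.
have I30 : 0 <= I3.
  apply: IT_ge0 => y; have [yA|yA] := leP `|y| (A + 1); last first.
    by rewrite (out_supp (supp_in_derive1 (@supp_rho _ chi A suchi t x phi)) yA) oppr0 mulr0.
  have sgn : 0 <= (y - x) * - derive1 (rho t x phi) y.
    rewrite derive1_rho // mulrN oppr_ge0 mulrDr; rewrite -[leRHS]addr0; apply: lerD.
      rewrite mulrA; apply: mulr_le0_ge0; first by apply: unichi; move: xA; lra.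
      by apply: mulr_ge0; [rewrite invr_ge0 ltW|exact: p0].
    have -> : (y - x) * (chi y * (t^-1 * (t^-1 * derive1 phi ((y - x) / t)))) =
       chi y * t^-1 * ((y - x) / t * derive1 phi ((y - x) / t)) by ring.
    apply: mulr_ge0_le0; last exact: uni.
    by apply: mulr_ge0; [case/andP: (chi01 y)|rewrite invr_ge0 ltW].
  have [->|yx] := eqVneq y x.
    have [k _ ->] := omk x.
    by rewrite !subrr !mulr0 subr0 add0r mul0r.
  have yx0 : y - x != 0 by rewrite subr_eq0.
  rewrite (_ : _ * _ = (F y - F x - K * (y - x) + B * om y) / (y - x) * ((y - x) * - derive1 (rho t x phi) y)); last first.
    by rewrite mulrA divfK.
  apply: mulr_ge0 sgn.
  have -> : (F y - F x - K * (y - x) + B * om y) / (y - x) = (F y - F x) / (y - x) - K + B * (om y / (y - x)).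
    by field.
  have n0 : 0 < `|y - x| by rewrite normr_gt0.
  have [yd|yd] := ltP `|y - x| delta.
    have := HK y; rewrite n0 yd => /(_ isT) Hq.
    apply: addr_ge0; first by rewrite subr_ge0.
    by apply: mulr_ge0 => //; have [k k0 ->] := omk y; rewrite mulfK.
  rewrite om1 // divff // mulr1 /B.
  have : `|(F y - F x) / (y - x)| <= 2 * M / delta.
    rewrite normrM normfV; apply: ler_pM => //.
      by apply: le_trans (ler_normB _ _) _; have := HM y yA; have := HM x ltac:(lra); lra.
    by rewrite lef_pV2 ?posrE.
  rewrite ler_norml => /andP[q1 _]; have := ler_norm K; lra.
have b1 : K - eta / 2 <= K * I1.
  have : `|K * (I1 - 1)| <= eta / 2.
    rewrite normrM; apply: le_trans (ler_wpM2l (normr_ge0 _) H1) _.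
    by rewrite mulrCA ler_piMr ?(ltW eta2) // ler_pdivrMr // mul1r; lra.
  by rewrite mulrBr mulr1 ler_norml => /andP[h _]; lra.
have b2 : - (eta / 2) <= B * I2.
  have : `|B * I2| <= eta / 2.
    rewrite normrM (ger0_norm B0); apply: le_trans (ler_wpM2l B0 H2) _.
    by rewrite mulrCA ler_piMr ?(ltW eta2) // ler_pdivrMr // mul1r; lra.
  by rewrite ler_norml => /andP[h _].
lra.
Qed.

(** Without monotonicity of the kernel the error is bounded in absolute value. Near [x] it is at
    most [e |y - x|], and [T0_majorant] integrates this against the derivative of the kernel with a
    bound independent of [t]; beyond a fixed distance the derivative of the cut kernel tends to 0
    uniformly. *)
Lemma T0_deriv F x (L eta : R) phi : continuous F -> `|x| <= A - 1 -> T0_class phi ->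
  (forall e : R, 0 < e -> exists2 delta : R, 0 < delta & forall y, `|y - x| < delta ->
    `|F y - F x - L * (y - x)| <= e * `|y - x|) -> 0 < eta ->
  exists2 tau : R, 0 < tau & forall t, 0 < t < tau -> `|- reg F (derive1 (rho t x phi)) - L| <= eta.
Proof.
move=> cF xA T0 HL eta0; have [sp p0 _ _] := T0.
have [G [G' [D [D0 dG cG' GG HD]]]] := T0_majorant T0.
have [X X0 HX] := bounded_on_supp (smooth_continuous (smooth_derive1 schi)).
have [M M0 HM] := bounded_on_supp cF.
pose A2 := A + 1; have A20 : 0 <= A2 by rewrite /A2; have := A1; lra.
(* [c2] is 1 on the support of [chi] and plays the role of a constant there, keeping the majorant
   continuous and compactly supported. *)
have [c2 [sc2 c201 c21 suc2 _]] := cutoff_ex A20.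
have AA2 : - (A2 + 1) < A2 + 1 by lra.
pose V := X * (A + 1 - - (A + 1)).
have V0 : 0 <= V by apply: mulr_ge0 => //; have := AA; lra.
(* the near part costs e D V, the far part kap times a constant *)
pose e := eta / 4 / (D * V + 1).
have DV1 : 0 < D * V + 1 by rewrite ltr_wpDl // mulr_ge0.
have e0 : 0 < e by rewrite !divr_gt0.
have [d0' d0'0 Hd0] := HL e e0.
(* With [d <= 1] and [|x| <= A - 1] the derivative of [chi] vanishes in the near zone. *)
pose d := Num.min d0' 1; have dp : 0 < d by rewrite lt_min d0'0 ltr01.
have d1 : d <= 1 by rewrite ge_min lexx orbT.
have Hd y : `|y - x| < d -> `|F y - F x - L * (y - x)| <= e * `|y - x|.
  by rewrite lt_min => /andP[yd _]; apply: Hd0.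
pose Q := 2 * M + `|L| * (2 * A + 2).
have Q0 : 0 <= Q by apply: addr_ge0; [exact: mulr_ge0|apply: mulr_ge0 => //; have := A1; lra].
pose kap := eta / 4 / (Q * (A2 + 1 - - (A2 + 1)) + 1).
have QA : 0 < Q * (A2 + 1 - - (A2 + 1)) + 1 by rewrite ltr_wpDl // mulr_ge0 //; lra.
have k0 : 0 < kap by rewrite !divr_gt0.
pose k1 := kap / 2 / (X + 1).
have X1 : 0 < X + 1 by rewrite ltr_wpDl.
have k10 : 0 < k1 by rewrite !divr_gt0.
have L1 : 0 < `|L| + 1 by rewrite ltr_wpDl.
have [t1 t10 H1] := @IT_affine_rho _ chi A A1 schi chi1 suchi phi _ T0 (divr_gt0 (divr_gt0 eta0 (ltr0n _ 4)) L1).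
have [B1 B10 HB1] := T0_decay 0 T0 (mulr_gt0 k10 dp).
have kd2 : 0 < kap / 2 * d ^+ 2 by rewrite mulr_gt0 ?divr_gt0 // exprn_gt0.
have [B2 B20 HB2] := T0_decay 1 T0 kd2.
exists (Num.min t1 (Num.min (d / B1) (d / B2))); first by rewrite !lt_min t10 !divr_gt0.
move=> t /andP[t0]; rewrite !lt_min => /and3P[tt1 tt2 tt3].
have {}H1 := H1 t x ltac:(by rewrite t0) xA.
have ti0 : 0 < t^-1 by rewrite invr_gt0.
have nz y : `|(y - x) / t| = `|y - x| / t by rewrite normrM (gtr0_norm ti0).
have farB B y : 0 < B -> t < d / B -> d <= `|y - x| -> B <= `|(y - x) / t|.
  move=> B0 tB dy; rewrite nz ler_pdivlMr //; apply: le_trans dy.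
  by rewrite mulrC -ler_pdivlMr // ltW.
have far1 y : d <= `|y - x| -> tker t x phi y <= k1.
  move=> dy; have yp : 0 < `|y - x| by exact: lt_le_trans dp dy.
  have := HB1 _ (farB B1 y B10 tt2 dy); rewrite expr1 /= (ger0_norm (p0 _)) nz => H.
  have K0 : 0 <= tker t x phi y by apply: mulr_ge0; [exact: ltW|exact: p0].
  rewrite -(ler_pM2r dp); apply: le_trans H.
  rewrite [leRHS](_ : _ = tker t x phi y * `|y - x|); last by rewrite /tker /dil; ring.
  exact: ler_wpM2l.
have far2 y : d <= `|y - x| -> t^-1 * (t^-1 * `|derive1 phi ((y - x) / t)|) <= kap / 2.
  move=> dy; have yp : 0 < `|y - x| by exact: lt_le_trans dp dy.
  have := HB2 _ (farB B2 y B20 tt3 dy); rewrite nz => H.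
  have dd : 0 < d ^+ 2 by rewrite exprn_gt0.
  rewrite -(ler_pM2r dd); apply: le_trans H.
  rewrite [leRHS](_ : _ = t^-1 * (t^-1 * `|derive1 phi ((y - x) / t)|) * `|y - x| ^+ 2); last first.
    by rewrite /=; ring.
  apply: ler_wpM2l; first by do !apply: mulr_ge0 => //; exact: ltW.
  by apply: lerXn2r; rewrite ?nnegrE // ltW.
rewrite (@reg_rho_split F (fun=> 0) L 0 t x phi sp cF (@cont_cst _ 0)) mul0r addr0.
set I1 := - IT _ in H1 *; set I3 := IT _.
have cx : continuous (fun y : R => y - x).
  by apply: contB; [exact: smooth_continuous smooth_id|exact: cont_cst].
have sr := @smooth_rho _ chi schi t x phi sp.
have cr : continuous (derive1 (rho t x phi)) by exact/smooth_continuous/smooth_derive1.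
pose maj y := e * D * (chi y * (t^-1 * G' ((y - x) / t))) + (Q * kap) * c2 y.
have cG't : continuous (fun y => t^-1 * G' ((y - x) / t)).
  apply: contZ; apply: cont_comp => //.
  rewrite (_ : (fun y => _) = fun y => t^-1 * y + - x / t); last by apply/funext => y; ring.
  exact: cont_affine.
have cchi := smooth_continuous schi; have cc2 := smooth_continuous sc2.
have c1 : continuous (fun y => chi y * (t^-1 * G' ((y - x) / t))) by exact: contM.
have suW (f : R -> R) : supp_in (- (A + 1)) (A + 1) f -> supp_in (- (A2 + 1)) (A2 + 1) f.
  by apply: supp_inW; rewrite /A2; lra.
have su1 : supp_in (- (A + 1)) (A + 1) (fun y => chi y * (t^-1 * G' ((y - x) / t))) by exact: supp_inMl.
have b3 : `|I3| <= IT maj.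
  apply: (IT_norm AA2).
  - apply: contM; last exact: contN.
    apply: contD; last by apply: contM; exact: cont_cst.
    by apply: contB; [apply: contB => //; exact: cont_cst|exact: contZ].
  - by apply: contD; apply: contZ.
  - apply: suW => y Hy; rewrite (supp_in_derive1 (@supp_rho _ chi A suchi t x phi)) //.
    by rewrite oppr0 mulr0.
  - by apply: supp_inD; [apply: suW; exact: supp_inM|exact: supp_inM].
  move=> y; rewrite mul0r addr0 normrM normrN.
  have [c20 _] := andP (c201 y); have [ch0 ch1] := andP (chi01 y).
  have G0 := (GG ((y - x) / t)).1.
  have maj1 : 0 <= e * D * (chi y * (t^-1 * G' ((y - x) / t))).
    by apply: mulr_ge0; [apply: mulr_ge0 => //; exact: ltW|apply: mulr_ge0 => //; apply: mulr_ge0 => //; exact: ltW].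
  have maj2 : 0 <= Q * kap * c2 y by apply: mulr_ge0 => //; apply: mulr_ge0 => //; exact: ltW.
  have [yA|yA] := leP `|y| (A + 1); last first.
    by rewrite (out_supp (supp_in_derive1 (@supp_rho _ chi A suchi t x phi)) yA) normr0 mulr0 addr_ge0.
  rewrite derive1_rho //.
  have [yd|yd] := ltP `|y - x| d.
    have -> : derive1 chi y = 0.
      apply: (cutoff_derive0 chi1).
      have := ler_normD (y - x) x; rewrite subrK => H; apply: le_lt_trans H _; lra.
    rewrite mul0r add0r; apply: (@le_trans _ _ (e * D * (chi y * (t^-1 * G' ((y - x) / t))))); last by rewrite lerDl.
    apply: le_trans (ler_wpM2r (normr_ge0 _) (Hd y yd)) _.
    rewrite !normrM (ger0_norm ch0) !(gtr0_norm ti0).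
    rewrite [leLHS](_ : _ = e * chi y * t^-1 * (`|(y - x) / t| * `|derive1 phi ((y - x) / t)|)); last by rewrite nz; ring.
    rewrite [leRHS](_ : _ = e * chi y * t^-1 * (D * G' ((y - x) / t))); last by ring.
    apply: ler_wpM2l; last exact: HD.
    by apply: mulr_ge0; [apply: mulr_ge0 => //; exact: ltW|exact: ltW].
  apply: (@le_trans _ _ (Q * kap * c2 y)); last by rewrite lerDr.
  rewrite c21 // mulr1; apply: ler_pM => //.
    rewrite /Q; apply: le_trans (ler_normB _ _) _; apply: lerD.
      by apply: le_trans (ler_normB _ _) _; have := HM y yA; have := HM x ltac:(lra); lra.
    rewrite normrM ler_wpM2l //; apply: le_trans (ler_normB _ _) _; lra.
  apply: le_trans (ler_normD _ _) _; rewrite normrM [X in X + _](_ : _ = `|derive1 chi y| * tker t x phi y); last first.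
    by rewrite (ger0_norm (_ : 0 <= tker t x phi y)) //; apply: mulr_ge0; [exact: ltW|exact: p0].
  have l1 : `|derive1 chi y| * tker t x phi y <= kap / 2.
    apply: (@le_trans _ _ (X * k1)).
      by apply: ler_pM => //; [apply: mulr_ge0; [exact: ltW|exact: p0]|exact: HX|exact: far1].
    rewrite /k1 mulrA ler_pdivrMr // mulrC ler_wpM2l //; [by rewrite divr_ge0 // ltW|lra].
  have l2 : `|chi y * (t^-1 * (t^-1 * derive1 phi ((y - x) / t)))| <= kap / 2.
    rewrite !normrM (ger0_norm ch0) !(gtr0_norm ti0).
    by apply: le_trans (far2 y yd); rewrite ler_piMl //; do !apply: mulr_ge0 => //; exact: ltW.
  lra.
have b4 : IT maj <= eta / 4 + eta / 4.
  rewrite /maj (@IT_lin _ (- (A2 + 1)) (A2 + 1)) //; [|exact: contZ|exact: suW|exact: supp_inM].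
  rewrite (ITZ (Q * kap) AA2 cc2 suc2); apply: lerD.
    have dGt (y : R) : is_derive y 1 (fun y => G (t^-1 * y + - x / t)) (t^-1 * G' ((y - x) / t)).
      have := is_derive_comp_affine (dG (t^-1 * y + - x / t)).
      by rewrite (_ : t^-1 * y + - x / t = (y - x) / t); [|ring].
    have cG : continuous (fun y => G (t^-1 * y + - x / t)) by move=> y; apply: is_derive_continuous (dGt y).
    have sc' := smooth_continuous (smooth_derive1 schi).
    rewrite (@IT_by_parts _ (- (A + 1)) (A + 1) chi _ (derive1 chi) _ AA (fun y => smooth_is_derive y schi) dGt
      sc' cG't suchi (supp_in_derive1 suchi)).
    have : `|IT (fun y => derive1 chi y * G (t^-1 * y + - x / t))| <= V.
      apply: (IT_bound AA); [exact: contM|apply: supp_inMl; exact: supp_in_derive1|].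
      move=> y; have [yA|yA] := leP `|y| (A + 1); last first.
        by rewrite (out_supp (supp_in_derive1 suchi) yA) mul0r normr0.
      rewrite normrM -[leRHS]mulr1; apply: ler_pM => //; [exact: HX|exact: (GG _).2].
    rewrite ler_norml => /andP[h1 _].
    have h2 : - IT (fun y => derive1 chi y * G (t^-1 * y + - x / t)) <= V by lra.
    have eD : 0 <= e * D by apply: mulr_ge0 => //; exact: ltW.
    apply: le_trans (ler_wpM2l eD h2) _.
    rewrite /e [leLHS](_ : _ = eta / 4 * ((D * V) / (D * V + 1))); last by ring.
    by rewrite ler_piMr ?divr_ge0 ?(ltW eta0) // ler_pdivrMr // mul1r; lra.
  have Ic2 : IT c2 <= 1 * (A2 + 1 - - (A2 + 1)).
    apply: le_trans (ler_norm _) _; apply: IT_bound => // y.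
    by have [h1 h2] := andP (c201 y); rewrite ger0_norm.
  rewrite mul1r in Ic2.
  have Qk : 0 <= Q * kap by apply: mulr_ge0 => //; exact: ltW.
  apply: le_trans (ler_wpM2l Qk Ic2) _.
  rewrite /kap; set Z := A2 + 1 - - (A2 + 1) in QA *.
  rewrite [leLHS](_ : _ = eta / 4 * (Q * Z / (Q * Z + 1))); last by ring.
  by rewrite ler_piMr ?divr_ge0 ?(ltW eta0) // ler_pdivrMr // mul1r; lra.
have b1 : `|L * (I1 - 1)| <= eta / 4.
  rewrite normrM; apply: le_trans (ler_wpM2l (normr_ge0 _) H1) _.
  by rewrite mulrCA ler_piMr ?divr_ge0 ?(ltW eta0) // ler_pdivrMr // mul1r; lra.
rewrite (_ : L * I1 + I3 - L = L * (I1 - 1) + I3); last by ring.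
apply: le_trans (ler_normD _ _) _; lra.
Qed.

End RegularValues.

(** * Null sets and steep functions *)

Section SteepPoints.
Context {R : realType}.
Implicit Types (s g : R -> R) (x y e : R) (i j : R * R) (L : seq (R * R)).
Notation mu := (@lebesgue_measure R).

Let lo (i : R * R) := Num.min i.1 i.2.
Let hi (i : R * R) := Num.max i.1 i.2.

(** Induction on the list: the first interval separates the others into those on its left and those
    on its right. *)
Lemma sum_increments s L (lb ub : R) : {homo s : x y / x <= y} -> uniq L -> lb <= ub ->
  (forall i, i \in L -> lb <= s (lo i) /\ s (hi i) <= ub) ->
  (forall i j, i \in L -> j \in L -> i != j -> hi i <= lo j \/ hi j <= lo i) ->
  \sum_(i <- L) (s (hi i) - s (lo i)) <= ub - lb.
Proof.
move=> ms; have [n] := ubnP (size L); elim: n L lb ub => // n IH [|i L] lb ub.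
  by move=> _ _ lu _ _; rewrite big_nil subr_ge0.
rewrite ltnS => sz /= /andP[iL uL] lu bL dL.
pose left (j : R * R) := hi j <= lo i.
have [b1 b2] := bL i (mem_head _ _).
have ilh : s (lo i) <= s (hi i) by apply: ms; rewrite /lo /hi ge_min !le_max !lexx !orbT.
rewrite big_cons (bigID left) /= -(big_filter _ left) -(big_filter _ (fun j => ~~ left j)).
have inL j : j \in L -> j \in i :: L by move=> jL; rewrite inE jL orbT.
have dj j k : j \in L -> k \in L -> j != k -> hi j <= lo k \/ hi k <= lo j.
  by move=> jL kL; apply: dL; exact: inL.
have H1 : \sum_(j <- seq.filter left L) (s (hi j) - s (lo j)) <= s (lo i) - lb.
  apply: IH => //.
  - by rewrite (leq_ltn_trans _ sz) // size_filter count_size.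
  - exact: filter_uniq.
  - move=> j; rewrite mem_filter => /andP[jl jL]; split; first by case: (bL j (inL _ jL)).
    exact: ms.
  - by move=> j k; rewrite !mem_filter => /andP[_ jL] /andP[_ kL]; apply: dj.
have H2 : \sum_(j <- seq.filter (fun j => ~~ left j) L) (s (hi j) - s (lo j)) <= ub - s (hi i).
  apply: IH => //.
  - by rewrite (leq_ltn_trans _ sz) // size_filter count_size.
  - exact: filter_uniq.
  - move=> j; rewrite mem_filter => /andP[jl jL]; split; last by case: (bL j (inL _ jL)).
    have ji : j != i by apply: contraNneq iL => <-.
    apply: ms; case: (dL j i (inL _ jL) (mem_head _ _) ji) => // h.
    by rewrite /left h in jl.
  - by move=> j k; rewrite !mem_filter => /andP[_ jL] /andP[_ kL]; apply: dj.
lra.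
Qed.

Lemma measure_cover_le (B : R * R -> set R) (r : R * R -> R) L (C : set R) :
  measurable C -> (forall i, i \in L -> measurable (B i) /\ (mu (B i) <= (r i)%:E)%E) ->
  C `<=` \bigcup_(i in [set` L]) B i -> (mu C <= (\sum_(i <- L) r i)%:E)%E.
Proof.
elim: L C => [|i L IH] C mC HB CB.
  by rewrite (_ : C = set0) ?measure0 ?big_nil // -subset0 => x /CB [j].
have [mBi Bi] := HB i (mem_head _ _).
rewrite big_cons EFinD.
apply: (@le_trans _ _ (mu (B i) + mu (C `\` B i))%E).
  apply: le_trans _ (measureU2 mu mBi (measurableD mC mBi)).
  apply: le_measure; rewrite ?inE //; first by apply: measurableU => //; exact: measurableD.
  by move=> x Cx; have [?|?] := pselect (B i x); [left|right].
apply: leeD => //; apply: IH; first exact: measurableD.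
  by move=> j jL; apply: HB; rewrite inE jL orbT.
move=> x [/CB[j /= ]]; rewrite inE => /orP[/eqP ->//|jL] Bjx _; by exists j.
Qed.

(* A weak type inequality for the difference quotients of a monotone function. *)
Lemma steep_open s (s0 S lam : R) : {homo s : x y / x <= y} -> (forall x, s0 <= s x <= s0 + S) ->
  0 < lam -> exists G : set R, [/\ open G, (mu G <= (6 * S / lam)%:E)%E &
    forall x y, y != x -> lam < (s y - s x) / (y - x) -> G x].
Proof.
move=> ms bs lam0.
pose steep i := i.2 != i.1 /\ lam < (s i.2 - s i.1) / (i.2 - i.1).
(* The value 1 at degenerate pairs, which are never steep, only keeps all the balls nonempty for the
   covering lemma. *)
pose r i : R := if i.1 == i.2 then 1 else `|i.2 - i.1|.
have r0 i : 0 < r i by rewrite /r; case: eqVneq => // ne; rewrite normr_gt0 subr_eq0 eq_sym.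
pose B i : set R := ball i.1 (r i).
pose G := \bigcup_(i in steep) B i.
have oB i : open (B i) by exact: ball_open.
have oG : open G by apply: bigcup_open => i _.
exists G; split => //; last first.
  by move=> x y yx q; exists (x, y) => //; apply: ballxx.
rewrite lebesgue_regularity_inner_sup; last exact: open_measurable.
apply: ge_ereal_sup => _ [C [cC CG] <-].
have [D' D'I CD'] : finite_subset_cover steep B C.
  by move: cC; rewrite compact_cover; apply.
have isB i : is_ball (B i) by exact: is_ball_ball.
have B0 i : B i !=set0 by exists i.1; apply: ballxx.
have [L [uL sL tL cL]] := vitali_lemma_finite_cover isB B0 (finmap.enum_fset D').
have HL i : i \in L -> steep i by move=> /sL iD; have := D'I i iD; rewrite inE.
(* Vitali's selection triples the balls, and a ball of radius [r] has length [2 * r], whence the 6.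
   The ball around [i.1] contains the open interval between [i.1] and [i.2], so disjoint balls give
   disjoint intervals, over which the increments of [s] add up to at most [S]. *)
apply: (@le_trans _ _ (\sum_(i <- L) (6 * r i))%:E).
  apply: (@measure_cover_le (scale_ball 3 \o B)).
  - exact: compact_measurable.
  - move=> i _ /=; rewrite scale_ballE //; split; first by apply: open_measurable; exact: ball_open.
    rewrite lebesgue_measure_ball; last by apply: mulr_ge0 => //; exact: ltW.
    by rewrite lee_fin -mulr_natl; lra.
  - by move=> x /CD' cx; apply: cL.
rewrite lee_fin -mulr_sumr -mulrA ler_pM2l // ler_pdivlMr // mulrC mulr_sumr.
apply: (@le_trans _ _ (\sum_(i <- L) (s (hi i) - s (lo i)))).
  rewrite !big_seq; apply: ler_sum => i /HL[ne q].
  rewrite /r eq_sym (negbTE ne) /hi /lo; have [lt|lt|E] := ltgtP i.1 i.2; last by rewrite E eqxx in ne.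
    by rewrite gtr0_norm ?subr_gt0 // -ler_pdivlMr ?subr_gt0 // ltW.
  rewrite ltr0_norm ?subr_lt0 // -ler_pdivlMr ?oppr_gt0 ?subr_lt0 // ltW //.
  by apply: lt_le_trans q _; rewrite -mulrNN -invrN !opprB.
rewrite [leRHS](_ : _ = s0 + S - s0); last by ring.
apply: sum_increments => //.
- by have /andP[h1 h2] := bs 0; exact: le_trans h1 h2.
- by move=> i _; have /andP[h1 _] := bs (lo i); have /andP[_ h2] := bs (hi i).
move=> i j iL jL ij; have [ne _] := HL i iL; have [ne' _] := HL j jL.
have [h|h] := leP (hi i) (lo j); first by left.
have [h'|h'] := leP (hi j) (lo i); first by right.
exfalso; have [E|/eqP nE] := eqVneq i j; first by rewrite E eqxx in ij.
pose m := (Num.max (lo i) (lo j) + Num.min (hi i) (hi j)) / 2.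
have lhi k : k.2 != k.1 -> lo k < hi k.
  by move=> nk; rewrite /lo /hi; have [//|//|E] := ltgtP k.1 k.2; rewrite E eqxx in nk.
have mm : Num.max (lo i) (lo j) < Num.min (hi i) (hi j).
  by rewrite gt_max !lt_min (lhi _ ne) (lhi _ ne') h h'.
have m1 : lo i < m /\ lo j < m.
  have := le_max (lo i) (lo i) (lo j); have := le_max (lo j) (lo i) (lo j); rewrite !lexx orbT /=.
  by rewrite /m; split; lra.
have m2 : m < hi i /\ m < hi j.
  have := ge_min (hi i) (hi i) (hi j); have := ge_min (hi j) (hi i) (hi j); rewrite !lexx orbT /=.
  by rewrite /m; split; lra.
have inB k : k.2 != k.1 -> lo k < m -> m < hi k -> B k m.
  move=> nk l1 l2; rewrite /B ball_itv /= in_itv /= /r eq_sym (negbTE nk).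
  move: l1 l2; rewrite /lo /hi; have [lt|lt|E] := ltgtP k.1 k.2; last by rewrite E eqxx in nk.
    by rewrite gtr0_norm ?subr_gt0 // => ? ?; apply/andP; split; lra.
  by rewrite ltr0_norm ?subr_lt0 // => ? ?; apply/andP; split; lra.
apply: nE; apply: tL => //; exists m; split; apply: inB => //; tauto.
Qed.

End SteepPoints.

(** * Steep continuous functions on null sets *)

Section NullSets.
Context {R : realType}.
Implicit Types (g : R -> R) (x y e : R).
Notation mu := (@lebesgue_measure R).

Lemma sumr_tail (M : R) a n : 0 <= M -> gdom M a -> `|sumr a - \sum_(l < n) a l| <= 2 * (M * 2^-1 ^+ n).
Proof.
move=> M0 ga; rewrite (sumr_split n ga) addrAC subrr add0r; apply: gdom_le => l.
by have := ga (n + l)%N; rewrite exprD mulrA.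
Qed.

Lemma sumr_ge0 (M : R) a : 0 <= M -> gdom M a -> (forall l, 0 <= a l) -> 0 <= sumr a.
Proof.
move=> M0 ga a0; rewrite leNgt; apply/negP => s0.
have /cvgrPdist_lt/(_ (- sumr a)) := gdom_cvg ga; rewrite oppr_gt0 => /(_ s0)[n _ /(_ n (leqnn n))].
rewrite -/(sumr a) => /ltr_normlP[h _].
have : 0 <= series a n by rewrite /series /=; apply: sumr_ge0.
by move: h; rewrite opprB; move: (series a n) => z; lra.
Qed.

Lemma negligible_open (Z : set R) (e : R) : mu.-negligible Z -> 0 < e ->
  exists U : set R, [/\ open U, Z `<=` U & (mu U <= e%:E)%E].
Proof.
move=> [N [mN N0 ZN]] e0.
have Nfin : (mu N < +oo)%E by rewrite [mu N]N0 ltry.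
have [U [oU NU Ue]] := lebesgue_regularity_outer mN Nfin e0.
exists U; split=> //; first exact: subset_trans NU.
have mU : measurable U by exact: open_measurable.
apply: (@le_trans _ _ (mu N + mu (U `\` N))%E).
  apply: le_trans _ (measureU2 mu mN (measurableD mU mN)).
  apply: le_measure; rewrite ?inE //; first by apply: measurableU => //; exact: measurableD.
  by move=> x Ux; have [?|?] := pselect (N x); [left|right].
by rewrite [mu N]N0 add0e ltW.
Qed.

(** The witness is the measure of the part of [U] in []-oo, x]]. *)
Lemma cumulative (U : set R) (e : R) : open U -> (mu U <= e%:E)%E -> exists g : R -> R,
  [/\ forall x, 0 <= g x <= e, forall x y, x <= y -> 0 <= g y - g x <= y - x &
   forall x y, x <= y -> `]x, y] `<=` U -> g y - g x = y - x].
Proof.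
move=> oU Ue; have mU : measurable U by exact: open_measurable.
pose h x := mu (U `&` `]-oo, x]).
have mI x : measurable (U `&` `]-oo, x]) by apply: measurableI.
have he x : (h x <= e%:E)%E.
  by apply: le_trans Ue; apply: le_measure; rewrite ?inE; [exact: mI|exact: mU|move=> z []].
have hf x : h x \is a fin_num by rewrite ge0_fin_numE ?measure_ge0 //; apply: le_lt_trans (he x) _; rewrite ltry.
have hD x y : x <= y -> h y = (h x + mu (U `&` `]x, y]))%E.
  move=> xy; have dis : (U `&` `]-oo, x]) `&` (U `&` `]x, y]) = set0.
    rewrite -subset0 => z [[_ /=]]; rewrite in_itv /= => zx [_ /=]; rewrite in_itv /= => /andP[xz _].
    by move: xz; rewrite ltNge zx.
  have mB : measurable (U `&` `]x, y]) by exact: measurableI.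
  rewrite /h -(measureU mu (mI x) mB dis).
  congr (mu _); apply/seteqP; split=> z /=; rewrite !in_itv /=.
    by move=> [Uz zy]; have [zx|xz] := leP z x; [left|right]; split.
  by move=> [[Uz zx]|[Uz /andP[_ zy]]]; split=> //; exact: le_trans xy.
have mxy x y : mu (U `&` `]x, y]) \is a fin_num.
  rewrite ge0_fin_numE ?measure_ge0 //; apply: le_lt_trans (ltry e); apply: le_trans Ue.
  by apply: le_measure; rewrite ?inE; [exact: measurableI|exact: mU|move=> z []].
have gE x y : x <= y -> fine (h y) - fine (h x) = fine (mu (U `&` `]x, y])).
  by move=> xy; rewrite (hD x y xy) fineD // addrAC subrr add0r.
have mu_itv x y : x <= y -> mu `]x, y] = (y - x)%:E.
  move=> xy; rewrite lebesgue_measure_itv /= lte_fin; case: ltP => // yx.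
  by rewrite (_ : y - x = 0) //; lra.
exists (fun x => fine (h x)); split.
- by move=> x; rewrite fine_ge0 ?measure_ge0 //= -lee_fin fineK.
- move=> x y xy; rewrite gE // fine_ge0 ?measure_ge0 //= -lee_fin fineK // -mu_itv //.
  by apply: le_measure; rewrite ?inE; [exact: measurableI|exact: measurable_itv|move=> z []].
- by move=> x y xy xyU; rewrite gE // (_ : U `&` _ = `]x, y]%classic) ?mu_itv //; exact: setIidr.
Qed.

(* g = sum of the distribution functions of shrinking open neighbourhoods of Z *)
Lemma steep_function (Z : set R) (eta : R) : mu.-negligible Z -> 0 < eta -> exists g : R -> R,
  [/\ continuous g, {homo g : x y / x <= y}, forall x, 0 <= g x <= eta &
    forall x (K : R), Z x -> exists2 delta : R, 0 < delta &
      forall y, 0 < `|y - x| < delta -> K <= (g y - g x) / (y - x)].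
Proof.
move=> nZ eta0.
have ek n : 0 < eta / 2 * 2^-1 ^+ n by rewrite mulr_gt0 ?divr_gt0 // exprn_gt0 // invr_gt0.
have /choice[U HU] := fun n => negligible_open nZ (ek n).
have /choice[G HG] : forall n, exists g : R -> R,
  [/\ forall x, 0 <= g x <= eta / 2 * 2^-1 ^+ n, forall x y, x <= y -> 0 <= g y - g x <= y - x &
   forall x y, x <= y -> `]x, y] `<=` U n -> g y - g x = y - x].
  by move=> n; have [oU _ Ue] := HU n; exact: cumulative.
have eta2 : 0 <= eta / 2 by rewrite divr_ge0 // ltW.
have gd x : gdom (eta / 2) (fun l => G l x).
  by move=> l; have [H _ _] := HG l; have /andP[h1 h2] := H x; rewrite ger0_norm.
pose g x := sumr (fun l => G l x).
have gB x y : g y - g x = sumr (fun l => G l y - G l x).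
  by rewrite (sumrB (gd y) (gd x)).
have gdB x y : gdom (eta / 2 + eta / 2) (fun l => G l y - G l x) by exact: gdomB.
have e22 : 0 <= eta / 2 + eta / 2 by lra.
have part n x y : x <= y -> \sum_(l < n) (G l y - G l x) <= g y - g x.
  move=> xy; rewrite gB (sumr_split n (gdB x y)) lerDl.
  apply: (@sumr_ge0 (eta / 2 + eta / 2)) => //; first exact: (gdom_shift n (gdB x y)).
  by move=> l; have [_ H _] := HG (n + l)%N; case/andP: (H x y xy).
have mg : {homo g : x y / x <= y}.
  by move=> x y xy; rewrite -subr_ge0; apply: le_trans (part 0%N x y xy); rewrite big_ord0.
exists g; split=> //.
- move=> x; apply/cvgrPdist_lt => e e0.
  have e3 : 0 < e / 3 by rewrite divr_gt0.
  have [n Hn] : exists n, 2 * ((eta / 2 + eta / 2) * 2^-1 ^+ n) < e / 3.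
    have c0 : 2 * (eta / 2 + eta / 2) * (2^-1) ^+ n @[n --> \oo] --> (0 : R).
      rewrite -[X in _ --> X](mulr0 (2 * (eta / 2 + eta / 2))); apply: cvgM; first exact: cvg_cst.
      by apply: cvg_expr; rewrite ger0_norm ?invr_ge0 // invf_lt1 //; lra.
    have /cvgrPdist_lt/(_ _ e3)[n _ /(_ n (leqnn n))] := c0.
    by rewrite sub0r normrN -mulrA => /(le_lt_trans (ler_norm _)); exists n.
  have n1 : 0 < n%:R + 1 :> R by rewrite ltr_wpDl.
  exists (e / 3 / (n%:R + 1)); first by rewrite /= divr_gt0.
  move=> y /=; rewrite distrC => xy; rewrite gB.
  have := sumr_tail n e22 (gdB y x); set S := sumr _; set P := \sum_(l < n) _ => HP.
  have P1 : `|P| <= n%:R * `|y - x|.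
    apply: le_trans (ler_norm_sum _ _ _) _.
    apply: (@le_trans _ _ (\sum_(l < n) `|y - x|)); last by rewrite sumr_const card_ord mulr_natl.
    apply: ler_sum => l _; have [_ H _] := HG l; have [yx|/ltW yx] := leP y x.
      by have /andP[h1 h2] := H y x yx; rewrite ger0_norm // ler0_norm ?subr_le0 // opprB.
    by have /andP[h1 h2] := H x y yx; rewrite distrC ger0_norm // ger0_norm // subr_ge0.
  have P2 : n%:R * `|y - x| <= e / 3.
    apply: (@le_trans _ _ ((n%:R + 1) * `|y - x|)); first by rewrite ler_wpM2r // lerDl.
    by rewrite mulrC -ler_pdivlMr // ltW.
  rewrite (_ : S = (S - P) + P); last by rewrite subrK.
  by apply: le_lt_trans (ler_normD _ _) _; lra.
- move=> x; have h := gdom_le (gd x); apply/andP; split.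
    by apply: (sumr_ge0 eta2 (gd x)) => l; have [H _ _] := HG l; case/andP: (H x).
  by apply: le_trans (ler_norm _) _; apply: le_trans h _; lra.
move=> x K Zx.
have [n Kn] : exists n : nat, K <= n%:R.
  exists (Num.bound `|K|); apply: le_trans (ler_norm K) _.
  by apply: ltW; apply: archi_boundP.
have /choice[d Hd] : forall l, exists d : R, 0 < d /\ forall y, `|y - x| < d -> U l y.
  move=> l; have [oU ZU _] := HU l; have := oU x (ZU x Zx).
  move=> [d /= d0 Hd]; exists d; split=> // y yx; apply: Hd; by rewrite /ball_ /= distrC.
have [D D0 HD] : exists2 D : R, 0 < D & forall l, (l < n)%N -> D <= d l.
  elim: n {Kn} => [|m [D D0 HD]]; first by exists 1.
  exists (Num.min D (d m)); first by rewrite lt_min D0 (Hd m).1.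
  by move=> l; rewrite ltnS leq_eqVlt ge_min => /orP[/eqP ->|/HD ->//]; rewrite lexx orbT.
(* Within distance [D] of [x] the first [n] neighbourhoods of [Z] contain the whole interval, and
   each contributes slope 1. *)
have step u v : u <= v -> (forall z, u < z <= v -> `|z - x| < D) -> n%:R * (v - u) <= g v - g u.
  move=> uv Huv; apply: le_trans (part n u v uv).
  rewrite mulr_natl -[X in _ *+ X]card_ord -sumr_const; apply: ler_sum => l _.
  have [_ _ H] := HG l; rewrite H // => z /=; rewrite in_itv /= => /Huv zD.
  by apply: (Hd l).2; apply: lt_le_trans zD _; apply: HD.
exists D => // y /andP[y0 yD]; apply: le_trans Kn _.
move: yD => /ltr_normlP[y1 y2]; move: y0; rewrite normr_gt0 subr_eq0 neq_lt => /orP[yx|xy].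
  rewrite -mulrNN -invrN !opprB ler_pdivlMr ?subr_gt0 //; apply: step; first exact: ltW.
  by move=> z /andP[? ?]; rewrite ltr_norml; apply/andP; split; lra.
rewrite ler_pdivlMr ?subr_gt0 //; apply: step; first exact: ltW.
by move=> z /andP[? ?]; rewrite ltr_norml; apply/andP; split; lra.
Qed.

End NullSets.

(** * Lower and upper limits expressed by bounds *)

Section LimInf.
Context {R : realType}.
Implicit Types (k : R -> R) (F : set_system R) (c : R).

Lemma einf_gt k F c : (c%:E < limf_einf (fun t => (k t)%:E) F)%E -> exists2 V, F V & forall t, V t -> c < k t.
Proof.
rewrite /limf_einf /limf_esup /= lteNr => /ereal_inf_lt[_ [V FV <-] H].
exists V => // t Vt; rewrite -lte_fin -lteN2; apply: le_lt_trans H.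
by apply: ereal_sup_ubound; exists t.
Qed.

Lemma einf_ge k F c V : F V -> (forall t, V t -> c <= k t) -> (c%:E <= limf_einf (fun t => (k t)%:E) F)%E.
Proof.
move=> FV H; rewrite /limf_einf /limf_esup leeNr.
apply: (@le_trans _ _ (ereal_sup [set (- (k t)%:E)%E | t in V])); first by apply: ereal_inf_lbound; exists V.
by apply: ge_ereal_sup => _ [t Vt <-]; rewrite leeN2 lee_fin; apply: H.
Qed.

Lemma esupE k F : limf_esup (fun t => (k t)%:E) F = (- limf_einf (fun t => (- k t)%:E) F)%E.
Proof.
rewrite /limf_einf oppeK; congr limf_esup; apply/funext => t /=.
by rewrite !EFinN !oppeK.
Qed.

Lemma right_ex V : 0^'+ V -> exists2 d : R, 0 < d & forall t, 0 < t < d -> V t.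
Proof.
move=> [d /= d0 H]; exists d => // t /andP[t0 td]; apply: H => //=.
by rewrite sub0r normrN gtr0_norm.
Qed.

Lemma right_in (d : R) : 0 < d -> 0^'+ [set t | 0 < t < d].
Proof.
move=> d0; exists d => //= t; rewrite /ball_ /= sub0r normrN => td t0.
by rewrite /= t0; apply: le_lt_trans td; exact: ler_norm.
Qed.

Lemma lower_value_gt u (phi : R -> R) x c : (c%:E < lower_value u phi x)%E -> exists2 d : R, 0 < d &
  forall t, 0 < t < d -> c < scaled_pairing (smooth_extension u) x t phi.
Proof.
by move=> /einf_gt[V /right_ex[d d0 H] HV]; exists d => // t /H /HV.
Qed.

Lemma le_lower_value u (phi : R -> R) x c d : 0 < d ->
  (forall t, 0 < t < d -> c <= scaled_pairing (smooth_extension u) x t phi) -> (c%:E <= lower_value u phi x)%E.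
Proof. by move=> /right_in d0 H; apply: einf_ge d0 _ => t; apply: H. Qed.

Lemma upper_value_lt u (phi : R -> R) x c : (upper_value u phi x < c%:E)%E -> exists2 d : R, 0 < d &
  forall t, 0 < t < d -> scaled_pairing (smooth_extension u) x t phi < c.
Proof.
rewrite /upper_value esupE lteNl -EFinN => /einf_gt[V /right_ex[d d0 H] HV].
by exists d => // t /H /HV; rewrite ltrN2.
Qed.

End LimInf.

(** * Comparison of major and minor pairs *)

Section Comparison.
Context {R : realType}.
Variables (a b : R) (f : R -> \bar R).
Hypothesis hab : a < b.
Notation mu := (@lebesgue_measure R).

(** Overriding the chosen values at [a] and [b] by the given ones avoids an appeal to the uniqueness
    of point values. *)
Lemma point_value_choice (U : (R -> R) -> R) (ca cb : R) : lojasiewicz U ->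
  has_point_value U a ca -> has_point_value U b cb ->
  exists h : R -> R, [/\ forall x, has_point_value U x (h x), h a = ca & h b = cb].
Proof.
move=> [_ lU] pa pb; have /choice[h Hh] := lU.
exists (fun x => if x == a then ca else if x == b then cb else h x); split.
- by move=> x; case: eqP => [->//|_]; case: eqP => [->//|_]; exact: Hh.
- by rewrite eqxx.
- by rewrite gt_eqF // eqxx.
Qed.

Lemma supp_derivative0 (u U : (R -> R) -> R) psi c d : compact_distribution a b u ->
  distributional_derivative U u -> smooth psi -> supp_in c d psi -> d < a \/ b < c -> U (derive1 psi) = 0.
Proof.
move=> [_ su] dU sp spsi dab; have tp := test_of_supp sp spsi.
have := dU _ tp; rewrite (su _ tp) => [/eqP|]; first by rewrite eq_sym oppr_eq0 => /eqP.
rewrite -subset0 => x [/(fsupp_in spsi) /=]; rewrite !in_itv /= => /andP[? ?] /andP[? ?].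
by case: dab => ?; lra.
Qed.

(** A real level is wanted even where the value of [f] lying in between is infinite. *)
Lemma real_between (x y : \bar R) : (x <= y)%E -> (-oo < y)%E -> (x < +oo)%E ->
  exists r : R, (x <= r%:E)%E /\ (r%:E <= y)%E.
Proof.
case: x y => [x| |] [y| |] //=.
- by exists x.
- by exists x; rewrite leey.
- by exists y; rewrite leNye.
- by exists 0; rewrite leNye leey.
Qed.

(** [W = U - V + F] with [F y = g y + eta * y]: the slope [eta] gives a strict margin where [f]
    separates the values of [u] and [v], and the steepness of [g] compensates for their otherwise
    arbitrary finite bounds on the null sets. *)
Lemma ends_le (u U v V : (R -> R) -> R) (cU cV : R) : major_pair a b f u U -> minor_pair a b f v V ->
  has_point_value U b cU -> has_point_value V b cV -> cV <= cU.
Proof.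
move=> [cu lU dU Ua [E1 [Z1 [cE1 nZ1 HZ1 HE1]]]] [cv lV dV Va [E2 [Z2 [cE2 nZ2 HZ2 HE2]]]] pU pV.
apply/ler_addgt0Pr => eta' eta'0.
(* Chosen so that [F b - F a <= eta + eta * (b - a) = eta']. *)
pose eta := eta' / (1 + (b - a)).
have ba0 : 0 < 1 + (b - a) by have := hab; lra.
have eta0 : 0 < eta by rewrite divr_gt0.
have [g [cg mg g01 Hg]] := steep_function (negligibleU nZ1 nZ2) eta0.
pose F y := g y + eta * y.
have cid : continuous (fun y : R => y) by exact: smooth_continuous smooth_id.
have cF : continuous F by apply: contD => //; exact: contZ.
have mF : {homo F : x y / x <= y}.
  by move=> x y xy; rewrite /F lerD // ?mg // ler_pM2l.
have [sU _] := lU; have [sV _] := lV.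
pose W (psi : R -> R) : R := 1 * U psi + (-1 * V psi + reg F psi).
have sW : schwartz_distribution W.
  exact: (@schwartz_comb _ U _ 1 sU (@schwartz_comb _ V _ (-1) sV (reg_schwartz cF))).
have [hU [HU hUa hUb]] := point_value_choice lU Ua pU.
have [hV [HV hVa hVb]] := point_value_choice lV Va pV.
pose h x := 1 * hU x + (-1 * hV x + F x).
have hW x : has_point_value W x (h x).
  exact: (@point_value_comb _ U _ 1 x _ _ (@HU x) (@point_value_comb _ V _ (-1) x _ _ (@HV x) (@reg_point_value _ F x cF))).
pose A := `|a| + `|b| + 3.
have A1 : 1 <= A by rewrite /A; have := normr_ge0 a; have := normr_ge0 b; lra.
have A0 : 0 <= A by lra.
have [chi [schi chi01 chi1 suchi uni]] := cutoff_ex A0.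
have [aA bA Aa Ab] : [/\ a <= A - 3, b <= A - 3, - (A - 3) <= a & - (A - 3) <= b].
  have := ler_norm a; have := ler_norm b; have := ler_norm (- a); have := ler_norm (- b).
  by rewrite !normrN /A; have := normr_ge0 a; have := normr_ge0 b => *; split; lra.
have [aA' bA' Aa' Ab'] : [/\ a < A, b < A, - A < a & - A < b] by split; lra.
(* Off [[a, b]] the derivatives of [U] and [V] vanish, and only that of the nondecreasing [F]
   remains. *)
have posW (c d : R) : d <= a \/ b <= c -> pos W c d.
  move=> dab psi c' d' sp p0 cc dd su.
  have dab' : d' < a \/ b < c' by case: dab => ?; [left|right]; lra.
  rewrite /W (supp_derivative0 cu dU sp su dab') (supp_derivative0 cv dV sp su dab') !mulr0 !add0r.
  by apply: reg_mono => //; exact: test_of_supp su.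
have gT1 := @gauss_T1 R; have gT0 := gT1.1; have [gsm _ _ _] := gT0.
have key x : a <= x <= b -> ~ (E1 `|` E2) x ->
    exists2 Th : R, 0 < Th & forall theta, Th <= theta -> 0 <= heat W chi 1 theta x.
  move=> xab nE; have xab' : x \in `[a, b]%classic by rewrite inE /= in_itv.
  have lu : (-oo < lower_value u gauss x)%E.
    by apply: HE1 => //; rewrite inE /=; split; [rewrite in_itv|move=> ?; apply: nE; left].
  have uv : (upper_value v gauss x < +oo)%E.
    by apply: HE2 => //; rewrite inE /=; split; [rewrite in_itv|move=> ?; apply: nE; right].
  have [r1 [r2 [K [d [d0 l1 l2 rK HK]]]]] : exists (r1 r2 K d : R),
     [/\ 0 < d, (r1%:E < lower_value u gauss x)%E, (upper_value v gauss x < r2%:E)%E, 0 < r1 - r2 + K &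
       forall y, 0 < `|y - x| < d -> K <= (F y - F x) / (y - x)].
    have FE y : y != x -> (F y - F x) / (y - x) = (g y - g x) / (y - x) + eta.
      by move=> yx; rewrite /F; field; rewrite subr_eq0.
    have [xZ|xZ] := pselect ((Z1 `|` Z2) x).
      have [r1 l1] : exists r1 : R, (r1%:E < lower_value u gauss x)%E.
        case: (lower_value u gauss x) lu => [r| |] // _; last by exists 0; rewrite ltry.
        by exists (r - 1); rewrite lte_fin; lra.
      have [r2 l2] : exists r2 : R, (upper_value v gauss x < r2%:E)%E.
        case: (upper_value v gauss x) uv => [r| |] // _; last by exists 0; rewrite ltNyr.
        by exists (r + 1); rewrite lte_fin; lra.
      have [d d0 Hd] := Hg x (r2 - r1 + 1) xZ.
      exists r1, r2, (r2 - r1 + 1), d; split=> //; first by lra.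
      move=> y yx; rewrite FE; last by case/andP: yx; rewrite normr_gt0 subr_eq0.
      by have := Hd y yx; lra.
    have h1 : (f x <= lower_value u gauss x)%E.
      by apply: HZ1 => //; rewrite inE /=; split; [rewrite in_itv|move=> ?; apply: xZ; left].
    have h2 : (upper_value v gauss x <= f x)%E.
      by apply: HZ2 => //; rewrite inE /=; split; [rewrite in_itv|move=> ?; apply: xZ; right].
    have [r [r1 r2]] := real_between (le_trans h2 h1) lu uv.
    (* Here [r1 - r2 + K] is [eta / 2]; the quotients of [F] are at least [eta] because [g] is
       nondecreasing. *)
    exists (r - eta / 4), (r + eta / 4), eta, 1; split=> //.
    - by apply: lt_le_trans r2; rewrite lte_fin; lra.
    - by apply: le_lt_trans r1 _; rewrite lte_fin; lra.
    - by lra.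
    move=> y /andP[yx _]; rewrite normr_gt0 subr_eq0 in yx; rewrite FE // lerDr.
    move: yx; rewrite neq_lt => /orP[yx|xy].
      by rewrite -mulrNN -invrN !opprB divr_ge0 // subr_ge0 ?mg // ltW.
    by rewrite divr_ge0 // subr_ge0 ?mg // ltW.
  have [d1 d10 H1] := lower_value_gt l1; have [d2 d20 H2] := upper_value_lt l2.
  (* Of the margin [s] one quarter is lost in [T1_lower] and one in the error of the cutoff. *)
  pose s := r1 - r2 + K; have s4 : 0 < s / 4 by rewrite divr_gt0.
  have xA : `|x| <= A - 1 by rewrite ler_norml; move: xab => /andP[? ?]; apply/andP; split; lra.
  have [d3 d30 H3] := @T1_lower _ chi A A1 schi chi01 chi1 suchi F x K d (s / 4) gauss cF xA gT1 uni d0 HK s4.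
  have [Th Th0 HTh] := heat1_tail sW A0 schi chi1 suchi s4.
  pose m := Num.min d1 (Num.min d2 d3); have m0 : 0 < m by rewrite !lt_min d10 d20.
  exists (Num.max Th (2 / m)); first by rewrite lt_max Th0.
  move=> theta; rewrite ge_max => /andP[th1 th2].
  have th0 : 0 < theta by lra.
  pose t := theta^-1; have t0 : 0 < t by rewrite invr_gt0.
  have tm : t < m.
    rewrite -[m]invrK ltf_pV2 ?posrE ?invr_gt0 //; apply: lt_le_trans th2.
    by rewrite ltr_pMl ?invr_gt0 //; lra.
  move: (tm); rewrite !lt_min => /and3P[td1 td2 td3].
  rewrite (heat1_split sW schi suchi).
  have kE : kern 0 theta x = tker t x gauss.
    apply/funext => y; rewrite /kern /tker /dil /t invrK expr1 /= -gaussN; congr (_ * gauss _).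
    ring.
  have tt (e : R) : t < e -> 0 < t < e by move=> te; rewrite t0.
  have E1' := @pair_eval _ u U a b A chi gauss t x cu dU aA' bA' Aa' Ab' schi chi1 suchi gsm t0.
  have E2' := @pair_eval _ v V a b A chi gauss t x cv dV aA' bA' Aa' Ab' schi chi1 suchi gsm t0.
  have := HTh theta x th1 xA; have := H1 t (tt _ td1); have := H2 t (tt _ td2); have := H3 t (tt _ td3).
  rewrite E1' E2' kE; set r := derive1 (fun y => chi y * tker t x gauss y).
  have -> : W r = U r - V r + reg F r by rewrite /W; ring.
  move: (U r) (V r) (reg F r) (W _) => p1 p2 p3 p4 q1 q2 q3 /ler_normlP[q4 q5].
  by move: q1 q2 q3 q4 q5; rewrite /s; clear; lra.
have cE : countable (E1 `|` E2).
  rewrite (_ : _ `|` _ = \bigcup_(i in [set: bool]) (if i then E1 else E2)).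
    by apply: bigcup_countable; [exact: countableP|case].
  by apply/seteqP; split=> x; [case=> ?; [exists true|exists false]|case=> -[] _ ?; [left|right]].
have A3 : - (A - 1) <= a - 1 by lra.
have B3 : b + 1 <= A - 1 by lra.
have P := @positive_derivative _ W chi h A (a - 1) (b + 1) a b (E1 `|` E2) sW A1 schi chi1 suchi hW A3 B3
  (posW _ _ (or_introl (lexx a))) (posW _ _ (or_intror (lexx b))) cE key.
have := @h_mono_in _ W h (a - 1) (b + 1) sW hW P a b ltac:(lra) hab ltac:(lra).
rewrite /h hUa hVa hUb hVb /F.
have /andP[ga0 ga1] := g01 a; have /andP[gb0 gb1] := g01 b.
have : eta * (1 + (b - a)) = eta' by rewrite /eta divfK // gt_eqF.
rewrite mulrDr mulr1 mulrBr; lra.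
Qed.

End Comparison.

(** * Major pairs from Perron major functions *)

Section LeastSolution.
Context {R : realType}.
Implicit Types (h : R -> R) (x y c d : R).
Variables (F h0 del : R -> R) (Z : set R) (a b : R).
Hypotheses (hab : a <= b) (cF : continuous F) (Fb : forall x, b <= x -> F x = F b)
  (mh0 : {homo h0 : x y / x <= y}) (h0a : forall x, x <= a -> h0 x = h0 a)
  (Hh0 : forall c d, Z c -> c < d -> d < c + del c -> F c - F d <= h0 d - h0 c).

Definition admissible h := [/\ {homo h : x y / x <= y}, forall x, x <= a -> h x = 0 &
  forall c d, Z c -> c < d -> d < c + del c -> F c - F d <= h d - h c].

Definition least x := inf [set h x | h in admissible].

Lemma admissible0 : admissible (fun x => h0 x - h0 a).
Proof.
split.
- by move=> x y xy; rewrite lerD2r mh0.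
- by move=> x xa; rewrite h0a // subrr.
- by move=> c d Zc cd dc; have := Hh0 Zc cd dc; lra.
Qed.

Lemma admissible_ge0 h x : admissible h -> 0 <= h x.
Proof.
move=> [mh ha _]; rewrite -(ha (Num.min x a)); first by apply: mh; rewrite ge_min lexx.
by rewrite ge_min lexx orbT.
Qed.

Lemma least_le h x : admissible h -> least x <= h x.
Proof.
move=> Hh; apply: ge_inf; last by exists h.
by exists 0 => _ [k Hk <-]; exact: admissible_ge0.
Qed.

Lemma least_ge x (v : R) : (forall h, admissible h -> v <= h x) -> v <= least x.
Proof.
move=> H; apply: lb_le_inf; first by exists (h0 x - h0 a), (fun x => h0 x - h0 a) => //; exact: admissible0.
by move=> _ [h Hh <-]; exact: H.
Qed.

(** Monotonicity and the constraints bound [h] at one point from below by [h] at another point plus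
    a constant, and such conditions pass to pointwise infima. *)
Lemma least_admissible : admissible least.
Proof.
split.
- move=> x y xy; apply: least_ge => h Hh; apply: le_trans (least_le x Hh) _.
  by case: Hh => mh _ _; exact: mh.
- move=> x xa; apply/eqP; rewrite eq_le; apply/andP; split.
    by apply: le_trans (least_le x admissible0) _; rewrite h0a // subrr.
  by apply: least_ge => h Hh; exact: admissible_ge0.
- move=> c d Zc cd dc; rewrite lerBrDr; apply: least_ge => h Hh.
  by have := least_le c Hh; case: Hh => _ _ /(_ c d Zc cd dc); lra.
Qed.

(** If [least] jumped at [x] from the left, lowering its single value at [x] would give an
    admissible function below it: a constraint ending at [x] is the limit of constraints ending at
    points [z < x], by the continuity of [F]. *)
Lemma least_left x (e : R) : 0 < e -> exists2 y, y < x & least x - e < least y.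
Proof.
move=> e0; apply: contrapT => N; have [ml la Hl] := least_admissible.
have Hy y : y < x -> least y <= least x - e.
  by move=> yx; rewrite leNgt; apply/negP => lt; apply: N; exists y.
pose h y := if y == x then least x - e else least y.
suff : admissible h.
  by move=> /(least_le x); rewrite /h eqxx; lra.
split.
- move=> u v uv; rewrite /h; have [ux|ux] := eqVneq u x; have [vx|vx] := eqVneq v x.
  + exact: lexx.
  + by have := ml _ _ uv; rewrite ux; lra.
  + by apply: Hy; rewrite lt_neqAle ux /= -vx.
  + exact: ml.
- move=> y ya; rewrite /h; case: eqVneq => [E|_]; last exact: la.
  exfalso; have := Hy (x - 1) ltac:(lra); rewrite la; last by rewrite -E; lra.
  by rewrite [least x]la -?E //; lra.
move=> c d Zc cd dc; rewrite /h; case: (eqVneq c x) => [cx|cx]; case: (eqVneq d x) => [dx|dx].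
- by rewrite cx dx ltxx in cd.
- by have := Hl c d Zc cd dc; rewrite cx; lra.
- have cx' : c < x by rewrite -dx.
  rewrite dx; apply/ler_addgt0Pr => eta eta0.
  have /cvgrPdist_lt/(_ _ eta0)[r /= r0 Hr] := @cF x.
  pose z := x - Num.min (r / 2) ((x - c) / 2).
  have m0 : 0 < Num.min (r / 2) ((x - c) / 2) by rewrite lt_min !divr_gt0 // subr_gt0.
  have m1 : Num.min (r / 2) ((x - c) / 2) <= r / 2 by rewrite ge_min lexx.
  have m2 : Num.min (r / 2) ((x - c) / 2) <= (x - c) / 2 by rewrite ge_min lexx orbT.
  have := Hr z; rewrite /ball_ /= => Hz.
  have {}Hz : `|F x - F z| < eta by apply: Hz; rewrite /z ltr_norml; apply/andP; split; lra.
  have cz : c < z by rewrite /z; lra.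
  have zx : z < x by rewrite /z; lra.
  have xd : x < c + del c by rewrite -dx.
  have := Hl c z Zc cz (lt_trans zx xd); have := Hy z zx.
  by move: Hz => /ltr_normlP[]; lra.
- exact: Hl.
Qed.

(** If [least] jumped by [e] just after [x], it could be lowered by [e / 2] on [(x, x + r)], where
    [F] falls at most [e / 2] below [F x]. A constraint starting at [x] is then met thanks to the
    jump, and one starting at [c < x] by adding the constraint from [c] to [x]. *)
Lemma least_right x (e : R) : 0 < e -> exists2 y, x < y & least y < least x + e.
Proof.
move=> e0; apply: contrapT => N; have [ml la Hl] := least_admissible.
have Hy y : x < y -> least x + e <= least y.
  by move=> yx; rewrite leNgt; apply/negP => lt; apply: N; exists y.
have ax : a <= x.
  rewrite leNgt; apply/negP => xa; have := Hy a xa; rewrite !la //; first by lra.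
  exact: ltW.
have e2 : 0 < e / 2 by rewrite divr_gt0.
have /cvgrPdist_lt/(_ _ e2)[r /= r0 Hr] := @cF x.
have HF d : x < d -> d < x + r -> F x - F d <= e / 2.
  move=> xd dr; have := Hr d; rewrite /ball_ /= => H.
  have /ltr_normlP[_ ?] : `|F x - F d| < e / 2 by apply: H; rewrite ltr_norml; apply/andP; split; lra.
  lra.
pose h y := if (x < y) && (y < x + r) then least y - e / 2 else least y.
have hle y : h y <= least y by rewrite /h; case: ifP => _; lra.
suff Hh : admissible h.
  have := least_le (x + r / 2) Hh; rewrite /h (_ : (x < _) && _) ?lra //; first by lra.
  by apply/andP; split; lra.
split.
- move=> u v uv; have := ml _ _ uv; rewrite {2}/h; case: ifP => [/andP[xv vr]|_] muv.
    rewrite /h; case: ifP => [_|/negbT]; first by lra.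
    rewrite negb_and -!leNgt => /orP[ux|ru]; last by lra.
    by have := Hy v xv; have := ml _ _ ux; lra.
  exact: le_trans (hle u) muv.
- by move=> y ya; rewrite /h (_ : (x < y) = false) ?la //; apply/negbTE; rewrite -leNgt; exact: le_trans ya ax.
move=> c d Zc cd dc; have := Hl c d Zc cd dc; rewrite {1}/h; case: ifP => [/andP[xd dr]|_] H; last first.
  by have := hle c; lra.
rewrite /h; case: ifP => [_|/negbT]; first by lra.
rewrite negb_and -!leNgt => /orP[cx|rc]; last by lra.
have HFd := HF d xd dr; have Hyd := Hy d xd.
move: cx; rewrite le_eqVlt => /orP[/eqP ->|cx]; first by lra.
by have := Hl c x Zc cx (lt_trans xd dc); lra.
Qed.

Lemma least_continuous : continuous least.
Proof.
have [ml _ _] := least_admissible.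
move=> x; apply/cvgrPdist_lt => e e0.
have [y yx Hy] := least_left x e0; have [z xz Hz] := least_right x e0.
exists (Num.min (x - y) (z - x)); first by rewrite /= lt_min !subr_gt0 yx.
move=> w /=; rewrite lt_min => /andP[/ltr_normlP[w1 w2] /ltr_normlP[w3 w4]].
have l1 : least y <= least w by apply: ml; lra.
have l2 : least w <= least z by apply: ml; lra.
by rewrite ltr_norml; apply/andP; split; lra.
Qed.

(** [least] is frozen beyond [b]; constraints with [c <= b < d] survive because [F] is constant
    there. *)
Theorem least_solution : exists h : R -> R, [/\ continuous h, {homo h : x y / x <= y},
  forall x, x <= a -> h x = 0, (forall x, b <= x -> h x = h b) &
  h b <= h0 b - h0 a /\
  forall c d, Z c -> c <= b -> c < d -> d < c + del c -> F c - F d <= h d - h c].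
Proof.
have [ml la Hl] := least_admissible.
have mb x y : x <= y -> Num.min x b <= Num.min y b.
  by move=> xy; rewrite le_min !ge_min xy lexx orbT.
have min1 x : x <= b -> Num.min x b = x by move=> xb; apply/min_idPl.
have min2 x : b <= x -> Num.min x b = b by move=> xb; apply/min_idPr.
exists (fun x => least (Num.min x b)); split.
- move=> x; apply/cvgrPdist_lt => e e0.
  have /cvgrPdist_lt/(_ _ e0)[r /= r0 Hr] := @least_continuous (Num.min x b).
  exists r => // y yx; apply: Hr => /=; apply: le_lt_trans yx.
  have [xb|xb] := leP x b; have [yb|yb] := leP y b; rewrite ?subrr ?normr0 //.
    by rewrite !ler0_norm ?subr_le0; lra.
  by rewrite !ger0_norm ?subr_ge0; lra.
- by move=> x y xy; apply: ml; exact: mb.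
- by move=> x xa; rewrite min1 ?la //; exact: le_trans xa hab.
- by move=> x xb; rewrite !min2.
split; first by rewrite min2 //; exact: (least_le b admissible0).
move=> c d Zc cb cd dc; rewrite (min1 c) //.
have [db|bd] := leP d b; first exact: Hl.
rewrite (Fb (ltW bd)); move: cb; rewrite le_eqVlt => /orP[/eqP ->|cb]; first by rewrite !subrr.
by apply: Hl => //; exact: lt_trans dc.
Qed.

End LeastSolution.

(** * The major pair of a continuous function *)

Section MajorPair.
Context {R : realType}.
Variables (a b : R) (f : R -> \bar R) (F h : R -> R) (Z : set R).
Hypotheses (hab : a < b) (cF : continuous F) (ch : continuous h) (mh : {homo h : x y / x <= y}).
Notation Uc := (fun y => F y + h y).
Hypotheses (Ua : forall x, x <= a -> Uc x = 0) (Ub : forall x, b <= x -> Uc x = Uc b).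
Hypothesis (low : forall x, a < x < b -> exists K d : R, 0 < d /\
  forall y, 0 < `|y - x| < d -> K <= (Uc y - Uc x) / (y - x)).
Hypotheses (nZ : lebesgue_measure.-negligible Z) (dF : forall x, a <= x <= b -> ~ Z x ->
  exists2 L : R, f x = L%:E & forall e : R, 0 < e -> exists2 delta : R, 0 < delta &
    forall y, `|y - x| < delta -> `|F y - F x - L * (y - x)| <= e * `|y - x|).

Let u (psi : R -> R) : R := - reg Uc (derive1 psi).
Let cU : continuous Uc. Proof. exact: contD. Qed.

Lemma u_schwartz : schwartz_distribution u.
Proof.
have [lin _] := reg_schwartz cU; split.
  move=> c phi psi tp tq; rewrite /u.
  have sp := test_smooth tp; have sq := test_smooth tq.
  have [A A0 sA] := test_supp tp; have [B B0 sB] := test_supp tq.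
  have -> : derive1 (fun x => c * phi x + psi x) = fun x => c * derive1 phi x + derive1 psi x.
    apply: derive1_fun => x; apply: is_derive_add (smooth_is_derive x sq).
    by have := is_derive_mul (is_derive_const c x) (smooth_is_derive x sp); rewrite mul0r add0r.
  by rewrite lin; [ring|exact: test_derive1 sA|exact: test_derive1 sB].
move=> K /compact_bounded[M0 [_ HM0]].
pose M := `|M0| + 1; have M0' : 0 < M by rewrite ltr_wpDl.
have HK x : K x -> `|x| <= M.
  by move=> Kx; apply: HM0 => //; have := ler_norm M0; rewrite /M; lra.
have [B B0 HB] := @cont_bounded_on _ (- M) M Uc ltac:(lra) cU.
exists 1%N, (B * (2 * M)) => phi tp Kphi.
have su : supp_in (- M) M phi.
  move=> x Hx; apply/eqP/negPn/negP => px.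
  have /HK : K x by apply: Kphi; apply: subset_closure.
  by move=> /ler_normlP[h1 h2]; case: Hx => Hx; lra.
have sp := test_smooth tp; have sp' := smooth_derive1 sp; have su' := supp_in_derive1 su.
have MM : - M < M by lra.
rewrite big_ord_recl big_ord_recl big_ord0 addr0 /=; set S0 := sup _; set S := sup _.
have [X0 HX0] := cont_supp_bounded MM (smooth_continuous sp) su.
have [X HX] := cont_supp_bounded MM (smooth_continuous sp') su'.
have pS0 x : `|phi x| <= S0 by apply: ub_le_sup; [exists X0 => _ [y _ <-]; apply: HX0|exists x].
have pS x : `|derive1 phi x| <= S by apply: ub_le_sup; [exists X => _ [y _ <-]; apply: HX|exists x].
have S00 : 0 <= S0 by apply: le_trans (pS0 0).
have S10 : 0 <= S by apply: le_trans (pS 0).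
apply: (@le_trans _ _ (B * S * (M - - M))); last first.
  rewrite (_ : B * S * _ = B * (2 * M) * S); last by ring.
  by apply: ler_wpM2l; [apply: mulr_ge0 => //; lra|lra].
rewrite /u normrN; apply: IT_bound => //; [by apply: contM => //; exact: smooth_continuous|exact: supp_inM|].
move=> x; have [xM|xM] := boolP (- M <= x <= M).
  by rewrite normrM ler_pM // HB.
by rewrite su' ?mulr0 ?normr0 ?mulr_ge0 //; move: xM; rewrite negb_and -!ltNge => /orP[|]; [left|right].
Qed.

Lemma u_supported : supported_in u `[a, b].
Proof.
move=> phi tp dis; have sp := test_smooth tp; have [A A0 sA] := test_supp tp.
have AA : - A < A by lra.
have away (x : R) : ~ fsupp phi x -> exists2 e : R, 0 < e & forall y, `|y - x| < e -> phi y = 0.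
  move=> nx; have := @closed_openC _ (fsupp phi) (@closed_closure _ _) x nx.
  move=> [e /= e0 He]; exists e => // y yx; apply/eqP/negPn/negP => py.
  by apply: (He y); [rewrite /ball_ /= distrC|apply: subset_closure].
have D (x : R) : is_derive x 1 (fun x => Uc x * phi x) (Uc x * derive1 phi x).
  have [xs|xs] := pselect (fsupp phi x); last first.
    have [e e0 He] := away x xs.
    have -> : derive1 phi x = 0.
      rewrite -[derive1 phi]/(derive1n 1 phi) (@derive1n_local _ 1 phi (fun=> 0) x e e0) ?derive1n_cst //.
    rewrite mulr0; apply: (is_derive_local e0 _ (is_derive_const 0 x)).
    by move=> y yx; rewrite He // mulr0.
  have [xa|ax] := ltP x a.
    have e0 : 0 < a - x by rewrite subr_gt0.
    rewrite (Ua (ltW xa)) mul0r; apply: (is_derive_local e0 _ (is_derive_const 0 x)).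
    by move=> y /ltr_normlP[? ?]; rewrite Ua ?mul0r //; lra.
  have [bx|xb] := ltP b x; last first.
    exfalso; have : (fsupp phi `&` `[a, b]) x by split=> //=; rewrite in_itv /= ax.
    by rewrite dis.
  have e0 : 0 < x - b by rewrite subr_gt0.
  have := is_derive_mul (is_derive_const (Uc b) x) (smooth_is_derive x sp); rewrite mul0r add0r (Ub (ltW bx)).
  by apply: is_derive_local e0 _ => y /ltr_normlP[? ?]; rewrite (Ub (x := y)) //; lra.
rewrite /u /reg (@IT_derive _ (- A) A _ _ AA _ D) ?oppr0 //.
  by apply: contM => //; exact/smooth_continuous/smooth_derive1.
exact: supp_inM.
Qed.

(** Off [Z] the values of a [T0_class] kernel on [F] tend to [L], and those on [h] are nonnegative
    by [reg_mono]. For [T1_class] kernels the lower bounds on the difference quotients of [F + h]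
    are used directly. *)
Theorem major_of_function : exists u U, major_pair a b f u U /\ has_point_value U b (Uc b).
Proof.
exists u, (reg Uc); split; last exact: reg_point_value.
have cu : compact_distribution a b u by split; [exact: u_schwartz|exact: u_supported].
have dU : distributional_derivative (reg Uc) u by [].
pose A := `|a| + `|b| + 3.
have [aA bA Aa Ab] : [/\ a <= A - 3, b <= A - 3, - (A - 3) <= a & - (A - 3) <= b].
  have := ler_norm a; have := ler_norm b; have := ler_norm (- a); have := ler_norm (- b).
  by rewrite !normrN /A; have := normr_ge0 a; have := normr_ge0 b => *; split; lra.
have A1 : 1 <= A by rewrite /A; have := normr_ge0 a; have := normr_ge0 b; lra.
have A0 : 0 <= A by lra.
have [aA' bA' Aa' Ab'] : [/\ a < A, b < A, - A < a & - A < b] by split; lra.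
have [chi [schi chi01 chi1 suchi uni]] := cutoff_ex A0.
have abA x : a <= x <= b -> `|x| <= A - 1.
  by move=> /andP[? ?]; rewrite ler_norml; apply/andP; split; lra.
split=> //.
- split; first exact: reg_schwartz.
  by move=> x; exists (Uc x); exact: reg_point_value.
- by rewrite -[X in has_point_value _ _ X](Ua (lexx a)); exact: reg_point_value.
(* The endpoints form the exceptional set, since [low] speaks of interior points only. *)
exists [set x | x = a \/ x = b], Z; split=> //.
- rewrite (_ : [set x | _] = [set` [:: a; b]]); first exact/finite_set_countable/finite_seq.
  apply/seteqP; split=> x /=; rewrite !inE; first by case=> ->; rewrite eqxx ?orbT.
  by move=> /orP[/eqP|/eqP]; [left|right].
- move=> x phi; rewrite inE /= => -[]; rewrite in_itv /= => xab xZ T0.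
  have [L -> HL] := dF xab xZ; have [sp p0 _ _] := T0.
  apply/lee_addgt0Pr => e e0.
  have [tau tau0 Ht] := @T0_deriv _ chi A A1 schi chi01 chi1 suchi F x L e phi cF (abA x xab) T0 HL e0.
  suff : ((L - e)%:E <= lower_value u phi x)%E by rewrite EFinB leeBlDr.
  apply: (le_lower_value tau0) => t tt; have /andP[t0 _] := tt.
  rewrite (@pair_eval _ u (reg Uc) a b A chi phi t x cu dU aA' bA' Aa' Ab' schi chi1 suchi sp t0).
  have := Ht t tt; rewrite ler_norml => /andP[h1 _].
  set r := (fun y => chi y * tker t x phi y) in h1 *.
  have sr : smooth r by exact: smooth_rho.
  have sur : supp_in (- (A + 1)) (A + 1) r by exact: supp_rho.
  have tr := test_of_supp sr sur.
  have := reg_mono ch mh tr (fun y => rho_ge0 chi01 x y t0 p0).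
  have cr : continuous (derive1 r) by exact/smooth_continuous/smooth_derive1.
  have AA : - (A + 1) < A + 1 by lra.
  have -> : reg Uc (derive1 r) = 1 * reg F (derive1 r) + reg h (derive1 r).
    rewrite /reg -(@IT_lin _ _ _ 1 _ _ AA).
    - by congr IT; apply/funext => y; rewrite mul1r mulrDl.
    - exact: contM.
    - exact: contM.
    - by apply: supp_inM; exact: supp_in_derive1.
    - by apply: supp_inM; exact: supp_in_derive1.
  by move: h1; move: (reg F _) (reg h _) => p q; lra.
move=> x phi; rewrite inE /= => -[]; rewrite in_itv /= => /andP[ax xb] xE T1.
have [[sp p0 _ _] _] := T1.
have xab : a < x < b.
  rewrite !lt_neqAle ax xb !andbT; apply/andP; split; apply/eqP => E; apply: xE; [left|right]; by rewrite E.
have [K [d [d0 HK]]] := low xab.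
have xA := abA x ltac:(by rewrite ax).
have [tau tau0 Ht] := @T1_lower _ chi A A1 schi chi01 chi1 suchi Uc x K d 1 phi cU xA T1 uni d0 HK ltr01.
apply: (@lt_le_trans _ _ (K - 1)%:E); first by rewrite ltNyr.
apply: (le_lower_value tau0) => t tt; have /andP[t0 _] := tt.
rewrite (@pair_eval _ u (reg Uc) a b A chi phi t x cu dU aA' bA' Aa' Ab' schi chi1 suchi sp t0).
exact: Ht.
Qed.

End MajorPair.

(** * The indefinite Perron integral *)

Section Perron.
Context {R : realType}.
Implicit Types (s U V F : R -> R) (x y c d K L : R) (f : R -> \bar R).
Variables (a b : R).
Hypothesis hab : a < b.
Notation mu := (@lebesgue_measure R).

(** Composition with it extends functions on [[a, b]] by constants, so that monotonicity and
    continuity can be stated on the whole line. *)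
Definition clamp x := Num.max a (Num.min x b).

Lemma clamp_in x : a <= clamp x <= b.
Proof. by rewrite /clamp le_max lexx /= ge_max ge_min lexx orbT andbT ltW. Qed.

Lemma clamp_id x : a <= x <= b -> clamp x = x.
Proof. by move=> /andP[ax xb]; rewrite /clamp; move/min_idPl: xb => ->; apply/max_idPr. Qed.

Lemma clamp_mono x y : x <= y -> clamp x <= clamp y.
Proof. by move=> xy; rewrite /clamp ge_max !le_max lexx /= le_min !ge_min xy lexx !orbT. Qed.

Lemma clamp_lo x : x <= a -> clamp x = a.
Proof. by move=> xa; apply/max_idPl; rewrite ge_min xa. Qed.

Lemma clamp_hi x : b <= x -> clamp x = b.
Proof. by move=> xb; rewrite /clamp; move/min_idPr: xb => ->; apply/max_idPr/ltW. Qed.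

Lemma clamp_lip x y : `|clamp x - clamp y| <= `|x - y|.
Proof.
wlog yx : x y / y <= x => [H|].
  by have [yx|/ltW xy] := leP y x; [exact: H|rewrite distrC [leRHS]distrC; exact: H].
rewrite !ger0_norm ?subr_ge0 ?clamp_mono //.
have [xa|ax] := leP x a; first by rewrite !clamp_lo ?(le_trans yx) //; lra.
have [by'|yb] := leP b y; first by rewrite !clamp_hi ?(le_trans _ yx) //; lra.
have l1 : clamp x <= x by rewrite /clamp ge_max (ltW ax) ge_min lexx.
have l2 : y <= clamp y by rewrite /clamp le_max le_min lexx (ltW yb) orbT.
lra.
Qed.

Definition quot U x y : R := (U y - U x) / (y - x).

(* The defining properties of a Perron major function, in epsilon-delta form. *)
Definition qmajor f U := forall x, a <= x <= b ->
  (exists K d, 0 < d /\ forall y, a <= y <= b -> 0 < `|y - x| < d -> K <= quot U x y) /\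
  forall c, (c%:E < f x)%E -> exists2 d, 0 < d & forall y, a <= y <= b -> 0 < `|y - x| < d -> c <= quot U x y.

Lemma within_ex x (V : set R) : within `[a, b] x^' V ->
  exists2 d : R, 0 < d & forall y, a <= y <= b -> 0 < `|y - x| < d -> V y.
Proof.
move=> [d /= d0 H]; exists d => // y yab /andP[yx yd].
have h1 : ball_ Num.Def.normr x d y by rewrite /ball_ /= distrC.
have h2 : y != x by rewrite -subr_eq0 -normr_gt0.
have h3 : y \in `[a, b] by rewrite in_itv.
exact: (H y h1 h2 h3).
Qed.

Lemma qmajor_major f U : perron_major a b f U -> qmajor f U.
Proof.
move=> H x xab; have [] := H x; first by rewrite ?inE /= ?in_itv.
have gt (c : R) : (c%:E < lower_derivate a b U x)%E ->
    exists2 d, 0 < d & forall y, a <= y <= b -> 0 < `|y - x| < d -> c <= quot U x y.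
  by move=> /einf_gt[V /within_ex[d d0 Hd] HV]; exists d => // y yab yx; apply/ltW/HV/Hd.
move=> l1 l2; split; last by move=> c cf; apply: gt; exact: lt_le_trans l2.
have [K lK] : exists K : R, (K%:E < lower_derivate a b U x)%E.
  case: (lower_derivate a b U x) l1 => [r| |] // _; last by exists 0; rewrite ltry.
  by exists (r - 1); rewrite lte_fin; lra.
by have [d d0 Hd] := gt K lK; exists K, d.
Qed.

Lemma qmajor_minor f V : perron_minor a b f V -> qmajor (fun x => - f x)%E (fun x => - V x).
Proof.
move=> H; apply: qmajor_major => x xab; have [l1 l2] := H x xab.
have -> : lower_derivate a b (fun x => - V x) x = (- upper_derivate a b V x)%E.
  rewrite /upper_derivate esupE oppeK; congr limf_einf; apply/funext => y; congr EFin.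
  by rewrite -mulNr; congr (_ * _); ring.
by rewrite lteNr leeN2.
Qed.

Lemma qmajor_shift f U (k : R) : qmajor f U -> qmajor f (fun x => U (clamp x) - k).
Proof.
move=> H x xab; have [[K [d [d0 HK]]] Hc] := H x xab.
have E y : a <= y <= b -> quot (fun x => U (clamp x) - k) x y = quot U x y.
  by move=> yab; rewrite /quot !clamp_id //; congr (_ * _); ring.
split; first by exists K, d; split=> // y yab yx; rewrite E //; exact: HK.
by move=> c /Hc[e e0 He]; exists e => // y yab yx; rewrite E //; exact: He.
Qed.

(** A creeping argument: the points reached from [c] while staying above a line of slope [- ep] have
    a supremum, which is itself reached and can be passed unless it is the right end. *)
Lemma quot_mono s : (forall x (e : R), a <= x <= b -> 0 < e -> exists2 d, 0 < d &
    forall y, a <= y <= b -> 0 < `|y - x| < d -> - e <= quot s x y) ->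
  forall x y, a <= x -> x <= y -> y <= b -> s x <= s y.
Proof.
move=> H c e ac ce eb; apply/ler_addgt0Pr => eta eta0.
pose ep := eta / (e - c + 1); have ec : 0 < e - c + 1 by lra.
have ep0 : 0 < ep by rewrite divr_gt0.
pose S := [set y | c <= y <= e /\ s c - ep * (y - c) <= s y].
have Sc : S c by split; [rewrite lexx|rewrite subrr mulr0 subr0].
have hS : has_sup S by split; [exists c|exists e => y [/andP[]]].
have ubS y : S y -> y <= sup S by move=> Sy; apply: ub_le_sup => //; case: hS.
pose t := sup S; have ct : c <= t by exact: ubS.
have te : t <= e by apply: ge_sup; [exists c|move=> y [/andP[]]].
have tab : a <= t <= b by apply/andP; split; lra.
have [d d0 Hd] := H t ep tab ep0.
have St : S t.
  have [y Sy ty] := sup_adherent d0 hS; rewrite -/t in ty.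
  have yt := ubS _ Sy; rewrite -/t in yt; have [/andP[cy ye] sy] := Sy.
  move: yt; rewrite le_eqVlt => /orP[/eqP <-//|yt]; split; first by rewrite ct.
  have := Hd y ltac:(apply/andP; split; lra) ltac:(by rewrite normr_gt0 subr_eq0 lt_eqF //= ltr0_norm ?subr_lt0 //; lra).
  rewrite /quot ler_ndivlMr ?subr_lt0 // => h.
  have := mulrBr ep t c; have := mulrBr ep y c; have := mulrBr (- ep) y t; lra.
move: (te); rewrite le_eqVlt => /orP[/eqP tE|lt]; last first.
  pose z := Num.min e (t + d / 2).
  have z1 : z <= e by rewrite ge_min lexx.
  have z2 : z <= t + d / 2 by rewrite ge_min lexx orbT.
  have tz : t < z by rewrite lt_min lt /=; lra.
  have : S z.
    split; first by apply/andP; split; lra.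
    have [_ st] := St.
    have := Hd z ltac:(apply/andP; split; lra) ltac:(by rewrite normr_gt0 subr_eq0 gt_eqF //= gtr0_norm ?subr_gt0 //; lra).
    rewrite /quot ler_pdivlMr ?subr_gt0 // => h.
    have := mulrBr ep t c; have := mulrBr ep z c; have := mulrBr (- ep) z t; lra.
  by move=> /ubS; rewrite -/t leNgt tz.
have [_] := St; rewrite tE.
have : ep * (e - c) <= eta.
  by rewrite /ep mulrAC ler_pdivrMr // ler_pM2l //; lra.
lra.
Qed.

(** The lower derivates of [U] and [V] add up to at least 0. Where [f] is infinite, one of them
    exceeds every bound and is set against the finite lower bound of the other. *)
Lemma major_add_mono f U V : qmajor f U -> qmajor (fun x => - f x)%E V ->
  forall x y, a <= x -> x <= y -> y <= b -> U x + V x <= U y + V y.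
Proof.
move=> HU HV; apply: (@quot_mono (fun x => U x + V x)) => x e xab e0.
have [[K1 [d1 [d10 H1]]] M1] := HU x xab; have [[K2 [d2 [d20 H2]]] M2] := HV x xab.
have [c1 [c2 [cc [[d3 d30 H3] [d4 d40 H4]]]]] : exists c1 c2, - e <= c1 + c2 /\
    (exists2 d, 0 < d & forall y, a <= y <= b -> 0 < `|y - x| < d -> c1 <= quot U x y) /\
    (exists2 d, 0 < d & forall y, a <= y <= b -> 0 < `|y - x| < d -> c2 <= quot V x y).
  case fx : (f x) M1 M2 => [L| |] M1 M2.
  - exists (L - e / 2), (- L - e / 2); split; first by lra.
    by split; [apply: M1|apply: M2]; rewrite lte_fin; lra.
  - exists (- K2), K2; split; first by lra.
    by split; [apply: M1; rewrite ltry|exists d2].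
  - exists K1, (- K1); split; first by lra.
    by split; [exists d1|apply: M2; rewrite /= ltry].
exists (Num.min d3 d4); first by rewrite lt_min d30.
move=> y yab; rewrite lt_min => /andP[y0 /andP[y3 y4]].
have := H3 y yab ltac:(by rewrite y0); have := H4 y yab ltac:(by rewrite y0).
have -> : quot (fun x => U x + V x) x y = quot U x y + quot V x y.
  by rewrite /quot -mulrDl; congr (_ * _); ring.
by lra.
Qed.

Definition gapn (n : nat) : R := n.+1%:R^-1.

Lemma gapn_gt0 n : 0 < gapn n. Proof. by rewrite invr_gt0. Qed.

Lemma gapn0 : gapn 0 = 1. Proof. exact: invr1. Qed.

(* U_n and -V_n are normalized major and minor functions with vanishing gap,
   and F is the indefinite integral squeezed between them. *)
Definition approx f (Us Vs : nat -> R -> R) F :=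
  [/\ forall n, qmajor f (Us n) /\ qmajor (fun x => - f x)%E (Vs n),
      forall x, F (clamp x) = F x, F a = 0,
      forall n x, Us n (clamp x) = Us n x /\ Vs n (clamp x) = Vs n x &
      forall n, [/\ {homo (fun x => Us n x - F x) : x y / x <= y}, {homo (fun x => F x + Vs n x) : x y / x <= y} &
        forall x, 0 <= Us n x - F x <= gapn n /\ 0 <= F x + Vs n x <= gapn n]].

Lemma approx_opp f Us Vs F : approx f Us Vs F -> approx (fun x => - f x)%E Vs Us (fun x => - F x).
Proof.
move=> [H1 H2 H3 H4 H5]; split.
- move=> n; have [h1 h2] := H1 n; split=> // x xab; have [h3 h4] := h1 x xab; split=> // c.
  by rewrite oppeK; exact: h4.
- by move=> x; rewrite H2.
- by rewrite H3 oppr0.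
- by move=> n x; have [] := H4 n x.
move=> n; have [h1 h2 h3] := H5 n; split.
- by move=> x y /h2; rewrite opprK addrC [X in _ <= X]addrC opprK.
- by move=> x y /h1; rewrite addrC [X in _ <= X]addrC.
- by move=> x; have [p1 p2] := h3 x; rewrite opprK [Vs n x + _]addrC [- F x + _]addrC.
Qed.

Lemma inv_small (e : R) : 0 < e -> exists n : nat, gapn n <= e.
Proof.
move=> e0; rewrite /gapn; exists (Num.bound e^-1); rewrite -[leRHS]invrK lef_pV2 ?posrE ?invr_gt0 //.
apply: le_trans (ltW (archi_boundP _)) _; first by rewrite invr_ge0 ltW.
by rewrite ?invrK ler_nat leqnSn.
Qed.

Lemma approx_ex f : DPHK_integrable a b f -> exists Us Vs F, approx f Us Vs F /\
  DPHK_integral a b f = (F b)%:E.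
Proof.
move=> [[_ [U0 mU0 _]] [_ [V0 mV0 _]] E].
pose I := DPHK_integral a b f.
have le1 U V : perron_major a b f U -> perron_minor a b f V -> V b - V a <= U b - U a.
  move=> /qmajor_major hU /qmajor_minor hV.
  by have := major_add_mono hU hV (lexx a) (ltW hab) (lexx b); lra.
have I1 U : perron_major a b f U -> (I <= (U b - U a)%:E)%E.
  by move=> hU; rewrite /I /DPHK_integral E; apply: ereal_inf_lbound; exists U.
have I2 V : perron_minor a b f V -> ((V b - V a)%:E <= I)%E.
  by move=> hV; apply: ereal_sup_ubound; exists V.
have If : I \is a fin_num.
  rewrite fin_numE; apply/andP; split; apply/eqP => Ie.
    by have := I2 V0 mV0; rewrite Ie leeNy_eq.
  by have := I1 U0 mU0; rewrite Ie leye_eq.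
have /choice[Us0 HUs0] : forall n, exists U, perron_major a b f U /\ U b - U a < fine I + gapn n / 2.
  move=> n; have : (ereal_inf (perron_major_ends a b f) < (fine I + gapn n / 2)%:E)%E.
    by rewrite -E -/(DPHK_integral a b f) -/I -(fineK If) lte_fin ltrDl divr_gt0 // gapn_gt0.
  by move=> /ereal_inf_lt[_ [U hU <-]]; rewrite lte_fin; exists U.
have /choice[Vs0 HVs0] : forall n, exists V, perron_minor a b f V /\ fine I - gapn n / 2 < V b - V a.
  move=> n; have : ((fine I - gapn n / 2)%:E < ereal_sup (perron_minor_ends a b f))%E.
    by rewrite -/(DPHK_integral a b f) -/I -(fineK If) lte_fin ltrBlDr ltrDl divr_gt0 // gapn_gt0.
  by move=> /ereal_sup_gt[_ [V hV <-]]; rewrite lte_fin; exists V.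
pose Us n x := Us0 n (clamp x) - Us0 n a.
pose Vs n x := - Vs0 n (clamp x) - - Vs0 n a.
have qU n : qmajor f (Us n) by apply: qmajor_shift; apply: qmajor_major; case: (HUs0 n).
have qV n : qmajor (fun x => - f x)%E (Vs n).
  by apply: (@qmajor_shift _ (fun x => - Vs0 n x)); apply: qmajor_minor; case: (HVs0 n).
have clK x : clamp (clamp x) = clamp x by rewrite clamp_id // clamp_in.
have ca : clamp a = a by rewrite clamp_id // lexx ltW.
have cb : clamp b = b by rewrite clamp_id // lexx andbT ltW.
have Ua n : Us n a = 0 by rewrite /Us ca subrr.
have Va n : Vs n a = 0 by rewrite /Vs ca subrr.
have Ucl n x : Us n (clamp x) = Us n x by rewrite /Us clK.
have Vcl n x : Vs n (clamp x) = Vs n x by rewrite /Vs clK.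
have mono n m x y : x <= y -> Us n x + Vs m x <= Us n y + Vs m y.
  move=> xy; rewrite -(Ucl n x) -(Ucl n y) -(Vcl m x) -(Vcl m y).
  have /andP[x1 _] := clamp_in x; have /andP[_ y1] := clamp_in y.
  exact: (major_add_mono (qU n) (qV m) x1 (clamp_mono xy) y1).
have ge0 n m x : 0 <= Us n x + Vs m x.
  rewrite -(Ucl n x) -(Vcl m x); have /andP[x1 _] := clamp_in x.
  by have := mono n m _ _ x1; rewrite Ua Va addr0.
have gapb n : Us n b + Vs n b <= gapn n.
  have [_ h1] := HUs0 n; have [_ h2] := HVs0 n; rewrite /Us /Vs cb; lra.
have gap n x : Us n x + Vs n x <= gapn n.
  apply: le_trans (gapb n); rewrite -(Ucl n x) -(Vcl n x); apply: mono.
  by case/andP: (clamp_in x).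
(* Since the gaps tend to 0, a function between all the [- Vs m] and all the [Us n] is unique; this
   supremum is one. *)
pose F x := sup [set - Vs m x | m in [set: nat]].
have hS x : has_sup [set - Vs m x | m in [set: nat]].
  split; first by exists (- Vs 0%N x), 0%N.
  by exists (Us 0%N x) => _ [m _ <-]; have := ge0 0%N m x; lra.
have F1 n x : - Vs n x <= F x by apply: ub_le_sup; [case: (hS x)|exists n].
have F2 n x : F x <= Us n x.
  by apply: ge_sup; [case: (hS x)|move=> _ [m _ <-]; have := ge0 n m x; lra].
have F2' m x : F x <= - Vs m x + gapn m by have := gap m x; have := F2 m x; lra.
have Fcl x : F (clamp x) = F x.
  by rewrite /F; congr sup; apply/seteqP; split=> _ [m _ <-]; exists m; rewrite ?Vcl.
exists Us, Vs, F; split.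
  split=> //.
  - by apply/eqP; rewrite eq_le; have := F1 0%N a; have := F2 0%N a; rewrite Ua Va oppr0 => -> ->.
  move=> n; split.
  - move=> x y xy; apply/ler_addgt0Pr => e e0; have [m me] := inv_small e0.
    by have := F2' m y; have := F1 m x; have := mono n m x y xy; lra.
  - move=> x y xy; apply/ler_addgt0Pr => e e0; have [m me] := inv_small e0.
    (* F x <= U_m x and F y >= U_m y - 1/(m + 1) *)
    by have := F2 m x; have := F1 m y; have := gap m y; have := mono m n x y xy; lra.
  by move=> x; have := F1 n x; have := F2 n x; have := gap n x; split; apply/andP; split; lra.
rewrite -/I -(fineK If); congr EFin; apply/eqP; rewrite eq_le; apply/andP; split;
  apply/ler_addgt0Pr => e e0; have [m me] := inv_small e0.
  by have [_] := HVs0 m; have := F1 m b; rewrite /Vs cb; have := gapn_gt0 m; lra.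
by have [_] := HUs0 m; have := F2 m b; rewrite /Us cb; have := gapn_gt0 m; lra.
Qed.

Lemma negligible_small (Z : set R) : (forall e : R, 0 < e -> exists G : set R,
  [/\ open G, Z `<=` G & (mu G <= e%:E)%E]) -> mu.-negligible Z.
Proof.
move=> H; have /choice[G HG] : forall n : nat, exists G : set R, [/\ open G, Z `<=` G & (mu G <= (gapn n)%:E)%E].
  by move=> n; apply: H; exact: gapn_gt0.
have mG n : measurable (G n) by apply: open_measurable; case: (HG n).
have mB : measurable (\bigcap_n G n) by exact: bigcapT_measurable.
exists (\bigcap_n G n); split=> //; last by move=> x Zx n _; case: (HG n) => _ ZG _; exact: ZG.
apply/eqP; rewrite eq_le measure_ge0 andbT; apply/lee_addgt0Pr => e e0; rewrite add0e.
have [n ne] := inv_small e0; have [_ _ Gn] := HG n.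
apply: le_trans (_ : (mu (G n) <= _)%E); last by apply: le_trans Gn _; rewrite lee_fin.
apply: le_measure; rewrite ?inE; [exact: mB|exact: mG|by move=> x; apply].
Qed.

Section Primitive.
Variables (f : R -> \bar R) (Us Vs : nat -> R -> R) (F : R -> R).
Hypothesis H : approx f Us Vs F.

(** [Us n] and [Vs n] need not be continuous, but their difference quotients at a point are locally
    bounded below, and [Us n - F] and [F + Vs n] vary by at most [gapn n]. This bounds the
    increments of [F] from both sides by a linear term plus an arbitrarily small gap. *)
Lemma approx_cont : continuous F.
Proof.
have [HUV Fcl Fa _ HM] := H.
move=> x; apply/cvgrPdist_lt => e e0.
have e2 : 0 < e / 2 by rewrite divr_gt0.
have [n ne] := inv_small e2.
have [hU hV] := HUV n; have [mU mV gap] := HM n.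
have xab := clamp_in x; set z := clamp x in xab.
have [[K1 [d1 [d10 H1]]] _] := hU z xab; have [[K2 [d2 [d20 H2]]] _] := hV z xab.
pose K := `|K1| + `|K2| + 1; have K0 : 0 < K by rewrite ltr_wpDl // addr_ge0.
have e2K : 0 < e / 2 / K by rewrite divr_gt0.
exists (Num.min (Num.min d1 d2) (e / 2 / K)); first by rewrite /= !lt_min d10 d20.
move=> y /=; rewrite distrC !lt_min => /andP[/andP[y1 y2] y3].
rewrite -(Fcl x) -(Fcl y) -/z; have yab := clamp_in y; set w := clamp y in yab *.
have wz : `|w - z| <= `|y - x| by exact: clamp_lip.
have [->|nwz] := eqVneq w z; first by rewrite subrr normr0.
have w0 : 0 < `|w - z| by rewrite normr_gt0 subr_eq0.
have q1 := H1 w yab ltac:(by rewrite w0 (le_lt_trans wz)).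
have q2 := H2 w yab ltac:(by rewrite w0 (le_lt_trans wz)).
have [/andP[g1 g2] /andP[g3 g4]] := gap z; have [/andP[g5 g6] /andP[g7 g8]] := gap w.
have wK : `|w - z| * K < e / 2 by rewrite -ltr_pdivlMr //; apply: le_lt_trans wz _.
have k1 : `|K1| * `|w - z| <= `|w - z| * K by rewrite mulrC ler_wpM2l //; rewrite /K; have := normr_ge0 K2; lra.
have k2 : `|K2| * `|w - z| <= `|w - z| * K by rewrite mulrC ler_wpM2l //; rewrite /K; have := normr_ge0 K1; lra.
have b1 : `|K1 * (w - z)| <= `|w - z| * K by rewrite normrM.
have b2 : `|K2 * (w - z)| <= `|w - z| * K by rewrite normrM.
move: b1 b2; rewrite !ler_norml => /andP[b11 b12] /andP[b21 b22].
rewrite ltr_norml.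
move: nwz; rewrite neq_lt => /orP[lt|lt].
  rewrite /quot ler_ndivlMr ?subr_lt0 // in q1; rewrite /quot ler_ndivlMr ?subr_lt0 // in q2.
  by have := mU _ _ (ltW lt); have := mV _ _ (ltW lt) => m1 m2; apply/andP; split; lra.
rewrite /quot ler_pdivlMr ?subr_gt0 // in q1; rewrite /quot ler_pdivlMr ?subr_gt0 // in q2.
by have := mU _ _ (ltW lt); have := mV _ _ (ltW lt) => m1 m2; apply/andP; split; lra.
Qed.

(** The threshold [gapn m] is the same for all [n]: for functions [s_ n] of total increase at most
    [gapn n] the weak type inequality bounds the measure by [6 gapn n / gapn m] for every [n], hence
    by 0. *)
Definition steep (s_ : nat -> R -> R) m := [set x | forall n, exists y, y != x /\ gapn m < quot (s_ n) x y].

Lemma steep_negligible (s_ : nat -> R -> R) m : (forall n, {homo s_ n : x y / x <= y}) ->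
  (forall n x, 0 <= s_ n x <= gapn n) -> mu.-negligible (steep s_ m).
Proof.
move=> ms bs; apply: negligible_small => e e0.
have l0 := gapn_gt0 m.
have em : 0 < e * gapn m / 6 by rewrite divr_gt0 // mulr_gt0.
have [n ne] := inv_small em.
have bs' x : 0 <= s_ n x <= 0 + gapn n by rewrite add0r.
have [G [oG Ge HG]] := steep_open (ms n) bs' l0.
exists G; split=> //; first by move=> x /(_ n)[y [yx q]]; exact: HG q.
by apply: le_trans Ge _; rewrite lee_fin ler_pdivrMr // mulrC -ler_pdivlMr.
Qed.

(** Off this set, for every [m], some [Us n] and some [Vs n] follow [F] up to an error [gapn m] in
    slope. The endpoints are included because the derivative of [F] is to be two-sided. *)
Definition bad_set := [set a] `|` [set b] `|` (\bigcup_m steep (fun n x => Us n x - F x) m `|`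
  \bigcup_m steep (fun n x => F x + Vs n x) m).

Lemma negligible1 x : mu.-negligible [set x].
Proof.
apply: negligible_small => e e0; exists (ball x (e / 2)); split.
- exact: ball_open.
- by move=> _ ->; apply: ballxx; rewrite divr_gt0.
- rewrite lebesgue_measure_ball; last by rewrite divr_ge0 // ltW.
  by rewrite lee_fin -mulr_natl; lra.
Qed.

Lemma bad_negligible : mu.-negligible bad_set.
Proof.
have [_ _ _ _ HM] := H.
apply: negligibleU; first by apply: negligibleU; exact: negligible1.
apply: negligibleU; apply: negligible_bigcup => m; apply: steep_negligible.
- by move=> n; case: (HM n).
- by move=> n x; case: (HM n) => _ _ /(_ x)[].
- by move=> n; case: (HM n).
- by move=> n x; case: (HM n) => _ _ /(_ x)[].
Qed.

Lemma not_bad_quot x m : ~ bad_set x ->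
  exists n1 n2, forall y, y != x -> quot (Us n1) x y - gapn m <= quot F x y /\ quot F x y <= gapn m - quot (Vs n2) x y.
Proof.
move=> nb.
have [n1 H1] : exists n, forall y, y != x -> quot (fun x => Us n x - F x) x y <= gapn m.
  apply: contrapT => N; apply: nb; right; left; exists m => // n; apply: contrapT => N'.
  by apply: N; exists n => y yx; rewrite leNgt; apply/negP => lt; apply: N'; exists y.
have [n2 H2] : exists n, forall y, y != x -> quot (fun x => F x + Vs n x) x y <= gapn m.
  apply: contrapT => N; apply: nb; right; right; exists m => // n; apply: contrapT => N'.
  by apply: N; exists n => y yx; rewrite leNgt; apply/negP => lt; apply: N'; exists y.
exists n1, n2 => y yx; have := H1 y yx; have := H2 y yx.
have -> : quot (fun x => Us n1 x - F x) x y = quot (Us n1) x y - quot F x y.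
  by rewrite /quot -mulrBl; congr (_ * _); ring.
have -> : quot (fun x => F x + Vs n2 x) x y = quot F x y + quot (Vs n2) x y.
  by rewrite /quot -mulrDl; congr (_ * _); ring.
by split; lra.
Qed.

(** Up to [gapn m], the quotients of [F] are squeezed between those of some [Us n1] and minus those
    of some [Vs n2], which the defining inequalities at [x] bring close to [f x]. *)
Lemma approx_derive x : a <= x <= b -> ~ bad_set x -> exists2 L : R, f x = L%:E &
  forall e : R, 0 < e -> exists2 d : R, 0 < d & forall y, `|y - x| < d -> `|F y - F x - L * (y - x)| <= e * `|y - x|.
Proof.
move=> xab nb; have [HUV _ _ _ _] := H.
have [ax xb] : a < x /\ x < b.
  move: xab; rewrite !le_eqVlt => /andP[/orP[/eqP E|->] /orP[/eqP E'|->]] //; exfalso; apply: nb; left;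
  by [left|right].
pose r := Num.min (x - a) (b - x).
have r0 : 0 < r by rewrite lt_min !subr_gt0 ax.
have rab y : `|y - x| < r -> a <= y <= b.
  by rewrite lt_min => /andP[/ltr_normlP[? ?] /ltr_normlP[? ?]]; apply/andP; split; lra.
have pick d1 d2 : 0 < d1 -> 0 < d2 -> exists y, [/\ a <= y <= b, y != x, 0 < `|y - x| < d1 & 0 < `|y - x| < d2].
  move=> d10 d20; pose z := Num.min (Num.min d1 d2) r / 2.
  have m0 : 0 < Num.min (Num.min d1 d2) r by rewrite lt_min r0 lt_min d10 d20.
  have m1 : Num.min (Num.min d1 d2) r <= d1 by rewrite !ge_min lexx.
  have m2 : Num.min (Num.min d1 d2) r <= d2 by rewrite !ge_min lexx orbT.
  have m3 : Num.min (Num.min d1 d2) r <= r by rewrite ge_min lexx orbT.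
  have z0 : 0 < z by rewrite divr_gt0.
  exists (x + z); rewrite addrAC subrr add0r gtr0_norm // z0 /=; split.
  - by apply: rab; rewrite addrAC subrr add0r gtr0_norm // /z; lra.
  - by rewrite -subr_eq0 addrAC subrr add0r gt_eqF.
  - by rewrite /z; lra.
  - by rewrite /z; lra.
case fx : (f x) => [L| |].
- exists L => // e e0; have e2 : 0 < e / 2 by rewrite divr_gt0.
  have [m me] := inv_small e2; have [n1 [n2 Hq]] := not_bad_quot m nb.
  have [_ M1] := (HUV n1).1 x xab; have [_ M2] := (HUV n2).2 x xab.
  have [d1 d10 H1] := M1 (L - e / 2) ltac:(rewrite fx lte_fin; lra).
  have [d2 d20 H2] := M2 (- L - e / 2) ltac:(rewrite fx /= lte_fin; lra).
  exists (Num.min (Num.min d1 d2) r); first by rewrite lt_min r0 lt_min d10 d20.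
  move=> y; rewrite lt_min => /andP[]; rewrite lt_min => /andP[y1 y2] /rab yab.
  have [->|yx] := eqVneq y x; first by rewrite !subrr mulr0 subr0 normr0 mulr0.
  have y0 : 0 < `|y - x| by rewrite normr_gt0 subr_eq0.
  have q1 := H1 y yab ltac:(by rewrite y0); have q2 := H2 y yab ltac:(by rewrite y0).
  have [q3 q4] := Hq y yx.
  have yn : y - x != 0 by rewrite subr_eq0.
  have -> : F y - F x - L * (y - x) = (quot F x y - L) * (y - x) by rewrite /quot; field.
  by rewrite normrM ler_wpM2r // ler_norml; apply/andP; split; lra.
- exfalso; have [n1 [n2 Hq]] := not_bad_quot 0 nb; rewrite gapn0 in Hq.
  have [_ M1] := (HUV n1).1 x xab; have [[K [d2 [d20 H2]]] _] := (HUV n2).2 x xab.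
  (* An infinite value is impossible: quotients at least [3 - K] for [Us n1] and at least [K] for
     [Vs n2] would place that of [F] above [2 - K] and below [1 - K]. *)
  have [d1 d10 H1] := M1 (3 - K) ltac:(by rewrite fx ltry).
  have [y [yab yx y1 y2]] := pick d1 d2 d10 d20.
  by have [q3 q4] := Hq y yx; have := H1 y yab y1; have := H2 y yab y2; lra.
exfalso; have [n1 [n2 Hq]] := not_bad_quot 0 nb; rewrite gapn0 in Hq.
have [[K [d1 [d10 H1]]] _] := (HUV n1).1 x xab; have [_ M2] := (HUV n2).2 x xab.
have [d2 d20 H2] := M2 (3 - K) ltac:(by rewrite fx /= ltry).
have [y [yab yx y1 y2]] := pick d1 d2 d10 d20.
by have [q3 q4] := Hq y yx; have := H1 y yab y1; have := H2 y yab y2; lra.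
Qed.

(** At a bad point the quotients of [Us n] are at least some [K] and those of the steep [g] at least
    [- K], so [h0], which adds [g] to [Us n - F], satisfies the constraints on both sides. It may
    jump, and is used only as a competitor bounding the least solutions. *)
Lemma major_exists (eta : R) : 0 < eta ->
  exists (u U : (R -> R) -> R) (c : R), [/\ major_pair a b f u U, has_point_value U b c & c <= F b + eta].
Proof.
move=> eta0; have [HUV Fcl Fa Ucl HM] := H; have cF := approx_cont.
have e4 : 0 < eta / 4 by rewrite divr_gt0.
(* [g] and [Us n - F] each rise by at most [eta / 4], so the corrections on the right and on the
   left rise by at most [eta / 2] each. *)
have [n ne] := inv_small e4; have [hU _] := HUV n; have [mU _ gap] := HM n.
have [g [cg mg g01 Hg]] := steep_function bad_negligible e4.
pose h0 x := g (clamp x) + (Us n x - F x).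
have Fb x : b <= x -> F x = F b.
  by move=> bx; rewrite -(Fcl x) -(Fcl b) !clamp_hi.
have Fl x : x <= a -> F x = F a.
  by move=> xa; rewrite -(Fcl x) -(Fcl a) !clamp_lo.
have h0cl x : h0 (clamp x) = h0 x.
  by rewrite /h0 Fcl (Ucl n x).1 clamp_id // clamp_in.
have mh0 : {homo h0 : x y / x <= y}.
  by move=> x y xy; apply: lerD; [apply/mg/clamp_mono|exact: mU].
have h0b : h0 b - h0 a <= eta / 2.
  rewrite /h0; have /andP[ga _] := g01 (clamp a); have /andP[_ gb] := g01 (clamp b).
  by have [/andP[p1 _] _] := gap a; have [/andP[_ p2] _] := gap b; lra.
pose Zab := [set x | bad_set x /\ a <= x <= b].
have /choice[del Hdel] : forall c, exists d : R, Zab c -> 0 < d /\ forall y, a <= y <= b -> `|y - c| < d ->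
    (c <= y -> F c - F y <= h0 y - h0 c) /\ (y <= c -> F y - F c <= h0 c - h0 y).
  move=> c; have [[bc cab]|nc] := pselect (Zab c); last by exists 1 => /nc.
  have [[K [d1 [d10 H1]]] _] := hU c cab; have [d2 d20 H2] := Hg c (- K) bc.
  exists (Num.min d1 d2) => _; split; first by rewrite lt_min d10.
  move=> y yab; rewrite lt_min => /andP[y1 y2].
  have [->|yc] := eqVneq y c; first by rewrite !subrr.
  have y0 : 0 < `|y - c| by rewrite normr_gt0 subr_eq0.
  have q1 := H1 y yab ltac:(by rewrite y0); have q2 := H2 y ltac:(by rewrite y0).
  rewrite /h0 !clamp_id //; split=> cy.
    have lt : c < y by rewrite lt_neqAle eq_sym yc.
    by rewrite /quot ler_pdivlMr ?subr_gt0 // in q1; rewrite ler_pdivlMr ?subr_gt0 // in q2; lra.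
  have lt : y < c by rewrite lt_neqAle yc.
  by rewrite /quot ler_ndivlMr ?subr_lt0 // in q1; rewrite ler_ndivlMr ?subr_lt0 // in q2; lra.
have HR c d : Zab c -> c < d -> d < c + del c -> F c - F d <= h0 d - h0 c.
  move=> Zc cd dc; have [_ Hc] := Hdel c Zc; have [_ /andP[ac cb]] := Zc.
  have /andP[p1 p2] := clamp_in d.
  have cd' : c <= clamp d by rewrite -(clamp_id (_ : a <= c <= b)) ?clamp_mono ?(ltW cd) // ac.
  have dd : clamp d <= d by rewrite /clamp ge_max ge_min lexx /= andbT; exact: le_trans ac (ltW cd).
  rewrite -(Fcl d) -(h0cl d); apply: (Hc (clamp d) (clamp_in d) _).1 => //.
  by rewrite ger0_norm ?subr_ge0 //; lra.
have HL c d : Zab c -> d < c -> c - del c < d -> F d - F c <= h0 c - h0 d.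
  move=> Zc dc cd; have [_ Hc] := Hdel c Zc; have [_ /andP[ac cb]] := Zc.
  have /andP[p1 p2] := clamp_in d.
  have cd' : clamp d <= c by rewrite -[X in _ <= X](clamp_id (_ : a <= c <= b)) ?clamp_mono ?(ltW dc) // ac.
  have dd : d <= clamp d by rewrite /clamp le_max le_min lexx (le_trans (ltW dc) cb) orbT.
  rewrite -(Fcl d) -(h0cl d); apply: (Hc (clamp d) (clamp_in d) _).2 => //.
  by rewrite ler0_norm ?subr_le0 //; lra.
have h0a x : x <= a -> h0 x = h0 a by move=> xa; rewrite -(h0cl x) -(h0cl a) !clamp_lo.
have h0B x : b <= x -> h0 x = h0 b by move=> xa; rewrite -(h0cl x) -(h0cl b) !clamp_hi.
have [hR [chR mhR hRa hRb [hRend HhR]]] := least_solution (ltW hab) cF Fb mh0 h0a HR.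
have cN : continuous (fun x : R => - x) by apply: contN; exact: smooth_continuous smooth_id.
have eF x : - a <= x -> - F (- x) = - F (- - a) by move=> ax; rewrite opprK (Fl (- x)) // lerNl.
have eh x : x <= - b -> - h0 (- x) = - h0 (- - b) by move=> xb; rewrite opprK (h0B (- x)) // lerNr.
have mh0N : {homo (fun x => - h0 (- x)) : x y / x <= y}.
  by move=> x y xy; rewrite lerN2; apply: mh0; rewrite lerN2.
have HLN c d : [set x | Zab (- x)] c -> c < d -> d < c + del (- c) -> - F (- c) - - F (- d) <= - h0 (- d) - - h0 (- c).
  move=> Zc cd dc; have dc' : - d < - c by rewrite ltrN2.
  have cd' : - c - del (- c) < - d by lra.
  by have := HL (- c) (- d) Zc dc' cd'; lra.
have nab : - b <= - a by rewrite lerN2 ltW.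
(* The constraints on the left become constraints on the right under the reflection of the line,
   which replaces [F] by [- F (- x)], [h0] by [- h0 (- x)] and the interval by [[- b, - a]]. *)
have [k [ck mk ka kb [kend Hk]]] := @least_solution _ (fun x => - F (- x)) (fun x => - h0 (- x)) (fun x => del (- x))
  [set x | Zab (- x)] (- b) (- a) nab (contN (cont_comp cF cN)) eF mh0N eh HLN.
pose hL x := k (- a) - k (- x).
have chL : continuous hL by apply: contB; [exact: cont_cst|exact: cont_comp].
have mhL : {homo hL : x y / x <= y} by move=> x y xy; rewrite /hL lerD2l lerN2 mk // lerN2.
pose h x := hR x + hL x.
have hLa x : x <= a -> hL x = 0 by move=> xa; rewrite /hL (kb (- x)) ?subrr // lerN2.
have hLb x : b <= x -> hL x = hL b by move=> bx; rewrite /hL (ka (- b) (lexx _)) (ka (- x)) // lerN2.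
have mh : {homo h : x y / x <= y} by move=> x y xy; apply: lerD; [exact: mhR|exact: mhL].
have ch : continuous h by exact: contD.
have quot0 s x y : {homo s : x y / x <= y} -> y != x -> 0 <= quot s x y.
  move=> ms; rewrite neq_lt /quot => /orP[yx|xy].
    by rewrite -mulrNN -invrN !opprB divr_ge0 // subr_ge0 ?ms // ltW.
  by rewrite divr_ge0 // subr_ge0 ?ms // ltW.
have [|||u [U [mp pv]]] := @major_of_function _ a b f F h bad_set cF ch mh _ _ _ bad_negligible approx_derive.
- by move=> x xa; rewrite Fl // Fa /h hRa // hLa // !addr0.
- by move=> x bx; rewrite Fb // /h (hRb x) // (hLb x).
- move=> x xab; have /andP[ax xb] := xab; have xab' : a <= x <= b by rewrite !ltW.
  have [bx|nbx] := pselect (bad_set x); last first.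
    have [L _ HLx] := approx_derive xab' nbx; have [d d0 Hd] := HLx 1 ltr01.
    exists (L - 1), d; split=> // y /andP[y0 yd].
    have yx : y != x by rewrite -subr_eq0 -normr_gt0.
    have yn : y - x != 0 by rewrite subr_eq0.
    have -> : (F y + h y - (F x + h x)) / (y - x) = (F y - F x - L * (y - x)) / (y - x) + L + quot h x y.
      by rewrite /quot; field.
    have := quot0 h x y mh yx.
    have : `|(F y - F x - L * (y - x)) / (y - x)| <= 1.
      by rewrite normrM normfV ler_pdivrMr // Hd.
    by rewrite ler_norml => /andP[? _]; lra.
  have Zx : Zab x by [].
  have [dx0 _] := Hdel x Zx.
  (* Each side of a bad point is taken care of by one of the two corrections, while the other is
     nondecreasing; hence the quotients are nonnegative. *)
  exists 0, (del x); split=> // y /andP[y0 yd].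
  have yx : y != x by rewrite -subr_eq0 -normr_gt0.
  move: yd yx => /ltr_normlP[yd1 yd2]; rewrite neq_lt => /orP[lt|lt].
    rewrite -mulrNN -invrN !opprB divr_ge0 // ?subr_ge0 ?(ltW lt) //.
    have := Hk (- x) (- y); rewrite /= !opprK => /(_ Zx) /(_ ltac:(by rewrite lerN2 ltW)) /(_ ltac:(by rewrite ltrN2)) /(_ ltac:(lra)).
    by have := mhR _ _ (ltW lt); rewrite /h /hL; lra.
  rewrite divr_ge0 // subr_ge0 ?(ltW lt) //.
  have := HhR x y Zx (ltW xb) lt ltac:(lra).
  by have := mhL _ _ (ltW lt); rewrite /h; lra.
exists u, U, (F b + h b); split=> //.
have hLend : hL b <= eta / 2.
  rewrite /hL (ka (- b) (lexx _)) subr0; apply: le_trans kend _; rewrite !opprK; lra.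
by rewrite lerD2l /h; lra.
Qed.

End Primitive.
End Perron.

(** * Minor pairs as opposites of major pairs *)

Section Opposite.
Context {R : realType}.
Variables (a b : R) (f : R -> \bar R).
Implicit Types (u U g : (R -> R) -> R).

Lemma schwartz_opp g : schwartz_distribution g -> schwartz_distribution (fun psi => - g psi).
Proof.
move=> [lin bd]; split; first by move=> c phi psi tp tq; rewrite lin //; ring.
by move=> K /bd[N [C HC]]; exists N, C => phi tp Kp; rewrite normrN; exact: HC.
Qed.

Lemma compact_opp u : compact_distribution a b u -> compact_distribution a b (fun psi => - u psi).
Proof.
move=> [su supu]; split; first exact: schwartz_opp.
by move=> phi tp dis; rewrite supu // oppr0.
Qed.

Lemma point_value_opp g x (v : R) : has_point_value g x v -> has_point_value (fun psi => - g psi) x (- v).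
Proof.
move=> pv phi tp; have := pv phi tp.
have -> : (fun eps => scaled_pairing (fun psi => - g psi) x eps phi) = (fun eps => - scaled_pairing g x eps phi).
  by apply/funext => e; rewrite /scaled_pairing mulrN.
by rewrite mulNr => h; exact: cvgN h.
Qed.

Lemma smooth_ext_opp u phi : compact_distribution a b u -> smooth phi ->
  smooth_extension (fun psi => - u psi) phi = - smooth_extension u phi.
Proof.
move=> cu sp; pose A := `|a| + `|b| + 1.
have [aA bA Aa Ab] : [/\ a < A, b < A, - A < a & - A < b].
  have := ler_norm a; have := ler_norm b; have := ler_norm (- a); have := ler_norm (- b).
  by rewrite !normrN /A; have := normr_ge0 a; have := normr_ge0 b => *; split; lra.
have A0 : 0 <= A by rewrite /A; have := normr_ge0 a; have := normr_ge0 b; lra.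
have [chi [schi _ chi1 suchi _]] := cutoff_ex A0.
rewrite (smooth_ext_eval cu aA bA Aa Ab schi chi1 suchi sp).
exact: (smooth_ext_eval (compact_opp cu) aA bA Aa Ab schi chi1 suchi sp).
Qed.

Lemma upper_value_opp u phi x : compact_distribution a b u -> smooth phi ->
  upper_value (fun psi => - u psi) phi x = (- lower_value u phi x)%E.
Proof.
move=> cu sp; rewrite /upper_value esupE; congr (- limf_einf _ _)%E; apply/funext => t; congr EFin.
rewrite /scaled_pairing -mulrN; congr (_ * _).
have sd : smooth (fun y => phi ((y - x) / t)) by exact: (@smooth_dil _ x t phi sp).
by rewrite (smooth_ext_opp cu sd) opprK.
Qed.

Lemma minor_of_major u U : major_pair a b (fun x => - f x)%E u U ->
  minor_pair a b f (fun psi => - u psi) (fun psi => - U psi).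
Proof.
move=> [cu [sU lU] dU Ua [E [Z [cE nZ HZ HE]]]]; split.
- exact: compact_opp.
- split; first exact: schwartz_opp.
  by move=> x; have [v pv] := lU x; exists (- v); exact: point_value_opp.
- by move=> phi tp; rewrite dU.
- by rewrite -oppr0; exact: point_value_opp.
exists E, Z; split=> //.
- move=> x phi xZ T0; have [sp _ _ _] := T0.
  by rewrite (upper_value_opp x cu sp) leeNl; exact: HZ.
- move=> x phi xE T1; have [[sp _ _ _] _] := T1.
  by rewrite (upper_value_opp x cu sp) lteNl; exact: HE.
Qed.

End Opposite.

(** * The squeeze between minor and major ends *)

Theorem theorem6p2 (R : realType) (a b : R) (hab : a < b) (f : R -> \bar R)
    (hf : DPHK_integrable a b f) :
  dist_integrable a b f /\ dist_integral a b f = DPHK_integral a b f.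
Proof.
have [Us [Vs [F [H ->]]]] := approx_ex hab hf.
have major (eta : R) : 0 < eta -> exists2 c : R, major_ends a b f c%:E & c <= F b + eta.
  move=> eta0; have [u [U [c [mp pv ce]]]] := major_exists hab H eta0.
  by exists c => //; exists u, U, c.
have minor (eta : R) : 0 < eta -> exists2 c : R, minor_ends a b f c%:E & F b - eta <= c.
  move=> eta0; have [u [U [c [mp pv ce]]]] := major_exists hab (approx_opp H) eta0.
  exists (- c); last by lra.
  exists (fun psi => - u psi), (fun psi => - U psi), (- c); split=> //; first exact: minor_of_major.
  exact: point_value_opp.
have le (c d : R) : minor_ends a b f c%:E -> major_ends a b f d%:E -> c <= d.
  move=> [v [V [c' [mv pv [->]]]]] [u [U [d' [mu pu [->]]]]]; exact: (ends_le hab mu mv pu pv).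
have sup_minor : ereal_sup (minor_ends a b f) = (F b)%:E.
  apply/eqP; rewrite eq_le; apply/andP; split.
    apply: ge_ereal_sup => y hy; have [v [V [c [mv pv yc]]]] := hy; rewrite yc in hy *.
    apply/lee_addgt0Pr => e e0; have [d hd de] := major e e0.
    by rewrite -EFinD lee_fin; exact: le_trans (le _ _ hy hd) de.
  apply/lee_addgt0Pr => e e0; have [c hc ce] := minor e e0.
  rewrite -leeBlDr // -EFinB; apply: (@le_trans _ _ c%:E); first by rewrite lee_fin.
  exact: ereal_sup_ubound.
have inf_major : ereal_inf (major_ends a b f) = (F b)%:E.
  apply/eqP; rewrite eq_le; apply/andP; split.
    apply/lee_addgt0Pr => e e0; have [d hd de] := major e e0.
    by rewrite -EFinD; apply: (@le_trans _ _ d%:E); [exact: ereal_inf_lbound|rewrite lee_fin].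
  apply: le_ereal_inf_tmp => y hy; have [u [U [d [mu pu yd]]]] := hy; rewrite yd in hy *.
  apply/lee_addgt0Pr => e e0; have [c hc ce] := minor e e0.
  by rewrite -leeBlDr // -EFinB lee_fin; exact: le_trans ce (le _ _ hc hy).
split; last exact: sup_minor.
split; last by rewrite sup_minor inf_major.
- by have [c hc _] := major 1 ltr01; exists c%:E.
- by have [c hc _] := minor 1 ltr01; exists c%:E.
Qed.
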